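(* Let $m>1$, let $f$ satisfy the combustion Assumption (A) stated in the context, and let $\phi\in\mathscr X$. For $\sigma>0$ let $u(t,r;\sigma\phi)$ be the solution of $u_t=\Delta u^m+f(u)$ in $\mathbb R^N\times(0,\infty)$ with initial datum $\sigma\phi$, and let $\sigma_*\in(0,\infty]$ be the threshold parameter described in the context. For each of the following assertions assume $\sigma_*<\infty$, let $u_*(t,r):=u(t,r;\sigma_*\phi)$ be the critical solution, and let $b_*(t)$ be its radial free-boundary radius, $\{u_*(\cdot,t)>0\}=B_{b_*(t)}$. (i) Suppose $N=2$ and $f(\theta+s)=\lambda s^p[1+o(1)]$ as $s\downarrow0$ for some $\lambda>0$ and $p\ge1$. Then there exist constants $c,C>0$ and $T>0$ such that \[ c\,\frac{\sqrt t}{(\log t)^{\frac{m-1}{2m}}}\le b_*(t)\le C\,\frac{\sqrt t}{(\log t)^{\frac{m-1}{2m}}},\qquad t\ge T. \] (ii) Suppose $N\ge3$ and that $\Upsilon=\{U(0):U\in\mathcal S\}$ is totally disconnected, and let $U_*\in\mathcal S$ denote the stationary state to which $u_*$ converges. Then there exist constants $c,C>0$ and $T>0$ such that \[ c\,t^{\beta_N}\le b_*(t)\le C\,t^{\beta_N},\qquad t\ge T,\qquad\text{where }\beta_N=\frac{m}{N(m-1)+2}. \]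
   Context: Assumption (A): there is $\theta\in(0,1)$ such that (F1) $f$ is locally Lipschitz on $[0,\infty)$, $f\in C^1([\theta,\infty))\cap C^2((\theta,\infty))$, $f=0$ on $[0,\theta]$, $f>0$ on $(\theta,1)$, $f(1)=0$, $f<0$ on $(1,\infty)$, $f'_+(\theta)\ge0$ (right derivative), $f'(1)<0$; (F2) there is $\delta_\theta>0$ such that $f$ is nondecreasing on $[\theta,\theta+\delta_\theta]$; (F3) if $N\ge3$, for each $q\in(\theta,1)$ the solution $W_q$ of $W_q''+\frac{N-1}{r}W_q'+f(W_q^{1/m})=0$, $W_q(0)=q^m$, $W_q'(0)=0$, reaches $\theta^m$ at a finite first radius $R(q)$, and with $\alpha(q)=-W_q'(R(q))$ one has $R(q)\alpha(q)\to0$ as $q\downarrow\theta$. $\mathscr X$ is the set of $\phi\in C([0,\infty))$ for which there is $r_0>0$ with $\phi^{m-1}\in C^1([0,r_0])$, $\phi(r)>0$ for $r\in[0,r_0)$, $\phi(r)=0$ for $r\ge r_0$, and $(\phi^{m-1})'(r_0)<0$; $\phi$ is identified with the radial function $x\mapsto\phi(|x|)$. ''Solution'' means the unique bounded nonnegative (radial) weak solution of the Cauchy problem; its positivity set at each $t>0$ is a ball centred at the origin. For $N\ge3$, $\mathcal S$ (ground states) is the set of positive radial stationary solutions $U=U(r)$ on $\mathbb R^N$ with $\Delta U^m+f(U)=0$, $U_r<0$ (for $r>0$), $U(0)\in(\theta,1)$, and $U(r)\to0$ as $r\to\infty$. Threshold parameter: $\sigma_*\in(0,\infty]$ is the unique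 value such that $u(t,\cdot;\sigma\phi)\to0$ uniformly as $t\to\infty$ for $0<\sigma<\sigma_*$, $u(t,\cdot;\sigma\phi)\to1$ locally uniformly for $\sigma>\sigma_*$, and, if $\sigma_*<\infty$, $u(t,\cdot;\sigma_*\phi)$ converges locally uniformly to $\theta$ when $N=2$, and uniformly to some $U_*\in\mathcal S$ when $N\ge3$ (for $N\ge3$ under total disconnectedness of $\Upsilon$). *)

(* Defs.v *)
From mathcomp Require Import all_boot all_order all_algebra.
From mathcomp Require Import all_classical all_reals all_analysis.

Set Implicit Arguments.
Unset Strict Implicit.
Unset Printing Implicit Defensive.

Import Order.TTheory GRing.Theory Num.Theory.
Import numFieldNormedType.Exports.

Local Open Scope classical_set_scope.
Local Open Scope ring_scope.

(* The difference quotient is restricted to [A], so this is a one-sided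
   derivative at an endpoint of an interval [A]. *)
Definition deriv_within (R : realType) (A : set R) (g : R -> R) (x l : R) : Prop :=
  (g y - g x) / (y - x) @[y --> within A x^'] --> l.

Definition C1_on (R : realType) (A : set R) (g dg : R -> R) : Prop :=
  (forall x, A x -> deriv_within A g x (dg x)) /\ {within A, continuous dg}.

(* The norm that the library puts on ['rV[R]_N] is the sup norm. *)
Definition enorm (R : realType) (N : nat) (x : 'rV[R]_N) : R :=
  Num.sqrt (\sum_(i < N) x 0 i ^+ 2).

Definition evec (R : realType) (N : nat) (i : 'I_N) : 'rV[R]_N := delta_mx 0 i.

Definition partial (R : realType) (N : nat) (i : 'I_N)
    (g : 'rV[R]_N -> R) (x : 'rV[R]_N) : R := 'D_(evec R i) g x.

Definition laplacian (R : realType) (N : nat)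
    (g : 'rV[R]_N -> R) (x : 'rV[R]_N) : R :=
  \sum_(i < N) partial i (partial i g) x.

Definition C1_space (R : realType) (N : nat) (g : 'rV[R]_N -> R) : Prop :=
  forall i : 'I_N,
    (forall x, derivable g x (evec R i)) /\ continuous (partial i g).

Definition C2_space (R : realType) (N : nat) (g : 'rV[R]_N -> R) : Prop :=
  C1_space g /\ forall i : 'I_N, C1_space (partial i g).

(* The library has no Lebesgue measure on R^N.  The iterated integral agrees
   with the integral for that measure on continuous compactly supported
   functions, the only integrands used below. *)
Fixpoint integral_RN (R : realType) (N : nat) : ('rV[R]_N -> R) -> R :=
  match N with
  | 0 => fun g => g 0
  | N'.+1 => fun g =>
      \int[@lebesgue_measure R]_s
        integral_RN (fun y : 'rV[R]_N' => g (row_mx (s%:M : 'rV[R]_1) y))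
  end.

(* C^{1,2} functions (C^1 in t, C^2 in x, jointly continuous derivatives) with
   compact support in R x R^N; they need not vanish at t = 0. *)
Definition test_function (R : realType) (N : nat)
    (psi : R -> 'rV[R]_N -> R) : Prop :=
  [/\ continuous (fun z : R * 'rV[R]_N => psi z.1 z.2),
      (forall t x, derivable (psi^~ x) t 1) /\
        continuous (fun z : R * 'rV[R]_N => derive1 (psi^~ z.2) z.1),
      forall i : 'I_N,
        (forall t x, derivable (psi t) x (evec R i)) /\
        continuous (fun z : R * 'rV[R]_N => partial i (psi z.1) z.2),
      forall i j : 'I_N,
        (forall t x, derivable (partial i (psi t)) x (evec R j)) /\
        continuous
          (fun z : R * 'rV[R]_N => partial j (partial i (psi z.1)) z.2) &
      exists M : R, forall t x, psi t x != 0 -> `|t| <= M /\ enorm x <= M].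

(* Bounded nonnegative weak solutions of u_t = Delta u^m + f(u) in
   R^N x (0, oo) that have the form u(t, |x|), with initial datum u0(|x|).
   The equation holds in the distributional sense, both space derivatives being
   on the test function.  A weak solution is represented by its continuous version, as pointwise
   positivity sets are used. *)
Definition weak_solution (R : realType) (N : nat) (m : R) (f u0 : R -> R)
    (u : R -> R -> R) : Prop :=
  [/\ {within [set z : R * R | 0 <= z.1 /\ 0 <= z.2],
        continuous (fun z : R * R => u z.1 z.2)},
      exists M : R, forall t r, 0 <= t -> 0 <= r -> 0 <= u t r <= M &
      forall psi : R -> 'rV[R]_N -> R, test_function psi ->
        \int[@lebesgue_measure R]_(t in `[0, +oo[)
          integral_RN (fun x : 'rV[R]_N =>
            u t (enorm x) * derive1 (psi^~ x) t
            + u t (enorm x) `^ m * laplacian (psi t) x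
            + f (u t (enorm x)) * psi t x)
        + integral_RN (fun x : 'rV[R]_N => u0 (enorm x) * psi 0 x) = 0].

(* [W] solves W'' + (N-1)/r W' + f(W^{1/m}) = 0 up to the first radius [rho]
   at which it equals theta^m; [dW] is W'. *)
Definition shooting (R : realType) (N : nat) (m theta : R) (f : R -> R)
    (q : R) (W dW : R -> R) (rho : R) : Prop :=
  [/\ 0 < rho,
      W 0 = q `^ m /\ dW 0 = 0,
      C1_on `[0, rho] W dW,
      exists d2W : R -> R, forall r, 0 < r <= rho ->
        deriv_within `[0, rho] dW r (d2W r) /\
        d2W r + (N.-1)%:R / r * dW r + f (W r `^ m^-1) = 0 &
      W rho = theta `^ m /\ forall r, 0 <= r < rho -> theta `^ m < W r].

Definition F1 (R : realType) (theta : R) (f : R -> R) : Prop :=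
  [/\ [locally [lipschitz f x | x in `[0, +oo[]],
      (forall s, 0 <= s <= theta -> f s = 0),
      (forall s, theta < s < 1 -> 0 < f s),
      f 1 = 0 /\ (forall s, 1 < s -> f s < 0) &
      exists df d2f : R -> R,
        [/\ C1_on `[theta, +oo[ f df, C1_on `]theta, +oo[ df d2f,
            0 <= df theta & df 1 < 0]].

Definition F2 (R : realType) (theta : R) (f : R -> R) : Prop :=
  exists2 delta : R, 0 < delta &
    {in `[theta, theta + delta] &, {homo f : x y / x <= y}}.

Definition F3 (R : realType) (N : nat) (m theta : R) (f : R -> R) : Prop :=
  (3 <= N)%N ->
  exists rho alpha : R -> R,
    (forall q, theta < q < 1 -> exists W dW : R -> R,
       shooting N m theta f q W dW (rho q) /\ alpha q = - dW (rho q)) /\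
    rho q * alpha q @[q --> theta^'+] --> (0 : R).

Definition combustion (R : realType) (N : nat) (m theta : R) (f : R -> R) : Prop :=
  [/\ 0 < theta < 1, F1 theta f, F2 theta f & F3 N m theta f].

Definition classX (R : realType) (m : R) (phi : R -> R) : Prop :=
  {within `[0, +oo[, continuous phi} /\
  exists r0 : R,
    [/\ 0 < r0,
        (forall r, 0 <= r < r0 -> 0 < phi r),
        (forall r, r0 <= r -> phi r = 0) &
        exists2 dv : R -> R,
          C1_on `[0, r0] (fun r => phi r `^ (m - 1)) dv & dv r0 < 0].

Definition ground_state (R : realType) (N : nat) (m theta : R) (f : R -> R)
    (U : R -> R) : Prop :=
  [/\ forall r, 0 <= r -> 0 < U r,
      C2_space (fun x : 'rV[R]_N => U (enorm x) `^ m) /\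
        (forall x : 'rV[R]_N,
           laplacian (fun y : 'rV[R]_N => U (enorm y) `^ m) x
             + f (U (enorm x)) = 0),
      forall r, 0 < r -> derivable U r 1 /\ derive1 U r < 0,
      theta < U 0 < 1 &
      U r @[r --> +oo] --> (0 : R)].

Definition Upsilon (R : realType) (N : nat) (m theta : R) (f : R -> R) : set R :=
  [set U 0 | U in ground_state N m theta f].

(* Uniform convergence in R^N of radial functions is uniform convergence of
   their profiles on [0, oo). *)
Definition cvg_unif (R : realType) (v : R -> R -> R) (w : R -> R) : Prop :=
  {uniform [set r : R | 0 <= r], v t @[t --> +oo] --> w}.

Definition cvg_loc_unif (R : realType) (v : R -> R -> R) (w : R -> R) : Prop :=
  forall rho : R, 0 < rho ->
    {uniform [set r : R | 0 <= r <= rho], v t @[t --> +oo] --> w}.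

(* [u s] is the solution with initial datum [s * phi]. *)
Definition is_threshold (R : realType) (N : nat) (m theta : R) (f : R -> R)
    (u : R -> R -> R -> R) (sigma : \bar R) : Prop :=
  [/\ (0 < sigma)%E,
      forall s : R, 0 < s -> (s%:E < sigma)%E -> cvg_unif (u s) (cst 0),
      forall s : R, (sigma < s%:E)%E -> cvg_loc_unif (u s) (cst 1) &
      (sigma < +oo)%E ->
        (N = 2%N -> cvg_loc_unif (u (fine sigma)) (cst theta)) /\
        ((3 <= N)%N -> totally_disconnected (Upsilon N m theta f) ->
           exists2 U, ground_state N m theta f U
                    & cvg_unif (u (fine sigma)) U)].

(* Main.v *)
Require Import Defs.
From mathcomp Require Import all_boot all_order all_algebra.
From mathcomp Require Import all_classical all_reals all_analysis.
From mathcomp Require Import zify ring lra.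

(** Integrated over a time interval and a ball, the equation becomes the radial
    flux identity r^(N-1) W'(r) = int_0^r (u(t) - u(s) - int_s^t f(u)) x^(N-1) dx
    with W(r) = int_s^t u^m(., r), and everything follows from it in one space
    dimension.

    Lower bounds: with B = b(T), the mass Y of u against the weight 1 + (r/B)^2
    (for N = 2, against log r / log B + (r/B)^2 outside the unit disc) satisfies
    Y' >= kappa + a Y^m, where kappa comes from the reaction (for N = 2, from the
    value of u^m near theta^m at r = 1), and a power of B controls 1/a.  As Y
    stays finite up to time T, this bounds T in terms of B.

    Upper bounds: beyond a radius rho with no reaction, W(rho) is at most the
    mass times rho^(2-N), and a compactly supported barrier for W in terms of
    that value bounds b(T).  For N >= 3 the reaction lives in a fixed ball, so
    the mass is O(t).  For N = 2 the mass is O(t / log t):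
    - reflection across lines missing the initial support, carried out on a
      lattice scheme that converges to u, makes u(t, .) monotone for large r;
    - a Kaplan argument with the weight (1 + k^2 r^2)^(-j) then gives
      u - theta = O(r^(-a)) with a p = 2 + 1/p, uniformly in late times;
    - the flux identity, integrated against dr/r, bounds the reaction mass times
      log t by O(t), and monotonicity turns the mass bound into u <= theta
      beyond C sqrt(t / log t). *)

Set Implicit Arguments.
Unset Strict Implicit.
Unset Printing Implicit Defensive.
Import Order.TTheory GRing.Theory Num.Theory.
Import numFieldNormedType.Exports.
Local Open Scope classical_set_scope.
Local Open Scope ring_scope.

(** * One-variable calculus *)

Section Calculus.
Variable R : realType.
Implicit Types (f g F G : R -> R) (a b c x y l : R).

(** The weak formulation gives no derivative of [u], but the time integral W is twice differentiable
    in r > 0, so Green identities and maximum principles are applied to W. In particular, where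
    earlier datum and reaction vanish, W solves W_t = (Delta W)^m, and the barrier is compared with
    that equation.

    The exponents are dimension counts. Mass growth forces T^m kappa^(m-1) <= C B^(N(m-1)+2); in the
    plane kappa ~ 1 / log B produces the logarithm. The barrier gives rho^(2m) <= C H^(m-1) T with H
    = mass * rho^(2-N), and the two mass bounds turn this into the same powers.

    Reflection calls for a comparison principle for degenerate weak solutions. It is replaced by an
    explicit monotone scheme, which satisfies the reflected inequality exactly, and by an energy
    estimate for the distance between scheme and solution. The reaction fits into that energy
    because f vanishes on [0, theta], the only range where diffusion degenerates. *)

Definition der f x l := is_derive x (1 : R) f l.

Lemma der_eq f x l l' : der f x l -> l = l' -> der f x l'.
Proof. by move=> h <-. Qed.

Lemma der_cst c x : der (fun=> c) x 0.
Proof. exact: is_derive_cst. Qed.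

Lemma der_id x : der id x 1.
Proof. exact: is_derive_id. Qed.

Lemma derD f g x a b : der f x a -> der g x b -> der (fun y => f y + g y) x (a + b).
Proof. by move=> hf hg; exact: (@is_deriveD _ _ _ f g). Qed.

Lemma derN f x a : der f x a -> der (fun y => - f y) x (- a).
Proof. by move=> hf; exact: (@is_deriveN _ _ _ f). Qed.

Lemma derB f g x a b : der f x a -> der g x b -> der (fun y => f y - g y) x (a - b).
Proof. by move=> hf hg; apply: derD => //; exact: derN. Qed.

Lemma derM f g x a b : der f x a -> der g x b ->
  der (fun y => f y * g y) x (a * g x + f x * b).
Proof.
move=> hf hg; apply: (@der_eq (f * g) x); first exact: (@is_deriveM _ _ f g _ _ a b).
by rewrite /GRing.scale /= addrC [g x * a]mulrC.
Qed.

Lemma derZ c f x a : der f x a -> der (fun y => c * f y) x (c * a).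
Proof.
by move=> hf; apply: der_eq (derM (der_cst c x) hf) _; rewrite mul0r add0r.
Qed.

Lemma der_comp f g x a b : der g x b -> der f (g x) a ->
  der (fun y => f (g y)) x (a * b).
Proof. by move=> hg hf; exact: is_derive1_comp. Qed.

Lemma derX n x : der (fun y => y ^+ n) x (n%:R * x ^+ n.-1).
Proof.
elim: n => [|n IH]; first by apply: der_eq (der_cst 1 x) _; rewrite mul0r.
have -> : (fun y : R => y ^+ n.+1) = (fun y => y * y ^+ n).
  by apply/funext => y; rewrite exprS.
apply: der_eq (derM (der_id x) IH) _.
by case: n {IH} => [|n] /=; rewrite ?expr0; [ring|rewrite exprS; ring].
Qed.

Lemma derV f x a : f x != 0 -> der f x a -> der (fun y => (f y)^-1) x (- a / f x ^+ 2).
Proof.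
move=> fx hf; apply: (@der_eq (fun y => (f y)^-1) x _ _ (@is_deriveV _ f x a 1 fx hf)).
by rewrite /GRing.scale /= mulNr mulNr mulrC.
Qed.

Lemma der_near f g x a : (\near x, f x = g x) -> der f x a -> der g x a.
Proof. exact: near_eq_is_derive. Qed.

Lemma der_continuous f x a : der f x a -> {for x, continuous f}.
Proof.
by move=> [h _]; apply: differentiable_continuous; apply/derivable1_diffP.
Qed.

Lemma der_ext f g x a : f =1 g -> der f x a -> der g x a.
Proof. by move=> /funext ->. Qed.

Lemma der_unique f x a b : der f x a -> der f x b -> a = b.
Proof. by move=> [_ <-] [_ <-]. Qed.

Lemma der_mvt F f a b : a < b -> (forall x, a < x < b -> der F x (f x)) ->
  {within `[a, b], continuous F} ->
  exists2 c, a < c < b & F b - F a = f c * (b - a).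
Proof.
move=> ab hF cF; have h x : x \in `]a, b[ -> is_derive x 1 F (f x) by rewrite in_itv /=; exact: hF.
by have [c] := MVT ab h cF; rewrite in_itv /= => ? ?; exists c.
Qed.

Lemma der_cvg f x a : der f x a -> h^-1 * (f (h + x) - f x) @[h --> 0^'] --> a.
Proof.
move=> [h1 <-]; rewrite -derive1E derive1E /derive.
have -> : (fun h : R => h^-1 * (f (h + x) - f x)) =
  (fun h => h^-1 *: ((f \o shift x) (h *: 1) - f x)).
  by apply/funext => h; rewrite /GRing.scale /= mulr1.
exact: h1.
Qed.

Lemma der_of_cvg f x a : h^-1 * (f (h + x) - f x) @[h --> 0^'] --> a -> der f x a.
Proof.
have E : (fun h : R => h^-1 * (f (h + x) - f x)) =
  (fun h => h^-1 *: ((f \o shift x) (h *: 1) - f x)).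
  by apply/funext => h; rewrite /GRing.scale /= mulr1.
rewrite E => h; split; first by apply/cvg_ex; exists a.
by apply/cvg_lim => //; exact: Rhausdorff.
Qed.

Lemma nbhsP_lt (P : R -> Prop) x :
  (exists2 d, 0 < d & forall y, `|y - x| < d -> P y) <-> (\forall y \near x, P y).
Proof.
split.
  by move=> [d d0 h]; apply/nbhs_ballP; exists d => //= y hy; apply: h; rewrite distrC.
move/nbhs_ballP => [d /= d0 h]; exists d => // y hy.
by apply: h; rewrite /ball /= distrC.
Qed.

Lemma der_eps f x a :
  (forall e, 0 < e -> exists2 d, 0 < d &
    forall y, `|y - x| < d -> `|f y - f x - a * (y - x)| <= e * `|y - x|) -> der f x a.
Proof.
move=> H; apply: der_of_cvg; apply/cvgrPdist_le => /= e e0.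
have [d d0 hd] := H _ e0; rewrite /dnbhs !near_withinE.
apply/nbhsP_lt; exists d => // h; rewrite subr0 => hh h0.
have := hd (h + x); rewrite addrK => /(_ hh) le1.
have -> : a - h^-1 * (f (h + x) - f x) = - h^-1 * (f (h + x) - f x - a * h).
  by field.
by rewrite normrM normrN normfV mulrC ler_pdivrMr // normr_gt0.
Qed.

Lemma der_epsP f x a : der f x a -> forall e, 0 < e -> exists2 d, 0 < d &
    forall y, `|y - x| < d -> `|f y - f x - a * (y - x)| <= e * `|y - x|.
Proof.
move=> /der_cvg /cvgrPdist_le /= H e e0.
have := H _ e0; rewrite /dnbhs !near_withinE => /nbhsP_lt [d d0 hd].
exists d => // y hy; have [->|yx] := eqVneq y x; first by rewrite !subrr mulr0 subr0 normr0 mulr0.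
have h0 : y - x != 0 by rewrite subr_eq0.
have := hd (y - x); rewrite subr0 => /(_ hy h0); rewrite subrK.
have -> : a - (y - x)^-1 * (f y - f x) = - (y - x)^-1 * (f y - f x - a * (y - x)).
  by field.
by rewrite normrM normrN normfV mulrC ler_pdivrMr // normr_gt0.
Qed.

Lemma der_const F a b : a <= b -> (forall x, a < x < b -> der F x 0) ->
  {within `[a, b], continuous F} -> F b = F a.
Proof.
rewrite le_eqVlt => /orP[/eqP-> //|ab] hF cF.
have [c _ /eqP] := der_mvt ab hF cF.
by rewrite mul0r subr_eq0 => /eqP.
Qed.

Lemma der_ndecr F f a b : a <= b -> (forall x, a < x < b -> der F x (f x)) ->
  {within `[a, b], continuous F} -> (forall x, a < x < b -> 0 <= f x) -> F a <= F b.
Proof.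
rewrite le_eqVlt => /orP[/eqP-> //|ab] hF cF f0.
have [c /f0 fc] := der_mvt ab hF cF; rewrite -subr_ge0 => ->.
by rewrite mulr_ge0 // subr_ge0 ltW.
Qed.

Lemma near_itv_oo a b x : a < x < b -> \forall y \near x, a < y < b.
Proof.
move=> /andP[ax xb]; apply/nbhsP_lt; exists (Num.min (x - a) (b - x)).
  by rewrite lt_min !subr_gt0 ax.
move=> y; rewrite lt_min !ltr_norml => /andP[/andP[h1 h2] /andP[h3 h4]].
by apply/andP; split; lra.
Qed.

Lemma continuous_integrable f a b : continuous f ->
  lebesgue_measure.-integrable `[a, b] (EFin \o f).
Proof.
move=> cf; apply: continuous_compact_integrable; first exact: segment_compact.
exact: continuous_subspaceT.
Qed.

Lemma Rint_itvD f a x b : continuous f -> a <= x -> x <= b ->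
  \int[lebesgue_measure]_(t in `[a, b]) f t =
  \int[lebesgue_measure]_(t in `[a, x]) f t + \int[lebesgue_measure]_(t in `[x, b]) f t.
Proof.
move=> cf ax xb; have i := continuous_integrable a b cf.
have := @Rintegral_itvB _ f (BLeft a) (BRight b) x i.
rewrite !bnd_simp => /(_ ax xb) E.
rewrite [X in _ = _ + X](_ : _ = \int[lebesgue_measure]_(t in `]x, b]) f t).
  by rewrite -E addrC subrK.
rewrite Rintegral_itv_obnd_cbnd //.
apply: integrableS (continuous_integrable x b cf) => //.
by apply: subset_itvr; rewrite bnd_simp.
Qed.

Lemma prim_exists f : continuous f -> exists F, forall x, der F x (f x).
Proof.
move=> cf; pose I a b := \int[lebesgue_measure]_(t in `[a, b]) f t.
pose G x := if 0 <= x then I 0 x else - I x 0.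
exists G => x; pose a := Num.min x 0 - 1.
have [ax a0] : a < x /\ a < 0.
  have : a < Num.min x 0 by rewrite ltrBlDr ltrDl.
  by rewrite lt_min => /andP[].
have GE : forall y, a < y -> G y = I a y - I a 0.
  move=> y ay; rewrite /G; case: ifPn => y0.
    by rewrite /I (@Rint_itvD f a 0 y) // ?ltW // [X in _ = X]addrAC subrr add0r.
  rewrite -ltNge in y0.
  by rewrite /I (@Rint_itvD f a y 0) // ?ltW // opprD addrA subrr add0r.
apply: (@der_near (fun y => I a y - I a 0)).
  have axx : a < x < x + 1 by rewrite ax ltrDl ltr01.
  by apply: filterS (near_itv_oo axx) => y /andP[ay _]; rewrite GE.
have xx1 : x < x + 1 by rewrite ltrDl ltr01.
have [h1 h2] := continuous_FTC1_closed xx1 (continuous_integrable a (x + 1) cf) ax (cf x).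
rewrite -[f x]subr0; apply: derB; last exact: der_cst.
by split; [exact: h1|rewrite -derive1E; exact: h2].
Qed.

(* A junk value unless [f] has an antiderivative, which holds for continuous [f]. *)
Definition prim f := xget (fun=> 0) (fun F => forall x, der F x (f x)).

Lemma prim_der f x : continuous f -> der (prim f) x (f x).
Proof.
by move=> /prim_exists [F hF]; rewrite /prim; case: xgetP => [G _ //|/(_ F)].
Qed.

(** Defining the oriented integral through a primitive turns every identity below into a computation
    of derivatives; [Rintegral_supp] is the bridge to the Lebesgue integral of the weak
    formulation. *)
Definition itg f a b := prim f b - prim f a.

Lemma prim_continuous f : continuous f -> continuous (prim f).
Proof. by move=> cf x; exact: der_continuous (prim_der x cf). Qed.

Lemma itg_der f a x : continuous f -> der (itg f a) x (f x).
Proof.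
by move=> cf; rewrite -[f x]subr0; apply: derB; [exact: prim_der|exact: der_cst].
Qed.

Lemma itg_continuous f a : continuous f -> continuous (itg f a).
Proof. by move=> cf x; exact: der_continuous (itg_der a x cf). Qed.

Lemma itg_ftc F f a b : a <= b -> continuous f ->
  (forall x, a < x < b -> der F x (f x)) -> {within `[a, b], continuous F} ->
  itg f a b = F b - F a.
Proof.
move=> ab cf hF cF.
have h : (fun y => itg f a y - F y) b = (fun y => itg f a y - F y) a.
  apply: (@der_const (fun y => itg f a y - F y)) => //.
    by move=> x /hF hx; rewrite -(subrr (f x)); apply: derB => //; exact: itg_der.
  move=> x; apply: cvgB; last exact: cF.
  by apply: continuous_subspaceT; exact: itg_continuous.
have -> : itg f a b = (itg f a b - F b) + F b by rewrite subrK.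
by rewrite h /itg subrr sub0r addrC.
Qed.

Lemma itg_ftcT F f a b : continuous f -> (forall x, der F x (f x)) ->
  itg f a b = F b - F a.
Proof.
move=> cf hF; have cF : continuous F by move=> x; exact: der_continuous (hF x).
case: (leP a b) => ab.
  by apply: itg_ftc => //; exact: continuous_subspaceT.
have : itg f b a = F a - F b.
  by apply: itg_ftc => //; [exact: ltW|exact: continuous_subspaceT].
by rewrite /itg => h; rewrite -[LHS]opprB h opprB.
Qed.

Lemma itg_id f a : itg f a a = 0.
Proof. exact: subrr. Qed.

Lemma itgN_swap f a b : itg f a b = - itg f b a.
Proof. by rewrite /itg opprB. Qed.

Lemma itg_chasles f a b c : itg f a c = itg f a b + itg f b c.
Proof. by rewrite /itg [RHS]addrC addrA subrK. Qed.

Lemma itgD f g a b : continuous f -> continuous g ->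
  itg (fun x => f x + g x) a b = itg f a b + itg g a b.
Proof.
move=> cf cg; rewrite (@itg_ftcT (fun x => prim f x + prim g x)).
- by rewrite /itg; ring.
- by move=> x; apply: cvgD; [exact: cf|exact: cg].
- by move=> x; apply: derD; exact: prim_der.
Qed.

Lemma itgZ c f a b : continuous f -> itg (fun x => c * f x) a b = c * itg f a b.
Proof.
move=> cf; rewrite (@itg_ftcT (fun x => c * prim f x)).
- by rewrite /itg; ring.
- by move=> x; apply: cvgM; [exact: cvg_cst|exact: cf].
- by move=> x; apply: derZ; exact: prim_der.
Qed.

Lemma itgN f a b : continuous f -> itg (fun x => - f x) a b = - itg f a b.
Proof.
move=> cf; rewrite -mulN1r -itgZ //; congr itg; apply/funext => x.
by rewrite mulN1r.
Qed.

Lemma itgB f g a b : continuous f -> continuous g ->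
  itg (fun x => f x - g x) a b = itg f a b - itg g a b.
Proof.
move=> cf cg; rewrite itgD ?itgN // => x; apply: cvgN; exact: cg.
Qed.

Lemma itg_cst c a b : itg (fun=> c) a b = c * (b - a).
Proof.
rewrite (@itg_ftcT (fun x => c * x)); first by rewrite mulrBr.
- by move=> x; exact: cvg_cst.
- by move=> x; apply: der_eq (derZ c (der_id x)) _; rewrite mulr1.
Qed.

Lemma itg_ge0 f a b : continuous f -> a <= b -> (forall x, a < x < b -> 0 <= f x) ->
  0 <= itg f a b.
Proof.
move=> cf ab f0; rewrite -(itg_id f a); apply: (@der_ndecr (itg f a) f) => //.
- by move=> x _; exact: itg_der.
- by apply: continuous_subspaceT; exact: itg_continuous.
Qed.

Lemma itg_le f g a b : continuous f -> continuous g -> a <= b ->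
  (forall x, a < x < b -> f x <= g x) -> itg f a b <= itg g a b.
Proof.
move=> cf cg ab fg; rewrite -subr_ge0 -itgB //; apply: itg_ge0 => //.
  by move=> x; apply: cvgB; [exact: cg|exact: cf].
by move=> x /fg; rewrite subr_ge0.
Qed.

Lemma itg_eq f g a b : continuous f -> continuous g -> a <= b ->
  (forall x, a < x < b -> f x = g x) -> itg f a b = itg g a b.
Proof.
by move=> cf cg ab fg; apply/eqP; rewrite eq_le !itg_le // => x /fg ->.
Qed.

Lemma itg_norm_le f a b C : continuous f -> a <= b ->
  (forall x, a < x < b -> `|f x| <= C) -> `|itg f a b| <= C * (b - a).
Proof.
move=> cf ab fC; have cc c : continuous (fun _ : R => c) by move=> x; exact: cvg_cst.
rewrite ler_norml -mulNr -!itg_cst; apply/andP; split; apply: itg_le => // x /fC.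
  by rewrite ler_norml => /andP[].
by rewrite ler_norml => /andP[].
Qed.

Lemma itg_eq0 f a b : continuous f -> a <= b -> (forall x, a < x < b -> f x = 0) ->
  itg f a b = 0.
Proof.
move=> cf ab h; rewrite (@itg_eq f (fun=> 0)) ?itg_cst ?mul0r //.
by move=> x; exact: cvg_cst.
Qed.

Lemma itg_parts F G f g a b : continuous f -> continuous g ->
  (forall x, der F x (f x)) -> (forall x, der G x (g x)) ->
  itg (fun x => f x * G x) a b = F b * G b - F a * G a - itg (fun x => F x * g x) a b.
Proof.
move=> cf cg hF hG.
have cF : continuous F by move=> x; exact: der_continuous (hF x).
have cG : continuous G by move=> x; exact: der_continuous (hG x).
have c1 : continuous (fun x => f x * G x) by move=> x; apply: cvgM; [exact: cf|exact: cG].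
have c2 : continuous (fun x => F x * g x) by move=> x; apply: cvgM; [exact: cF|exact: cg].
apply/eqP; rewrite eq_sym subr_eq -itgD //; apply/eqP; symmetry.
rewrite (@itg_ftcT (fun x => F x * G x)) //.
  by move=> x; apply: cvgD; [exact: c1|exact: c2].
by move=> x; exact: derM.
Qed.

Lemma itg_scale k f a b : k != 0 -> continuous f ->
  itg (fun x => f (x / k)) (k * a) (k * b) = k * itg f a b.
Proof.
move=> k0 cf; rewrite (@itg_ftcT (fun x => k * prim f (x / k))).
- by rewrite ![k * _ / k]mulrC !mulKf // /itg mulrBr.
- move=> x; apply: (@continuous_comp _ _ _ (fun x => x / k) f); last exact: cf.
  by apply: cvgM; [exact: cvg_id|exact: cvg_cst].
- move=> x; apply: der_eq (derZ k (@der_comp _ (fun x => x / k) x _ k^-1 _ (prim_der _ cf))) _.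
    apply: (@der_ext (fun x => k^-1 * x)) => [y|]; first by rewrite mulrC.
    by apply: der_eq (derZ _ (der_id x)) _; rewrite mulr1.
  by rewrite mulrCA mulfV ?mulr1.
Qed.

End Calculus.

(** * Integrals depending on a parameter *)

Section Parametric.
Variable R : realType.

Definition cont2 (P : topologicalType) (k : P -> R -> R) :=
  continuous (fun z : P * R => k z.1 z.2).

Lemma cont2_comp (P Q : topologicalType) (k : P -> R -> R) (g : Q -> P) (h : Q -> R) :
  cont2 k -> continuous g -> continuous h -> continuous (fun q => k (g q) (h q)).
Proof.
move=> ck cg ch q.
apply: (@continuous_comp _ _ _ (fun q => (g q, h q)) (fun z : P * R => k z.1 z.2)).
  exact: (cvg_pair (cg q) (ch q)).
exact: ck.
Qed.

Lemma continuous_cst (P Q : topologicalType) (c : Q) : continuous (fun _ : P => c).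
Proof. by move=> x; exact: cvg_cst. Qed.

Lemma continuous_id (P : topologicalType) : continuous (fun x : P => x).
Proof. by move=> x; exact: cvg_id. Qed.

Lemma continuous_fst (P Q : topologicalType) : continuous (fun z : P * Q => z.1).
Proof. by move=> z; exact: cvg_fst. Qed.

Lemma continuous_snd (P Q : topologicalType) : continuous (fun z : P * Q => z.2).
Proof. by move=> z; exact: cvg_snd. Qed.

Lemma continuousD (P : topologicalType) (f g : P -> R) :
  continuous f -> continuous g -> continuous (fun x => f x + g x).
Proof. by move=> cf cg x; apply: cvgD; [exact: cf|exact: cg]. Qed.

Lemma continuousN (P : topologicalType) (f : P -> R) :
  continuous f -> continuous (fun x => - f x).
Proof. by move=> cf x; apply: cvgN; exact: cf. Qed.

Lemma continuousB (P : topologicalType) (f g : P -> R) :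
  continuous f -> continuous g -> continuous (fun x => f x - g x).
Proof. by move=> cf cg x; apply: cvgB; [exact: cf|exact: cg]. Qed.

Lemma continuousM (P : topologicalType) (f g : P -> R) :
  continuous f -> continuous g -> continuous (fun x => f x * g x).
Proof. by move=> cf cg x; apply: cvgM; [exact: cf|exact: cg]. Qed.

Lemma continuousX (P : topologicalType) (f : P -> R) n :
  continuous f -> continuous (fun x => f x ^+ n).
Proof.
move=> cf; elim: n => [|n IH]; first exact: continuous_cst.
have -> : (fun x => f x ^+ n.+1) = (fun x => f x * f x ^+ n).
  by apply/funext => x; rewrite exprS.
exact: continuousM.
Qed.

Lemma continuous_after (P Q S : topologicalType) (f : Q -> S) (g : P -> Q) :
  continuous g -> continuous f -> continuous (fun x => f (g x)).
Proof. by move=> cg cf x; apply: (@continuous_comp _ _ _ g f); [exact: cg|exact: cf]. Qed.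

Lemma cont2_l (P : topologicalType) (k : P -> R -> R) p : cont2 k -> continuous (k p).
Proof.
move=> ck; apply: (@cont2_comp _ _ k (fun=> p) id) => //.
  exact: continuous_cst.
exact: continuous_id.
Qed.

Lemma cont2_r (P : topologicalType) (k : P -> R -> R) r : cont2 k -> continuous (k ^~ r).
Proof.
move=> ck; apply: (@cont2_comp _ _ k id (fun=> r)) => //.
  exact: continuous_id.
exact: continuous_cst.
Qed.

(** Tube lemma: compactness of the segment makes continuity in [p] uniform in [r]. *)
Lemma cont2_tube (P : topologicalType) (k : P -> R -> R) (p0 : P) (a b e : R) :
  cont2 k -> 0 < e ->
  \forall p \near p0, forall r, a <= r <= b -> `|k p r - k p0 r| < e.
Proof.
move=> ck e0; have e2 : 0 < e / 2 by rewrite divr_gt0.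
have /compact_near_coveringP := @segment_compact R a b.
move=> /(_ P (nbhs p0) (fun p r => `|k p r - k p0 r| < e) _) H.
suff : \forall p \near p0, `[a, b]%classic `<=` (fun r => `|k p r - k p0 r| < e).
  by apply: filterS => p hp r hr; apply: hp; rewrite /= in_itv.
apply: H => x _.
have /cvgrPdist_lt /(_ _ e2) h1 := ck (p0, x).
have /cvgrPdist_lt /(_ _ e2) /= h2 := cont2_l (p := p0) ck (x := x).
case: h1 => -[A B] /= [hA hB] hAB.
exists (B `&` [set r | `|k p0 x - k p0 r| < e / 2], A) => /=.
  by split => //; apply: filterI.
move=> [r p] /= [[Br h4] Ap]; have /= h3 := hAB (p, r) (conj Ap Br).
rewrite (_ : k p r - k p0 r = - (k p0 x - k p r) + (k p0 x - k p0 r)); last by ring.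
by rewrite (le_lt_trans (ler_normD _ _)) // normrN [e]splitr ltrD.
Qed.

Lemma itg_param (P : topologicalType) (k : P -> R -> R) (a b : R) :
  cont2 k -> continuous (fun p => itg (k p) a b).
Proof.
move=> ck.
wlog ab : a b / a <= b => [H|].
  have [/H //|/ltW/H h] := leP a b.
  have -> : (fun p => itg (k p) a b) = (fun p => - itg (k p) b a).
    by apply/funext => p; rewrite itgN_swap.
  exact: continuousN.
move=> p0; apply/cvgrPdist_le => /= e e0.
have e1 : 0 < e / (b - a + 1) by rewrite divr_gt0 // ltr_wpDl // subr_ge0.
apply: filterS (cont2_tube p0 a b ck e1) => p hp.
rewrite -itgB; [|exact: cont2_l|exact: cont2_l].
have cB : continuous (fun x => k p0 x - k p x) by apply: continuousB; exact: cont2_l.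
apply: (le_trans (@itg_norm_le _ _ a b (e / (b - a + 1)) cB ab _)).
  by move=> x /andP[ax xb]; rewrite distrC ltW // hp // !ltW.
rewrite mulrAC ler_pdivrMr ?ltr_wpDl ?subr_ge0 // ler_pM2l // lerDl.
exact: ler01.
Qed.

Lemma itg_param2 (P : topologicalType) (k : P -> R -> R) (a : R) :
  cont2 k -> cont2 (fun p x => itg (k p) a x).
Proof.
move=> ck.
(* Rescaling to the fixed interval [0, 1] turns the moving endpoint into one more parameter, so that
   [itg_param] applies. *)
have -> : (fun p x => itg (k p) a x) = (fun p x => itg (fun s => k p (a + s * (x - a)) * (x - a)) 0 1).
  apply/funext => p; apply/funext => x.
  have cl : continuous (fun s : R => a + s * (x - a)).
    apply: continuousD; first exact: continuous_cst.
    by apply: continuousM; [exact: continuous_id|exact: continuous_cst].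
  rewrite [RHS](@itg_ftcT _ (fun s => prim (k p) (a + s * (x - a)))).
  - by rewrite /itg /= mul1r mul0r addr0 [a + (x - a)]addrC subrK.
  - apply: continuousM; last exact: continuous_cst.
    by apply: (continuous_after cl); exact: cont2_l.
  - move=> s; apply: (@der_comp _ (prim (k p)) (fun s => a + s * (x - a))); last first.
      by apply: prim_der; exact: cont2_l.
    apply: der_eq (derD (der_cst a s) (derM (der_id s) (der_cst (x - a) s))) _.
    by ring.
apply: (@itg_param _ (fun (z : P * R) s => k z.1 (a + s * (z.2 - a)) * (z.2 - a))).
have c1 : continuous (fun q : P * R * R => q.1.2 - a).
  apply: continuousB; last exact: continuous_cst.
  by apply: (continuous_after (@continuous_fst _ _)); exact: continuous_snd.
apply: continuousM => //.
apply: (@cont2_comp _ _ k (fun q : P * R * R => q.1.1)) => //.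
  by apply: (continuous_after (@continuous_fst _ _)); exact: continuous_fst.
apply: continuousD; first exact: continuous_cst.
by apply: continuousM => //; exact: continuous_snd.
Qed.

Lemma cont2_swap (k : R -> R -> R) : cont2 k -> cont2 (fun x y => k y x).
Proof.
move=> ck; apply: (@cont2_comp _ _ k (fun z : R * R => z.2) (fun z => z.1)) => //.
  exact: continuous_snd.
exact: continuous_fst.
Qed.

Lemma der_itg_param (k : R -> R -> R) (a c d t : R) : cont2 k ->
  der (fun t => itg (fun r => itg (k ^~ r) a t) c d) t (itg (k t) c d).
Proof.
move=> ck; have ck' := cont2_swap ck.
have cK : cont2 (fun t r => itg (k ^~ r) a t).
  by apply: cont2_swap; apply: (@itg_param2 _ (fun r t => k t r)).
wlog cd : c d / c <= d => [H|].
  have [/H //|/ltW/H h] := leP c d.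
  apply: (@der_ext _ (fun t => - itg (fun r => itg (k ^~ r) a t) d c)).
    by move=> s; rewrite -itgN_swap.
  by rewrite itgN_swap; exact: derN.
apply: der_eps => e e0.
have e1 : 0 < e / (d - c + 1) by rewrite divr_gt0 // ltr_wpDl // subr_ge0.
have /nbhsP_lt [dl dl0 hdl] := cont2_tube t c d ck e1.
exists dl => // y hy.
have cs s : continuous (fun r => itg (k ^~ r) a s) by exact: (cont2_l (p := s) cK).
rewrite -itgB // mulrC -itgZ; last exact: cont2_l.
rewrite -itgB; [|by apply: continuousB|by apply: continuousM; [exact: continuous_cst|exact: cont2_l]].
apply: (le_trans (@itg_norm_le _ _ c d (e / (d - c + 1) * `|y - t|) _ cd _)).
- apply: continuousB; first exact: continuousB.
  by apply: continuousM; [exact: continuous_cst|exact: cont2_l].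
- move=> r /andP[cr rd].
  rewrite [X in `|X|](_ : _ = itg (k ^~ r) t y - k t r * (y - t)); last by rewrite /itg; ring.
  rewrite -itg_cst -itgB; last 2 first.
  - exact: cont2_l ck'.
  - exact: continuous_cst.
  have cc : continuous (fun x => k x r - k t r).
    by apply: continuousB; [exact: (cont2_l (p := r) ck')|exact: continuous_cst].
  have rcd : c <= r <= d by rewrite !ltW.
  have [ty|yt] := leP t y.
    rewrite [`|y - t|]ger0_norm ?subr_ge0 //.
    apply: itg_norm_le => // x /andP[tx xy]; apply/ltW/hdl => //.
    by apply: le_lt_trans hy; rewrite !ger0_norm ?subr_ge0 ?lerD2r ?(ltW tx) ?(ltW xy) ?ty.
  have yt' : y - t <= 0 by rewrite subr_le0 ltW.
  rewrite itgN_swap normrN (ler0_norm yt') opprB.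
  apply: itg_norm_le => //; first exact: ltW.
  move=> x /andP[yx xt]; apply/ltW/hdl => //.
  by apply: le_lt_trans hy; rewrite !ler0_norm ?subr_le0 ?lerN2 ?lerD2r ?(ltW xt) ?(ltW yx) ?(ltW yt).
rewrite -mulrA [`|_| * _]mulrC mulrA ler_wpM2r // mulrAC ler_pdivrMr; last first.
  by rewrite ltr_wpDl // subr_ge0.
by rewrite ler_pM2l // lerDl.
Qed.

(** As functions of the upper limit b, both sides vanish at b = a and have the same derivative, the
    right one by [der_itg_param]. *)
Lemma itg_fubini (k : R -> R -> R) (a b c d : R) : cont2 k ->
  itg (fun t => itg (k t) c d) a b = itg (fun r => itg (k ^~ r) a b) c d.
Proof.
move=> ck; rewrite (@itg_ftcT _ (fun t => itg (fun r => itg (k ^~ r) a t) c d)).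
- rewrite [X in _ - X](_ : _ = 0) ?subr0 //.
  have -> : (fun r => itg (k ^~ r) a a) = (fun=> 0) by apply/funext => r; rewrite itg_id.
  by rewrite itg_cst mul0r.
- exact: itg_param.
- by move=> t; exact: der_itg_param.
Qed.

End Parametric.

(** * Iterated integrals of radial functions *)

Section Polar.
Variable R : realType.
Implicit Types (H G h : R -> R) (K rho : R) (N : nat).

Lemma unif_cont (h : R -> R) (a b e : R) : continuous h -> 0 < e ->
  exists2 d, 0 < d & forall x y, a <= x <= b -> `|y - x| < d -> `|h y - h x| < e.
Proof.
move=> ch e0.
have ck : cont2 (fun p r : R => h (r + p)).
  apply: (@continuous_after _ _ _ h) => //.
  by apply: continuousD; [exact: continuous_snd|exact: continuous_fst].
have /nbhsP_lt [d d0 hd] := cont2_tube 0 a b ck e0.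
exists d => // x y xab yx; have := hd (y - x); rewrite subr0 => /(_ yx x xab).
by rewrite addr0 [x + _]addrC subrK.
Qed.

Lemma Rintegral_itg h a b : a < b -> continuous h ->
  \int[lebesgue_measure]_(x in `[a, b]) h x = itg h a b.
Proof.
move=> ab ch; rewrite /Rintegral (@continuous_FTC2 _ h (prim h)) //.
- exact: continuous_subspaceT.
- split.
  + by move=> x _; have [] := prim_der x ch.
  + by apply: cvg_at_right_filter; exact: prim_continuous.
  + by apply: cvg_at_left_filter; exact: prim_continuous.
- by move=> x _; rewrite derive1E; have [_ ->] := prim_der x ch.
Qed.

Lemma Rintegral_supp h a b (D : set R) : a < b -> continuous h -> `[a, b] `<=` D ->
  (forall x, D x -> ~ a <= x <= b -> h x = 0) ->
  \int[lebesgue_measure]_(x in D) h x = itg h a b.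
Proof.
move=> ab ch abD h0; rewrite -Rintegral_itg // [LHS]Rintegral_mkcond [RHS]Rintegral_mkcond.
congr (Rintegral _ _ _); apply/funext => x; rewrite /patch.
case: ifPn => [/set_mem xD|]; case: ifPn => //.
  move=> /negP xab; apply: h0 => // xx; apply: xab; apply/mem_set.
  by rewrite /= in_itv.
by move=> /set_mem /abD xD /negP[]; exact/mem_set.
Qed.

(** The iterated integral over the cube [-K, K]^N of H(|rho| + |y|^2). Using the squared radius as
    argument makes peeling off one coordinate an addition, and the absolute value means that H is
    only evaluated at nonnegative arguments. *)
Fixpoint rint K N H : R -> R :=
  match N with
  | 0 => fun rho => H `|rho|
  | N'.+1 => fun rho => itg (fun s => rint K N' H (`|rho| + s ^+ 2)) (- K) K
  end.

Lemma continuous_normr : continuous (fun x : R => `|x|).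
Proof. by move=> x; apply: (@norm_continuous _ R). Qed.

Lemma rint_continuous K N H : continuous H -> continuous (rint K N H).
Proof.
move=> cH; elim: N => [|N IH] /=.
  exact: (continuous_after continuous_normr cH).
apply: (@itg_param _ _ (fun rho s => rint K N H (`|rho| + s ^+ 2))).
apply: (@continuous_after _ _ _ (rint K N H)) => //.
apply: continuousD.
  exact: (continuous_after (@continuous_fst _ _) continuous_normr).
by apply: continuousX; exact: continuous_snd.
Qed.

Lemma rint_slice K N H rho : continuous H ->
  continuous (fun s : R => rint K N H (`|rho| + s ^+ 2)).
Proof.
move=> cH; apply: (@continuous_after _ _ _ (rint K N H)); last exact: rint_continuous.
apply: continuousD; first exact: continuous_cst.
by apply: continuousX; exact: continuous_id.
Qed.

Lemma rint_supp K N H rho : 0 < K -> continuous H ->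
  (forall r, K ^+ 2 <= r -> H r = 0) -> K ^+ 2 <= rho -> rint K N H rho = 0.
Proof.
move=> K0 cH H0; elim: N rho => [|N IH] rho rK /=.
  by apply: H0; apply: le_trans rK _; exact: ler_norm.
rewrite itg_eq0 //; first exact: rint_slice.
  by lra.
move=> s _; apply: IH; apply: (le_trans rK).
by rewrite -[rho]addr0 lerD ?sqr_ge0 // addr0 ler_norm.
Qed.

Lemma rintE K N H rho : 0 < K -> continuous H ->
  (forall r, K ^+ 2 <= r -> H r = 0) -> 0 <= rho ->
  integral_RN (fun x : 'rV[R]_N => H (rho + \sum_(i < N) x 0 i ^+ 2)) = rint K N H rho.
Proof.
move=> K0 cH H0; elim: N rho => [|N IH] rho r0 /=.
  by rewrite big_ord0 addr0 ger0_norm.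
have E s : integral_RN (fun y : 'rV[R]_N =>
    H (rho + \sum_(i < N.+1) (row_mx (s%:M : 'rV_1) y) 0 i ^+ 2)) =
    rint K N H (`|rho| + s ^+ 2).
  rewrite -IH ?addr_ge0 ?sqr_ge0 //; congr integral_RN; apply/funext => y.
  congr H; rewrite ger0_norm // -addrA; congr (_ + _).
  rewrite (@big_split_ord _ _ _ 1 N) /= big_ord1; congr (_ + _).
    by rewrite row_mxEl mxE eqxx mulr1n.
  by apply: eq_bigr => i _; rewrite row_mxEr.
have KK : - K < K by lra.
rewrite -(Rintegral_supp (D := setT) KK).
- by congr (Rintegral _ _ _); apply/funext => s; rewrite E.
- exact: rint_slice.
- by [].
- move=> s _ sK; apply: rint_supp => //.
  rewrite -[K ^+ 2]add0r lerD // -[s ^+ 2]real_normK ?num_real //.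
  rewrite lerXn2r ?nnegrE ?normr_ge0 ?(ltW K0) //.
  by rewrite leNgt; apply/negP => h; apply: sK; rewrite -ler_norml ltW.
Qed.

Lemma rint_K K K' N H rho : 0 < K -> 0 < K' -> continuous H ->
  (forall r, K ^+ 2 <= r -> H r = 0) -> (forall r, K' ^+ 2 <= r -> H r = 0) -> 0 <= rho ->
  rint K N H rho = rint K' N H rho.
Proof. by move=> ? ? ? ? ? ?; rewrite -rintE // -rintE. Qed.

Lemma rint_ext K N H G : continuous H -> continuous G -> 0 <= K ->
  (forall r, 0 <= r -> H r = G r) -> rint K N H =1 rint K N G.
Proof.
move=> cH cG K0 HG; elim: N => [|N IH] rho /=; first exact: HG.
by congr itg; apply/funext => s; rewrite IH.
Qed.

Lemma rintD K N H G rho : continuous H -> continuous G ->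
  rint K N (fun r => H r + G r) rho = rint K N H rho + rint K N G rho.
Proof.
move=> cH cG; elim: N rho => [//|N IH] rho /=.
by rewrite -itgD; [|exact: rint_slice..]; congr itg; apply/funext => s.
Qed.

Lemma rintZ K N c H rho : continuous H ->
  rint K N (fun r => c * H r) rho = c * rint K N H rho.
Proof.
move=> cH; elim: N rho => [//|N IH] rho /=.
by rewrite -itgZ; [|exact: rint_slice]; congr itg; apply/funext => s.
Qed.

Lemma rint_le K N H G rho : 0 < K -> continuous H -> continuous G ->
  (forall r, 0 <= r -> H r <= G r) -> rint K N H rho <= rint K N G rho.
Proof.
move=> K0 cH cG HG; elim: N rho => [|N IH] rho /=; first exact: HG.
by apply: itg_le; [exact: rint_slice|exact: rint_slice|lra|].
Qed.

Lemma rint_cst K N c rho : rint K N (fun=> c) rho = c * (2 * K) ^+ N.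
Proof.
elim: N rho => [|N IH] rho /=; first by rewrite expr0 mulr1.
have -> : (fun s : R => rint K N (fun=> c) (`|rho| + s ^+ 2)) = (fun=> c * (2 * K) ^+ N).
  by apply/funext => s; rewrite IH.
by rewrite itg_cst exprS; ring.
Qed.

Lemma rint_norm K N H C rho : 0 < K -> continuous H ->
  (forall r, 0 <= r -> `|H r| <= C) -> `|rint K N H rho| <= C * (2 * K) ^+ N.
Proof.
move=> K0 cH HC; rewrite -(rint_cst K N C rho) ler_norml; apply/andP; split.
  rewrite -[- _]mulN1r -rintZ; last exact: continuous_cst.
  apply: rint_le => //; first exact: continuous_cst.
  by move=> r /HC; rewrite ler_norml mulN1r => /andP[].
apply: rint_le => //; first exact: continuous_cst.
by move=> r /HC; rewrite ler_norml => /andP[].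
Qed.

Lemma rint_scale K N H k rho : 0 < k -> continuous H ->
  rint (k * K) N (fun r => H (r / k ^+ 2)) rho = k ^+ N * rint K N H (rho / k ^+ 2).
Proof.
move=> k0 cH; elim: N rho => [|N IH] rho /=.
  by rewrite expr0 mul1r normrM normfV [`|k ^+ 2|]ger0_norm ?sqr_ge0.
have k2 : k != 0 by rewrite gt_eqF.
have -> : (fun s => rint (k * K) N (fun r => H (r / k ^+ 2)) (`|rho| + s ^+ 2)) =
          (fun s => k ^+ N * rint K N H (`|rho / k ^+ 2| + (s / k) ^+ 2)).
  apply/funext => s; rewrite IH; congr (_ * rint _ _ _ _).
  rewrite normrM normfV [`|k ^+ 2|]ger0_norm ?sqr_ge0 //; by field.
rewrite -mulrN (@itg_scale _ k (fun s => k ^+ N * rint K N H (`|rho / k ^+ 2| + s ^+ 2))) //.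
  by rewrite itgZ; [rewrite [k ^+ N.+1]exprS mulrA|exact: rint_slice].
apply: continuousM; first exact: continuous_cst.
exact: rint_slice.
Qed.

Lemma itg_gt0 h a b c : continuous h -> a <= c <= b -> a < b ->
  (forall x, a < x < b -> 0 <= h x) -> 0 < h c -> 0 < itg h a b.
Proof.
move=> ch /andP[ac cb] ab h0 hc; rewrite lt_neqAle itg_ge0 ?(ltW ab) // andbT.
apply/negP => /eqP E.
have Z x : a <= x <= b -> itg h a x = 0.
  move=> /andP[ax xb]; move: E; rewrite (itg_chasles h a x b) => E.
  have i1 : 0 <= itg h a x.
    by apply: itg_ge0 => // y /andP[h1 h2]; apply: h0; rewrite h1 (lt_le_trans h2).
  have i2 : 0 <= itg h x b.
    by apply: itg_ge0 => // y /andP[h1 h2]; apply: h0; rewrite h2 (le_lt_trans ax).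
  by lra.
have hc2 : 0 < h c / 2 by rewrite divr_gt0.
have /nbhsP_lt [d d0 hd] : \forall x \near c, h c / 2 < h x.
  by apply: (cvgr_gt (h c) (ch c)); rewrite ltr_pdivrMr // mulr_natr mulr2n ltrDl.
have [y [z [ay yz zb yc zc]]] : exists y z, [/\ a <= y, y < z, z <= b, `|y - c| < d & `|z - c| < d].
  have [cb'|] := ltP c b.
    exists c, (Num.min b (c + d / 2)); split => //.
    - by rewrite lt_min cb' ltrDl divr_gt0.
    - by rewrite ge_min lexx.
    - by rewrite subrr normr0.
    - rewrite ger0_norm ?subr_ge0 ?le_min ?(ltW cb') ?lerDl ?ltW ?divr_gt0 //.
      by rewrite ltrBlDl gt_min; apply/orP; right; lra.
  move=> bc; have {cb} cb : c = b by apply/eqP; rewrite eq_le cb.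
  exists (Num.max a (c - d / 2)), c; split => //.
  - by rewrite le_max lexx.
  - by rewrite gt_max cb ab; lra.
  - by rewrite cb.
  - rewrite ler0_norm ?subr_le0 ?ge_max ?ac ?gerBl ?ltW ?divr_gt0 //.
    by rewrite opprB ltrBlDl addrC -ltrBlDl lt_max; apply/orP; right; lra.
  - by rewrite subrr normr0.
have : h c / 2 * (z - y) <= itg h y z.
  rewrite -itg_cst; apply: itg_le => //; [exact: continuous_cst|exact: ltW|].
  move=> x /andP[yx xz]; apply/ltW/hd; move: yc zc; rewrite !ltr_norml.
  by move=> /andP[? ?] /andP[? ?]; apply/andP; split; lra.
have -> : itg h y z = itg h a z - itg h a y by rewrite /itg; ring.
rewrite !Z ?ay ?zb ?(le_trans ay (ltW yz)) ?(le_trans (ltW yz) zb) // subrr.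
by rewrite leNgt mulr_gt0 // subr_gt0.
Qed.

Lemma rint_gt0 K N H : 0 < K -> continuous H -> (forall r, 0 <= r -> 0 <= H r) ->
  0 < H 0 -> 0 < rint K N H 0.
Proof.
move=> K0 cH H0 Hp.
have nonneg M rho : 0 <= rint K M H rho.
  have := @rint_le K M (fun=> 0) H rho K0 (@continuous_cst _ _ 0) cH H0.
  by rewrite rint_cst mul0r.
elim: N => [|N IH] /=; first by rewrite normr0.
have cs := @rint_slice K N H 0 cH.
apply: (@itg_gt0 _ _ _ 0) => //; [by apply/andP; split; lra|by lra|].
by rewrite normr0 add0r expr0n.
Qed.

(* Hinges span the piecewise linear functions, and scaling determines the radial
   integral of a hinge; polar coordinates follow by density. *)
Definition hinge (k r : R) := Num.max (k - r) 0.

Lemma hinge_continuous k : continuous (hinge k).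
Proof.
move=> r; apply: (@continuous_max R R (fun r => k - r) (fun=> 0)).
  by apply: continuousB; [exact: continuous_cst|exact: continuous_id].
exact: continuous_cst.
Qed.

Definition sq H := fun r : R => H (Num.sqrt r).

Lemma sqrt_cont : continuous (@Num.sqrt R).
Proof. exact: sqrt_continuous. Qed.

Lemma sq_continuous h : continuous h -> continuous (sq h).
Proof. by move=> ch; exact: (continuous_after sqrt_cont ch). Qed.

(** The N-dimensional integral of h(|x|), to be compared with the one-dimensional weighted integral
    [pint]. *)
Definition lam K N h := rint K N (sq h) 0.

Lemma lamD K N h g : continuous h -> continuous g ->
  lam K N (fun r => h r + g r) = lam K N h + lam K N g.
Proof. by move=> ch cg; rewrite /lam -rintD //; exact: sq_continuous. Qed.

Lemma lamZ K N c h : continuous h -> lam K N (fun r => c * h r) = c * lam K N h.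
Proof. by move=> ch; rewrite /lam -rintZ //; exact: sq_continuous. Qed.

Lemma lam_norm K N h C : 0 < K -> continuous h -> (forall r, 0 <= r -> `|h r| <= C) ->
  `|lam K N h| <= C * (2 * K) ^+ N.
Proof.
move=> K0 ch hC; apply: rint_norm => //; first exact: sq_continuous.
by move=> r _; apply: hC; exact: sqrtr_ge0.
Qed.

Lemma sqrt_geK K r : 0 < K -> K ^+ 2 <= r -> K <= Num.sqrt r.
Proof.
by move=> K0 h; rewrite -[K](ger0_norm (ltW K0)) -sqrtr_sqr ler_wsqrtr.
Qed.

(** The hinge at k vanishes beyond radius k, so the cube may be shrunk to half-side k; there it is a
    dilate of the unit hinge, with one factor k for its height and N for the volume. *)
Lemma lam_hinge K N k : 0 < K -> 0 < k <= K ->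
  lam K N (hinge k) = k ^+ N.+1 * lam 1 N (hinge 1).
Proof.
move=> K0 /andP[k0 kK]; rewrite /lam.
have ch := sq_continuous (@hinge_continuous k).
have hz L : 0 < L -> k <= L -> forall r, L ^+ 2 <= r -> sq (hinge k) r = 0.
  move=> L0 kL r /(sqrt_geK L0) h; rewrite /sq /hinge.
  by apply/max_idPr; rewrite subr_le0 (le_trans kL).
rewrite (@rint_K K k) //; try by apply: hz.
have E : rint k N (sq (hinge k)) =1 rint (k * 1) N (fun r => k * sq (hinge 1) (r / k ^+ 2)).
  rewrite mulr1; apply: rint_ext => //; [|exact: ltW|].
    apply: continuousM; first exact: continuous_cst.
    apply: (@continuous_after _ _ _ (sq (hinge 1))); last first.
      by apply: sq_continuous; exact: hinge_continuous.
    by apply: continuousM; [exact: continuous_id|exact: continuous_cst].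
  move=> r r0; rewrite /sq /hinge sqrtrM // sqrtrV ?sqr_ge0 // sqrtr_sqr gtr0_norm //.
  by rewrite maxr_pMr ?(ltW k0) // mulr0 mulrBr mulr1 mulrCA mulfV ?mulr1 // gt_eqF.
rewrite E rintZ; last first.
  apply: (@continuous_after _ _ _ (sq (hinge 1))); last first.
    by apply: sq_continuous; exact: hinge_continuous.
  by apply: continuousM; [exact: continuous_id|exact: continuous_cst].
rewrite (@rint_scale 1 N (sq (hinge 1))) //; last first.
  by apply: sq_continuous; exact: hinge_continuous.
by rewrite mul0r mulrA exprS.
Qed.

Definition pint K n h := itg (fun r => h r * r ^+ n) 0 K.

Lemma pint_continuous n h : continuous h -> continuous (fun r => h r * r ^+ n).
Proof. by move=> ch; apply: continuousM => //; exact/continuousX/continuous_id. Qed.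

Lemma pintD K n h g : continuous h -> continuous g ->
  pint K n (fun r => h r + g r) = pint K n h + pint K n g.
Proof.
move=> ch cg; rewrite /pint -itgD; [|exact: pint_continuous..].
by congr itg; apply/funext => r; rewrite mulrDl.
Qed.

Lemma pintZ K n c h : continuous h -> pint K n (fun r => c * h r) = c * pint K n h.
Proof.
move=> ch; rewrite /pint -itgZ; [|exact: pint_continuous].
by congr itg; apply/funext => r; rewrite mulrA.
Qed.

Lemma pint_norm K n h C : 0 < K -> continuous h -> (forall r, 0 <= r -> `|h r| <= C) ->
  `|pint K n h| <= C * K ^+ n * K.
Proof.
move=> K0 ch hC; rewrite -[X in _ <= _ * X]subr0; apply: itg_norm_le; [exact: pint_continuous|exact: ltW|].
move=> r /andP[r0 rK]; have r0' := ltW r0.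
rewrite normrM ler_pM ?normr_ge0 ?hC // normrX ger0_norm //.
by rewrite lerXn2r ?nnegrE ?ltW.
Qed.

Lemma pint_hinge K n k : 0 < K -> 0 < k <= K ->
  pint K n (hinge k) = k ^+ n.+2 / (n.+1%:R * n.+2%:R).
Proof.
move=> K0 /andP[k0 kK]; rewrite /pint (itg_chasles _ 0 k K).
rewrite [X in _ + X]itg_eq0 ?addr0 //; last 2 first.
- exact/pint_continuous/hinge_continuous.
- move=> x /andP[kx _]; rewrite /hinge (_ : Num.max _ _ = 0) ?mul0r //.
  by apply/max_idPr; rewrite subr_le0 ltW.
have n1 : n.+1%:R != 0 :> R by rewrite pnatr_eq0.
have n2 : n.+2%:R != 0 :> R by rewrite pnatr_eq0.
rewrite (@itg_eq _ _ (fun r => k * r ^+ n - r ^+ n.+1)); last 4 first.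
- exact/pint_continuous/hinge_continuous.
- apply: continuousB; last exact/continuousX/continuous_id.
  by apply: continuousM; [exact: continuous_cst|exact/continuousX/continuous_id].
- exact: ltW.
- move=> x /andP[x0 xk]; rewrite /hinge (_ : Num.max _ _ = k - x) ?mulrBl ?exprS //.
  by apply/max_idPl; rewrite subr_ge0 ltW.
rewrite (@itg_ftcT _ (fun r => k / n.+1%:R * r ^+ n.+1 - n.+2%:R^-1 * r ^+ n.+2)).
- rewrite !expr0n /= !mulr0 !subr0 !exprS.
  have E2 : n.+2%:R = n.+1%:R + 1 :> R by rewrite -natr1.
  move: n1 n2 E2; move: (n.+1%:R : R) (n.+2%:R : R) => A B A0 B0 BE; subst B.
  by field; rewrite A0 B0.
- apply: continuousB; last exact/continuousX/continuous_id.
  by apply: continuousM; [exact: continuous_cst|exact/continuousX/continuous_id].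
- move=> x; apply: der_eq (derB (derZ _ (derX _ x)) (derZ _ (derX _ x))) _ => /=.
  by rewrite mulrA mulfVK // mulrA mulVf // mul1r.
Qed.

(** The area of the unit sphere of R^(n+1), read off from the unit hinge: its one-dimensional
    integral against r^n is 1 / ((n+1) (n+2)). *)
Definition polar_const n := lam 1 n.+1 (hinge 1) * (n.+1%:R * n.+2%:R).

Lemma polar_const_gt0 n : 0 < polar_const n.
Proof.
rewrite /polar_const mulr_gt0 ?mulr_gt0 ?ltr0n // /lam; apply: rint_gt0 => //.
- exact/sq_continuous/hinge_continuous.
- by move=> r _; rewrite /sq /hinge le_max lexx orbT.
- by rewrite /sq /hinge sqrtr0 subr0 lt_max ltr01.
Qed.

Lemma lam_pint_hinge K n k : 0 < K -> k <= K ->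
  lam K n.+1 (hinge k) = polar_const n * pint K n (hinge k).
Proof.
move=> K0 kK; have [k0|k0] := leP k 0; last first.
  rewrite lam_hinge ?k0 // pint_hinge ?k0 // /polar_const.
  have n1 : n.+1%:R != 0 :> R by rewrite pnatr_eq0.
  have n2 : n.+2%:R != 0 :> R by rewrite pnatr_eq0.
  have := mulf_neq0 n1 n2; move: (n.+1%:R * n.+2%:R) => c c0.
  by field.
have hz r : 0 <= r -> hinge k r = 0.
  by move=> r0; apply/max_idPr; rewrite subr_le0 (le_trans k0).
rewrite /pint itg_eq0 ?(ltW K0) ?mulr0 //; last 2 first.
- exact/pint_continuous/hinge_continuous.
- by move=> x /andP[/ltW x0 _]; rewrite hz ?mul0r.
have := @lam_norm K n.+1 (hinge k) 0 K0 (@hinge_continuous k).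
rewrite mul0r normr_le0 => H; apply/eqP; apply: H => r /hz ->.
by rewrite normr0.
Qed.

End Polar.

(** * Piecewise linear interpolation and polar coordinates *)

Section Interpolation.
Variable R : realType.
Implicit Types (h g : R -> R) (K r x d : R) (n i : nat).

(** A second difference of hinges. Tents at consecutive multiples of d telescope to a partition of
    unity, so linear interpolants are combinations of hinges. *)
Definition tent d x r : R := (hinge (x + d) r - 2 * hinge x r + hinge (x - d) r) / d.

Lemma tent_ge0 d x r : 0 < d -> 0 <= tent d x r.
Proof.
move=> d0; rewrite /tent divr_ge0 ?(ltW d0) // /hinge.
case: (leP (x + d - r) 0) => ?; case: (leP (x - r) 0) => ?; case: (leP (x - d - r) 0) => ?; lra.
Qed.

Lemma tent_out d x r : 0 < d -> d <= `|r - x| -> tent d x r = 0.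
Proof.
move=> d0 h; rewrite /tent (_ : hinge _ _ - _ + _ = 0) ?mul0r // /hinge; move: h.
case: (ger0P (r - x)) => ?;
case: (leP (x + d - r) 0) => ?; case: (leP (x - r) 0) => ?; case: (leP (x - d - r) 0) => ?;
 lra.
Qed.

Lemma tent_sum d r m : 0 < d -> 0 <= r <= m%:R * d -> \sum_(i < m.+1) tent d (i%:R * d) r = 1.
Proof.
move=> d0 /andP[r0 rm].
have S k : \sum_(i < k) tent d (i%:R * d) r = (hinge (k%:R * d) r - hinge (k%:R * d - d) r) / d.
  elim: k => [|k IH].
    rewrite big_ord0 mul0r sub0r /hinge.
    by case: (leP (0 - r) 0) => ?; case: (leP (- d - r) 0) => ?; rewrite ?subrr ?mul0r //; lra.
  have E : k.+1%:R * d = k%:R * d + d by rewrite -natr1 mulrDl mul1r.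
  rewrite big_ord_recr /= IH /tent E addrK; field.
  by rewrite gt_eqF.
have E : m.+1%:R * d = m%:R * d + d by rewrite -natr1 mulrDl mul1r.
rewrite S E addrK /hinge (max_idPl _) ?(max_idPl _); [|lra|lra].
by rewrite opprB addrA subrK [X in X - _]addrC addrK divff // gt_eqF.
Qed.

(** The difference [D] of the two sides is linear, bounded by the sup norm on [0, oo), and zero on
    hinges that end before K; hence it is zero on interpolants, and on [h] by uniform
    approximation. *)
Lemma lam_pint K n h : 0 < K -> continuous h -> (forall r, K <= r -> h r = 0) ->
  lam K n.+1 h = polar_const R n * pint K n h.
Proof.
move=> K0 ch hK; apply/eqP; rewrite -subr_eq0.
pose D (f : R -> R) := lam K n.+1 f - polar_const R n * pint K n f.
have DD (f g : R -> R) : continuous f -> continuous g -> D (fun r => f r + g r) = D f + D g.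
  by move=> cf cg; rewrite /D lamD // pintD //; ring.
have DZ (c : R) (f : R -> R) : continuous f -> D (fun r => c * f r) = c * D f.
  by move=> cf; rewrite /D lamZ // pintZ //; ring.
have chin (k : R) : continuous (@hinge R k) by exact: hinge_continuous.
have ccst (c : R) : continuous (fun _ : R => c) by exact: continuous_cst.
have ctent (d x : R) : continuous (tent d x).
  apply: continuousM => //; apply: continuousD => //; apply: continuousB => //.
  exact: continuousM.
have Dtent (d x : R) : x + d <= K -> 0 < d -> D (tent d x) = 0.
  move=> xd d0; have -> : tent d x = (fun r => d^-1 * (hinge (x + d) r +
      (-2 * hinge x r + hinge (x - d) r))).
    by apply/funext => r; rewrite /tent; ring.
  have c2 : continuous (fun r => -2 * hinge x r) by apply: continuousM.
  rewrite DZ; last by apply: continuousD => //; exact: continuousD.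
  rewrite DD //; last exact: continuousD.
  rewrite DD // DZ //.
  have Dh k : k <= K -> D (hinge k) = 0 by move=> ?; rewrite /D lam_pint_hinge // subrr.
  by rewrite !Dh; [ring|lra|lra|lra].
set C := (2 * K) ^+ n.+1 + polar_const R n * (K ^+ n * K).
have pc := polar_const_gt0 R n.
have C0 : 0 < C.
  by apply: addr_gt0; [apply/exprn_gt0/mulr_gt0|apply: mulr_gt0 => //; apply/mulr_gt0/K0/exprn_gt0].
have Dnorm (f : R -> R) (e : R) : continuous f -> (forall r, 0 <= r -> `|f r| <= e) -> `|D f| <= C * e.
  move=> cf fe; rewrite /D (le_trans (ler_normB _ _)) // /C mulrDl lerD //.
    by rewrite mulrC lam_norm.
  rewrite normrM (gtr0_norm pc) -[X in _ <= X]mulrA ler_pM2l //.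
  by rewrite mulrC mulrA pint_norm.
have main (e : R) : 0 < e -> `|D h| <= C * e.
  move=> e0; have [d1 d10 hd1] := unif_cont 0 K ch e0.
  pose m := (Num.bound (K / d1)).+1; pose d := K / m%:R.
  have m0 : 0 < m%:R :> R by rewrite ltr0n.
  have d0 : 0 < d by rewrite divr_gt0.
  have dd1 : d < d1.
    rewrite /d ltr_pdivrMr // mulrC -ltr_pdivrMr //.
    have := archi_boundP (ltW (divr_gt0 K0 d10)); move/lt_trans; apply.
    by rewrite ltr_nat.
  have md : m%:R * d = K by rewrite /d mulrC divfK // gt_eqF.
  pose p k r := \sum_(i < k) h (i%:R * d) * tent d (i%:R * d) r.
  have cp k : continuous (p k).
    elim: k => [|k IH].
      by rewrite (_ : p 0 = fun=> 0) //; apply/funext => r; rewrite /p big_ord0.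
    rewrite (_ : p k.+1 = fun r => p k r + h (k%:R * d) * tent d (k%:R * d) r).
      by apply: continuousD => //; exact: continuousM.
    by apply/funext => r; rewrite /p big_ord_recr.
  (* The last node m is left out: its tent would reach beyond K. Nothing is lost, as h(K) = 0. *)
  have Dp k : (k <= m)%N -> D (p k) = 0.
    elim: k => [_|k IH km].
      rewrite (_ : p 0 = fun r => 0 * hinge 0 r) ?DZ ?mul0r //.
      by apply/funext => r; rewrite /p big_ord0 mul0r.
    rewrite (_ : p k.+1 = fun r => p k r + h (k%:R * d) * tent d (k%:R * d) r); last first.
      by apply/funext => r; rewrite /p big_ord_recr.
    rewrite DD // ?IH ?(ltnW km) //; last exact: continuousM.
    rewrite DZ // Dtent ?mulr0 ?addr0 //.
    rewrite -md -[X in _ + X]mul1r -mulrDl natr1 ler_pM2r // ler_nat.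
    done.
  have hp r : 0 <= r -> `|h r - p m r| <= e.
    move=> r0; have [Kr|rK] := leP K r.
      rewrite hK // sub0r normrN /p big1 ?normr0 ?(ltW e0) // => i _.
      rewrite tent_out ?mulr0 // ler_normr; apply/orP; left.
      have : i.+1%:R * d <= K by rewrite -md ler_pM2r // ler_nat.
      by rewrite -natr1 mulrDl mul1r; lra.
    have -> : p m r = \sum_(i < m.+1) h (i%:R * d) * tent d (i%:R * d) r.
      by rewrite big_ord_recr /= md (hK K) ?lexx // mul0r addr0.
    have rm : 0 <= r <= m%:R * d by rewrite md r0 ltW.
    have T c : c = \sum_(i < m.+1) c * tent d (i%:R * d) r.
      by rewrite -mulr_sumr tent_sum // mulr1.
    rewrite [h r]T -sumrB.
    apply: (le_trans (ler_norm_sum _ _ _)).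
    rewrite [X in _ <= X]T; apply: ler_sum => i _.
    rewrite -mulrBl normrM [`|tent _ _ _|]ger0_norm ?tent_ge0 //.
    have [out|] := leP d `|r - i%:R * d|; first by rewrite tent_out // !mulr0.
    move=> close; rewrite ler_wpM2r ?tent_ge0 // distrC ltW // hd1 //.
      by rewrite r0 ltW.
    by rewrite distrC (lt_trans close).
  have -> : D h = D (fun r => h r - p m r).
    have -> : (fun r => h r - p m r) = (fun r => h r + -1 * p m r).
      by apply/funext => r; rewrite mulN1r.
    by rewrite DD ?DZ ?Dp ?mulr0 ?addr0 //; exact: continuousM.
  by apply: Dnorm => //; exact: continuousB.
rewrite -/(D h) -normr_le0 leNgt; apply/negP => Dpos.
have := main (`|D h| / (2 * C)); rewrite divr_gt0 ?mulr_gt0 // => /(_ isT).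
have -> : C * (`|D h| / (2 * C)) = `|D h| / 2 by field; rewrite gt_eqF.
by lra.
Qed.

End Interpolation.

(** * Radial test functions and the flux identity *)

Section RadialTest.
Variables (R : realType) (N : nat).
Implicit Types (x : 'rV[R]_N).

Definition sqnorm x : R := \sum_(i < N) x 0 i ^+ 2.

Lemma continuous_sum (P : topologicalType) (I : Type) (s : seq I) (F : I -> P -> R) :
  (forall i, continuous (F i)) -> continuous (fun p => \sum_(i <- s) F i p).
Proof.
move=> cF; elim: s => [|i s IH].
  rewrite (_ : (fun p => _) = fun=> 0); first exact: continuous_cst.
  by apply/funext => p; rewrite big_nil.
rewrite (_ : (fun p => _) = fun p => F i p + \sum_(j <- s) F j p).
  exact: continuousD.
by apply/funext => p; rewrite big_cons.
Qed.

Lemma coord_cont (i : 'I_N) : continuous (fun x => x 0 i).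
Proof. by move=> x; exact: (@coord_continuous _ 1 N 0 i). Qed.

Lemma sqnorm_continuous : continuous sqnorm.
Proof. by apply: continuous_sum => i; apply/continuousX/coord_cont. Qed.

Lemma sqnorm_ge0 x : 0 <= sqnorm x.
Proof. by apply: sumr_ge0 => i _; exact: sqr_ge0. Qed.

Lemma enormE x : enorm x = Num.sqrt (sqnorm x).
Proof. by []. Qed.

Lemma line_is_derive (F : 'rV[R]_N -> R) x v l :
  der (fun s => F (s *: v + x)) 0 l -> is_derive x v F l.
Proof.
move=> /der_cvg.
have -> : (fun h : R => h^-1 * (F ((h + 0) *: v + x) - F (0 *: v + x))) =
  (fun h => h^-1 *: ((F \o shift x) (h *: v) - F x)).
  by apply/funext => h /=; rewrite addr0 scale0r add0r.
move=> h; split; first by apply/cvg_ex; exists l.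
by apply/cvg_lim => //; exact: Rhausdorff.
Qed.

Lemma sqnorm_line (i : 'I_N) x s : sqnorm (s *: evec R i + x) = sqnorm x + s * (2 * x 0 i) + s ^+ 2.
Proof.
rewrite /sqnorm (bigD1 i) //= [in RHS](bigD1 i) //= !mxE !eqxx /= mulr1.
rewrite (eq_bigr (fun j => x 0 j ^+ 2)); first by ring.
by move=> j /negbTE ji; rewrite !mxE ji andbF mulr0 add0r.
Qed.

Lemma der_sqnorm_line (G : R -> R) (i : 'I_N) x l : der G (sqnorm x) l ->
  der (fun s => G (sqnorm (s *: evec R i + x))) 0 (l * (2 * x 0 i)).
Proof.
move=> hG; apply: (@der_ext _ (fun s => G (sqnorm x + s * (2 * x 0 i) + s ^+ 2))).
  by move=> s; rewrite sqnorm_line.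
apply: (@der_comp _ G (fun s => sqnorm x + s * (2 * x 0 i) + s ^+ 2)).
  apply: der_eq (derD (derD (der_cst _ _) (derM (der_id _) (der_cst _ _))) (derX 2 _)) _.
  by rewrite /=; ring.
by rewrite mul0r expr0n /= !addr0.
Qed.

Lemma is_derive_radial (G : R -> R) (i : 'I_N) x l : der G (sqnorm x) l ->
  is_derive x (evec R i) (fun x => G (sqnorm x)) (l * (2 * x 0 i)).
Proof. by move=> hG; apply: line_is_derive; exact: der_sqnorm_line. Qed.

Lemma is_derive_radial2 (G : R -> R) (i j : 'I_N) x l : der G (sqnorm x) l ->
  is_derive x (evec R j) (fun x => G (sqnorm x) * (2 * x 0 i))
    (l * (2 * x 0 j) * (2 * x 0 i) + G (sqnorm x) * (2 * (i == j)%:R)).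
Proof.
move=> hG; apply: line_is_derive.
apply: der_eq (derM (der_sqnorm_line j hG) (_ : der _ _ (2 * (i == j)%:R))) _; last first.
  by rewrite scale0r add0r.
apply: derZ; apply: (@der_ext _ (fun s : R => s * (i == j)%:R + x 0 i)).
  by move=> s; rewrite !mxE eqxx andTb.
by apply: der_eq (derD (derM (der_id _) (der_cst _ _)) (der_cst _ _)) _; ring.
Qed.

Variables (g dg ddg : R -> R) (K : R).
Hypothesis K0 : 0 < K.
Hypothesis hg : forall r, der g r (dg r).
Hypothesis hdg : forall r, der dg r (ddg r).
Hypothesis cddg : continuous ddg.
Hypothesis gK : forall r, K ^+ 2 <= r -> [/\ g r = 0, dg r = 0 & ddg r = 0].

Variables (eta deta : R -> R) (T : R).
Hypothesis heta : forall t, der eta t (deta t).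
Hypothesis cdeta : continuous deta.
Hypothesis T0 : 0 < T.
Hypothesis etaT : forall t, T <= `|t| -> eta t = 0.

(** A profile in |x|^2 instead of |x| keeps the test function smooth at the origin. *)
Let psi (t : R) x := eta t * g (sqnorm x).

Let cg : continuous g. Proof. by move=> x; exact: der_continuous (hg x). Qed.
Let cdg : continuous dg. Proof. by move=> x; exact: der_continuous (hdg x). Qed.
Let ceta : continuous eta. Proof. by move=> x; exact: der_continuous (heta x). Qed.

Lemma psi_dt t x : is_derive t (1 : R) (psi ^~ x) (deta t * g (sqnorm x)).
Proof.
by apply: der_eq (derM (heta t) (der_cst (g (sqnorm x)) t)) _; ring.
Qed.

Lemma psi_partial t i x : is_derive x (evec R i) (psi t) (eta t * dg (sqnorm x) * (2 * x 0 i)).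
Proof. by apply: (@is_derive_radial (fun r => eta t * g r)); exact: derZ. Qed.

Lemma psi_partialE t i : partial i (psi t) = fun x => eta t * dg (sqnorm x) * (2 * x 0 i).
Proof. by apply/funext => x; have [_ <-] := psi_partial t i x. Qed.

Lemma psi_partial2 t i j x : is_derive x (evec R j) (partial i (psi t))
  (eta t * ddg (sqnorm x) * (2 * x 0 j) * (2 * x 0 i) +
   eta t * dg (sqnorm x) * (2 * (i == j)%:R)).
Proof.
by rewrite psi_partialE; apply: (@is_derive_radial2 (fun r => eta t * dg r)); exact: derZ.
Qed.

Lemma psi_laplacian t x : laplacian (psi t) x =
  eta t * (4 * sqnorm x * ddg (sqnorm x) + 2 * N%:R * dg (sqnorm x)).
Proof.
rewrite /laplacian (eq_bigr (fun i => 4 * eta t * ddg (sqnorm x) * x 0 i ^+ 2 +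
    2 * eta t * dg (sqnorm x))).
  rewrite big_split /= -mulr_sumr sumr_const card_ord -mulr_natl.
  by rewrite -/(sqnorm x); ring.
move=> i _; rewrite {1}/partial; have [_ ->] := psi_partial2 t i i x.
by rewrite eqxx /= mulr1n; ring.
Qed.

Lemma psi_test : test_function psi.
Proof.
have cs (G : R -> R) : continuous G -> continuous (fun z : R * 'rV[R]_N => G (sqnorm z.2)).
  move=> cG; apply: (@continuous_after _ _ _ G) => //.
  by apply: (continuous_after (@continuous_snd _ _)); exact: sqnorm_continuous.
have ct (e : R -> R) : continuous e -> continuous (fun z : R * 'rV[R]_N => e z.1).
  by move=> ce; apply: (@continuous_after _ _ _ e) => //; exact: continuous_fst.
have cx i : continuous (fun z : R * 'rV[R]_N => 2 * z.2 0 i).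
  apply: continuousM; first exact: continuous_cst.
  move=> z; apply: (@continuous_comp _ _ _ snd (fun x : 'rV[R]_N => x 0 i)).
    exact: cvg_snd.
  exact: coord_cont.
split.
- by apply: continuousM; [exact: ct|exact: cs].
- split; first by move=> t x; have [] := psi_dt t x.
  rewrite (_ : (fun z => _) = fun z : R * 'rV[R]_N => deta z.1 * g (sqnorm z.2)).
    by apply: continuousM; [exact: ct|exact: cs].
  by apply/funext => z; rewrite derive1E; have [_ <-] := psi_dt z.1 z.2.
- move=> i; split; first by move=> t x; have [] := psi_partial t i x.
  rewrite (_ : (fun z => _) = fun z : R * 'rV[R]_N => eta z.1 * dg (sqnorm z.2) * (2 * z.2 0 i)).
    by apply: continuousM => //; apply: continuousM; [exact: ct|exact: cs].
  by apply/funext => z; rewrite psi_partialE.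
- move=> i j; split; first by move=> t x; have [] := psi_partial2 t i j x.
  rewrite (_ : (fun z => _) = fun z : R * 'rV[R]_N =>
     eta z.1 * ddg (sqnorm z.2) * (2 * z.2 0 j) * (2 * z.2 0 i) +
     eta z.1 * dg (sqnorm z.2) * (2 * (i == j)%:R)); last first.
    by apply/funext => z; have [_ <-] := psi_partial2 z.1 i j z.2.
  apply: continuousD; last first.
    apply: continuousM; last exact: continuous_cst.
    by apply: continuousM; [exact: ct|exact: cs].
  apply: continuousM => //; apply: continuousM => //.
  by apply: continuousM; [exact: ct|exact: cs].
- exists (Num.max T K) => t x; rewrite /psi mulf_eq0 negb_or => /andP[et gx].
  split.
    rewrite le_max; apply/orP; left; rewrite leNgt; apply/negP => /ltW /etaT h.
    by rewrite h eqxx in et.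
  rewrite le_max; apply/orP; right; rewrite leNgt; apply/negP => h.
  have /gK[g0 _ _] : K ^+ 2 <= sqnorm x.
    rewrite -[sqnorm x]sqr_sqrtr ?sqnorm_ge0 // lerXn2r ?nnegrE ?sqrtr_ge0 ?(ltW K0) //.
    exact: ltW.
  by rewrite g0 eqxx in gx.
Qed.

End RadialTest.

(** * Smooth cut-offs and their sharp limit *)

Section Step.
Variable R : realType.
Implicit Types (s b c h K : R).

(** Continuous with total mass 1, whence the factor 6. Thus [step] is C^1 and its primitives are
    C^2, exactly the smoothness asked of test functions in time and in space. *)
Definition bump s : R := 6 * Num.max (s * (1 - s)) 0.

Lemma bump_continuous : continuous bump.
Proof.
apply: continuousM; first exact: continuous_cst.
move=> r; apply: (@continuous_max R R (fun s : R => s * (1 - s)) (fun=> 0)); last exact: cvg_cst.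
apply: cvgM; first exact: cvg_id.
by apply: cvgB; [exact: cvg_cst|exact: cvg_id].
Qed.

Lemma bump_ge0 s : 0 <= bump s.
Proof. by rewrite mulr_ge0 // le_max lexx orbT. Qed.

Lemma bump_left s : s <= 0 -> bump s = 0.
Proof.
move=> s0; rewrite /bump (_ : Num.max _ _ = 0) ?mulr0 //; apply/max_idPr.
by rewrite mulr_le0_ge0 // subr_ge0 (le_trans s0).
Qed.

Lemma bump_right s : 1 <= s -> bump s = 0.
Proof.
move=> s1; rewrite /bump (_ : Num.max _ _ = 0) ?mulr0 //; apply/max_idPr.
by rewrite mulr_ge0_le0 ?subr_le0 // (le_trans _ s1).
Qed.

Definition step s : R := 1 - itg bump 0 s.

Lemma step_der s : der step s (- bump s).
Proof.
by rewrite -[- _]add0r; apply: derB; [exact: der_cst|apply: itg_der; exact: bump_continuous].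
Qed.

Lemma step_left s : s <= 0 -> step s = 1.
Proof.
move=> s0; have E : itg bump s 0 = 0.
  apply: itg_eq0 => //; first exact: bump_continuous.
  by move=> x /andP[_ x0]; rewrite bump_left // ltW.
by rewrite /step itgN_swap E oppr0 subr0.
Qed.

Lemma bump_mass : itg bump 0 1 = 1.
Proof.
rewrite (@itg_eq _ _ (fun s => 6 * (s * (1 - s)))) //; last 3 first.
- exact: bump_continuous.
- apply: continuousM; first exact: continuous_cst.
  apply: continuousM; first exact: continuous_id.
  by apply: continuousB; [exact: continuous_cst|exact: continuous_id].
- move=> x /andP[x0 x1]; rewrite /bump (max_idPl _) //.
  by rewrite mulr_ge0 ?subr_ge0 ?ltW.
rewrite (@itg_ftcT _ (fun s => 3 * s ^+ 2 - 2 * s ^+ 3)).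
- by rewrite !expr1n !expr0n /=; ring.
- apply: continuousM; first exact: continuous_cst.
  apply: continuousM; first exact: continuous_id.
  by apply: continuousB; [exact: continuous_cst|exact: continuous_id].
- move=> x; apply: der_eq (derB (derZ _ (derX 2 x)) (derZ _ (derX 3 x))) _ => /=; ring.
Qed.

Lemma step_right s : 1 <= s -> step s = 0.
Proof.
move=> s1; rewrite /step (itg_chasles _ _ 1) bump_mass itg_eq0 ?addr0 ?subrr //.
  exact: bump_continuous.
by move=> x /andP[x1 _]; rewrite bump_right // ltW.
Qed.

Lemma step_itv s : 0 <= step s <= 1.
Proof.
have cb := bump_continuous.
have [s0|s0] := leP s 0; first by rewrite step_left // ler01 lexx.
have [s1|s1] := leP 1 s; first by rewrite step_right // ler01 lexx.
have h1 : 0 <= itg bump 0 s by apply: itg_ge0 => //; [exact: ltW|move=> *; exact: bump_ge0].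
have h2 : 0 <= itg bump s 1 by apply: itg_ge0 => //; [exact: ltW|move=> *; exact: bump_ge0].
have := bump_mass; rewrite (itg_chasles _ _ s) /step => E.
by apply/andP; split; lra.
Qed.

Lemma step_continuous : continuous step.
Proof. by move=> x; exact: der_continuous (step_der x). Qed.

Lemma avg_close (Phi w : R -> R) b h K e : continuous Phi -> continuous w ->
  0 <= b -> 0 < h -> b + h <= K -> (forall x, 0 < x < K -> 0 <= w x) ->
  (forall x, 0 < x < K -> ~ b <= x <= b + h -> w x = 0) -> itg w 0 K = 1 ->
  (forall x, b <= x <= b + h -> `|Phi x - Phi b| <= e) ->
  `|itg (fun x => Phi x * w x) 0 K - Phi b| <= e.
Proof.
move=> cP cw b0 h0 hK w0 wout w1 hP.
have K0 : 0 <= K by rewrite (le_trans _ hK) // addr_ge0 // ltW.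
have -> : itg (fun x => Phi x * w x) 0 K - Phi b = itg (fun x => (Phi x - Phi b) * w x) 0 K.
  rewrite -[X in _ - X]mulr1 -w1 -itgZ // -itgB; last 2 first.
  - exact: continuousM.
  - by apply: continuousM => //; exact: continuous_cst.
  by congr itg; apply/funext => x; rewrite mulrBl.
have c1 : continuous (fun x => (Phi x - Phi b) * w x).
  by apply: continuousM => //; apply: continuousB => //; exact: continuous_cst.
have E x : 0 < x < K -> `|(Phi x - Phi b) * w x| <= e * w x.
  move=> xK; rewrite normrM [`|w x|]ger0_norm ?w0 //.
  have [xb|xb] := boolP (b <= x <= b + h); first by rewrite ler_wpM2r ?w0 // hP.
  by rewrite wout ?mulr0 //; exact/negP.
rewrite -[e]mulr1 -w1 -itgZ // ler_norml -itgN; last first.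
  by apply: continuousM => //; exact: continuous_cst.
apply/andP; split; apply: itg_le => //.
- by apply: continuousN; apply: continuousM => //; exact: continuous_cst.
- by move=> x /E; rewrite ler_norml => /andP[].
- by apply: continuousM => //; exact: continuous_cst.
- by move=> x /E; rewrite ler_norml => /andP[].
Qed.

Lemma step_close (Psi x : R -> R) b h K C : continuous Psi -> continuous x ->
  0 <= b -> 0 < h -> b + h <= K -> (forall r, 0 < r < K -> `|x r| <= 1) ->
  (forall r, 0 < r < b -> x r = 1) -> (forall r, b + h < r < K -> x r = 0) ->
  (forall r, 0 <= r <= K -> `|Psi r| <= C) ->
  `|itg (fun r => Psi r * x r) 0 K - itg Psi 0 b| <= C * h.
Proof.
move=> cP cx b0 h0 hK x1 xb xK PC.
have c1 : continuous (fun r => Psi r * x r) by exact: continuousM.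
have hb : b <= b + h by rewrite lerDl ltW.
rewrite (itg_chasles _ 0 b) (itg_chasles _ b (b + h)).
rewrite [X in _ + (_ + X)]itg_eq0 //; last first.
  by move=> r /xK ->; rewrite mulr0.
rewrite (@itg_eq _ _ Psi 0 b) //; last by move=> r /xb ->; rewrite mulr1.
rewrite addr0 addrAC subrr add0r.
have -> : C * h = C * (b + h - b) by rewrite addrAC subrr add0r.
apply: itg_norm_le => // r /andP[br rb].
have rK : 0 < r < K by rewrite (le_lt_trans b0 br) (lt_le_trans rb hK).
rewrite normrM -[C]mulr1 ler_pM // ?x1 // PC //.
by case/andP: rK => ? ?; rewrite !ltW.
Qed.

Lemma cont_bounded (Psi : R -> R) a b : continuous Psi -> exists2 C, 0 < C &
  forall r, a <= r <= b -> `|Psi r| <= C.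
Proof.
move=> cP; have [ab|ba] := leP a b; last first.
  by exists 1 => // r /andP[h1 h2]; have := le_trans h1 h2; rewrite leNgt ba.
have cn : continuous (fun r => `|Psi r|).
  exact: (continuous_after cP (@continuous_normr R)).
have [c cab hc] := EVT_max ab (continuous_subspaceT cn).
exists (`|Psi c| + 1); first by rewrite ltr_wpDl.
by move=> r rab; rewrite (le_trans (hc r _)) ?in_itv // lerDl.
Qed.

(** Passage from smooth to sharp cut-offs: as h tends to 0, [x] tends to the indicator of [0, b] and
    [w] to the Dirac mass at b. It serves in time for [moment] and in the radius for
    [flux_integrated]. *)
Lemma step_avg_limit (Phi Psi : R -> R) b c K h0 :
  continuous Phi -> continuous Psi -> 0 <= b -> 0 < h0 -> b + h0 <= K ->
  (forall h, 0 < h < h0 -> exists x w : R -> R, [/\ continuous x, continuous w,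
     (forall r, 0 < r < K -> `|x r| <= 1) /\ (forall r, 0 < r < b -> x r = 1) /\
       (forall r, b + h < r < K -> x r = 0),
     (forall r, 0 < r < K -> 0 <= w r) /\
       (forall r, 0 < r < K -> ~ b <= r <= b + h -> w r = 0) /\ itg w 0 K = 1 &
     itg (fun r => Phi r * w r) 0 K = itg (fun r => Psi r * x r) 0 K + c]) ->
  Phi b = itg Psi 0 b + c.
Proof.
move=> cP cQ b0 h00 hK H; apply/eqP; rewrite -subr_eq0 -normr_le0 leNgt.
set X := Phi b - _; apply/negP => X0.
have X4 : 0 < `|X| / 4 by rewrite divr_gt0.
have [d d0 hd] := unif_cont b b cP X4.
have [C C0 hC] := cont_bounded 0 K cQ.
pose h := Num.min (Num.min (h0 / 2) (d / 2)) (`|X| / (4 * C)).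
have h_gt0 : 0 < h by rewrite !lt_min !divr_gt0 // mulr_gt0.
have hh0 : h <= h0 / 2 by rewrite !ge_min lexx.
have hd2 : h <= d / 2 by rewrite !ge_min lexx orbT.
have hC2 : h <= `|X| / (4 * C) by rewrite ge_min lexx orbT.
have [|x [w [cx cw [x1 [xb xK]] [w0 [wout w1]] E]]] := H h.
  by rewrite h_gt0 /=; lra.
have bhK : b + h <= K by lra.
have A1 : `|itg (fun x => Phi x * w x) 0 K - Phi b| <= `|X| / 4.
  apply: (@avg_close _ _ b h) => // r /andP[br rb]; apply/ltW/hd; rewrite ?lexx //.
  by rewrite ger0_norm ?subr_ge0 //; lra.
have A2 : `|itg (fun r => Psi r * x r) 0 K - itg Psi 0 b| <= C * h.
  exact: step_close.
have A3 : C * h <= `|X| / 4.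
  rewrite mulrC -ler_pdivlMr // (le_trans hC2) //.
  by rewrite invfM mulrA.
have : `|X| <= `|X| / 4 + `|X| / 4.
  rewrite {1}/X.
  have -> : Phi b - (itg Psi 0 b + c) =
     - (itg (fun x => Phi x * w x) 0 K - Phi b) +
       (itg (fun r => Psi r * x r) 0 K - itg Psi 0 b) by rewrite E; ring.
  rewrite (le_trans (ler_normD _ _)) // normrN lerD // (le_trans A2) //.
by lra.
Qed.

End Step.

(** * The flux identity from the weak formulation *)

Section Flux.
Variables (R : realType) (n : nat).
Implicit Types (r s t : R).
Variables (U V F : R -> R -> R) (U0 : R -> R).
Hypothesis cU : cont2 U.
Hypothesis cV : cont2 V.
Hypothesis cF : cont2 F.
Hypothesis cU0 : continuous U0.
Hypothesis weak : forall psi : R -> 'rV[R]_n.+1 -> R, test_function psi ->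
  \int[@lebesgue_measure R]_(t in `[0, +oo[)
    integral_RN (fun x : 'rV[R]_n.+1 =>
      U t (enorm x) * derive1 (psi^~ x) t + V t (enorm x) * laplacian (psi t) x
      + F t (enorm x) * psi t x)
  + integral_RN (fun x : 'rV[R]_n.+1 => U0 (enorm x) * psi 0 x) = 0.

Lemma integral_radial (h : R -> R) (K : R) : 0 < K -> continuous h ->
  (forall r, K <= r -> h r = 0) ->
  integral_RN (fun x : 'rV[R]_n.+1 => h (enorm x)) = polar_const R n * pint K n h.
Proof.
move=> K0 ch hK; rewrite -lam_pint // /lam -rintE //.
- by congr integral_RN; apply/funext => x; rewrite add0r /sq.
- exact: sq_continuous.
- by move=> r /(sqrt_geK K0); exact: hK.
Qed.

Section Test.
Variables (g dg ddg : R -> R) (K : R).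
Hypothesis K0 : 0 < K.
Hypothesis hg : forall r, der g r (dg r).
Hypothesis hdg : forall r, der dg r (ddg r).
Hypothesis cddg : continuous ddg.
Hypothesis gK : forall r, K ^+ 2 <= r -> [/\ g r = 0, dg r = 0 & ddg r = 0].

Let cg : continuous g. Proof. by move=> x; exact: der_continuous (hg x). Qed.
Let cdg : continuous dg. Proof. by move=> x; exact: der_continuous (hdg x). Qed.

Let Lg r : R := 4 * r ^+ 2 * ddg (r ^+ 2) + 2 * n.+1%:R * dg (r ^+ 2).
Let A t := pint K n (fun r => U t r * g (r ^+ 2)).
Let A0 := pint K n (fun r => U0 r * g (r ^+ 2)).
Let B t := pint K n (fun r => V t r * Lg r + F t r * g (r ^+ 2)).

Let csq (G : R -> R) : continuous G -> continuous (fun r : R => G (r ^+ 2)).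
Proof.
move=> cG; apply: (@continuous_after _ _ _ G) => //.
by apply: continuousX; exact: continuous_id.
Qed.

Let cLg : continuous Lg.
Proof.
apply: continuousD; apply: continuousM; try exact: csq; try exact: continuous_cst.
by apply: continuousM; [exact: continuous_cst|exact/continuousX/continuous_id].
Qed.

Let c2s (G : R -> R) : continuous G -> continuous (fun z : R * R => G z.2).
Proof. by move=> cG; exact: (continuous_after (@continuous_snd _ _) cG). Qed.

Let cA : continuous A.
Proof.
apply: (@itg_param _ _ (fun t r => U t r * g (r ^+ 2) * r ^+ n)).
apply: continuousM; last exact: (c2s (continuousX (@continuous_id _))).
by apply: continuousM => //; exact: (c2s (csq cg)).
Qed.

Let cB : continuous B.
Proof.
apply: (@itg_param _ _ (fun t r => (V t r * Lg r + F t r * g (r ^+ 2)) * r ^+ n)).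
apply: continuousM; last exact: (c2s (continuousX (@continuous_id _))).
apply: continuousD; apply: continuousM => //; first exact: (c2s cLg).
exact: (c2s (csq cg)).
Qed.

Lemma weak_radial (eta deta : R -> R) (T : R) :
  (forall t, der eta t (deta t)) -> continuous deta -> 0 < T ->
  (forall t, T <= `|t| -> eta t = 0) -> (forall t, T <= `|t| -> deta t = 0) ->
  itg (fun t => deta t * A t + eta t * B t) 0 T + eta 0 * A0 = 0.
Proof.
move=> heta cdeta T0 etaT detaT.
have ceta : continuous eta by move=> x; exact: der_continuous (heta x).
pose psi (t : R) (x : 'rV[R]_n.+1) := eta t * g (sqnorm x).
have gz r : K <= r -> [/\ g (r ^+ 2) = 0, dg (r ^+ 2) = 0 & ddg (r ^+ 2) = 0].
  by move=> Kr; apply: gK; rewrite lerXn2r ?nnegrE ?(ltW K0) // (le_trans (ltW K0)).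
have Lz r : K <= r -> Lg r = 0 by move=> /gz [g0 d0 dd0]; rewrite /Lg d0 dd0 !mulr0 addr0.
have := weak (psi_test n.+1 K0 hg hdg cddg gK heta cdeta etaT).
have -> : (fun x : 'rV[R]_n.+1 => U0 (enorm x) * (eta 0 * g (sqnorm x))) =
          (fun x : 'rV[R]_n.+1 => (fun r => eta 0 * (U0 r * g (r ^+ 2))) (enorm x)).
  by apply/funext => x; rewrite enormE sqr_sqrtr ?sqnorm_ge0 // mulrCA.
have cU0g : continuous (fun r => U0 r * g (r ^+ 2)) by apply: continuousM => //; exact: csq.
rewrite (@integral_radial (fun r => eta 0 * (U0 r * g (r ^+ 2))) K) //; last 2 first.
- by apply: continuousM => //; exact: continuous_cst.
- by move=> r /gz[-> _ _]; rewrite !mulr0.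
rewrite pintZ // -/A0.
have E t : integral_RN (fun x : 'rV[R]_n.+1 =>
      U t (enorm x) * derive1 (psi^~ x) t + V t (enorm x) * laplacian (psi t) x
      + F t (enorm x) * psi t x) = polar_const R n * (deta t * A t + eta t * B t).
  have cUg : continuous (fun r => U t r * g (r ^+ 2)).
    by apply: continuousM; [exact: cont2_l|exact: csq].
  have cVL : continuous (fun r => V t r * Lg r + F t r * g (r ^+ 2)).
    apply: continuousD; apply: continuousM; try exact: cont2_l; first exact: cLg.
    exact: csq.
  rewrite -pintZ // -pintZ // -pintD; last 2 first.
  - by apply: continuousM => //; exact: continuous_cst.
  - by apply: continuousM => //; exact: continuous_cst.
  rewrite -integral_radial //; last 2 first.
  - by apply: continuousD; apply: continuousM => //; exact: continuous_cst.
  - by move=> r Kr; have [-> _ _] := gz r Kr; rewrite Lz // !mulr0 addr0 mulr0 addr0.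
  congr integral_RN; apply/funext => x.
  have -> : derive1 (psi^~ x) t = deta t * g (sqnorm x).
    by rewrite derive1E; have [_ ->] := psi_dt g heta t x.
  rewrite (psi_laplacian hg hdg) /psi /Lg.
  have -> : enorm x ^+ 2 = sqnorm x by rewrite enormE sqr_sqrtr // sqnorm_ge0.
  by ring.
pose H t := polar_const R n * (deta t * A t + eta t * B t).
have cH : continuous H.
  apply: continuousM; first exact: continuous_cst.
  by apply: continuousD; apply: continuousM.
have -> : \int[@lebesgue_measure R]_(t in `[0, +oo[)
    integral_RN (fun x : 'rV[R]_n.+1 =>
      U t (enorm x) * derive1 (psi^~ x) t + V t (enorm x) * laplacian (psi t) x
      + F t (enorm x) * psi t x) = itg H 0 T.
  rewrite -(@Rintegral_supp _ H 0 T `[0, +oo[) //.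
  - by apply: eq_Rintegral => t _; exact: E.
  - by apply: subset_itvl.
  - move=> t; rewrite /= in_itv /= andbT => t0 tT; rewrite /H.
    have Tt : T <= `|t|.
      by rewrite ger0_norm // leNgt; apply/negP => h; apply: tT; rewrite t0 ltW.
    by rewrite etaT // detaT // !mul0r addr0 mulr0.
rewrite /H itgZ; last by apply: continuousD; apply: continuousM.
rewrite -mulrDr => /eqP; rewrite mulf_eq0 gt_eqF ?polar_const_gt0 //=.
by move=> /eqP.
Qed.

(** The weak formulation is tested with a time cut-off descending just after t1; its derivative
    concentrates at t1 and produces [A t1]. *)
Lemma moment (t1 : R) : 0 <= t1 -> A t1 = A0 + itg B 0 t1.
Proof.
move=> t10; rewrite addrC.
apply: (@step_avg_limit _ A B t1 A0 (t1 + 3) 1) => //.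
  by rewrite lerD2l; lra.
move=> h /andP[h0 h1].
pose x t : R := step ((t - t1) / h); pose w t : R := h^-1 * bump ((t - t1) / h).
have cl : continuous (fun t : R => (t - t1) / h).
  apply: continuousM; last exact: continuous_cst.
  by apply: continuousB; [exact: continuous_id|exact: continuous_cst].
have cx : continuous x by exact: (continuous_after cl (@step_continuous R)).
have cw : continuous w.
  apply: continuousM; first exact: continuous_cst.
  exact: (continuous_after cl (@bump_continuous R)).
have derx t : der x t (- w t).
  apply: der_eq (@der_comp _ (@step R) (fun t => (t - t1) / h) t _ h^-1 _ (step_der _)) _.
    apply: der_eq (derM (derB (der_id t) (der_cst t1 t)) (der_cst h^-1 t)) _; ring.
  by rewrite /w mulNr mulrC.
have xl t : t <= t1 -> x t = 1.
  by move=> tt; rewrite /x step_left // mulr_le0_ge0 ?subr_le0 // invr_ge0 ltW.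
have xr t : t1 + h <= t -> x t = 0.
  by move=> tt; rewrite /x step_right // ler_pdivlMr // mul1r lerBrDl.
have wr t : t1 + h <= t -> w t = 0.
  by move=> tt; rewrite /w bump_right ?mulr0 // ler_pdivlMr // mul1r lerBrDl.
have wl t : t <= t1 -> w t = 0.
  by move=> tt; rewrite /w bump_left ?mulr0 // mulr_le0_ge0 ?subr_le0 // invr_ge0 ltW.
exists x, w; split => //.
- split; last split.
  + by move=> r _; have /andP[a1 a2] := step_itv ((r - t1) / h); rewrite ger0_norm.
  + by move=> r /andP[_ /ltW]; exact: xl.
  + by move=> r /andP[/ltW]; move=> ? _; exact: xr.
- split; last split.
  + by move=> r _; rewrite mulr_ge0 ?bump_ge0 // invr_ge0 ltW.
  + move=> r _ out; have [rt|tr] := leP r t1; first exact: wl.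
    by apply: wr; rewrite leNgt; apply/negP => rh; apply: out; rewrite !ltW.
  + have Nder t : der (fun t => - x t) t (w t) by rewrite -[w t]opprK; exact: derN.
    rewrite (itg_ftcT 0 (t1 + 3) cw Nder) (xl 0) // (xr (t1 + 3)) ?opprK ?oppr0 ?add0r //.
    by rewrite lerD2l; lra.
(* The factor [y] is 1 for t >= 0 and 0 for t <= -2. It makes the time profile compactly supported
   on the whole line without changing it where the equation is tested. *)
pose y t : R := step (- t - 1).
have cy : continuous (fun t : R => - t - 1).
  by apply: continuousB; [exact: continuousN (@continuous_id _)|exact: continuous_cst].
have dery t : der y t (bump (- t - 1)).
  apply: der_eq (@der_comp _ (@step R) (fun t => - t - 1) t _ (-1) _ (step_der _)) _.
    by apply: der_eq (derB (derN (der_id t)) (der_cst 1 t)) _; ring.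
  by rewrite mulrN1 opprK.
have yp t : 0 <= t -> y t = 1 by move=> t0; rewrite /y step_left //; lra.
have := @weak_radial (fun t => x t * y t)
  (fun t => - w t * y t + x t * bump (- t - 1)) (t1 + 3) _ _ _ _ _.
rewrite yp // xl // !mul1r => /(_ _ _ _ _ _)/eqP.
rewrite addr_eq0 => H.
have : itg (fun t => (- w t * y t + x t * bump (- t - 1)) * A t + x t * y t * B t) 0 (t1 + 3) = - A0.
  apply/eqP; apply: H.
  - by move=> t; exact: derM.
  - apply: continuousD; apply: continuousM => //.
    + exact: continuousN.
    + exact: (continuous_after cy (@step_continuous R)).
    + exact: (continuous_after cy (@bump_continuous R)).
  - by lra.
  - move=> t; have [t0|t0] := ger0P t => tT; first by rewrite xr ?mul0r //; lra.
    by rewrite /y step_right ?mulr0 //; lra.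
  - move=> t; have [t0|t0] := ger0P t => tT.
      by rewrite wr ?xr ?oppr0 ?mul0r ?addr0 //; lra.
    by rewrite /y step_right ?bump_right ?mulr0 ?addr0 //; lra.
have cAw : continuous (fun t => A t * w t) by apply: continuousM.
have cBx : continuous (fun t => B t * x t) by apply: continuousM.
rewrite (@itg_eq _ _ (fun t => B t * x t - A t * w t)); last 4 first.
- apply: continuousD; apply: continuousM => //.
  + apply: continuousD; apply: continuousM => //.
    * exact: continuousN.
    * exact: (continuous_after cy (@step_continuous R)).
    * exact: (continuous_after cy (@bump_continuous R)).
  + by apply: continuousM => //; exact: (continuous_after cy (@step_continuous R)).
- exact: continuousB.
- by lra.
- move=> t /andP[t0 _]; rewrite yp ?(ltW t0) // bump_left; last by lra.
  by ring.
by rewrite itgB // => E; lra.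
Qed.

End Test.

Let wint t r := itg (V ^~ r) 0 t.
Let exc0 t r := U t r - U0 r - itg (F ^~ r) 0 t.
Let flux0 t r := itg (fun x => exc0 t x * x ^+ n) 0 r.

Let c2s (G : R -> R) : continuous G -> continuous (fun z : R * R => G z.2).
Proof. by move=> cG; exact: (continuous_after (@continuous_snd _ _) cG). Qed.

Let cW t : continuous (wint t).
Proof. exact: (@itg_param _ _ (fun r t => V t r) 0 t (cont2_swap cV)). Qed.

Let cE t : continuous (exc0 t).
Proof.
apply: continuousB; last exact: (@itg_param _ _ (fun r t => F t r) 0 t (cont2_swap cF)).
by apply: continuousB => //; exact: cont2_l.
Qed.

Let cEx t : continuous (fun x => exc0 t x * x ^+ n).
Proof. by apply: continuousM => //; exact/continuousX/continuous_id. Qed.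

Let cQ t : continuous (flux0 t).
Proof. exact: itg_continuous. Qed.

(** In the limit the test profile is min(r^2 - b^2, 0). Its Laplacian is the constant 2 (n+1) inside
    the ball of radius b plus a surface term on the sphere, which yields the pointwise value
    [wint t b]; one integration by parts turns the left side into [flux0]. *)
Lemma flux_integrated t (b : R) : 0 <= t -> 0 <= b ->
  2 * b ^+ n.+1 * wint t b =
  itg (fun r => 2 * n.+1%:R * r ^+ n * wint t r + 2 * r * flux0 t r) 0 b.
Proof.
move=> t0 b0; rewrite -[RHS]addr0.
have cX k : continuous (fun r : R => r ^+ k) by exact/continuousX/continuous_id.
have cc (c : R) : continuous (fun _ : R => c) by exact: continuous_cst.
have cPsi : continuous (fun r => 2 * n.+1%:R * r ^+ n * wint t r + 2 * r * flux0 t r).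
  apply: continuousD; apply: continuousM => //; apply: continuousM => //.
  exact: continuous_id.
apply: (@step_avg_limit _ (fun r => 2 * r ^+ n.+1 * wint t r) _ b 0 (b + 1) 1) => //.
  by apply: continuousM => //; apply: continuousM.
move=> h /andP[h0 h1]; pose K := b + 1; rewrite -/K.
have K0 : 0 < K by rewrite /K; lra.
pose d := (b + h) ^+ 2 - b ^+ 2.
have d0 : 0 < d by rewrite /d subr_gt0 ltrXn2r ?nnegrE //; lra.
pose dg r := step ((r - b ^+ 2) / d); pose ddg r := - (d^-1 * bump ((r - b ^+ 2) / d)).
have cl : continuous (fun r => (r - b ^+ 2) / d).
  by apply: continuousM => //; apply: continuousB => //; exact: continuous_id.
have hdg r : der dg r (ddg r).
  apply: der_eq (@der_comp _ (@step R) (fun r => (r - b ^+ 2) / d) r _ d^-1 _ (step_der _)) _.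
    apply: der_eq (derM (derB (der_id r) (der_cst (b ^+ 2) r)) (der_cst d^-1 r)) _; ring.
  by rewrite /ddg mulNr mulrC.
have cdg : continuous dg by move=> r; exact: der_continuous (hdg r).
have cddg : continuous ddg.
  apply: continuousN; apply: continuousM => //.
  exact: (continuous_after cl (@bump_continuous R)).
pose g r := itg dg (K ^+ 2) r.
have hg r : der g r (dg r) by exact: itg_der.
have cg : continuous g by move=> r; exact: der_continuous (hg r).
have bK : (b + h) ^+ 2 <= K ^+ 2 by rewrite lerXn2r ?nnegrE /K //; lra.
have dl r : r <= b ^+ 2 -> dg r = 1.
  by move=> rb; rewrite /dg step_left // mulr_le0_ge0 ?subr_le0 // invr_ge0 ltW.
have ddl r : r <= b ^+ 2 -> ddg r = 0.
  by move=> rb; rewrite /ddg bump_left ?mulr0 ?oppr0 // mulr_le0_ge0 ?subr_le0 // invr_ge0 ltW.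
have dr r : (b + h) ^+ 2 <= r -> dg r = 0.
  by move=> br; rewrite /dg step_right // ler_pdivlMr // mul1r /d lerD2r.
have ddr r : (b + h) ^+ 2 <= r -> ddg r = 0.
  by move=> br; rewrite /ddg bump_right ?mulr0 ?oppr0 // ler_pdivlMr // mul1r /d lerD2r.
have gK r : K ^+ 2 <= r -> [/\ g r = 0, dg r = 0 & ddg r = 0].
  move=> Kr; split; [|by apply/dr/(le_trans bK)|by apply/ddr/(le_trans bK)].
  apply: itg_eq0 => // x /andP[Kx _]; apply/dr/(le_trans bK); exact: ltW.
have csq (G : R -> R) : continuous G -> continuous (fun r => G (r ^+ 2)).
  by move=> cG; apply: (@continuous_after _ _ _ G).
pose x r := dg (r ^+ 2); pose w r := - (2 * r * ddg (r ^+ 2)).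
have cx : continuous x by exact: csq.
have cw : continuous w.
  apply: continuousN; apply: continuousM; last exact: csq.
  by apply: continuousM => //; exact: continuous_id.
have derx r : der x r (2 * r * ddg (r ^+ 2)).
  apply: der_eq (@der_comp _ dg (fun r => r ^+ 2) r _ _ (derX 2 r) (hdg _)) _.
  by rewrite mulrC expr1.
exists x, w; split => //.
- split; last split.
  + move=> r _; have /andP[a1 a2] := step_itv ((r ^+ 2 - b ^+ 2) / d).
    by rewrite ger0_norm.
  + by move=> r /andP[r0 rb]; apply: dl; rewrite lerXn2r ?nnegrE // ltW.
  + move=> r /andP[br _]; apply: dr; rewrite lerXn2r ?nnegrE ?ltW //; lra.
- split; last split.
  + move=> r /andP[r0 _]; rewrite /w /ddg mulrN opprK.
    apply: mulr_ge0; first by apply: mulr_ge0 => //; exact: ltW.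
    by apply: mulr_ge0; [rewrite invr_ge0 ltW|exact: bump_ge0].
  + move=> r /andP[r0 _] out; rewrite /w; have [rb|br] := leP r b.
      by rewrite ddl ?mulr0 ?oppr0 // lerXn2r ?nnegrE // ltW.
    rewrite ddr ?mulr0 ?oppr0 // lerXn2r ?nnegrE ?(ltW r0) //; first lra.
    by rewrite leNgt; apply/negP => rh; apply: out; rewrite !ltW.
  + have Nder r : der (fun r => - x r) r (w r) by exact: derN.
    rewrite (itg_ftcT 0 K cw Nder) /x (dr (K ^+ 2)) // (dl (0 ^+ 2)).
      by rewrite oppr0 opprK add0r.
    by rewrite expr0n sqr_ge0.
rewrite addr0.
have := @moment g dg ddg K K0 hg hdg cddg gK t t0.
pose Lg r : R := 4 * r ^+ 2 * ddg (r ^+ 2) + 2 * n.+1%:R * dg (r ^+ 2).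
have cLg : continuous Lg by apply: continuousD; apply: continuousM => //; [exact: continuousM|exact: csq].
have cgs : continuous (fun r => g (r ^+ 2)) by exact: csq.
rewrite /pint itg_fubini; last first.
  apply: continuousM; last exact: (c2s (cX n)).
  by apply: continuousD; apply: continuousM => //; [exact: (c2s cLg)|exact: (c2s cgs)].
have -> : (fun r => itg (fun s => (V s r * (4 * r ^+ 2 * ddg (r ^+ 2) + 2 * n.+1%:R * dg (r ^+ 2)) +
     F s r * g (r ^+ 2)) * r ^+ n) 0 t) =
   (fun r => wint t r * Lg r * r ^+ n + itg (F ^~ r) 0 t * g (r ^+ 2) * r ^+ n).
  apply/funext => r; have cVr := cont2_r (r := r) cV; have cFr := cont2_r (r := r) cF.
  have -> : wint t r * Lg r * r ^+ n + itg (F ^~ r) 0 t * g (r ^+ 2) * r ^+ n =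
     Lg r * r ^+ n * itg (V ^~ r) 0 t + g (r ^+ 2) * r ^+ n * itg (F ^~ r) 0 t.
    by rewrite /wint; ring.
  rewrite -!itgZ // -itgD; [|exact: continuousM..].
  by congr itg; apply/funext => s; rewrite /Lg; ring.
have cFi : continuous (fun r => itg (F ^~ r) 0 t).
  exact: (@itg_param _ _ (fun r t => F t r) 0 t (cont2_swap cF)).
have cEg : continuous (fun r => exc0 t r * r ^+ n * g (r ^+ 2)) by exact: continuousM.
have cWL : continuous (fun r => wint t r * Lg r * r ^+ n).
  by apply: continuousM => //; exact: continuousM.
have cFg : continuous (fun r => itg (F ^~ r) 0 t * g (r ^+ 2) * r ^+ n).
  by apply: continuousM => //; exact: continuousM.
have cU0g : continuous (fun r => U0 r * g (r ^+ 2) * r ^+ n).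
  by apply: continuousM => //; exact: continuousM.
rewrite itgD // => M.
have {M} M : itg (fun r => exc0 t r * r ^+ n * g (r ^+ 2)) 0 K =
             itg (fun r => wint t r * Lg r * r ^+ n) 0 K.
  have -> : (fun r => exc0 t r * r ^+ n * g (r ^+ 2)) =
     (fun r => (U t r * g (r ^+ 2) * r ^+ n - U0 r * g (r ^+ 2) * r ^+ n) -
        itg (F ^~ r) 0 t * g (r ^+ 2) * r ^+ n).
    by apply/funext => r; rewrite /exc0; ring.
  have cUg : continuous (fun r => U t r * g (r ^+ 2) * r ^+ n).
    by apply: continuousM => //; apply: continuousM => //; exact: cont2_l.
  by rewrite !itgB //; [rewrite M; ring|exact: continuousB].
have dgs r : der (fun r => g (r ^+ 2)) r (2 * r * dg (r ^+ 2)).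
  apply: der_eq (@der_comp _ g (fun r => r ^+ 2) r _ _ (derX 2 r) (hg _)) _.
  by rewrite mulrC expr1.
have c2 : continuous (fun r => 2 * r * dg (r ^+ 2)).
  by apply: continuousM; [apply: continuousM => //; exact: continuous_id|exact: csq].
have dQ r : der (flux0 t) r (exc0 t r * r ^+ n) by exact: itg_der.
have := @itg_parts _ (flux0 t) (fun r => g (r ^+ 2)) _ _ 0 K (@cEx t) c2 dQ dgs.
have [gK0 _ _] := gK (K ^+ 2) (lexx _).
have Q00 : flux0 t 0 = 0 by rewrite /flux0 itg_id.
rewrite Q00 M gK0 mulr0 mul0r subrr sub0r => P.
have cQx : continuous (fun r => flux0 t r * (2 * r * dg (r ^+ 2))) by exact: continuousM.
have cWx : continuous (fun r => 2 * n.+1%:R * r ^+ n * wint t r * x r).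
  by apply: continuousM => //; apply: continuousM => //; exact: continuousM.
have cPw : continuous (fun r => 2 * r ^+ n.+1 * wint t r * w r).
  by apply: continuousM => //; apply: continuousM => //; exact: continuousM.
have -> : (fun r => (2 * n.+1%:R * r ^+ n * wint t r + 2 * r * flux0 t r) * x r) =
  (fun r => 2 * n.+1%:R * r ^+ n * wint t r * x r + flux0 t r * (2 * r * dg (r ^+ 2))).
  by apply/funext => r; rewrite /x; ring.
rewrite itgD //.
have PE : itg (fun r => wint t r * Lg r * r ^+ n) 0 K =
  itg (fun r => 2 * n.+1%:R * r ^+ n * wint t r * x r) 0 K -
  itg (fun r => 2 * r ^+ n.+1 * wint t r * w r) 0 K.
  rewrite -itgB //; congr itg; apply/funext => r.
  by rewrite /Lg /x /w [r ^+ n.+1]exprS; ring.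
by move: P; rewrite PE => P; lra.
Qed.

(** By [flux_integrated], [wint] is a primitive of a continuous function divided by 2 r^(n+1). This
    is where differentiability in r comes from: no regularity of [U] beyond continuity enters. *)
Lemma flux_der0 t r : 0 <= t -> 0 < r -> der (wint t) r (flux0 t r / r ^+ n).
Proof.
move=> t0 r0; pose G b := itg (fun r => 2 * n.+1%:R * r ^+ n * wint t r + 2 * r * flux0 t r) 0 b.
have cX k : continuous (fun r : R => r ^+ k) by exact/continuousX/continuous_id.
have cc (c : R) : continuous (fun _ : R => c) by exact: continuous_cst.
have dG : der G r (2 * n.+1%:R * r ^+ n * wint t r + 2 * r * flux0 t r).
  apply: (@itg_der _ (fun r => 2 * n.+1%:R * r ^+ n * wint t r + 2 * r * flux0 t r) 0 r).
  apply: continuousD; apply: continuousM => //; apply: continuousM => //.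
  exact: continuous_id.
have rn0 k : r ^+ k != 0 by rewrite expf_neq0 // gt_eqF.
have d2 : der (fun r => 2 * r ^+ n.+1) r (2 * (n.+1%:R * r ^+ n)) by apply: derZ; exact: derX.
have D2 : 2 * r ^+ n.+1 != 0 by rewrite mulf_neq0 // pnatr_eq0.
apply: (@der_near _ (fun r => G r * (2 * r ^+ n.+1)^-1)).
  have rr : 0 < r < r + 1 by rewrite r0 ltrDl ltr01.
  apply: filterS (near_itv_oo rr) => y /andP[y0 _].
  rewrite /G -flux_integrated // ?(ltW y0) // mulrAC divff ?mul1r //.
  by rewrite mulf_neq0 ?pnatr_eq0 // expf_neq0 // gt_eqF.
apply: der_eq (derM dG (@derV _ (fun r => 2 * r ^+ n.+1) r _ D2 d2)) _.
rewrite /G -flux_integrated // ?(ltW r0) // [r ^+ n.+1]exprS in D2 *.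
have rn := rn0 n; have r00 : r != 0 by rewrite gt_eqF.
by field; rewrite rn r00.
Qed.

(** At t = 0 the time integral vanishes identically, hence so does its flux for every radius, and
    differentiating the flux identifies the data. *)
Lemma initial_value r : 0 < r -> U 0 r = U0 r.
Proof.
have Q0 x : 0 < x -> flux0 0 x = 0.
  move=> x0; have := flux_der0 (lexx 0) x0.
  have -> : wint 0 = fun=> 0 by apply/funext => y; rewrite /wint itg_id.
  move=> /der_unique /(_ (der_cst 0 x)) /eqP.
  by rewrite mulf_eq0 invr_eq0 expf_eq0 (gt_eqF x0) andbF orbF => /eqP.
move=> r0; have h1 : der (flux0 0) r 0.
  apply: (@der_near _ (fun=> 0)); last exact: der_cst.
  have rr : 0 < r < r + 1 by rewrite r0 ltrDl ltr01.
  by apply: filterS (near_itv_oo rr) => y /andP[/Q0 ->].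
have := itg_der 0 r (@cEx 0) => /der_unique /(_ h1) /eqP.
rewrite mulf_eq0 expf_eq0 (gt_eqF r0) andbF orbF /exc0 itg_id subr0 subr_eq0.
by move=> /eqP.
Qed.

Theorem flux_identity s t r : 0 <= s -> 0 <= t -> 0 < r ->
  der (fun r => itg (V ^~ r) s t) r
   (itg (fun x => (U t x - U s x - itg (F ^~ x) s t) * x ^+ n) 0 r / r ^+ n).
Proof.
move=> s0 t0 r0.
apply: (@der_ext _ (fun r => wint t r - wint s r)).
  by move=> x; rewrite /wint /itg; ring.
apply: der_eq (derB (flux_der0 t0 r0) (flux_der0 s0 r0)) _.
rewrite -mulrBl; congr (_ / _); rewrite /flux0 -itgB; [|exact: cEx..].
by congr itg; apply/funext => x; rewrite /exc0 /itg; ring.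
Qed.

End Flux.

(** * Moments and retention of the support *)

Section Moments.
Variables (R : realType) (n : nat).
Implicit Types (r s t a b x : R).
Variables (u v ff : R -> R -> R) (m M : R).
Hypothesis m1 : 1 < m.
Hypothesis cu : cont2 u.
Hypothesis cv : cont2 v.
Hypothesis cff : cont2 ff.
Hypothesis u0 : forall t r, 0 <= u t r.
Hypothesis uM : forall t r, u t r <= M.
Hypothesis vE : forall t r, v t r = u t r `^ m.

Definition wint s t r := itg (v ^~ r) s t.
(** By the equation this is the Laplacian of [wint s t], and [flux] is r^n times its radial
    derivative. *)
Definition exc s t r := u t r - u s r - itg (ff ^~ r) s t.
Definition flux s t r := itg (fun x => exc s t x * x ^+ n) 0 r.

Hypothesis star : forall s t r, 0 <= s -> 0 <= t -> 0 < r ->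
  der (wint s t) r (flux s t r / r ^+ n).

Lemma cX k : continuous (fun r : R => r ^+ k).
Proof. exact/continuousX/continuous_id. Qed.

Lemma c2snd (G : R -> R) : continuous G -> continuous (fun z : R * R => G z.2).
Proof. by move=> cG; exact: (continuous_after (@continuous_snd _ _) cG). Qed.

Lemma wint_continuous s t : continuous (wint s t).
Proof. exact: (@itg_param _ _ (fun r t => v t r) s t (cont2_swap cv)). Qed.

Lemma src_continuous s t : continuous (fun r => itg (ff ^~ r) s t).
Proof. exact: (@itg_param _ _ (fun r t => ff t r) s t (cont2_swap cff)). Qed.

Lemma exc_continuous s t : continuous (exc s t).
Proof.
apply: continuousB; last exact: src_continuous.
by apply: continuousB; exact: cont2_l.
Qed.

Lemma excX_continuous s t : continuous (fun x => exc s t x * x ^+ n).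
Proof. by apply: continuousM; [exact: exc_continuous|exact: cX]. Qed.

Lemma flux_continuous s t : continuous (flux s t).
Proof. by apply: itg_continuous; exact: excX_continuous. Qed.

Lemma flux0 s t : flux s t 0 = 0.
Proof. exact: itg_id. Qed.

Lemma v_ge0 t r : 0 <= v t r.
Proof. by rewrite vE powR_ge0. Qed.

(** The Green boundary term r^n (W' z - W z') at radius a, with W = [wint s t] and r^n W' =
    [flux s t]. *)
Definition boundary s t (z dz : R -> R) a :=
  flux s t a * z a - wint s t a * (a ^+ n * dz a).

(** Green's second identity on the annulus a < r < b: [p] is r^n times the radial Laplacian of [z],
    and the derivative of [boundary] is exc r^n z - W p. *)
Lemma moment_boundary (z dz p : R -> R) s t a b :
  0 <= s -> 0 <= t -> 0 <= a -> a <= b ->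
  continuous z -> continuous dz -> continuous p ->
  (forall r, a < r < b -> der z r (dz r)) ->
  (forall r, a < r < b -> der (fun r => r ^+ n * dz r) r (p r)) ->
  itg (fun r => u t r * z r * r ^+ n) a b - itg (fun r => u s r * z r * r ^+ n) a b =
  itg (fun tau => itg (fun r => ff tau r * z r * r ^+ n + v tau r * p r) a b) s t
  + (boundary s t z dz b - boundary s t z dz a).
Proof.
move=> s0 t0 a0 ab cz cdz cp hz hp.
have cH : continuous (boundary s t z dz).
  apply: continuousB; apply: continuousM => //; [exact: flux_continuous|exact: wint_continuous|].
  by apply: continuousM => //; exact: cX.
have cw := @wint_continuous s t.
have cwp : continuous (fun r => wint s t r * p r) by exact: continuousM.
have cuz q : continuous (fun r => u q r * z r * r ^+ n).
  by apply: continuousM; [apply: continuousM => //; exact: cont2_l|exact: cX].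
have csz : continuous (fun r => itg (ff ^~ r) s t * z r * r ^+ n).
  by apply: continuousM; [apply: continuousM => //; exact: src_continuous|exact: cX].
have dH : itg (fun r => exc s t r * r ^+ n * z r - wint s t r * p r) a b =
   boundary s t z dz b - boundary s t z dz a.
  apply: itg_ftc => //.
  - by apply: continuousB => //; apply: continuousM => //; exact: excX_continuous.
  - move=> r /andP[ar rb]; have r0 : 0 < r by exact: le_lt_trans ar.
    have rab : a < r < b by rewrite ar.
    have dQ : der (flux s t) r (exc s t r * r ^+ n).
      by apply: itg_der; exact: excX_continuous.
    apply: der_eq (derB (derM dQ (hz r rab)) (derM (star s0 t0 r0) (hp r rab))) _.
    have rn : r ^+ n != 0 by rewrite expf_neq0 // gt_eqF.
    by field.
  - exact: continuous_subspaceT.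
rewrite -dH itg_fubini; last first.
  apply: continuousD.
    apply: continuousM; last exact: (c2snd (@cX n)).
    by apply: continuousM => //; exact: (c2snd cz).
  by apply: continuousM => //; exact: (c2snd cp).
have -> : (fun r => itg (fun tau => ff tau r * z r * r ^+ n + v tau r * p r) s t) =
   (fun r => itg (ff ^~ r) s t * z r * r ^+ n + wint s t r * p r).
  apply/funext => r; have cvr := cont2_r (r := r) cv; have cfr := cont2_r (r := r) cff.
  have -> : itg (ff ^~ r) s t * z r * r ^+ n + wint s t r * p r =
     z r * r ^+ n * itg (ff ^~ r) s t + p r * itg (v ^~ r) s t by rewrite /wint; ring.
  have cc c : continuous (fun _ : R => c : R) by exact: continuous_cst.
  rewrite -!itgZ // -itgD; [|exact: continuousM..].
  by congr itg; apply/funext => q; ring.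
rewrite -itgB // -itgD.
- by congr itg; apply/funext => r; rewrite /exc; ring.
- exact: continuousD.
- by apply: continuousB => //; apply: continuousM => //; exact: excX_continuous.
Qed.

Lemma flux_zero s t b : 0 <= s -> 0 <= t -> 0 < b ->
  (forall r, b <= r -> wint s t r = 0) -> flux s t b = 0.
Proof.
move=> s0 t0 b0 hw.
have Q0 r : b < r -> flux s t r = 0.
  move=> br; have r0 := lt_trans b0 br.
  have h0 : der (wint s t) r 0.
    apply: (@der_near _ (fun=> 0)); last exact: der_cst.
    have rr : b < r < r + 1 by rewrite br ltrDl ltr01.
    by apply: filterS (near_itv_oo rr) => y /andP[/ltW /hw ->].
  have /eqP := der_unique (star s0 t0 r0) h0.
  by rewrite mulf_eq0 invr_eq0 expf_eq0 (gt_eqF r0) andbF orbF => /eqP.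
apply/eqP; rewrite -normr_le0 leNgt; apply/negP => F0.
have [d d0 hd] := unif_cont b b (@flux_continuous s t) F0.
have := hd b (b + d / 2); rewrite lexx => /(_ isT); rewrite addrAC subrr add0r.
rewrite gtr0_norm ?divr_gt0 // => h; have d2 : d / 2 < d by lra.
have := h d2; rewrite Q0; last by rewrite ltrDl divr_gt0.
by rewrite sub0r normrN ltxx.
Qed.

Hypothesis M0 : 0 < M.

Lemma v_le t r : v t r <= M `^ (m - 1) * u t r.
Proof.
have m0 : 0 < m by rewrite (lt_trans ltr01).
rewrite vE -mulr_powRB1 // mulrC ler_wpM2r //.
by apply: ge0_ler_powR; rewrite ?nnegrE ?subr_ge0 ?(ltW m1) ?(ltW M0).
Qed.

Lemma v_eq0 t r : u t r = 0 -> v t r = 0.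
Proof. by move=> h; rewrite vE h powR0 // gt_eqF // (lt_trans ltr01). Qed.

(** With dq^2 = D^2 - 4 q the second-order part is q (6 D^2 - 30 q), whence the 30; the first-order
    part costs at most 3 n (D / a) q^2. The bound completes the square 6 (D - K q / (12 D))^2. *)
Lemma cubic_weight (r a b K : R) : 0 < a -> a < r < b ->
  let q := (r - a) * (b - r) in let dq := a + b - 2 * r in let D := b - a in
  K = 30 + 3 * n%:R * D / a ->
  - (K ^+ 2 / (24 * D ^+ 2)) * (q ^+ 3 * r ^+ n) <=
  n%:R * r ^+ n.-1 * (3 * q ^+ 2 * dq) + r ^+ n * (6 * q * dq ^+ 2 - 6 * q ^+ 2).
Proof.
move=> a0 /andP[ar rb] q dq D KE; have r0 := lt_trans a0 ar.
have q0 : 0 < q by rewrite mulr_gt0 ?subr_gt0.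
have D0 : 0 < D by rewrite subr_gt0 (lt_trans ar).
have rn : 0 < r ^+ n by rewrite exprn_gt0.
have dqE : dq ^+ 2 = D ^+ 2 - 4 * q by rewrite /dq /D /q; ring.
have ndq : `|dq| <= D by rewrite ler_norml /dq /D; apply/andP; split; lra.
have nr : n%:R * r ^+ n.-1 <= n%:R * r ^+ n / a.
  case: (n) => [|k]; first by rewrite !mul0r.
  rewrite /= -mulrA ler_wpM2l // ler_pdivlMr // exprSr ler_wpM2l ?exprn_ge0 //; exact: ltW.
have t1 : - (n%:R * r ^+ n / a * (3 * q ^+ 2 * D)) <= n%:R * r ^+ n.-1 * (3 * q ^+ 2 * dq).
  have q2 : 0 <= 3 * q ^+ 2 by apply: mulr_ge0 => //; exact: sqr_ge0.
  have A0 : 0 <= n%:R * r ^+ n.-1 by apply: mulr_ge0 => //; apply: exprn_ge0; exact: ltW.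
  rewrite lerNl -mulrN; apply: (@le_trans _ _ (n%:R * r ^+ n.-1 * (3 * q ^+ 2 * D))).
    apply: (ler_wpM2l A0); rewrite -mulrN; apply: (ler_wpM2l q2).
    by move: ndq; rewrite ler_norml => /andP[? _]; lra.
  by apply: ler_wpM2r => //; apply: mulr_ge0 => //; exact: ltW.
have key : 0 <= 6 * D ^+ 2 - K * q + K ^+ 2 / (24 * D ^+ 2) * q ^+ 2.
  have -> : 6 * D ^+ 2 - K * q + K ^+ 2 / (24 * D ^+ 2) * q ^+ 2 = 6 * (D - K * q / (12 * D)) ^+ 2.
    by field; rewrite gt_eqF.
  by rewrite mulr_ge0 ?sqr_ge0.
rewrite dqE -subr_ge0.
apply: (@le_trans _ _ (r ^+ n * q * (6 * D ^+ 2 - K * q + K ^+ 2 / (24 * D ^+ 2) * q ^+ 2))).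
  by apply: mulr_ge0 => //; apply: mulr_ge0; exact: ltW.
rewrite -subr_ge0.
set X := n%:R * r ^+ n.-1 * _ in t1 *; set C := K ^+ 2 / _.
have -> : X + r ^+ n * (6 * q * (D ^+ 2 - 4 * q) - 6 * q ^+ 2) - - C * (q ^+ 3 * r ^+ n)
    - r ^+ n * q * (6 * D ^+ 2 - K * q + C * q ^+ 2) =
    X - - (n%:R * r ^+ n / a * (3 * q ^+ 2 * D)).
  by rewrite KE; field; rewrite gt_eqF.
by rewrite subr_ge0.
Qed.

Lemma gronwall_back (Y B : R -> R) (K T t : R) : continuous B -> 0 <= t -> t <= T ->
  (forall s, 0 <= s <= T -> Y s = Y 0 + itg B 0 s) ->
  (forall s, 0 < s < T -> - K * Y s <= B s) -> Y T = 0 -> Y t <= 0.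
Proof.
move=> cB t0 tT hY hB YT.
pose Z s := expR (K * s) * (Y 0 + itg B 0 s).
have dE s : der (fun s => expR (K * s)) s (expR (K * s) * K).
  apply: (@der_comp _ (@expR R) (fun s => K * s)); last exact: is_derive_expR.
  by apply: der_eq (derZ K (der_id s)) _; rewrite mulr1.
have dZ s : der Z s (expR (K * s) * K * (Y 0 + itg B 0 s) + expR (K * s) * B s).
  apply: derM => //; apply: der_eq (derD (der_cst (Y 0) s) (itg_der 0 s cB)) _.
  by rewrite add0r.
have : Z t <= Z T.
  apply: (@der_ndecr _ Z _ t T tT (fun s _ => dZ s)).
    by apply: continuous_subspaceT => s; exact: der_continuous (dZ s).
  move=> s /andP[ts sT]; have s0 : 0 < s by exact: le_lt_trans ts.
  rewrite -mulrA -mulrDr mulr_ge0 ?expR_ge0 // -hY; last by rewrite !ltW.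
  have := hB s; rewrite s0 sT => /(_ isT); rewrite mulNr lerNl => h.
  by rewrite -[B s]opprK subr_ge0.
have T0 : 0 <= T by exact: le_trans tT.
by rewrite /Z -!hY ?t0 ?tT ?T0 ?lexx // YT mulr0 pmulr_rle0 // expR_gt0.
Qed.

(* Backward Gronwall for the moment against [((r - a) (b - r))^3], whose radial
   Laplacian is bounded below by a multiple of the weight. *)
Lemma retention_open (Cf T t r a : R) : (forall t r, - Cf * u t r <= ff t r) ->
  0 < a -> 0 <= t -> t <= T -> (forall r, a <= r -> u T r = 0) -> a < r -> u t r = 0.
Proof.
move=> hff a0 t0 tT uT ar; pose b := r + 1.
have ab : a < b by rewrite /b (lt_trans ar) // ltrDl.
pose q x := (x - a) * (b - x); pose dq x := a + b - 2 * x.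
pose z x := q x ^+ 3; pose dz x := 3 * q x ^+ 2 * dq x.
pose p x := n%:R * x ^+ n.-1 * dz x + x ^+ n * (6 * q x * dq x ^+ 2 - 6 * q x ^+ 2).
have dqd x : der q x (dq x).
  apply: der_eq (derM (derB (der_id x) (der_cst a x)) (derB (der_cst b x) (der_id x))) _.
  by rewrite /dq; ring.
have ddq x : der dq x (-2).
  by apply: der_eq (derB (der_cst (a + b) x) (derZ 2 (der_id x))) _; ring.
have hz x : der z x (dz x).
  apply: der_eq (@der_comp _ (fun y => y ^+ 3) q x _ _ (dqd x) (derX 3 (q x))) _.
  by rewrite /dz.
have hdz x : der dz x (6 * q x * dq x ^+ 2 - 6 * q x ^+ 2).
  have h2 := @der_comp _ (fun y => y ^+ 2) q x _ _ (dqd x) (derX 2 (q x)).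
  apply: der_eq (derM (derZ 3 h2) (ddq x)) _ => /=; ring.
have hp x : der (fun x => x ^+ n * dz x) x (p x).
  by apply: der_eq (derM (derX n x) (hdz x)) _.
have cz : continuous z by move=> x; exact: der_continuous (hz x).
have cdz : continuous dz by move=> x; exact: der_continuous (hdz x).
have cq : continuous q by move=> x; exact: der_continuous (dqd x).
have cdq : continuous dq by move=> x; exact: der_continuous (ddq x).
have cc c : continuous (fun _ : R => c : R) by exact: continuous_cst.
have cp : continuous p.
  apply: continuousD; apply: continuousM => //; try exact: cX.
    by apply: continuousM => //; exact: cX.
  by apply: continuousB; apply: continuousM => //; [exact: continuousM|exact: continuousX|exact: continuousX].
pose Y s := itg (fun x => u s x * z x * x ^+ n) a b.
pose B s := itg (fun x => ff s x * z x * x ^+ n + v s x * p x) a b.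
have cB : continuous B.
  apply: (@itg_param _ _ (fun s x => ff s x * z x * x ^+ n + v s x * p x)).
  apply: continuousD.
    apply: continuousM; last exact: (c2snd (@cX n)).
    by apply: continuousM => //; exact: (c2snd cz).
  by apply: continuousM => //; exact: (c2snd cp).
have cY s : continuous (fun x => u s x * z x * x ^+ n).
  by apply: continuousM; [apply: continuousM => //; exact: cont2_l|exact: cX].
have hY s : 0 <= s <= T -> Y s = Y 0 + itg B 0 s.
  move=> /andP[s0 _].
  have := @moment_boundary z dz p 0 s a b (lexx 0) s0 (ltW a0) (ltW ab) cz cdz cp
    (fun x _ => hz x) (fun x _ => hp x).
  rewrite /boundary /z /dz /q !subrr mul0r mulr0 !expr0n /= !mulr0 !mul0r !mulr0 subrr.
  by move=> E; rewrite -[LHS](subrK (Y 0)) E /B /Y addr0 addrC.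
have z0 x : a < x < b -> 0 < z x.
  by move=> /andP[ax xb]; rewrite /z exprn_gt0 // /q mulr_gt0 ?subr_gt0.
pose D := b - a; pose K0 := 30 + 3 * n%:R * D / a; pose C2 := K0 ^+ 2 / (24 * D ^+ 2).
have C20 : 0 <= C2.
  apply: mulr_ge0; first exact: sqr_ge0.
  by rewrite invr_ge0; apply: mulr_ge0 => //; exact: sqr_ge0.
(* The reaction contributes [Cf]. The negative part of the Laplacian of the weight is at most [C2]
   times the weight, and v <= M^(m-1) u converts its contribution into the moment of u. *)
pose K := Cf + C2 * M `^ (m - 1).
have hB s : 0 < s < T -> - K * Y s <= B s.
  move=> _; rewrite -itgZ //; apply: itg_le.
  - exact: continuousM.
  - apply: continuousD; last by apply: continuousM => //; exact: cont2_l.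
    by apply: continuousM; [apply: continuousM => //; exact: cont2_l|exact: cX].
  - exact: ltW.
  move=> x xab; have x0 : 0 < x by case/andP: xab => ax _; exact: lt_trans ax.
  have xn : 0 < x ^+ n by rewrite exprn_gt0.
  have zx := z0 x xab.
  have h1 : - Cf * u s x * (z x * x ^+ n) <= ff s x * (z x * x ^+ n).
    by rewrite ler_wpM2r ?hff // mulr_ge0 // ltW.
  have h2 : - C2 * (z x * x ^+ n) <= p x by exact: (cubic_weight a0 xab erefl).
  have h3 : v s x * (- C2 * (z x * x ^+ n)) <= v s x * p x by rewrite ler_wpM2l ?v_ge0.
  have h4 : M `^ (m - 1) * u s x * (- C2 * (z x * x ^+ n)) <= v s x * (- C2 * (z x * x ^+ n)).
    rewrite ler_wnM2r ?v_le // mulNr oppr_le0 mulr_ge0 // mulr_ge0 //; exact: ltW.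
  rewrite (_ : - K * (u s x * z x * x ^+ n) = - Cf * u s x * (z x * x ^+ n) +
     M `^ (m - 1) * u s x * (- C2 * (z x * x ^+ n))); last by rewrite /K; ring.
  by rewrite -[X in _ <= X + _]mulrA; exact: lerD h1 (le_trans h4 h3).
have YT : Y T = 0.
  apply: itg_eq0 => //; first exact: ltW.
  by move=> x /andP[/ltW ax _]; rewrite uT // !mul0r.
have Yt := gronwall_back cB t0 tT hY hB YT.
apply/eqP; apply/negPn/negP => ur.
have : 0 < Y t.
  apply: (@itg_gt0 _ _ _ _ r) => //.
  - by rewrite !ltW // /b ltrDl.
  - move=> x xab; have x0 : 0 < x by case/andP: xab => ax _; exact: lt_trans ax.
    apply: mulr_ge0; last by apply: exprn_ge0; exact: ltW.
    by apply: mulr_ge0; [exact: u0|apply: ltW; exact: z0].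
  - apply: mulr_gt0; last by apply: exprn_gt0; exact: lt_trans ar.
    apply: mulr_gt0; first by rewrite lt_neqAle eq_sym ur u0.
    by apply: z0; rewrite ar /b ltrDl /=.
by rewrite ltNge Yt.
Qed.

Lemma retention (Cf T t r a : R) : (forall t r, - Cf * u t r <= ff t r) ->
  0 < a -> 0 <= t -> t <= T -> (forall r, a <= r -> u T r = 0) -> a <= r -> u t r = 0.
Proof.
move=> hff a0 t0 tT uT; rewrite le_eqVlt => /orP[/eqP <-|ar]; last exact: (retention_open hff a0 t0 tT uT ar).
apply/eqP; rewrite -normr_le0 leNgt; apply/negP => F0.
have [d d0 hd] := unif_cont a a (cont2_l (p := t) cu) F0.
have := hd a (a + d / 2); rewrite lexx => /(_ isT); rewrite addrAC subrr add0r.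
rewrite gtr0_norm ?divr_gt0 // => h; have d2 : d / 2 < d by lra.
have := h d2; rewrite (retention_open hff a0 t0 tT uT); last by rewrite ltrDl divr_gt0.
by rewrite sub0r normrN ltxx.
Qed.

End Moments.

(** * Lower bounds on the front *)

Section PowR.
Variable R : realType.
Implicit Types (x y k m : R).

(** The graph of x^m lies above its tangent at k. In this form it is Young's inequality with
    exponents m and m / (m - 1). *)
Lemma powR_tangent m x k : 1 < m -> 0 <= x -> 0 <= k ->
  m * k `^ (m - 1) * x - (m - 1) * k `^ m <= x `^ m.
Proof.
move=> m1 x0 k0; have m0 : 0 < m by rewrite (lt_trans ltr01).
have mm : m - 1 != 0 by rewrite gt_eqF // subr_gt0.
have q0 : 0 < m / (m - 1) by rewrite divr_gt0 // subr_gt0.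
have pq : m^-1 + (m / (m - 1))^-1 = 1 by field; rewrite mm gt_eqF.
have := @conjugate_powR _ x (k `^ (m - 1)) m (m / (m - 1)) x0 (powR_ge0 _ _) m0 q0 pq.
rewrite -powRrM (_ : (m - 1) * (m / (m - 1)) = m); last by field.
move=> h; have := ler_wpM2l (ltW m0) h.
have -> : m * (x `^ m / m + k `^ m / (m / (m - 1))) = x `^ m + (m - 1) * k `^ m.
  by field; rewrite mm gt_eqF.
by rewrite mulrA mulrAC; lra.
Qed.

Lemma powR_der m x : 0 < x -> der (fun y => y `^ m) x (m * x `^ (m - 1)).
Proof. by move=> x0; exact: is_derive1_powR. Qed.

Lemma powRK m x : 0 < m -> 0 <= x -> (x `^ m^-1) `^ m = x.
Proof. by move=> m0 x0; rewrite -powRrM mulVf ?powRr1 // gt_eqF. Qed.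

Lemma powRKV m x : 0 < m -> 0 <= x -> (x `^ m) `^ m^-1 = x.
Proof. by move=> m0 x0; rewrite -powRrM mulfV ?powRr1 // gt_eqF. Qed.

Lemma powR_le m x y : 0 <= m -> 0 <= x -> x <= y -> x `^ m <= y `^ m.
Proof.
move=> m0 x0 xy; apply: ge0_ler_powR => //; rewrite nnegrE //; exact: le_trans xy.
Qed.

Lemma powR_add_le m x y : 0 <= m -> 0 <= x -> 0 <= y ->
  (x + y) `^ m <= 2 `^ m * (x `^ m + y `^ m).
Proof.
move=> m0 x0 y0; wlog xy : x y x0 y0 / x <= y => [H|].
  by have [/H|/ltW/H] := leP x y; rewrite ?[y + x]addrC 1?[y `^ m + _]addrC; apply.
apply: (@le_trans _ _ ((2 * y) `^ m)).
  by apply: powR_le => //; [exact: addr_ge0|lra].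
by rewrite powRM // ler_wpM2l ?powR_ge0 // lerDr powR_ge0.
Qed.

(* [(Y + k)^(1 - m)] decreases at a definite rate and stays positive. *)
Lemma ode_blowup (Y B : R -> R) m kap a s0 T : 1 < m -> 0 < kap -> 0 < a -> s0 < T ->
  continuous B -> (forall t, s0 <= t <= T -> Y t = Y s0 + itg B s0 t) ->
  (forall t, s0 <= t <= T -> 0 <= Y t) ->
  (forall t, s0 < t < T -> kap + a * Y t `^ m <= B t) ->
  (T - s0) `^ m * kap `^ (m - 1) * a <= (2 `^ m / (m - 1)) `^ m.
Proof.
move=> m1 kap0 a0 sT cB hY Y0 hB; have m0 : 0 < m by rewrite (lt_trans ltr01).
have mm : 0 < m - 1 by rewrite subr_gt0.
(* The shift balances the two source terms: kap = a k^m, so kap + a Y^m = a (Y^m + k^m) dominates a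
   2^(-m) (Y + k)^m. *)
pose k := (kap / a) `^ m^-1.
have ka0 : 0 < kap / a by rewrite divr_gt0.
have k0 : 0 < k by exact: powR_gt0.
have km : k `^ m = kap / a by rewrite powRK // ltW.
pose Z t := Y s0 + itg B s0 t.
have dZ t : der Z t (B t).
  by apply: der_eq (derD (der_cst (Y s0) t) (itg_der s0 t cB)) _; rewrite add0r.
pose c := (m - 1) * a / 2 `^ m.
have c20 : 0 < 2 `^ m :> R by rewrite powR_gt0.
pose G t := - ((Z t + k) `^ (1 - m) + c * t).
have ZY t : s0 <= t <= T -> Z t = Y t by move=> /hY ->.
have Zk t : s0 <= t <= T -> 0 < Z t + k by move=> ht; rewrite ZY // ltr_wpDl // Y0.
have dG t : s0 < t < T -> der G t (- ((1 - m) * (Z t + k) `^ (1 - m - 1) * B t + c)).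
  move=> /andP[st tT]; have ht : s0 <= t <= T by rewrite !ltW.
  apply: derN; apply: derD; last by apply: der_eq (derZ c (der_id t)) _; rewrite mulr1.
  apply: (@der_comp _ (fun y => y `^ (1 - m)) (fun t => Z t + k)).
    by apply: der_eq (derD (dZ t) (der_cst k t)) _; rewrite addr0.
  by apply: powR_der; exact: Zk.
have cZ : continuous Z by move=> t; exact: der_continuous (dZ t).
have GsT : G s0 <= G T.
  apply: (@der_ndecr _ G _ s0 T (ltW sT) dG).
    apply: continuous_in_subspaceT => t; rewrite inE /= in_itv /= => ht.
    apply: (@der_continuous _ G t (- ((1 - m) * (Z t + k) `^ (1 - m - 1) * B t + c))).
    apply: derN; apply: derD; last by apply: der_eq (derZ c (der_id t)) _; rewrite mulr1.
    apply: (@der_comp _ (fun y => y `^ (1 - m)) (fun t => Z t + k)).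
      by apply: der_eq (derD (dZ t) (der_cst k t)) _; rewrite addr0.
    by apply: powR_der; exact: Zk.
  move=> t ht; have ht' : s0 <= t <= T by case/andP: ht => ? ?; rewrite !ltW.
  have Zk0 := Zk t ht'.
  have -> : 1 - m - 1 = - m by ring.
  rewrite powRN oppr_ge0 -opprB mulNr mulNr addrC subr_le0 /c.
  have hb := hB t ht; rewrite -ZY // in hb.
  have h1 : a / 2 `^ m * (Z t + k) `^ m <= B t.
    apply: le_trans hb.
    have -> : kap + a * Z t `^ m = a / 2 `^ m * (2 `^ m * (Z t `^ m + k `^ m)).
      by rewrite km; field; rewrite !gt_eqF.
    rewrite ler_wpM2l ?divr_ge0 ?(ltW a0) ?(ltW c20) // powR_add_le ?(ltW m0) ?(ltW k0) //.
    by rewrite ZY // Y0.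
  rewrite -!mulrA ler_wpM2l ?(ltW mm) // mulrC [X in _ <= X]mulrC ler_pdivlMr ?powR_gt0 //.
  by rewrite [_^-1 * a]mulrC.
have TT : s0 <= T <= T by rewrite (ltW sT) lexx.
have ss : s0 <= s0 <= T by rewrite (ltW sT) lexx.
have b1 : c * (T - s0) <= (Z s0 + k) `^ (1 - m).
  by have := powR_ge0 (Z T + k) (1 - m); move: GsT; rewrite /G mulrBr; lra.
have b2 : (Z s0 + k) `^ (1 - m) <= k `^ (1 - m).
  rewrite -opprB !powRN lef_pV2 ?posrE ?powR_gt0 ?Zk //.
  by apply: powR_le; rewrite ?(ltW mm) ?(ltW k0) // lerDr ZY // Y0.
have b3 : T - s0 <= 2 `^ m / (m - 1) * (k `^ (1 - m) / a).
  have := le_trans b1 b2; rewrite /c mulrC => h.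
  have -> : 2 `^ m / (m - 1) * (k `^ (1 - m) / a) = k `^ (1 - m) / ((m - 1) * a / 2 `^ m).
    by field; rewrite !gt_eqF.
  by rewrite ler_pdivlMr // divr_gt0 // mulr_gt0.
have Ts : 0 <= T - s0 by rewrite subr_ge0 ltW.
have b4 := powR_le (ltW m0) Ts b3.
rewrite powRM ?divr_ge0 ?powR_ge0 ?(ltW mm) ?(ltW a0) // in b4.
(* The choice of k makes the m-th power of the bound on T - s0, times kap^(m-1) a, independent of
   kap and a. *)
have E : (k `^ (1 - m) / a) `^ m * (kap `^ (m - 1) * a) = 1.
  rewrite powRM ?powR_ge0 ?invr_ge0 ?(ltW a0) //.
  have -> : (k `^ (1 - m)) `^ m = (kap / a) `^ (1 - m) by rewrite powRAC km.
  have -> : a^-1 `^ m = a^-1 * a^-1 `^ (m - 1).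
    by rewrite mulr_powRB1 // invr_ge0 ltW.
  rewrite -opprB powRN powRM ?invr_ge0 ?(ltW a0) ?(ltW kap0) //.
  field; rewrite ?gt_eqF ?powR_gt0 ?invr_gt0 //.
rewrite -mulrA; apply: (le_trans (ler_wpM2r _ b4)).
  by rewrite mulr_ge0 ?powR_ge0 // ltW.
by rewrite -mulrA E mulr1.
Qed.

(** Jensen's inequality obtained by integrating the tangent inequality at k = S / Vol. Replacing the
    true volume by the upper bound Vol only weakens the subtracted term. *)
Lemma jensen_radial (u : R -> R) m n a b Vol : 1 < m -> continuous u ->
  continuous (fun r => u r `^ m) -> (forall r, 0 <= u r) -> 0 <= a -> a <= b ->
  0 < Vol -> itg (fun r : R => r ^+ n) a b <= Vol ->
  (itg (fun r => u r * r ^+ n) a b) `^ m * Vol `^ (1 - m) <= itg (fun r => u r `^ m * r ^+ n) a b.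
Proof.
move=> m1 cu cum u0 a0 ab V0 hV; have m0 : 0 < m by rewrite (lt_trans ltr01).
have cX (j : nat) : continuous (fun r : R => r ^+ j) by exact/continuousX/continuous_id.
have c1 : continuous (fun r => u r * r ^+ n) by exact: continuousM.
have c2 : continuous (fun r => u r `^ m * r ^+ n) by exact: continuousM.
have cc (c : R) : continuous (fun _ : R => c) by exact: continuous_cst.
set S := itg _ a b.
have S0 : 0 <= S.
  apply: itg_ge0 => // r /andP[ar _]; rewrite mulr_ge0 ?exprn_ge0 //.
  by rewrite (le_trans a0) // ltW.
pose k := S / Vol; have k0 : 0 <= k by rewrite divr_ge0 // ltW.
have h : m * k `^ (m - 1) * S - (m - 1) * k `^ m * itg (fun r : R => r ^+ n) a b <=
    itg (fun r => u r `^ m * r ^+ n) a b.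
  rewrite /S -!itgZ // -itgB; [|exact: continuousM..].
  apply: itg_le => //; first by apply: continuousB; exact: continuousM.
  move=> r /andP[ar _]; have r0 : 0 <= r by rewrite (le_trans a0) // ltW.
  rewrite !mulrA -mulrBl ler_wpM2r ?exprn_ge0 //.
  exact: powR_tangent.
apply: le_trans h.
apply: (@le_trans _ _ (m * k `^ (m - 1) * S - (m - 1) * k `^ m * Vol)); last first.
  by rewrite lerB // ler_wpM2l // mulr_ge0 ?powR_ge0 // subr_ge0 ltW.
have SE : S = k * Vol by rewrite /k divfK // gt_eqF.
have E1 : S `^ m * Vol `^ (1 - m) = k `^ m * Vol.
  rewrite SE powRM ?(ltW V0) // -mulrA -powRD ?(gt_eqF V0) ?implybT //.
  by rewrite addrC subrK powRr1 // ltW.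
have E2 : m * k `^ (m - 1) * S = m * k `^ m * Vol.
  by rewrite SE -(@mulr_powRB1 _ k m) //; ring.
by rewrite E1 E2; lra.
Qed.

End PowR.

(** * Derivatives at a maximum *)

Section Extrema.
Variable R : realType.
Implicit Types (x y t d : R).

Lemma der_left_max (g : R -> R) t d a : a < t -> der g t d ->
  (forall y, a < y < t -> g y <= g t) -> 0 <= d.
Proof.
move=> at0 hg hmax; rewrite leNgt; apply/negP => d0.
have e0 : 0 < - d / 2 by lra.
have [dl dl0 hd] := der_epsP hg e0.
pose h := Num.min (dl / 2) ((t - a) / 2).
have h0 : 0 < h by rewrite lt_min !divr_gt0 // subr_gt0.
have h1 : h <= dl / 2 by rewrite ge_min lexx.
have h2 : h <= (t - a) / 2 by rewrite ge_min lexx orbT.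
have := hd (t - h); rewrite addrAC subrr add0r normrN gtr0_norm // => /(_ _).
have hh : h < dl by lra.
move=> /(_ hh); rewrite ler_norml => /andP[lo _].
have : g (t - h) <= g t by apply: hmax; apply/andP; split; lra.
have dh : 0 < - d * h by rewrite mulr_gt0 // oppr_gt0.
by lra.
Qed.

(** If D' were positive at x, D would be positive just to the right of x and phi would increase
    there. Differentiability of D at the single point x is enough. *)
Lemma second_order_max (phi D : R -> R) x a b d2 : a < x < b ->
  (forall y, a < y < b -> der phi y (D y)) -> der D x d2 ->
  (forall y, a < y < b -> phi y <= phi x) -> D x = 0 /\ d2 <= 0.
Proof.
move=> xab hphi hD hmax; have /andP[ax xb] := xab.
have Dx : D x = 0.
  have ab : a <= b by apply: ltW; exact: lt_trans xb.
  have xi : x \in `]a, b[ by rewrite in_itv.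
  have h1 t : t \in `]a, b[ -> derivable phi t 1.
    by rewrite in_itv /= => ht; have [] := hphi t ht.
  have h2 t : t \in `]a, b[ -> phi t <= phi x by rewrite in_itv /=; exact: hmax.
  exact: der_unique (hphi x xab) (derive1_at_max ab h1 xi h2).
split=> //; rewrite leNgt; apply/negP => d20.
have e0 : 0 < d2 / 2 by lra.
have [dl dl0 hd] := der_epsP hD e0.
pose h := Num.min (dl / 2) ((b - x) / 2).
have h0 : 0 < h by rewrite lt_min !divr_gt0 // subr_gt0.
have h1 : h <= dl / 2 by rewrite ge_min lexx.
have h2 : h <= (b - x) / 2 by rewrite ge_min lexx orbT.
have xh : x < x + h by rewrite ltrDl.
have sub y : x <= y <= x + h -> a < y < b by move=> /andP[? ?]; apply/andP; split; lra.
have [||c /andP[xc ch] E] := @der_mvt _ phi D x (x + h) xh.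
- by move=> y /andP[? ?]; apply: hphi; apply: sub; rewrite !ltW.
- apply: continuous_in_subspaceT => y; rewrite inE /= in_itv /= => /sub hy.
  exact: der_continuous (hphi y hy).
have Dc : 0 < D c.
  have cx : `|c - x| < dl by rewrite gtr0_norm ?subr_gt0 //; lra.
  have cx0 : 0 < c - x by rewrite subr_gt0.
  have := hd c cx; rewrite Dx subr0 (gtr0_norm cx0) ler_norml => /andP[lo _].
  have : 0 < d2 / 2 * (c - x) by rewrite mulr_gt0.
  lra.
have : 0 < D c * (x + h - x) by rewrite mulr_gt0 // subr_gt0.
rewrite -E subr_gt0 ltNge hmax //; apply: sub.
by rewrite (ltW xh) lexx.
Qed.

Lemma pospow_der k x :
  der (fun y : R => Num.max y 0 ^+ k.+2) x (k.+2%:R * Num.max x 0 ^+ k.+1).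
Proof.
have [x0|x0|->] := ltgtP x 0.
- rewrite expr0n mulr0.
  apply: (@der_near _ (fun=> 0)); last exact: der_cst.
  have xx : x - 1 < x < 0 by rewrite x0 andbT ltrBlDr ltrDl.
  apply: filterS (near_itv_oo xx) => y /andP[_ y0].
  by rewrite max_r ?ltW // expr0n.
- apply: (@der_near _ (fun y => y ^+ k.+2)); last exact: derX.
  have xx : 0 < x < x + 1 by rewrite x0 ltrDl ltr01.
  apply: filterS (near_itv_oo xx) => y /andP[y0 _].
  by rewrite max_l ?ltW.
- rewrite ?maxxx expr0n mulr0; apply: der_eps => e e0.
  exists (Num.min 1 e); first by rewrite lt_min ltr01.
  move=> y; rewrite subr0 maxxx mul0r subr0 expr0n subr0 lt_min => /andP[y1 ye].
  have [y0|y0] := leP y 0; first by rewrite expr0n normr0 mulr_ge0 // ltW.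
  rewrite normrX gtr0_norm // in y1 ye *.
  rewrite exprSr ler_wpM2r ?(ltW y0) // exprS.
  apply: (le_trans _ (ltW ye)); rewrite -[X in _ <= X]mulr1 ler_wpM2l ?(ltW y0) //.
  by rewrite exprn_ile1 // ltW.
Qed.

End Extrema.

Section Bounds.
Variables (R : realType) (n : nat).
Implicit Types (r s t a b x T X B kap H ell : R).
Variables (u v ff : R -> R -> R) (m M : R).
Hypothesis m1 : 1 < m.
Hypothesis cu : cont2 u.
Hypothesis cv : cont2 v.
Hypothesis cff : cont2 ff.
Hypothesis u0 : forall t r, 0 <= u t r.
Hypothesis uM : forall t r, u t r <= M.
Hypothesis vE : forall t r, v t r = u t r `^ m.
Hypothesis star : forall s t r, 0 <= s -> 0 <= t -> 0 < r ->
  der (wint v s t) r (flux n u ff s t r / r ^+ n).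

Let m0 : 0 < m. Proof. exact: lt_trans m1. Qed.
Let cc (c : R) : continuous (fun _ : R => c). Proof. exact: continuous_cst. Qed.
Let cXn (j : nat) : continuous (fun r : R => r ^+ j). Proof. exact: cX. Qed.
Let v0 t r : 0 <= v t r. Proof. by rewrite vE powR_ge0. Qed.
Let vz t r : u t r = 0 -> v t r = 0. Proof. exact: (v_eq0 m1 vE). Qed.

Lemma wint_zero s t r : s <= t -> (forall q, s <= q <= t -> u q r = 0) -> wint v s t r = 0.
Proof.
move=> st h; apply: itg_eq0 => //; first exact: cont2_r.
by move=> q /andP[sq qt]; apply: vz; apply: h; rewrite !ltW.
Qed.

Lemma boundary_out s t b z dz : 0 <= s -> s <= t -> 0 < b ->
  (forall q r, s <= q <= t -> b <= r -> u q r = 0) -> boundary n u v ff s t z dz b = 0.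
Proof.
move=> s0 st b0 h; rewrite /boundary wint_zero // ?mul0r ?subr0; last by move=> q hq; exact: h.
rewrite (flux_zero cu cff star) ?mul0r // ?(le_trans s0) // => r br.
by apply: wint_zero => // q hq; exact: h.
Qed.

Lemma slice_continuous (w : R -> R -> R) t : cont2 w -> continuous (fun r => w t r * r ^+ n).
Proof. by move=> cw; apply: continuousM => //; exact: cont2_l. Qed.

Lemma itgXn b : 0 <= b -> itg (fun r => r ^+ n) 0 b <= b ^+ n.+1.
Proof.
move=> b0; rewrite exprSr -[X in _ * X](subr0 b) -itg_cst; apply: itg_le => //.
by move=> r /andP[r0 rb]; rewrite lerXn2r ?nnegrE // ltW.
Qed.

(* Weight [1 + (r / B)^2]: its Laplacian is a positive constant, and Jensen bounds
   the moment of [u^m] below by a power of the mass. *)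
Lemma growth_constraint s0 T B kap : 0 <= s0 -> s0 < T -> 0 < B -> 0 < kap ->
  (forall t r, s0 <= t <= T -> B <= r -> u t r = 0) ->
  (forall t r, s0 <= t <= T -> 0 <= r <= B -> 0 <= ff t r) ->
  (forall t, s0 <= t <= T -> kap <= itg (fun r => ff t r * r ^+ n) 0 B) ->
  (T - s0) `^ m * kap `^ (m - 1) *
    (2 * n.+1%:R / B ^+ 2 * ((2 `^ m)^-1 * (B ^+ n.+1) `^ (1 - m))) <= (2 `^ m / (m - 1)) `^ m.
Proof.
move=> s00 sT B0 kap0 hout hff hkap.
have B2 : 0 < B ^+ 2 by rewrite exprn_gt0.
pose z r : R := 1 + (B ^+ 2)^-1 * r ^+ 2; pose dz r : R := (B ^+ 2)^-1 * (2 * r).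
pose p r : R := 2 * n.+1%:R / B ^+ 2 * r ^+ n.
have hz r : der z r (dz r).
  by apply: der_eq (derD (der_cst 1 r) (derZ _ (derX 2 r))) _; rewrite add0r expr1.
have hp r : der (fun r => r ^+ n * dz r) r (p r).
  apply: (@der_ext _ (fun r => 2 / B ^+ 2 * r ^+ n.+1)).
    have E (X c y : R) : 2 * c * (X * y) = X * (c * (2 * y)) by ring.
    by move=> x; rewrite (exprSr x n); exact: E.
  apply: der_eq (derZ _ (derX n.+1 r)) _; rewrite /p /=.
  by move: (r ^+ n) (_^-1) (n.+1%:R) => X c k; ring.
have cz : continuous z by move=> r; exact: der_continuous (hz r).
have cdz : continuous dz by apply: continuousM => //; apply: continuousM => //; exact: continuous_id.
have cp : continuous p by apply: continuousM.
have z1 r : 0 <= r <= B -> 1 <= z r <= 2.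
  move=> /andP[r0 rB]; rewrite /z lerDl mulr_ge0 ?invr_ge0 ?sqr_ge0 //=.
  rewrite (_ : 2 = 1 + 1); last by ring.
  by rewrite lerD2l mulrC ler_pdivrMr // mul1r lerXn2r ?nnegrE // ltW.
pose Y t := itg (fun r => u t r * z r * r ^+ n) 0 B.
pose Bt t := itg (fun r => ff t r * z r * r ^+ n + v t r * p r) 0 B.
have cuz w t : cont2 w -> continuous (fun r => w t r * z r * r ^+ n).
  by move=> cw; apply: continuousM => //; apply: continuousM => //; exact: cont2_l.
have cvp t : continuous (fun r => v t r * p r) by apply: continuousM => //; exact: cont2_l.
have cBt : continuous Bt.
  apply: (@itg_param _ _ (fun s x => ff s x * z x * x ^+ n + v s x * p x)).
  apply: continuousD.
    apply: continuousM; last exact: (c2snd (@cXn n)).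
    by apply: continuousM => //; exact: (c2snd cz).
  by apply: continuousM => //; exact: (c2snd cp).
have Vol0 : 0 < B ^+ n.+1 by rewrite exprn_gt0.
have a0 : 0 < 2 * n.+1%:R / B ^+ 2 * ((2 `^ m)^-1 * (B ^+ n.+1) `^ (1 - m)).
  apply: mulr_gt0; first by apply: divr_gt0 => //; apply: mulr_gt0; rewrite ?ltr0n.
  by apply: mulr_gt0; rewrite ?invr_gt0 powR_gt0.
apply: (@ode_blowup _ Y Bt) => //.
- move=> t /andP[st tT]; have t0 := le_trans s00 st.
  have := moment_boundary cu cv cff star s00 t0 (lexx 0) (ltW B0) cz cdz cp
    (fun x _ => hz x) (fun x _ => hp x).
  rewrite boundary_out // => [|q r /andP[q1 q2] rB]; last by rewrite hout // q1 (le_trans q2).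
  rewrite /boundary flux0 /dz !mulr0 mul0r !subrr addr0.
  by move=> E; rewrite -[LHS](subrK (Y s0)) /Y E addrC.
- move=> t ht; apply: itg_ge0; [exact: cuz|exact: ltW|move=> r /andP[r0 rB]].
  have /andP[z1' _] : 1 <= z r <= 2 by apply: z1; rewrite !ltW.
  apply: mulr_ge0; last by apply: exprn_ge0; exact: ltW.
  by apply: mulr_ge0 => //; apply: le_trans z1'.
move=> t /andP[st tT]; have ht : s0 <= t <= T by rewrite !ltW.
rewrite /Bt itgD; [|exact: cuz|exact: cvp].
apply: lerD.
  apply: (le_trans (hkap t ht)); apply: itg_le; [exact: slice_continuous|exact: cuz|exact: ltW|].
  move=> r /andP[r0 rB]; have rB' : 0 <= r <= B by rewrite !ltW.
  have /andP[z1' _] := z1 r rB'.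
  apply: ler_wpM2r; first by apply: exprn_ge0; exact: ltW.
  by rewrite -[X in X <= _]mulr1; apply: ler_wpM2l => //; exact: hff.
have -> : (fun r => v t r * p r) = (fun r => 2 * n.+1%:R / B ^+ 2 * (v t r * r ^+ n)).
  by apply/funext => r; rewrite /p; ring.
rewrite itgZ; last exact: slice_continuous.
rewrite -[X in X <= _]mulrA; apply: ler_wpM2l.
  by apply: divr_ge0; [apply: mulr_ge0 => //|exact: ltW].
have cut := cont2_l (p := t) cu.
have cvt : continuous (fun r => u t r `^ m).
  by rewrite (_ : (fun r => _) = v t); [exact: cont2_l|apply/funext => r; rewrite vE].
have := @jensen_radial _ (u t) m n 0 B (B ^+ n.+1) m1 cut cvt (u0 t) (lexx 0) (ltW B0) Vol0
  (itgXn (ltW B0)).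
have -> : (fun r => u t r `^ m * r ^+ n) = (fun r => v t r * r ^+ n).
  by apply/funext => r; rewrite vE.
apply: le_trans; rewrite mulrAC; apply: ler_wpM2r; first exact: powR_ge0.
have S0 : 0 <= itg (fun r => u t r * r ^+ n) 0 B.
  apply: itg_ge0; [exact: slice_continuous|exact: ltW|move=> r /andP[r0 _]].
  by apply: mulr_ge0 => //; apply: exprn_ge0; exact: ltW.
(* Since z <= 2, the weighted mass is at most twice the mass; this is the origin of the factor
   2^(-m) in the constraint. *)
rewrite mulrC ler_pdivrMr ?powR_gt0 // mulrC -powRM //.
apply: powR_le; first exact: ltW.
  apply: itg_ge0; [exact: cuz|exact: ltW|move=> r /andP[r0 rB]].
  have /andP[z1' _] : 1 <= z r <= 2 by apply: z1; rewrite !ltW.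
  apply: mulr_ge0; last by apply: exprn_ge0; exact: ltW.
  by apply: mulr_ge0 => //; apply: le_trans z1'.
rewrite -itgZ; last exact: slice_continuous.
apply: itg_le; [exact: cuz| |exact: ltW|].
  by apply: continuousM => //; exact: slice_continuous.
move=> r /andP[r0 rB]; have rB' : 0 <= r <= B by rewrite !ltW.
have /andP[_ z2] := z1 r rB'.
rewrite mulrA; apply: ler_wpM2r; first by apply: exprn_ge0; exact: ltW.
by rewrite mulrC; apply: ler_wpM2r.
Qed.

End Bounds.

Lemma continuous_max0 (R : realType) (P : topologicalType) (g : P -> R) (c : R) :
  continuous g -> continuous (fun p => Num.max (g p) c).
Proof.
move=> cg; have -> : (fun p => Num.max (g p) c) = (fun p => 2^-1 * ((g p + c) + `|g p - c|)).
  by apply/funext => p; rewrite maxr_absE mulrC.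
apply: continuousM; first exact: continuous_cst.
apply: continuousD; first by apply: continuousD => //; exact: continuous_cst.
apply: (continuous_after _ (@norm_continuous _ R)).
by apply: continuousB => //; exact: continuous_cst.
Qed.

(** * Mass growth outside a disc in the plane *)

Section Exterior.
Variables (R : realType).
Implicit Types (r s t a b x T X B kap H ell : R).
Variables (u v ff : R -> R -> R) (m M : R).
Hypothesis m1 : 1 < m.
Hypothesis cu : cont2 u.
Hypothesis cv : cont2 v.
Hypothesis cff : cont2 ff.
Hypothesis u0 : forall t r, 0 <= u t r.
Hypothesis vE : forall t r, v t r = u t r `^ m.
Hypothesis star : forall s t r, 0 <= s -> 0 <= t -> 0 < r ->
  der (wint v s t) r (flux 1 u ff s t r / r ^+ 1).

Let m0 : 0 < m. Proof. exact: lt_trans m1. Qed.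
Let cc (c : R) : continuous (fun _ : R => c). Proof. exact: continuous_cst. Qed.
Let cXn (j : nat) : continuous (fun r : R => r ^+ j). Proof. exact: cX. Qed.
Let v0 t r : 0 <= v t r. Proof. by rewrite vE powR_ge0. Qed.

(* The logarithmic part of the weight is harmonic and picks up [v t R0] through the
   boundary term at [R0]. *)
Lemma growth_constraint_exterior (s0 T R0 B kap ell : R) : 0 <= s0 -> s0 < T -> 0 < R0 -> R0 < B -> 0 < kap ->
  ell = ln (B / R0) -> 0 < ell ->
  (forall t r, s0 <= t <= T -> B <= r -> u t r = 0) ->
  (forall t r, s0 <= t <= T -> R0 <= r <= B -> 0 <= ff t r) ->
  (forall t, s0 <= t <= T -> kap <= v t R0) ->
  (T - s0) `^ m * (kap / ell) `^ (m - 1) *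
    (4 / B ^+ 2 * ((2 `^ m)^-1 * (B ^+ 2) `^ (1 - m))) <= (2 `^ m / (m - 1)) `^ m.
Proof.
move=> s00 sT R00 RB kap0 ellE ell0 hout hff hkap.
have B0 : 0 < B by exact: lt_trans RB.
have B2 : 0 < B ^+ 2 by rewrite exprn_gt0.
(* Freezing the radius below R0 keeps the logarithm and the inverse continuous on the whole line;
   only r >= R0 is integrated. *)
pose mx r : R := Num.max r R0.
have mx0 r : 0 < mx r by rewrite lt_max R00 orbT.
have cmx : continuous mx by apply: continuous_max0; exact: continuous_id.
have mxE r : R0 <= r -> mx r = r by move=> h; rewrite /mx max_l.
pose z r : R := ell^-1 * ln (mx r / R0) + (B ^+ 2)^-1 * (r ^+ 2 - R0 ^+ 2).
pose dz r : R := ell^-1 * (mx r)^-1 + (B ^+ 2)^-1 * (2 * r).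
pose p r : R := 4 / B ^+ 2 * r.
have hz r : R0 < r < B -> der z r (dz r).
  move=> rr; have r0 : 0 < r by case/andP: rr => h _; exact: lt_trans h.
  apply: (@der_near _ (fun r => ell^-1 * ln (r * R0^-1) + (B ^+ 2)^-1 * (r ^+ 2 - R0 ^+ 2))).
    by apply: filterS (near_itv_oo rr) => y /andP[/ltW hy _]; rewrite /z mxE.
  have d1 : der (fun r => r * R0^-1) r R0^-1.
    by apply: der_eq (derM (der_id r) (der_cst R0^-1 r)) _; ring.
  have rR : 0 < r * R0^-1 by rewrite divr_gt0.
  have d2 := @der_comp _ (@ln R) (fun r => r * R0^-1) r _ _ d1 (is_derive1_ln rR).
  apply: der_eq (derD (derZ _ d2) (derZ _ (derB (derX 2 r) (der_cst (R0 ^+ 2) r)))) _.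
  rewrite /dz mxE; last by case/andP: rr => /ltW.
  by field; rewrite !gt_eqF.
have hp r : R0 < r < B -> der (fun r => r ^+ 1 * dz r) r (p r).
  move=> rr; apply: (@der_near _ (fun r => ell^-1 + 2 * (B ^+ 2)^-1 * r ^+ 2)).
    apply: filterS (near_itv_oo rr) => y /andP[hy _].
    rewrite /dz mxE ?(ltW hy) //; have y0 : 0 < y by exact: lt_trans hy.
    by field; rewrite !gt_eqF.
  apply: der_eq (derD (der_cst _ r) (derZ _ (derX 2 r))) _.
  by rewrite /p; field; rewrite !gt_eqF.
have cz : continuous z.
  apply: continuousD.
    apply: continuousM => // r; apply: (@continuous_comp _ _ _ (fun r => mx r / R0) (@ln R)).
      by apply: continuousM.
    by apply: continuous_ln; rewrite divr_gt0.
  apply: continuousM => //; exact: continuousB.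
have cdz : continuous dz.
  apply: continuousD; apply: continuousM => //.
    move=> r; apply: (@continuous_comp _ _ _ mx (@GRing.inv R)); first exact: cmx.
    by apply: inv_continuous; rewrite gt_eqF.
  by apply: continuousM => //; exact: continuous_id.
have cp : continuous p by apply: continuousM => //; exact: continuous_id.
have z1 r : R0 <= r <= B -> 0 <= z r <= 2.
  move=> /andP[r0 rB]; have rr : 0 < r by exact: lt_le_trans r0.
  rewrite /z mxE //.
  have l1 : 0 <= ln (r / R0) by apply: ln_ge0; rewrite ler_pdivlMr // mul1r.
  have l2 : ln (r / R0) <= ell.
    by rewrite ellE ler_ln ?posrE ?divr_gt0 // ler_pM2r ?invr_gt0.
  have q1 : 0 <= r ^+ 2 - R0 ^+ 2 by rewrite subr_ge0 lerXn2r ?nnegrE // ltW.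
  have q2 : r ^+ 2 - R0 ^+ 2 <= B ^+ 2.
    apply: (@le_trans _ _ (r ^+ 2)); first by rewrite gerBl sqr_ge0.
    by rewrite lerXn2r ?nnegrE // ltW.
  apply/andP; split.
    by apply: addr_ge0; apply: mulr_ge0 => //; rewrite invr_ge0 ltW.
  rewrite (_ : 2 = 1 + 1); last by ring.
  by apply: lerD; rewrite mulrC ler_pdivrMr // mul1r.
pose Y t : R := itg (fun r => u t r * z r * r ^+ 1) R0 B.
(* K = R0 z'(R0). As z(R0) = 0, the boundary term at R0 reduces to K times the time integral of v at
   R0, and it enters with a favourable sign. *)
pose K : R := ell^-1 + (B ^+ 2)^-1 * (2 * R0) * R0.
pose Bt t : R := itg (fun r => ff t r * z r * r ^+ 1 + v t r * p r) R0 B + K * v t R0.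
have cuz w t : cont2 w -> continuous (fun r => w t r * z r * r ^+ 1).
  by move=> cw; apply: continuousM => //; apply: continuousM => //; exact: cont2_l.
have cvp t : continuous (fun r => v t r * p r) by apply: continuousM => //; exact: cont2_l.
have cvR : continuous (fun t => v t R0) by exact: cont2_r.
have cI : continuous (fun t => itg (fun r => ff t r * z r * r ^+ 1 + v t r * p r) R0 B).
  apply: (@itg_param _ _ (fun s x => ff s x * z x * x ^+ 1 + v s x * p x)).
  apply: continuousD.
    apply: continuousM; last exact: (c2snd (@cXn 1)).
    by apply: continuousM => //; exact: (c2snd cz).
  by apply: continuousM => //; exact: (c2snd cp).
have cBt : continuous Bt by apply: continuousD => //; exact: continuousM.
have Vol0 : 0 < B ^+ 2 by rewrite exprn_gt0.
have a0 : 0 < 4 / B ^+ 2 * ((2 `^ m)^-1 * (B ^+ 2) `^ (1 - m)).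
  apply: mulr_gt0; first by apply: divr_gt0.
  by apply: mulr_gt0; rewrite ?invr_gt0 powR_gt0.
have Y0 t : 0 <= Y t.
  apply: itg_ge0; [exact: cuz|exact: ltW|move=> r /andP[r0 rB]].
  have /andP[z1' _] : 0 <= z r <= 2 by apply: z1; rewrite !ltW.
  apply: mulr_ge0; last by apply: exprn_ge0; apply: ltW; exact: lt_trans r0.
  by apply: mulr_ge0.
apply: (@ode_blowup _ Y Bt) => //; first exact: divr_gt0.
- move=> t /andP[st tT]; have t0 := le_trans s00 st.
  have := moment_boundary cu cv cff star s00 t0 (ltW R00) (ltW RB) cz cdz cp hz hp.
  rewrite (boundary_out m1 cu cv cff vE star) // => [|q r /andP[q1 q2] rB]; last by rewrite hout // q1 (le_trans q2).
  rewrite /boundary (_ : z R0 = 0); last first.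
    by rewrite /z mxE // divff ?gt_eqF // ln1 subrr !mulr0 addr0.
  have cKv : continuous (fun t => K * v t R0) by exact: continuousM.
  have EB := itgD s0 t cI cKv; rewrite itgZ // in EB.
  move=> E; rewrite -[LHS](subrK (Y s0)) /Y E addrC /Bt EB mulr0 !sub0r opprK.
  congr (_ + (_ + _)).
  by rewrite /K /dz mxE // expr1 mulrC; congr (_ * _); field; rewrite !gt_eqF.
move=> t /andP[st tT]; have ht : s0 <= t <= T by rewrite !ltW.
rewrite addrC /Bt; apply: lerD; last first.
  rewrite mulrC /K; apply: (@le_trans _ _ (ell^-1 * v t R0)).
    by apply: ler_wpM2l; [rewrite invr_ge0 ltW|exact: hkap].
  apply: ler_wpM2r => //; rewrite lerDl.
  by apply: mulr_ge0; [apply: mulr_ge0; [rewrite invr_ge0 ltW|apply: mulr_ge0 => //; exact: ltW]|exact: ltW].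
rewrite itgD; [|exact: cuz|exact: cvp].
rewrite -[X in X <= _]add0r; apply: lerD.
  apply: itg_ge0; [exact: cuz|exact: ltW|move=> r /andP[r0 rB]].
  have rB' : R0 <= r <= B by rewrite !ltW.
  have /andP[z1' _] := z1 r rB'.
  apply: mulr_ge0; last by apply: exprn_ge0; apply: ltW; exact: lt_trans r0.
  by apply: mulr_ge0 => //; exact: hff.
have cvr : continuous (fun r => v t r * r ^+ 1) by apply: continuousM => //; exact: cont2_l.
have -> : (fun r => v t r * p r) = (fun r => 4 / B ^+ 2 * (v t r * r ^+ 1)).
  by apply/funext => r; rewrite /p expr1; ring.
rewrite itgZ //.
rewrite -[X in X <= _]mulrA; apply: ler_wpM2l; first by apply: divr_ge0 => //; exact: ltW.
have cut := cont2_l (p := t) cu.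
have cvt : continuous (fun r => u t r `^ m).
  by rewrite (_ : (fun r => _) = v t); [exact: cont2_l|apply/funext => r; rewrite vE].
have hVol : itg (fun r : R => r ^+ 1) R0 B <= B ^+ 2.
  apply: (@le_trans _ _ (B * (B - R0))).
    rewrite -itg_cst; apply: itg_le => //; first exact: ltW.
    by move=> r /andP[_ /ltW]; rewrite expr1.
  by rewrite expr2 ler_wpM2l ?(ltW B0) // gerBl ltW.
have := @jensen_radial _ (u t) m 1 R0 B (B ^+ 2) m1 cut cvt (u0 t) (ltW R00) (ltW RB) Vol0 hVol.
have -> : (fun r => u t r `^ m * r ^+ 1) = (fun r => v t r * r ^+ 1).
  by apply/funext => r; rewrite vE.
apply: le_trans; rewrite mulrAC; apply: ler_wpM2r; first exact: powR_ge0.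
have S0 : 0 <= itg (fun r => u t r * r ^+ 1) R0 B.
  apply: itg_ge0; [by apply: continuousM|exact: ltW|move=> r /andP[r0 _]].
  by apply: mulr_ge0 => //; apply: exprn_ge0; apply: ltW; exact: lt_trans r0.
rewrite mulrC ler_pdivrMr ?powR_gt0 // mulrC -powRM //.
apply: powR_le => //; first exact: ltW.
rewrite -itgZ; last by apply: continuousM.
apply: itg_le; [exact: cuz| |exact: ltW|].
  by apply: continuousM => //; apply: continuousM.
move=> r /andP[r0 rB]; have rB' : R0 <= r <= B by rewrite !ltW.
have /andP[_ z2] := z1 r rB'.
rewrite mulrA; apply: ler_wpM2r; first by apply: exprn_ge0; apply: ltW; exact: lt_trans r0.
by rewrite mulrC; apply: ler_wpM2r.
Qed.

End Exterior.

(** * Upper bounds on the front *)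

Lemma powR_expr_le (R : realType) (m P : R) (i k : nat) : 0 <= P <= 1 -> 0 < m -> k%:R <= i%:R * m ->
  (0 < i)%N -> (0 < k)%N -> (P ^+ i) `^ m <= P ^+ k.
Proof.
move=> /andP[]; rewrite le_eqVlt => /orP[/eqP <-|P0] P1 m0 h i0 k0.
  by rewrite !expr0n !gtn_eqF // powR0 // gt_eqF.
rewrite -!powR_mulrn ?(ltW P0) // -powRrM; apply: ger_powR => //.
by rewrite P0.
Qed.

Section Upper.
Variables (R : realType) (n : nat).
Implicit Types (r s t a b x y T X B kap H ell eps rho : R).
Variables (u v ff : R -> R -> R) (m : R).
Hypothesis m1 : 1 < m.
Hypothesis cu : cont2 u.
Hypothesis cv : cont2 v.
Hypothesis cff : cont2 ff.
Hypothesis u0 : forall t r, 0 <= u t r.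
Hypothesis vE : forall t r, v t r = u t r `^ m.
Hypothesis star : forall s t r, 0 <= s -> 0 <= t -> 0 < r ->
  der (wint v s t) r (flux n u ff s t r / r ^+ n).

Let m0 : 0 < m. Proof. exact: lt_trans m1. Qed.
Let cc (c : R) : continuous (fun _ : R => c). Proof. exact: continuous_cst. Qed.
Let v0 t r : 0 <= v t r. Proof. by rewrite vE powR_ge0. Qed.

(* Comparison of [wint v T0 t] with [H / tau * (t - T0 + tau)] times a power of the
   positive part of [(rho + ell - x) / ell]. *)
Lemma barrier_support T0 T rho X H ell j : 0 <= T0 -> T0 < T -> 0 < rho -> rho < X ->
  (forall t r, T0 <= t <= T -> X <= r -> u t r = 0) ->
  (forall r, rho <= r -> u T0 r = 0) ->
  (forall t r, T0 <= t <= T -> rho <= r -> ff t r = 0) ->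
  0 < H -> (forall t, T0 <= t <= T -> wint v T0 t rho <= H) ->
  j.+3%:R <= j.+1%:R * m -> 0 < ell ->
  (2 * H * (j.+3%:R * j.+2%:R)) `^ m * (T - T0) <= H * (ell ^+ 2) `^ m ->
  forall r, rho + ell <= r -> u T r = 0.
Proof.
move=> T00 TT rho0 rX hX hT0 hf H0 hH hj ell0 hell r hr.
pose tau : R := T - T0; have tau0 : 0 < tau by rewrite subr_gt0.
pose P x : R := Num.max ((rho + ell - x) / ell) 0.
pose k2 : R := j.+3%:R * j.+2%:R.
(* The height of the barrier at rho rises from H to 2 H over [T0, T]: it stays above [wint] at rho,
   while the slope H / tau pays for the diffusion. *)
pose c t : R := H / tau * (t - T0 + tau).
pose Wb t x : R := c t * P x ^+ j.+3.
pose dW t x : R := - (c t * j.+3%:R / ell) * P x ^+ j.+2.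
pose ddW t x : R := c t * k2 / ell ^+ 2 * P x ^+ j.+1.
have HT0 : 0 < H / tau by rewrite divr_gt0.
have P0 x : 0 <= P x by rewrite le_max lexx orbT.
have lin x : der (fun x => (rho + ell - x) / ell) x (- ell^-1).
  apply: der_eq (derM (derB (der_cst (rho + ell) x) (der_id x)) (der_cst ell^-1 x)) _.
  by rewrite mulr0 addr0 sub0r mulN1r.
have dP i x : der (fun x => P x ^+ i.+2) x (i.+2%:R * P x ^+ i.+1 * - ell^-1).
  exact: (@der_comp _ (fun y => Num.max y 0 ^+ i.+2) _ x _ _ (lin x) (pospow_der _ _)).
have hWb t x : der (Wb t) x (dW t x).
  apply: der_eq (derZ _ (dP _ x)) _; rewrite /dW.
  by move: (P x ^+ _) (ell^-1) (c t) (j.+3%:R) => A B C D; ring.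
have hdW t x : der (dW t) x (ddW t x).
  apply: der_eq (derZ (- (c t * j.+3%:R / ell)) (dP j x)) _; rewrite /ddW /k2 -[_ ^- 2]exprVn.
  by move: (P x ^+ _) (ell^-1) (c t) (j.+3%:R) (j.+2%:R) => A B C D E; ring.
have cle t : T0 <= t <= T -> H <= c t <= 2 * H.
  move=> /andP[t0 tT]; rewrite /c; move: HT0; set q := H / tau => q0.
  have E : H = q * tau by rewrite divfK // gt_eqF.
  apply/andP; split; rewrite E ?[2 * _]mulrCA.
    by apply: ler_wpM2l; [exact: ltW|rewrite lerDr subr_ge0].
  by apply: ler_wpM2l; [exact: ltW|rewrite /tau; lra].
(* For x >= rho the datum at T0 and the reaction vanish, so u = Delta W and W_t = (Delta W)^m. This
   inequality makes [Wb] a supersolution: [hell] fixes the constants, and j+3 <= (j+1) m compares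
   the powers of P <= 1. *)
have barrier t x : T0 <= t <= T -> rho <= x -> ddW t x `^ m <= H / tau * P x ^+ j.+3.
  move=> ht hx; have P1 : P x <= 1.
    by rewrite ge_max ler01 andbT ler_pdivrMr // mul1r; lra.
  have /andP[c1 c2] := cle t ht.
  have k20 : 0 <= k2 by rewrite mulr_ge0.
  have ce0 : 0 <= 2 * H * k2 / ell ^+ 2.
    by apply: divr_ge0; [apply: mulr_ge0 => //; apply: mulr_ge0 => //; exact: ltW|exact: sqr_ge0].
  apply: (@le_trans _ _ ((2 * H * k2 / ell ^+ 2 * P x ^+ j.+1) `^ m)).
    apply: powR_le; first exact: ltW.
      apply: mulr_ge0; last exact: exprn_ge0.
      apply: divr_ge0; last exact: sqr_ge0.
      by apply: mulr_ge0 => //; apply: le_trans c1; exact: ltW.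
    apply: ler_wpM2r; first exact: exprn_ge0.
    by apply: ler_wpM2r; [rewrite invr_ge0 sqr_ge0|apply: ler_wpM2r].
  rewrite powRM //; last exact: exprn_ge0.
  apply: ler_pM; [exact: powR_ge0|exact: powR_ge0| |]; last first.
    by apply: powR_expr_le => //; rewrite P0.
  have k2H : 0 <= 2 * H * k2 by apply: mulr_ge0 => //; apply: mulr_ge0 => //; exact: ltW.
  rewrite powRM ?invr_ge0 ?sqr_ge0 //.
  have -> : (ell ^+ 2)^-1 `^ m = ((ell ^+ 2) `^ m)^-1.
    by rewrite -powR_inv1 ?sqr_ge0 // powRAC powR_inv1 ?powR_ge0.
  by rewrite ler_pdivrMr ?powR_gt0 ?exprn_gt0 // [H / tau * _]mulrAC ler_pdivlMr.
(* The term eps (t - T0) makes the comparison strict at a positive maximum, which must be interior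
   in x because H dominates at rho and u vanishes at X. *)
have key eps : 0 < eps -> forall t x, T0 <= t <= T -> rho <= x <= X ->
    wint v T0 t x - Wb t x - eps * (t - T0) <= 0.
  move=> e0.
  pose Phi (q : R * R) : R := wint v T0 q.1 q.2 - Wb q.1 q.2 - eps * (q.1 - T0).
  have cP : continuous P.
    by apply: continuous_max0 => x; exact: der_continuous (lin x).
  have cPhi : continuous Phi.
    apply: continuousB.
      apply: continuousB.
        have := cont2_swap (itg_param2 (a := T0) (cont2_swap cv)); exact.
      apply: continuousM.
        apply: continuousM; first exact: continuous_cst.
        apply: continuousD; last exact: continuous_cst.
        by apply: continuousB; [exact: continuous_fst|exact: continuous_cst].
      by apply: continuousX; exact: (c2snd cP).
    apply: continuousM; first exact: continuous_cst.
    by apply: continuousB; [exact: continuous_fst|exact: continuous_cst].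
  pose A : set (R * R) := `[T0, T] `*` `[rho, X].
  have inA t x : T0 <= t <= T -> rho <= x <= X -> (t, x) \in A.
    by move=> h1 h2; rewrite inE; split; rewrite /= in_itv.
  have A0 : A !=set0.
    by exists (T0, rho); rewrite -inE; apply: inA; rewrite lexx ltW.
  have cA : compact A by apply: compact_setX; exact: segment_compact.
  have [[t x] tA hmax] := compact_EVT_max A0 cA (continuous_subspaceT cPhi).
  have [] : T0 <= t <= T /\ rho <= x <= X.
    by move: tA; rewrite inE => -[/=]; rewrite !in_itv.
  move=> /andP[t1 t2] /andP[x1 x2].
  have [Ple0|Pgt0] := leP (Phi (t, x)) 0.
    move=> t' x' h1 h2; apply: le_trans Ple0; exact: hmax (t', x') (inA _ _ h1 h2).
  exfalso.
  have ht : T0 <= t <= T by rewrite t1.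
  have /andP[c1 c2] := cle t ht.
  have Wb0 : 0 <= Wb t x.
    by apply: mulr_ge0; [apply: le_trans c1; exact: ltW|exact: exprn_ge0].
  have et : 0 <= eps * (t - T0) by apply: mulr_ge0; [exact: ltW|rewrite subr_ge0].
  have Wpos : 0 < wint v T0 t x by move: Pgt0; rewrite /Phi /=; lra.
  have tl : T0 < t.
    rewrite lt_neqAle t1 andbT; apply/eqP => E.
    by move: Wpos; rewrite -E /wint itg_id ltxx.
  have xl : rho < x.
    rewrite lt_neqAle x1 andbT; apply/eqP => E.
    have := hH t ht; rewrite E; move: Pgt0; rewrite /Phi /= /Wb.
    have -> : P x = 1.
      by rewrite /P -E (_ : (rho + ell - rho) / ell = 1) ?max_l //; field; rewrite gt_eqF.
    by rewrite expr1n mulr1; lra.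
  have xr : x < X.
    rewrite lt_neqAle x2 andbT; apply/eqP => E.
    move: Wpos; rewrite (wint_zero m1 cv vE) ?ltxx //.
    by move=> q /andP[q1 q2]; apply: hX; rewrite ?E // q1 (le_trans q2).
  have x0 : 0 < x by exact: lt_trans xl.
  have d1 : der (fun q => wint v T0 q x - Wb q x - eps * (q - T0)) t
      (v t x - H / tau * P x ^+ j.+3 - eps).
    have e1 : der (fun q => wint v T0 q x) t (v t x) by apply: itg_der; exact: cont2_r.
    have e2 : der (fun q => Wb q x) t (H / tau * P x ^+ j.+3).
      have e3 := derM (derZ (H / tau) (derD (derB (der_id t) (der_cst T0 t)) (der_cst tau t)))
         (der_cst (P x ^+ j.+3) t).
      by apply: der_eq e3 _; rewrite mulr0 !addr0 subr0 mulr1.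
    apply: der_eq (derB (derB e1 e2) (derZ eps (derB (der_id t) (der_cst T0 t)))) _.
    by rewrite subr0 mulr1.
  have D1 := der_left_max tl d1.
  have /D1 {}D1 : forall y, T0 < y < t -> Phi (y, x) <= Phi (t, x).
    move=> y /andP[y1 y2]; apply: hmax; apply: inA; rewrite ?x1 ?(ltW y1) //.
    exact: le_trans (ltW y2) t2.
  have d2 y : rho < y < X -> der (fun q => wint v T0 t q - Wb t q) y
      (flux n u ff T0 t y / y ^+ n - dW t y).
    move=> /andP[y1 y2]; apply: derB => //; apply: star => //; first exact: le_trans t1.
    exact: lt_trans y1.
  have xn0 : x ^+ n != 0 by rewrite expf_neq0 // gt_eqF.
  pose Dx := flux n u ff T0 t x / x ^+ n.
  have d3 : der (fun y => flux n u ff T0 t y / y ^+ n - dW t y) x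
      (u t x - n%:R / x * Dx - ddW t x).
    have eF : der (flux n u ff T0 t) x (exc u ff T0 t x * x ^+ n).
      by apply: itg_der; exact: excX_continuous.
    apply: der_eq (derB (derM eF (@derV _ (fun y => y ^+ n) x _ xn0 (derX n x))) (hdW t x)) _.
    rewrite /exc hT0 ?(ltW xl) // itg_eq0 ?(ltW tl) //; last 2 first.
      exact: cont2_r.
      by move=> q /andP[q1 q2]; apply: hf; rewrite ?(ltW q1) ?(ltW xl) ?(le_trans (ltW q2)).
    rewrite !subr0 /Dx; case: (n) xn0 => [|i] xn0.
      by rewrite expr0 !mul0r oppr0 !mul0r mulr0; field.
    have xi0 : x ^+ i != 0 by rewrite expf_neq0 // gt_eqF.
    by rewrite /= !exprS; field; rewrite xi0 gt_eqF.
  have xin : rho < x < X by rewrite xl.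
  have [|E1 E2] := second_order_max xin d2 d3.
    move=> y /andP[y1 y2].
    have hy : rho <= y <= X by rewrite !ltW.
    by have := hmax (t, y) (inA _ _ ht hy); rewrite /Phi /=; lra.
  (* At the maximum the radial derivative equals that of the decreasing barrier, so the first-order
     part of the radial Laplacian has the favourable sign and u <= ddW remains. *)
  have Dx0 : Dx <= 0.
    have -> : Dx = dW t x by apply/eqP; rewrite -subr_eq0; apply/eqP.
    rewrite /dW mulNr oppr_le0; apply: mulr_ge0; last exact: exprn_ge0.
    apply: divr_ge0; last exact: ltW.
    by apply: mulr_ge0 => //; apply: le_trans c1; exact: ltW.
  have nD : n%:R / x * Dx <= 0.
    by apply: mulr_ge0_le0 => //; apply: divr_ge0 => //; exact: ltW.
  have uW : u t x <= ddW t x by lra.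
  have := powR_le (ltW m0) (u0 t x) uW; rewrite -vE.
  by have := barrier t x ht (ltW xl); lra.
have [Xr|rX'] := leP X r; first by apply: hX => //; rewrite ltW ?lexx.
have rr : rho < r by apply: lt_le_trans hr; rewrite ltrDl.
have TTT : T0 <= T <= T by rewrite lexx ltW.
have W0 : wint v T0 T r <= 0.
  rewrite leNgt; apply/negP => W0.
  have rh : rho <= r <= X by rewrite !ltW.
  have e0 : 0 < wint v T0 T r / (2 * tau) by rewrite divr_gt0 // mulr_gt0.
  have := key _ e0 T r TTT rh; rewrite /Wb (_ : P r = 0); last first.
    by rewrite /P max_r // pmulr_lle0 ?invr_gt0 //; lra.
  rewrite expr0n mulr0 subr0 -/tau.
  have -> : wint v T0 T r / (2 * tau) * tau = wint v T0 T r / 2 by field; rewrite gt_eqF.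
  by lra.
apply/eqP; apply/negPn/negP => ur.
have vr : 0 < v T r by rewrite vE; apply: powR_gt0; rewrite lt_neqAle eq_sym ur u0.
have := @itg_gt0 _ (v ^~ r) T0 T T (cont2_r (r := r) cv) TTT TT (fun q _ => v0 q r) vr.
by rewrite ltNge W0.
Qed.

End Upper.

Section Front.
Variables (R : realType) (n : nat).
Implicit Types (r s t a b x y T X B kap H ell eps rho Mass : R).
Variables (u v ff : R -> R -> R) (m : R).
Hypothesis m1 : 1 < m.
Hypothesis cu : cont2 u.
Hypothesis cv : cont2 v.
Hypothesis cff : cont2 ff.
Hypothesis u0 : forall t r, 0 <= u t r.
Hypothesis vE : forall t r, v t r = u t r `^ m.
Hypothesis star : forall s t r, 0 <= s -> 0 <= t -> 0 < r ->
  der (wint v s t) r (flux n u ff s t r / r ^+ n).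

Let m0 : 0 < m. Proof. exact: lt_trans m1. Qed.
Let cun t : continuous (fun x => u t x * x ^+ n). Proof. exact: slice_continuous. Qed.

(** Mean value theorem on [rho, 2 rho], where W vanishes at the right end: at the intermediate point
    c, W' is minus the mass beyond c divided by c^n, because earlier datum and reaction vanish
    there. *)
Lemma wint_mass T0 t rho X Mass : 0 <= T0 -> T0 <= t -> 0 < rho -> X = 2 * rho ->
  (forall q r, T0 <= q <= t -> X <= r -> u q r = 0) ->
  (forall r, rho <= r -> u T0 r = 0) ->
  (forall q r, T0 <= q <= t -> rho <= r -> ff q r = 0) ->
  itg (fun r => u t r * r ^+ n) 0 X <= Mass ->
  wint v T0 t rho <= Mass * (rho / rho ^+ n).
Proof.
move=> T00 Tt rho0 XE hX hT0 hf hM; have t0 := le_trans T00 Tt.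
have rX : rho < X by rewrite XE; lra.
have X0 : 0 < X by exact: lt_trans rX.
have wX r : X <= r -> wint v T0 t r = 0.
  move=> Xr; apply: (wint_zero m1 cv vE) => // q hq; exact: hX.
have fX : flux n u ff T0 t X = 0 by apply: (flux_zero cu cff star).
have hder x : rho < x < X -> der (wint v T0 t) x (flux n u ff T0 t x / x ^+ n).
  by move=> /andP[rx _]; apply: star => //; exact: lt_trans rx.
have [||c /andP[rc cX] E] := @der_mvt _ (wint v T0 t) (fun x => flux n u ff T0 t x / x ^+ n) rho X rX.
- by move=> x /andP[h1 h2]; apply: hder; rewrite h1.
- by apply: continuous_subspaceT; exact: wint_continuous.
have c0 : 0 < c by exact: lt_trans rc.
have cE : continuous (fun x => exc u ff T0 t x * x ^+ n) by exact: excX_continuous.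
have fc : - flux n u ff T0 t c <= Mass.
  have -> : - flux n u ff T0 t c = itg (fun x => exc u ff T0 t x * x ^+ n) c X.
    have := itg_chasles (fun x => exc u ff T0 t x * x ^+ n) 0 c X; rewrite -/(flux n u ff T0 t c) -/(flux n u ff T0 t X) fX.
    by lra.
  apply: le_trans hM; rewrite (itg_chasles _ 0 c X).
  rewrite -[X in X <= _]add0r; apply: lerD.
    apply: itg_ge0; [exact: cun|exact: ltW|move=> x /andP[x0 _]].
    by apply: mulr_ge0 => //; apply: exprn_ge0; exact: ltW.
  apply: itg_le => //; first exact: ltW.
  move=> x /andP[cx _]; have rx := ltW (lt_trans rc cx).
  rewrite /exc hT0 // itg_eq0 ?subr0 //; first exact: cont2_r.
  by move=> q /andP[q1 q2]; apply: hf => //; rewrite (ltW q1) ltW.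
have Xr : X - rho = rho by rewrite XE; ring.
have -> : wint v T0 t rho = - flux n u ff T0 t c * (rho / c ^+ n).
  by move: E; rewrite wX // Xr sub0r => /eqP; rewrite eqr_oppLR => /eqP ->; ring.
have M0 : 0 <= Mass.
  apply: le_trans hM; apply: itg_ge0; [exact: cun|exact: ltW|move=> x /andP[x0 _]].
  by apply: mulr_ge0 => //; apply: exprn_ge0; exact: ltW.
apply: (@le_trans _ _ (Mass * (rho / c ^+ n))).
  by apply: ler_wpM2r => //; apply: divr_ge0; [exact: ltW|apply: exprn_ge0; exact: ltW].
apply: ler_wpM2l => //; apply: ler_wpM2l; first exact: ltW.
rewrite lef_pV2 ?posrE ?exprn_gt0 //.
by rewrite lerXn2r ?nnegrE // ltW.
Qed.

(** The width [ell] is chosen so that the barrier condition is an equality. If the bound failed, ell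
    < rho would hold, and u(T, .) would vanish at rho + ell, which lies inside the front X = 2
    rho. *)
Lemma front_upper T0 T rho X Mass j : 0 <= T0 -> T0 < T -> 0 < rho -> X = 2 * rho ->
  (forall t r, T0 <= t <= T -> X <= r -> u t r = 0) ->
  (forall r, 0 <= r < X -> 0 < u T r) ->
  (forall r, rho <= r -> u T0 r = 0) ->
  (forall t r, T0 <= t <= T -> rho <= r -> ff t r = 0) ->
  0 < Mass -> (forall t, T0 <= t <= T -> itg (fun r => u t r * r ^+ n) 0 X <= Mass) ->
  j.+3%:R <= j.+1%:R * m ->
  (rho ^+ 2) `^ m <=
    (2 * (j.+3%:R * j.+2%:R)) `^ m * (Mass * (rho / rho ^+ n)) `^ (m - 1) * (T - T0).
Proof.
move=> T00 TT rho0 XE hX hpos hT0 hf M0 hM hj.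
set k2 := j.+3%:R * j.+2%:R; set H := Mass * _; set A := _ * (T - T0).
have k20 : 0 < k2 by rewrite mulr_gt0 ?ltr0n.
have H0 : 0 < H by rewrite mulr_gt0 // divr_gt0 // exprn_gt0.
have A0 : 0 < A.
  by rewrite !mulr_gt0 ?subr_gt0 ?powR_gt0 // mulr_gt0.
have rX : rho < X by rewrite XE; lra.
rewrite leNgt; apply/negP => hA.
pose ell := Num.sqrt (A `^ m^-1).
have Am0 : 0 < A `^ m^-1 by rewrite powR_gt0.
have ell0 : 0 < ell by rewrite sqrtr_gt0.
have ell2 : ell ^+ 2 = A `^ m^-1 by rewrite sqr_sqrtr // ltW.
have ellm : (ell ^+ 2) `^ m = A by rewrite ell2 powRK // ltW.
have ellr : ell < rho.
  have : ell ^+ 2 < rho ^+ 2.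
    rewrite ltNge; apply/negP => h.
    have := powR_le (ltW m0) (sqr_ge0 rho) h; rewrite ellm.
    by rewrite leNgt hA.
  by rewrite ltr_pXn2r ?nnegrE // ltW.
have E : (2 * H * k2) `^ m * (T - T0) <= H * (ell ^+ 2) `^ m.
  rewrite ellm /A (_ : 2 * H * k2 = (2 * k2) * H); last by ring.
  have q0 : 0 <= 2 * k2 by rewrite mulr_ge0 // ltW.
  rewrite powRM ?(ltW H0) // -(@mulr_powRB1 _ H m) ?(ltW H0) //.
  by rewrite le_eqVlt; apply/orP; left; apply/eqP; ring.
have hH t : T0 <= t <= T -> wint v T0 t rho <= H.
  move=> /andP[t1 t2]; apply: (@wint_mass T0 t rho X) => //.
  - by move=> q r /andP[q1 q2]; apply: hX; rewrite q1 (le_trans q2).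
  - by move=> q r /andP[q1 q2]; apply: hf; rewrite q1 (le_trans q2).
  - by apply: hM; rewrite t1.
have := barrier_support m1 cu cv cff u0 vE star T00 TT rho0 rX hX hT0 hf H0 hH hj ell0 E (lexx (rho + ell)).
have rl : 0 <= rho + ell < X by apply/andP; split; [exact/ltW/addr_gt0|rewrite XE; lra].
by have := hpos _ rl => /[swap] ->; rewrite ltxx.
Qed.

End Front.

Section PowerAlgebra.
Variable R : realType.
Implicit Types (x y a b m D : R).

Lemma powR_addp x a b : 0 < x -> x `^ (a + b) = x `^ a * x `^ b.
Proof. by move=> x0; rewrite powRD // (gt_eqF x0) implybT. Qed.

Lemma powR_root_le x y D : 0 < D -> 0 <= x -> 0 <= y -> x <= y `^ D -> x `^ D^-1 <= y.
Proof.
move=> D0 x0 y0 h; rewrite -[X in _ <= X](powRKV D0 y0); apply: powR_le => //.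
by rewrite invr_ge0 ltW.
Qed.

Lemma powR_root_ge x y D : 0 < D -> 0 <= x -> 0 <= y -> y `^ D <= x -> y <= x `^ D^-1.
Proof.
move=> D0 x0 y0 h; rewrite -[X in X <= _](powRKV D0 y0); apply: powR_le => //.
  by rewrite invr_ge0 ltW.
exact: powR_ge0.
Qed.

(** Supplies an integer barrier exponent j + 3 whose second derivative, raised to the power m, is
    dominated by the barrier; this is possible exactly because m > 1. *)
Lemma exists_nat_ratio m : 1 < m -> exists j : nat, j.+3%:R <= j.+1%:R * m.
Proof.
move=> m1; have mm : 0 < m - 1 by rewrite subr_gt0.
pose j := Num.truncn (2 / (m - 1)).
exists j; have h : 2 / (m - 1) < j.+1%:R by exact: truncnS_gt.
move: h; rewrite ltr_pdivrMr // -(addn2 j.+1) natrD; lra.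
Qed.

End PowerAlgebra.

(** * Front bounds when the late reaction stays in a fixed ball *)

Section GroundFront.
Variables (R : realType) (n : nat).
Implicit Types (r s t a x y T X B kap H ell eps rho Mass : R).
Variables (u v ff : R -> R -> R) (m M Cf Fm : R) (b : R -> R).
Hypothesis m1 : 1 < m.
Hypothesis cu : cont2 u.
Hypothesis cv : cont2 v.
Hypothesis cff : cont2 ff.
Hypothesis u0 : forall t r, 0 <= u t r.
Hypothesis uM : forall t r, u t r <= M.
Hypothesis M0 : 0 < M.
Hypothesis vE : forall t r, v t r = u t r `^ m.
Hypothesis star : forall s t r, 0 <= s -> 0 <= t -> 0 < r ->
  der (wint v s t) r (flux n u ff s t r / r ^+ n).
Hypothesis hCf : forall t r, - Cf * u t r <= ff t r.
Hypothesis hFm : forall t r, ff t r <= Fm.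
Hypothesis Fm0 : 0 <= Fm.
Hypothesis hb : forall t r, 0 < t -> 0 <= r -> (0 < u t r) = (r < b t).

Let m0 : 0 < m. Proof. exact: lt_trans m1. Qed.
Let cun t : continuous (fun x => u t x * x ^+ n). Proof. exact: slice_continuous. Qed.

Lemma front_out t T r : 0 < t -> t <= T -> 0 < b T -> b T <= r -> u t r = 0.
Proof.
move=> t0 tT bT br; have T0 := lt_le_trans t0 tT.
have := @retention _ n u v ff m M m1 cu cv cff u0 uM vE star M0 Cf T t r (b T) hCf bT (ltW t0) tT; apply=> //.
move=> x bx; apply/eqP; rewrite eq_le u0 andbT leNgt hb // -?leNgt //.
by apply: le_trans bx; exact: ltW.
Qed.

(** No flux crosses a sphere beyond the support, so mass changes by the accumulated reaction
    alone. *)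
Lemma mass_eq (T1 : R) t X : 0 <= T1 -> T1 <= t -> 0 < X ->
  (forall q r, T1 <= q <= t -> X <= r -> u q r = 0) ->
  itg (fun r => u t r * r ^+ n) 0 X = itg (fun r => (u T1 r + itg (ff ^~ r) T1 t) * r ^+ n) 0 X.
Proof.
move=> T10 T1t X0 hX; have t0 := le_trans T10 T1t.
have fX : flux n u ff T1 t X = 0.
  apply: (flux_zero cu cff star) => // r Xr.
  by apply: (wint_zero m1 cv vE) => // q hq; exact: hX.
have cg : continuous (fun r => (u T1 r + itg (ff ^~ r) T1 t) * r ^+ n).
  apply: continuousM; last exact: cX.
  by apply: continuousD; [exact: cont2_l|exact: (src_continuous cff)].
apply/eqP; rewrite -subr_eq0 -itgB //; apply/eqP; rewrite -[RHS]fX.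
by congr itg; apply/funext => r; rewrite /exc; ring.
Qed.

Lemma mass_linear (T1 : R) t X (R0 : R) : 0 <= T1 -> T1 <= t -> 0 < R0 -> R0 <= X ->
  (forall q r, T1 <= q <= t -> X <= r -> u q r = 0) ->
  (forall r, R0 <= r -> u T1 r = 0) ->
  (forall q r, T1 <= q <= t -> R0 <= r -> ff q r = 0) ->
  itg (fun r => u t r * r ^+ n) 0 X <= (M + Fm * (t - T1)) * R0 ^+ n.+1.
Proof.
move=> T10 T1t R00 RX hX hT hf; have X0 := lt_le_trans R00 RX.
rewrite (mass_eq T10 T1t X0 hX) (itg_chasles _ 0 R0).
have cg : continuous (fun r => (u T1 r + itg (ff ^~ r) T1 t) * r ^+ n).
  apply: continuousM; last exact: cX.
  by apply: continuousD; [exact: cont2_l|exact: (src_continuous cff)].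
rewrite [X in _ + X]itg_eq0 //; last first.
  move=> x /andP[/ltW h _]; rewrite hT // add0r itg_eq0 ?mul0r //; first exact: cont2_r.
  by move=> q /andP[q1 q2]; apply: hf => //; rewrite !ltW.
rewrite addr0; apply: (@le_trans _ _ ((M + Fm * (t - T1)) * itg (fun r => r ^+ n) 0 R0)).
  rewrite -itgZ; last exact: cX.
  apply: itg_le => //; [|exact: ltW|].
    by apply: continuousM; [exact: continuous_cst|exact: cX].
  move=> x /andP[x0 _]; apply: ler_wpM2r; first by apply: exprn_ge0; exact: ltW.
  apply: lerD => //; rewrite -itg_cst; apply: itg_le => //; first exact: cont2_r.
  exact: continuous_cst.
apply: ler_wpM2l; last exact/itgXn/ltW.
by apply: addr_ge0; [exact: ltW|apply: mulr_ge0 => //; rewrite subr_ge0].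
Qed.

Variables (T1 R0 kap : R).
Hypothesis T10 : 0 < T1.
Hypothesis R00 : 0 < R0.
Hypothesis kap0 : 0 < kap.
Hypothesis late_ge0 : forall t r, T1 <= t -> 0 <= r -> 0 <= ff t r.
Hypothesis late_zero : forall t r, T1 <= t -> R0 <= r -> ff t r = 0.
Hypothesis late_kap : forall t, T1 <= t -> kap <= itg (fun r => ff t r * r ^+ n) 0 R0.
Hypothesis grow : forall x, exists T2, forall t, T2 <= t -> x < b t.

Let D : R := n.+1%:R * (m - 1) + 2.
Let D0 : 0 < D. Proof. by rewrite addr_gt0 // mulr_gt0 // subr_gt0. Qed.

Lemma ground_front_lower : exists c T : R, [/\ 0 < c, 0 < T & forall t, T <= t -> c * t `^ (m / D) <= b t].
Proof.
have [T2 hT2] := grow R0.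
pose K : R := (2 `^ m / (m - 1)) `^ m.
have K0 : 0 < K by rewrite powR_gt0 // divr_gt0 ?powR_gt0 // subr_gt0.
pose c1 : R := (2^-1 `^ m * kap `^ (m - 1) * (2 * n.+1%:R / 2 `^ m)) / K.
have c10 : 0 < c1.
  apply: divr_gt0 => //; apply: mulr_gt0; first by apply: mulr_gt0; apply: powR_gt0.
  by apply: divr_gt0; [apply: mulr_gt0; rewrite ?ltr0n|apply: powR_gt0].
exists (c1 `^ D^-1), (Num.max (2 * T1) T2); split; first exact: powR_gt0.
  by rewrite lt_max mulr_gt0.
move=> T; rewrite ge_max => /andP[TT1 TT2].
have RB := hT2 T TT2; set B := b T in RB *.
have B0 : 0 < B by exact: lt_trans RB.
have T0 : 0 < T by apply: lt_le_trans TT1; rewrite mulr_gt0.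
have sT : T1 < T by move: T10 TT1 => ? ?; lra.
have := @growth_constraint _ n u v ff m m1 cu cv cff u0 vE star T1 T B kap (ltW T10) sT B0 kap0.
move=> H; have {H} := H _ _ _.
have h1 t r : T1 <= t <= T -> B <= r -> u t r = 0.
  by move=> /andP[t1 t2]; apply: front_out => //; exact: lt_le_trans t1.
have h2 t r : T1 <= t <= T -> 0 <= r <= B -> 0 <= ff t r.
  by move=> /andP[t1 t2] /andP[r1 r2]; apply: late_ge0.
have h3 t : T1 <= t <= T -> kap <= itg (fun r => ff t r * r ^+ n) 0 B.
  move=> /andP[t1 _]; rewrite (itg_chasles _ 0 R0) -[kap]addr0; apply: lerD; first exact: late_kap.
  apply: itg_ge0; [exact: slice_continuous|exact: ltW|].
  move=> x /andP[Rx _]; have x0 := ltW (lt_trans R00 Rx).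
  by apply: mulr_ge0; [exact: late_ge0|exact: exprn_ge0].
move=> /(_ h1 h2 h3); rewrite -/K.
(* The factor B^2 of the Laplacian and the volume B^(n+1) to the power m - 1 combine to B^D, with N
   = n + 1 in D = N (m - 1) + 2. *)
have -> : 2 * n.+1%:R / B ^+ 2 * ((2 `^ m)^-1 * (B ^+ n.+1) `^ (1 - m)) =
   2 * n.+1%:R / 2 `^ m / B `^ D.
  rewrite /D (powR_addp _ _ B0) powRrM powR_mulrn ?(ltW B0) // powR_mulrn ?(ltW B0) //.
  rewrite -opprB powRN; field.
  by rewrite !gt_eqF ?powR_gt0 ?exprn_gt0.
rewrite mulrA ler_pdivrMr ?powR_gt0 // => h.
have h' : c1 * T `^ m <= B `^ D.
  rewrite /c1 mulrAC ler_pdivrMr // [X in _ <= X]mulrC.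
  apply: le_trans h.
  have : (2^-1 * T) `^ m <= (T - T1) `^ m.
    apply: powR_le; [exact: ltW|apply: mulr_ge0 => //; exact: ltW|lra].
  rewrite powRM // ?(ltW T0) // => h4.
  have q0 : 0 <= kap `^ (m - 1) * (2 * n.+1%:R / 2 `^ m).
    by apply: mulr_ge0; [exact: powR_ge0|apply: divr_ge0; [exact: mulr_ge0|exact: powR_ge0]].
  have := ler_wpM2r q0 h4.
  by rewrite !mulrA; congr (_ <= _); ring.
rewrite powRrM -powRM ?powR_ge0 ?(ltW c10) //.
by apply: powR_root_le => //; [apply: mulr_ge0; [exact: ltW|exact: powR_ge0]|exact: ltW].
Qed.

Lemma ground_front_upper : exists C T : R, [/\ 0 < C, 0 < T & forall t, T <= t -> b t <= C * t `^ (m / D)].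
Proof.
pose R1 := Num.max R0 (b T1).
(* Beyond R1 there is neither mass at time T1 nor reaction afterwards. T is then taken so late that
   half of the front exceeds R1. *)
have R10 : 0 < R1 by rewrite lt_max R00.
have [T2 hT2] := grow (2 * R1).
have [j hj] := exists_nat_ratio m1.
pose k2 : R := (2 * (j.+3%:R * j.+2%:R)) `^ m.
have k20 : 0 < k2 by rewrite powR_gt0 // mulr_gt0 // mulr_gt0.
pose C1 : R := (M + Fm) * R1 ^+ n.+1.
have C10 : 0 < C1 by apply: mulr_gt0; [exact: ltr_wpDr|exact: exprn_gt0].
pose C2 : R := k2 * C1 `^ (m - 1).
have C20 : 0 < C2 by rewrite mulr_gt0 ?powR_gt0.
exists (2 * C2 `^ D^-1), (1 + T1 + `|T2|); split; first by rewrite mulr_gt0 ?powR_gt0.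
  by rewrite ltr_wpDr // ltr_wpDr // ltW.
move=> T hT; have n0 := normr_ge0 T2; have T1p := T10; have T1' : 1 <= T by lra.
have TT1 : T1 < T by lra.
have T0 : 0 < T by lra.
have TT2 : T2 <= T by have := ler_norm T2; lra.
have := hT2 T TT2; set X := b T => RX.
pose rho := X / 2; have XE : X = 2 * rho by rewrite /rho; lra.
have Rrho : R1 < rho by move: RX; rewrite XE; lra.
have rho0 : 0 < rho by exact: lt_trans Rrho.
have X0 : 0 < X by rewrite XE mulr_gt0.
have h1 t r : T1 <= t <= T -> X <= r -> u t r = 0.
  by move=> /andP[t1 t2]; apply: front_out => //; exact: lt_le_trans t1.
have h2 r : 0 <= r < X -> 0 < u T r by move=> /andP[r1 r2]; rewrite hb.
have hR1 r : R1 <= r -> R0 <= r /\ u T1 r = 0.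
  rewrite ge_max => /andP[q1 q2]; split=> //; apply/eqP; rewrite eq_le u0 andbT leNgt hb // -?leNgt //.
  by apply: le_trans q1; exact: ltW.
have h3 r : rho <= r -> u T1 r = 0 by move=> /(le_trans (ltW Rrho)) /hR1[].
have h4 t r : T1 <= t <= T -> rho <= r -> ff t r = 0.
  by move=> /andP[t1 _] /(le_trans (ltW Rrho)) /hR1[? _]; exact: late_zero.
have CT0 : 0 < C1 * T by exact: mulr_gt0.
have h5 t : T1 <= t <= T -> itg (fun r => u t r * r ^+ n) 0 X <= C1 * T.
  move=> /andP[t1 t2]; apply: le_trans (_ : (M + Fm * (t - T1)) * R1 ^+ n.+1 <= _).
    apply: mass_linear => //; [exact: ltW|by rewrite XE; lra| | |].
    - by move=> q r /andP[q1 q2]; apply: h1; rewrite q1 (le_trans q2).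
    - by move=> r /hR1[].
    - by move=> q r /andP[q1 q2] /hR1[? _]; exact: late_zero.
  rewrite /C1 mulrAC; apply: ler_wpM2r; first by apply: exprn_ge0; exact: ltW.
  rewrite mulrDl; apply: lerD; first by rewrite -[X in X <= _]mulr1 ler_wpM2l // ltW.
  by apply: ler_wpM2l => //; lra.
have := @front_upper _ n u v ff m m1 cu cv cff u0 vE star T1 T rho X (C1 * T) j (ltW T10) TT1 rho0 XE
  h1 h2 h3 h4 CT0 h5 hj.
rewrite -/k2 => H.
have H' : rho `^ D <= C2 * T `^ m.
  (* The factor rho^(1-n) is the decay rho^(2-N) of W; since 2 m = D + (1 - n)(m - 1), it cancels
     and leaves rho^D. *)
  have E1 : (rho ^+ 2) `^ m = rho `^ D * (rho / rho ^+ n) `^ (m - 1).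
    have -> : rho / rho ^+ n = rho `^ (1 - n%:R).
      by rewrite (powR_addp _ _ rho0) powRr1 ?(ltW rho0) // powRN powR_mulrn // ltW.
    rewrite -powR_mulrn ?(ltW rho0) // -!powRrM -powR_addp //; congr (_ `^ _).
    by rewrite /D -natr1; ring.
  have q0 : 0 < (rho / rho ^+ n) `^ (m - 1) by rewrite powR_gt0 // divr_gt0 // exprn_gt0.
  rewrite -(ler_pM2r q0) -E1; apply: (le_trans H).
  have q1 : 0 <= rho / rho ^+ n by apply: divr_ge0; [exact: ltW|apply: exprn_ge0; exact: ltW].
  rewrite (powRM (m - 1) (ltW CT0) q1) (powRM (m - 1) (ltW C10) (ltW T0)).
  rewrite -(@mulr_powRB1 _ T m) ?(ltW T0) // /C2.
  rewrite (_ : k2 * (_ * _ * _) * (T - T1) = (k2 * C1 `^ (m - 1) * T `^ (m - 1) *  (rho / rho ^+ n) `^ (m - 1)) * (T - T1)); last by ring.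
  rewrite (_ : _ * (T * _) * _ = (k2 * C1 `^ (m - 1) * T `^ (m - 1) *  (rho / rho ^+ n) `^ (m - 1)) * T); last by ring.
  apply: ler_wpM2l; last by lra.
  by do !apply: mulr_ge0; rewrite ?powR_ge0 ?(ltW k20).
have := powR_root_ge D0 _ (ltW rho0) H'; rewrite XE powRM ?(ltW C20) ?powR_ge0 // -powRrM.
by move=> H2; rewrite -mulrA; apply: ler_wpM2l => //; apply: H2; apply: mulr_ge0; [exact: ltW|exact: powR_ge0].
Qed.

End GroundFront.

(** * Reflection through a lattice scheme *)

Section Energy.
Variables (R : realFieldType) (V : finType) (s1 p1 s2 p2 : V -> V).
Hypotheses (s1K : cancel s1 p1) (s2K : cancel s2 p2).
Implicit Types (w z : V -> R).

Definition lap w x : R :=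
  w (s1 x) + w (p1 x) + w (s2 x) + w (p2 x) - 4 * w x.

Definition dirichlet w z : R :=
  \sum_x ((w (s1 x) - w x) * (z (s1 x) - z x) + (w (s2 x) - w x) * (z (s2 x) - z x)).

Lemma sum_shift (g : V -> R) (s p : V -> V) : cancel s p -> \sum_x g (s x) = \sum_x g x.
Proof. by move=> sK; rewrite [RHS](reindex_inj (can_inj sK)). Qed.

Lemma lap_parts w z : \sum_x lap w x * z x = - dirichlet w z.
Proof.
have h (s p : V -> V) : cancel s p -> \sum_x (w (s x) + w (p x) - 2 * w x) * z x =
    - \sum_x (w (s x) - w x) * (z (s x) - z x).
  move=> sK; have e : \sum_x (w x - w (p x)) * z x = \sum_x (w (s x) - w x) * z (s x).
    by rewrite -(sum_shift _ sK); apply: eq_bigr => x _; rewrite sK.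
  rewrite -sumrN; apply/eqP; rewrite -subr_eq0 -sumrB.
  have -> : \sum_x ((w (s x) + w (p x) - 2 * w x) * z x - - ((w (s x) - w x) * (z (s x) - z x))) =
     \sum_x (- ((w x - w (p x)) * z x) + (w (s x) - w x) * z (s x)).
    by apply: eq_bigr => x _; ring.
  by rewrite big_split /= sumrN e addNr.
rewrite /dirichlet big_split opprD -(h _ _ s1K) -(h _ _ s2K) -big_split /=.
by apply: eq_bigr => x _; rewrite /lap; ring.
Qed.

Lemma dirichletD w z : dirichlet (fun x => w x + z x) (fun x => w x + z x) =
  dirichlet w w + 2 * dirichlet w z + dirichlet z z.
Proof. by rewrite /dirichlet mulr_sumr -!big_split; apply: eq_bigr => x _ /=; ring. Qed.

Lemma dirichlet_ge0 w : 0 <= dirichlet w w.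
Proof. by apply: sumr_ge0 => x _; rewrite -!expr2 addr_ge0 ?sqr_ge0. Qed.

Lemma dirichlet_le w : dirichlet w w <= 8 * \sum_x w x ^+ 2.
Proof.
have h (s p : V -> V) : cancel s p -> \sum_x (w (s x) - w x) * (w (s x) - w x) <= 4 * \sum_x w x ^+ 2.
  move=> sK; have -> : 4 * \sum_x w x ^+ 2 = \sum_x (2 * w (s x) ^+ 2 + 2 * w x ^+ 2).
    by rewrite big_split /= (sum_shift (fun x => 2 * w x ^+ 2) sK) -mulr_sumr; ring.
  apply: ler_sum => x _; rewrite -subr_ge0.
  have -> : 2 * w (s x) ^+ 2 + 2 * w x ^+ 2 - (w (s x) - w x) * (w (s x) - w x) =
    (w (s x) + w x) ^+ 2 by ring.
  exact: sqr_ge0.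
rewrite /dirichlet big_split /=; have := h _ _ s1K; have := h _ _ s2K; lra.
Qed.

Variables (e z df G : nat -> V -> R) (c h P Cf g T : R) (K : nat).
Hypotheses (h0 : 0 < h) (c0 : 0 <= c) (P0 : 0 < P) (Cf0 : 0 <= Cf).
Hypothesis cfl : 16 * P * c * h <= 1.
Hypothesis ez0 : forall k x, 0 <= e k x * z k x.
Hypothesis zP : forall k x, z k x ^+ 2 <= P * (e k x * z k x).
Hypothesis dfC : forall k x, df k x ^+ 2 <= Cf * (e k x * z k x).
Hypothesis Gg : forall k x, (k < K)%N -> `|G k x| <= g.
Hypothesis KT : K%:R * h <= T.
Let w k x : R := \sum_(l < k) h * z l x.
Let F k x : R := \sum_(l < k) h * df l x.
Hypothesis eq_e : forall k x, (k < K)%N -> e k x = c * lap (w k) x + F k x + G k x.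
Let S k : R := \sum_x e k x * z k x.
Let E k : R := \sum_(l < k) h * S l.
Let B : R := 4 * P * T * Cf * h.
Let A : R := 4 * P * T * (g ^+ 2 * #|V|%:R).

Let S0 k : 0 <= S k. Proof. exact: sumr_ge0. Qed.
Let E0 k : 0 <= E k. Proof. by apply: sumr_ge0 => l _; apply: mulr_ge0 => //; exact: ltW. Qed.
Let T0 : 0 <= T. Proof. by apply: le_trans KT; apply: mulr_ge0 => //; exact: ltW. Qed.

Let F_le k : (k <= K)%N -> \sum_x F k x ^+ 2 <= T * Cf * E k.
Proof.
move=> kK.
have cs j (q : nat -> R) : (\sum_(l < j) q l) ^+ 2 <= j%:R * \sum_(l < j) q l ^+ 2.
  elim: j => [|j IH]; first by rewrite !big_ord0 mulr0 expr0n.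
  rewrite !big_ord_recr /=; set a := \sum_(i < j) q i in IH *; set s := \sum_(i < j) _ in IH *.
  have [j0|j0] := posnP j.
    by subst j; rewrite /a /s !big_ord0 !add0r mul1r.
  have jp : 0 < j%:R :> R by rewrite ltr0n.
  rewrite -subr_ge0; have : 0 <= (a - j%:R * q j) ^+ 2 / j%:R.
    by apply: divr_ge0; [exact: sqr_ge0|exact: ltW].
  have -> : (a - j%:R * q j) ^+ 2 / j%:R = a ^+ 2 / j%:R - 2 * a * q j + j%:R * q j ^+ 2.
    by field; rewrite gt_eqF.
  have : a ^+ 2 / j%:R <= s by rewrite ler_pdivrMr // mulrC.
  by rewrite -natr1 mulrDl !mul1r !mulrDr; lra.
apply: (@le_trans _ _ (\sum_x k%:R * \sum_(l < k) (h * df l x) ^+ 2)).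
  by apply: ler_sum => x _; exact: (cs k (fun l => h * df l x)).
rewrite -mulr_sumr exchange_big /=.
apply: (@le_trans _ _ (k%:R * \sum_(l < k) h ^+ 2 * Cf * S l)).
  apply: ler_wpM2l => //; apply: ler_sum => l _; rewrite /S mulr_sumr; apply: ler_sum => x _.
  by rewrite exprMn -mulrA; apply: ler_wpM2l; rewrite ?sqr_ge0.
have -> : k%:R * \sum_(l < k) h ^+ 2 * Cf * S l = k%:R * h * (Cf * E k).
  rewrite /E -!mulrA; congr (_ * _); rewrite !mulr_sumr; apply: eq_bigr => l _; ring.
rewrite -[X in _ <= X]mulrA; apply: ler_wpM2r; first exact: mulr_ge0.
apply: le_trans KT; apply: ler_wpM2r; [exact: ltW|by rewrite ler_nat].
Qed.

(** The increment of [w] is h z, so testing the Laplacian telescopes the Dirichlet form up to the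
    quadratic term in h z. That term takes 1/4 of h S by [cfl]; Young's inequality for F and for G
    takes another 1/4 each, whence 3/4. *)
Let step k : (k < K)%N -> h * S k <= 2^-1 * c * (dirichlet (w k) (w k) - dirichlet (w k.+1) (w k.+1)) +
  3 / 4 * (h * S k) + h * P * (T * Cf * E k + g ^+ 2 * #|V|%:R).
Proof.
move=> kK.
have wS : w k.+1 = (fun x => w k x + h * z k x).
  by apply/funext => x; rewrite /w big_ord_recr.
have lapE : c * (\sum_x lap (w k) x * (h * z k x)) =
   2^-1 * c * (dirichlet (w k) (w k) - dirichlet (w k.+1) (w k.+1)) +
   2^-1 * c * dirichlet (fun x => h * z k x) (fun x => h * z k x).
  by rewrite wS dirichletD lap_parts; field.
have zz : \sum_x z k x ^+ 2 <= P * S k by rewrite /S mulr_sumr; apply: ler_sum.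
have dz : 2^-1 * c * dirichlet (fun x => h * z k x) (fun x => h * z k x) <= 4^-1 * (h * S k).
  apply: (@le_trans _ _ (2^-1 * c * (8 * (h ^+ 2 * (P * S k))))).
    apply: ler_wpM2l; first by rewrite mulr_ge0 // invr_ge0.
    apply: le_trans (dirichlet_le _) _; apply: ler_wpM2l => //.
    have -> : \sum_x (h * z k x) ^+ 2 = h ^+ 2 * \sum_x z k x ^+ 2.
      by rewrite mulr_sumr; apply: eq_bigr => x _; rewrite exprMn.
    by apply: ler_wpM2l => //; exact: sqr_ge0.
  have -> : 2^-1 * c * (8 * (h ^+ 2 * (P * S k))) = 4^-1 * (h * S k) * (16 * P * c * h) by field.
  by rewrite -[X in _ <= X]mulr1; apply: ler_wpM2l => //; rewrite !mulr_ge0 ?invr_ge0 // ltW.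
have young (q : V -> R) : \sum_x q x * z k x <= P * \sum_x q x ^+ 2 + 4^-1 * S k.
  rewrite /S !mulr_sumr -big_split; apply: ler_sum => x _ /=.
  have h1 : 0 <= P * (q x - (2 * P)^-1 * z k x) ^+ 2 by apply: mulr_ge0; [exact: ltW|exact: sqr_ge0].
  have h2 : P * (q x - (2 * P)^-1 * z k x) ^+ 2 = P * q x ^+ 2 - q x * z k x + 4^-1 * P^-1 * z k x ^+ 2.
    by field; rewrite gt_eqF.
  have h3 : 4^-1 * P^-1 * z k x ^+ 2 <= 4^-1 * (e k x * z k x).
    rewrite -mulrA; apply: ler_wpM2l; first by rewrite invr_ge0.
    by rewrite mulrC ler_pdivrMr // mulrC.
  rewrite h2 in h1; lra.
have gV : \sum_x G k x ^+ 2 <= g ^+ 2 * #|V|%:R.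
  have -> : g ^+ 2 * #|V|%:R = \sum_(x : V) g ^+ 2 by rewrite sumr_const -[RHS]mulr_natr; congr (_ * _%:R); exact: eq_card.
  apply: ler_sum => x _; rewrite -[G k x ^+ 2]real_normK ?num_real //.
  have := Gg x kK => gx; rewrite lerXn2r ?nnegrE //; apply: le_trans gx; exact: normr_ge0.
have SE : h * S k = c * (\sum_x lap (w k) x * (h * z k x)) +
    h * (\sum_x F k x * z k x) + h * (\sum_x G k x * z k x).
  rewrite /S !mulr_sumr -!big_split; apply: eq_bigr => x _ /=; rewrite eq_e //; ring.
have y1 := ler_wpM2l (ltW h0) (young (F k)).
have y2 := ler_wpM2l (ltW h0) (young (G k)).
have f1 : h * P * \sum_x F k x ^+ 2 <= h * P * (T * Cf * E k).
  by apply: ler_wpM2l; [apply: mulr_ge0; exact: ltW|apply: F_le; exact: ltnW].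
have f2 : h * P * \sum_x G k x ^+ 2 <= h * P * (g ^+ 2 * #|V|%:R).
  by apply: ler_wpM2l => //; apply: mulr_ge0; exact: ltW.
move: SE; rewrite lapE; move: y1 y2 f1 f2; rewrite !mulrDr !mulrA; lra.
Qed.

Let sum_step k : (k <= K)%N -> E k <= 3 / 4 * E k +
   \sum_(l < k) h * P * (T * Cf * E l + g ^+ 2 * #|V|%:R) - 2^-1 * c * dirichlet (w k) (w k).
Proof.
elim: k => [|k IH] kK.
  have -> : dirichlet (w 0) (w 0) = 0.
    rewrite /dirichlet big1 // => x _; rewrite /w !big_ord0; ring.
  by rewrite /E !big_ord0 !mulr0 addr0 subr0.
have := IH (ltnW kK); have := step kK.
rewrite /E !big_ord_recr /= -/(E k); move: (dirichlet (w k) _) (dirichlet (w k.+1) _) => D1 D2.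
by rewrite !mulrDr !mulrA; lra.
Qed.

(* Oleinik's uniqueness argument: test the time-summed equation for [e] against [z]. *)
Lemma discrete_energy : E K <= A * (1 + B) ^+ K.
Proof.
have B0 : 0 <= B by rewrite /B !mulr_ge0 // ltW.
have gV0 : 0 <= g ^+ 2 * #|V|%:R :> R by apply: mulr_ge0 => //; exact: sqr_ge0.
have P4 : 0 <= 4 * P by apply: mulr_ge0 => //; exact: ltW.
have A0 : 0 <= A by rewrite /A; apply: mulr_ge0 => //; exact: mulr_ge0.
(* Absorbing 3/4 of E into the left side produces the factor 4 in A and B; what remains is a
   discrete Gronwall inequality. *)
have main k : (k <= K)%N -> E k <= A + B * \sum_(l < k) E l.
  move=> kK; have := sum_step kK.
  have := mulr_ge0 c0 (dirichlet_ge0 (w k)).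
  have -> : \sum_(l < k) h * P * (T * Cf * E l + g ^+ 2 * #|V|%:R) =
     4^-1 * (B * \sum_(l < k) E l) + k%:R * h * (P * (g ^+ 2 * #|V|%:R)).
    rewrite (_ : k%:R * h * _ = \sum_(l < k) h * P * (g ^+ 2 * #|V|%:R)); last first.
      by rewrite sumr_const card_ord -mulr_natl; ring.
    by rewrite !mulr_sumr -big_split; apply: eq_bigr => l _ /=; rewrite /B; field.
  have : k%:R * h * (P * (g ^+ 2 * #|V|%:R)) <= T * (P * (g ^+ 2 * #|V|%:R)).
    apply: ler_wpM2r; first by apply: mulr_ge0 => //; exact: ltW.
    by apply: le_trans KT; apply: ler_wpM2r; [exact: ltW|rewrite ler_nat].
  rewrite /A; lra.
suff H : forall k, (k <= K)%N -> E k <= A * (1 + B) ^+ k by exact: H.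
have geo k : A + B * \sum_(l < k) A * (1 + B) ^+ l = A * (1 + B) ^+ k.
  elim: k => [|k IH]; first by rewrite big_ord0 mulr0 addr0 expr0 mulr1.
  by rewrite big_ord_recr /= mulrDr addrA IH exprS; ring.
move=> k; elim/ltn_ind: k => k IH kK; apply: le_trans (main k kK) _; rewrite -geo lerD2l.
apply: ler_wpM2l => //; apply: ler_sum => l _; apply: IH => //.
by apply: leq_trans kK; exact: ltnW.
Qed.

End Energy.

(** * A monotone explicit scheme *)

Section Scheme.
Variables (R : realFieldType) (V : finType) (s1 p1 s2 p2 : V -> V).
Variables (phi f : R -> R) (h c P L C : R).
Hypotheses (h0 : 0 <= h) (c0 : 0 <= c) (C0 : 0 <= C).
Hypothesis phi0 : phi 0 = 0.
Hypothesis phi_le : forall a b : R, 0 <= a -> a <= b -> b <= C -> phi a <= phi b.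
Hypothesis phi_lip : forall a b : R, 0 <= a -> a <= b -> b <= C -> phi b - phi a <= P * (b - a).
Hypothesis f_lip : forall a b : R, 0 <= a -> a <= b -> b <= C -> f a - f b <= L * (b - a).
Hypotheses (f0 : f 0 = 0) (fC : f C <= 0).
Hypothesis cfl : h * (4 * c * P + L) <= 1.

Definition scheme_step (U : V -> R) x : R :=
  U x + h * c * lap s1 p1 s2 p2 (fun y => phi (U y)) x + h * f (U x).

Fixpoint scheme (U0 : V -> R) (k : nat) : V -> R :=
  if k is j.+1 then scheme_step (scheme U0 j) else U0.

Lemma scheme_sum U0 k x : scheme U0 k x = U0 x +
  c * lap s1 p1 s2 p2 (fun y => \sum_(l < k) h * phi (scheme U0 l y)) x +
  \sum_(l < k) h * f (scheme U0 l x).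
Proof.
elim: k => [|k IH]; first by rewrite /lap /= !big_ord0; ring.
by rewrite /= /scheme_step {1}IH /lap !big_ord_recr /=; ring.
Qed.

(** The updated value is nondecreasing in each of the five values involved. For the neighbours this
    is monotonicity of phi; for the central value the condition [cfl] lets the identity dominate the
    loss from diffusion and reaction. *)
Let ptw (a a' n1 n1' n2 n2' n3 n3' n4 n4' : R) :
  0 <= a -> a <= a' -> a' <= C -> 0 <= n1 -> n1 <= n1' -> n1' <= C ->
  0 <= n2 -> n2 <= n2' -> n2' <= C -> 0 <= n3 -> n3 <= n3' -> n3' <= C ->
  0 <= n4 -> n4 <= n4' -> n4' <= C ->
  a + h * c * (phi n1 + phi n2 + phi n3 + phi n4 - 4 * phi a) + h * f a <=
  a' + h * c * (phi n1' + phi n2' + phi n3' + phi n4' - 4 * phi a') + h * f a'.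
Proof.
move=> a0 aa aC *; have hc0 : 0 <= h * c by apply: mulr_ge0.
have e1 : h * c * (phi n1 + phi n2 + phi n3 + phi n4) <= h * c * (phi n1' + phi n2' + phi n3' + phi n4').
  by apply: ler_wpM2l => //; rewrite !lerD // phi_le.
have e2 := ler_wpM2l hc0 (phi_lip a0 aa aC).
have e3 := ler_wpM2l h0 (f_lip a0 aa aC).
have d0 : 0 <= a' - a by rewrite subr_ge0.
have e4 := ler_wpM2r d0 cfl.
have e5 : h * (4 * c * P + L) * (a' - a) = 4 * (h * c * (P * (a' - a))) + h * (L * (a' - a)) by ring.
rewrite e5 mul1r in e4; move: e1 e2 e3 e4; rewrite !(mulrBr, mulrDr) !mulrA.
by lra.
Qed.

Lemma scheme_range (U0 : V -> R) : (forall x, 0 <= U0 x <= C) -> forall k x, 0 <= scheme U0 k x <= C.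
Proof.
move=> hU; elim=> [|k IH] x //=; rewrite /scheme_step /lap; move: (IH).
have lo y : 0 <= scheme U0 k y by case/andP: (IH y).
have hi y : scheme U0 k y <= C by case/andP: (IH y).
move=> _; apply/andP; split.
  have := @ptw 0 (scheme U0 k x) 0 (scheme U0 k (s1 x)) 0 (scheme U0 k (p1 x))
    0 (scheme U0 k (s2 x)) 0 (scheme U0 k (p2 x)).
  have E0 : 0 + h * c * (phi 0 + phi 0 + phi 0 + phi 0 - 4 * phi 0) + h * f 0 = 0.
    by rewrite phi0 f0; ring.
  by rewrite E0 => H; apply: H.
have := @ptw (scheme U0 k x) C (scheme U0 k (s1 x)) C (scheme U0 k (p1 x)) C
    (scheme U0 k (s2 x)) C (scheme U0 k (p2 x)) C.
move=> H; apply: le_trans (H _ _ _ _ _ _ _ _ _ _ _ _ _ _ _) _ => //.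
have := mulr_ge0_le0 h0 fC; lra.
Qed.

Variables (mu : V -> V) (Q : pred V).
Hypothesis mu_s1 : forall x, mu (s1 x) = p1 (mu x).
Hypothesis mu_p1 : forall x, mu (p1 x) = s1 (mu x).
Hypothesis mu_s2 : forall x, mu (s2 x) = s2 (mu x).
Hypothesis mu_p2 : forall x, mu (p2 x) = p2 (mu x).
Hypothesis Q1 : forall x, Q x -> mu x = x \/ Q (s1 x) /\ Q (p1 x).
Hypothesis Q2 : forall x, Q x -> Q (s2 x) /\ Q (p2 x).

(** A node and its mirror image have stencils that correspond under [mu], so monotonicity of the
    update propagates the order. A node of Q is either its own image or has its four neighbours in
    Q. *)
Lemma scheme_mirror (U0 : V -> R) : (forall x, 0 <= U0 x <= C) ->
  (forall x, Q x -> U0 x <= U0 (mu x)) ->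
  forall k x, Q x -> scheme U0 k x <= scheme U0 k (mu x).
Proof.
move=> hU hm; elim=> [|k IH] x Qx /=; first exact: hm.
have [->//|[q1 q2]] := Q1 Qx; have [q3 q4] := Q2 Qx.
have R0 := scheme_range hU k.
have lo y : 0 <= scheme U0 k y by case/andP: (R0 y).
have hi y : scheme U0 k y <= C by case/andP: (R0 y).
rewrite /scheme_step /lap.
rewrite [phi (scheme U0 k (s1 (mu x))) + phi (scheme U0 k (p1 (mu x)))]addrC.
by apply: ptw => //; rewrite -?mu_s1 -?mu_p1 -?mu_s2 -?mu_p2; exact: IH.
Qed.

End Scheme.

Lemma compact_shift (R : realType) (Q : topologicalType) (K : set Q) (h : R -> Q -> R) (e : R) :
  compact K -> continuous (fun z : R * Q => h z.1 z.2) -> (forall q, K q -> h 0 q = 0) -> 0 < e ->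
  exists2 d : R, 0 < d & forall s q, `|s| < d -> K q -> `|h s q| < e.
Proof.
move=> /compact_near_coveringP cK ch h0 e0.
have H : \forall s \near (0 : R), K `<=` (fun q => `|h s q| < e).
  apply: (cK R (nbhs (0 : R)) (fun s q => `|h s q| < e)) => q Kq.
  have /cvgrPdist_lt /(_ _ e0) [[A B] /= [hA hB] hAB] := ch (0, q).
  exists (B, A) => //= -[q' s] /= [Bq As].
  by have /= := hAB (s, q') (conj As Bq); rewrite (h0 q Kq) sub0r normrN.
have /nbhsP_lt [d d0 hd] := H.
by exists d => // s q sd Kq; apply: (hd s) => //; rewrite subr0.
Qed.

Lemma second_difference (R : realType) (g g1 g2 : R -> R) (x e : R) : 0 < e ->
  (forall y, der g y (g1 y)) -> (forall y, der g1 y (g2 y)) ->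
  exists2 q : R, -1 <= q <= 1 & g (x + e) + g (x - e) - 2 * g x = e ^+ 2 * g2 (x + q * e).
Proof.
move=> e0 h1 h2.
have sh (f f' : R -> R) (s y : R) : (forall y, der f y (f' y)) -> der (fun y => f (y + s)) y (f' (y + s)).
  move=> hf; apply: der_eq (@der_comp _ f (fun y => y + s) y _ _ (derD (der_id y) (der_cst s y)) (hf _)) _.
  by rewrite addr0 mulr1.
have cc (f f' : R -> R) (A : set R) : (forall y, der f y (f' y)) -> {within A, continuous f}.
  by move=> hf; apply: continuous_subspaceT => y; exact: der_continuous (hf y).
pose p (s : R) := g (s + e) - g s.
have hp y : der p y (g1 (y + e) - g1 y) by apply: derB => //; exact: sh.
have xe : x - e < x by rewrite ltrBlDr ltrDl.
have [c /andP[c1 c2] E1] := der_mvt xe (fun y _ => hp y) (cc _ _ _ hp).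
have ce : c < c + e by rewrite ltrDl.
have [q /andP[q1 q2] E2] := der_mvt ce (fun y _ => h2 y) (cc _ _ _ h2).
exists ((q - x) / e).
  by rewrite ler_pdivlMr // ler_pdivrMr //; apply/andP; split; lra.
rewrite divfK ?gt_eqF // (_ : x + (q - x) = q); last by ring.
move: E1; rewrite /p subrK E2 => E1.
have -> : g (x + e) + g (x - e) - 2 * g x = g (x + e) - g x - (g x - g (x - e)) by ring.
by rewrite E1; ring.
Qed.

(** * Consistency of the five-point Laplacian up to the origin *)

Section Consistency.
Variable R : realType.
Implicit Types (t r x y e A T : R).
Variables (W E : R -> R -> R).
Hypothesis cW : forall t, continuous (W t).
Hypothesis cE : cont2 E.
Hypothesis hW : forall t r, 0 <= t -> 0 < r -> der (W t) r (itg (fun x => E t x * x) 0 r / r).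

Definition rho x y : R := Num.sqrt (x ^+ 2 + y ^+ 2).
(** This is W'(r) / r written without division, hence continuous up to r = 0. *)
Definition mean t r : R := itg (fun s => E t (r * s) * s) 0 1.
(** The second x-derivative of W(t, rho x y). At the origin the quotient takes the default value 0,
    which is harmless because E - 2 mean vanishes there. *)
Definition hess t x y : R :=
  mean t (rho x y) + x ^+ 2 / rho x y ^+ 2 * (E t (rho x y) - 2 * mean t (rho x y)).

Lemma rhoC x y : rho x y = rho y x.
Proof. by rewrite /rho addrC. Qed.

Lemma rho2 x y : rho x y ^+ 2 = x ^+ 2 + y ^+ 2.
Proof. by rewrite sqr_sqrtr // addr_ge0 ?sqr_ge0. Qed.

Lemma rho_ge0 x y : 0 <= rho x y.
Proof. exact: sqrtr_ge0. Qed.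

Lemma mean_cont2 : cont2 mean.
Proof.
rewrite /cont2 /mean; apply: (@itg_param _ _ (fun (z : R * R) s => E z.1 (z.2 * s) * s)).
have cs : continuous (fun z : (R * R) * R => z.2) by exact: continuous_snd.
have c1 : continuous (fun z : (R * R) * R => z.1.1).
  by apply: (continuous_after (@continuous_fst _ _)); exact: continuous_fst.
have c2 : continuous (fun z : (R * R) * R => z.1.2).
  by apply: (continuous_after (@continuous_fst _ _)); exact: continuous_snd.
apply: continuousM => //; apply: (cont2_comp cE) => //.
exact: continuousM.
Qed.

Lemma mean_flux t r : 0 < r -> itg (fun x => E t x * x) 0 r = r ^+ 2 * mean t r.
Proof.
move=> r0; rewrite /mean.
have c1 : continuous (fun s => E t (r * s) * s).
  apply: continuousM; last exact: continuous_id.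
  have cr : continuous (fun s : R => r * s).
    by apply: continuousM; [exact: continuous_cst|exact: continuous_id].
  by apply: (continuous_after cr); exact: cont2_l.
have := @itg_scale _ r (fun s => E t (r * s) * s) 0 1; rewrite gt_eqF // => /(_ isT c1).
rewrite mulr0 mulr1 expr2 -mulrA => <-.
rewrite -itgZ.
  by congr itg; apply/funext => x; rewrite [RHS]mulrCA !(mulrC r) !divfK ?gt_eqF.
have cr : continuous (fun s : R => s / r).
  by apply: continuousM; [exact: continuous_id|exact: continuous_cst].
exact: (continuous_after cr c1).
Qed.

Lemma mean0 t : 2 * mean t 0 = E t 0.
Proof.
rewrite /mean; have -> : (fun s : R => E t (0 * s) * s) = (fun s => E t 0 * s).
  by apply/funext => s; rewrite mul0r.
rewrite itgZ; last exact: continuous_id.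
have -> : itg (fun s : R => s) 0 1 = 2^-1.
  rewrite (@itg_ftcT _ (fun s : R => 2^-1 * s ^+ 2)).
  - by rewrite expr1n expr0n mulr1 mulr0 subr0.
  - exact: continuous_id.
  - by move=> x; apply: der_eq (derZ _ (derX 2 x)) _; rewrite expr1 mulKf.
by rewrite mulrCA divff ?mulr1 // pnatr_eq0.
Qed.

Lemma mean_der t r : 0 < r -> der (mean t) r ((E t r - 2 * mean t r) / r).
Proof.
move=> r0; have rr : 0 < r < r + 1 by rewrite r0 ltrDl ltr01.
apply: (@der_near _ (fun r => itg (fun x => E t x * x) 0 r * (r ^+ 2)^-1)).
  apply: filterS (near_itv_oo rr) => s /andP[s0 _].
  by rewrite mean_flux // mulrC mulKf // expf_neq0 // gt_eqF.
have cEx : continuous (fun x => E t x * x).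
  by apply: continuousM; [exact: cont2_l|exact: continuous_id].
have r20 : r ^+ 2 != 0 by rewrite expf_neq0 // gt_eqF.
apply: der_eq (derM (itg_der 0 r cEx) (@derV _ (fun r => r ^+ 2) r _ r20 (derX 2 r))) _.
by rewrite mean_flux //= expr1; field; rewrite gt_eqF.
Qed.

(** As a function of p = r^2, W has the continuous derivative [mean] / 2 up to p = 0. Composing with
    the polynomial x^2 + y^2 then avoids the singularity of the radius at the origin. *)
Lemma radial_primitive t r : 0 <= t -> 0 <= r ->
  W t r = W t 0 + itg (fun p => 2^-1 * mean t (Num.sqrt p)) 0 (r ^+ 2).
Proof.
move=> t0 r0.
have cm : continuous (fun p => 2^-1 * mean t (Num.sqrt p)).
  apply: continuousM; first exact: continuous_cst.
  by apply: (continuous_after (@sqrt_continuous R)); exact: (cont2_l (p := t) mean_cont2).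
have hI p : der (itg (fun p => 2^-1 * mean t (Num.sqrt p)) 0) p (2^-1 * mean t (Num.sqrt p)).
  exact: itg_der.
have hIc s : der (fun s => itg (fun p => 2^-1 * mean t (Num.sqrt p)) 0 (s ^+ 2)) s
    (2^-1 * mean t (Num.sqrt (s ^+ 2)) * (2%:R * s ^+ 1)).
  exact: (@der_comp _ (itg (fun p => 2^-1 * mean t (Num.sqrt p)) 0) (fun s => s ^+ 2) s _ _ (derX 2 s) (hI _)).
pose F s := W t s - itg (fun p => 2^-1 * mean t (Num.sqrt p)) 0 (s ^+ 2).
have : F r = F 0.
  apply: der_const => //.
    move=> s /andP[s0 sr]; apply: der_eq (derB (hW t0 s0) (hIc s)) _.
    by rewrite mean_flux // sqrtr_sqr gtr0_norm // expr1; field; rewrite gt_eqF.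
  apply: continuous_subspaceT; apply: continuousB => // s; exact: der_continuous (hIc s).
by rewrite /F expr0n itg_id subr0 => <-; rewrite subrK.
Qed.

Let rho_cont1 y : continuous (fun x => rho x y).
Proof.
apply: (continuous_after _ (@sqrt_continuous R)).
by apply: continuousD; [exact/continuousX/continuous_id|exact: continuous_cst].
Qed.

Lemma grad_der t x y : 0 <= t -> der (fun x => W t (rho x y)) x (x * mean t (rho x y)).
Proof.
move=> t0.
have cm : continuous (fun p => 2^-1 * mean t (Num.sqrt p)).
  apply: continuousM; first exact: continuous_cst.
  by apply: (continuous_after (@sqrt_continuous R)); exact: (cont2_l (p := t) mean_cont2).
apply: (@der_ext _ (fun x => W t 0 + itg (fun p => 2^-1 * mean t (Num.sqrt p)) 0 (x ^+ 2 + y ^+ 2))).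
  by move=> s; rewrite [RHS]radial_primitive ?rho_ge0 // rho2.
have h := @der_comp _ (itg (fun p => 2^-1 * mean t (Num.sqrt p)) 0) (fun x => x ^+ 2 + y ^+ 2) x _ _
  (derD (derX 2 x) (der_cst _ x)) (itg_der 0 _ cm).
apply: der_eq (derD (der_cst _ x) h) _; by rewrite /rho /= expr1; field.
Qed.

Lemma hess_der t x y : 0 <= t -> der (fun x => x * mean t (rho x y)) x (hess t x y).
Proof.
move=> t0; have [r0|] := boolP (0 < rho x y).
  have dr : der (fun x => rho x y) x (x / rho x y).
    have s0 : 0 < x ^+ 2 + y ^+ 2 by rewrite -rho2 exprn_gt0.
    have h := @der_comp _ (@Num.sqrt R) (fun x => x ^+ 2 + y ^+ 2) x _ _
      (derD (derX 2 x) (der_cst _ x)) (is_derive1_sqrt s0).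
    apply: der_eq h _; rewrite /= -/(rho x y) expr1; field; by rewrite gt_eqF.
  have h := @der_comp _ (mean t) (fun x => rho x y) x _ _ dr (mean_der t r0).
  apply: der_eq (derM (der_id x) h) _; rewrite /hess.
  by field; rewrite gt_eqF.
rewrite -leNgt => r0; have {}r0 : rho x y = 0 by apply/eqP; rewrite eq_le r0 rho_ge0.
have x0 : x = 0.
  apply/eqP; rewrite -sqrf_eq0; have := rho2 x y; rewrite r0 expr0n => /esym/eqP.
  by rewrite paddr_eq0 ?sqr_ge0 // => /andP[].
have cr : continuous (fun x => mean t (rho x y)).
  by apply: (continuous_after (@rho_cont1 y)); exact: (cont2_l (p := t) mean_cont2).
rewrite /hess r0 x0 expr0n /= mul0r mul0r addr0.
apply: der_eps => e e0; have [d d0 hd] := unif_cont 0 0 cr e0; exists d => // s.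
rewrite subr0 mul0r subr0 => sd; have := hd 0 s; rewrite lexx subr0 => /(_ isT sd).
rewrite -{1}x0 r0 => h; rewrite [X in `|X|](_ : _ = (mean t (rho s y) - mean t 0) * s); last by ring.
by rewrite normrM; apply: ler_wpM2r => //; exact: ltW.
Qed.

Let rho_cont (P : topologicalType) (f g : P -> R) : continuous f -> continuous g ->
  continuous (fun p => rho (f p) (g p)).
Proof.
move=> cf cg; apply: (continuous_after _ (@sqrt_continuous R)).
by apply: continuousD; exact: continuousX.
Qed.

(** At the origin the discontinuous quotient x^2 / rho^2 lies in [0, 1] and multiplies a continuous
    factor that vanishes there. *)
Lemma hess_cont (P : topologicalType) (a f g : P -> R) :
  continuous a -> continuous f -> continuous g -> continuous (fun p => hess (a p) (f p) (g p)).
Proof.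
move=> ca cf cg.
have cr := rho_cont cf cg.
have cm : continuous (fun p => mean (a p) (rho (f p) (g p))) by exact: (cont2_comp mean_cont2).
have cD : continuous (fun p => E (a p) (rho (f p) (g p)) - 2 * mean (a p) (rho (f p) (g p))).
  apply: continuousB; first exact: (cont2_comp cE).
  by apply: continuousM => //; exact: continuous_cst.
apply: continuousD => //; move=> p.
have [r0|] := boolP (0 < rho (f p) (g p)).
  apply: cvgM; last exact: cD.
  apply: cvgM; first exact: (@continuousX _ _ f 2 cf p).
  apply: (@cvgV _ _ _ _ (fun p => rho (f p) (g p) ^+ 2)); first by rewrite expf_neq0 // gt_eqF.
  exact: (@continuousX _ _ _ 2 cr p).
rewrite -leNgt => r0; have {}r0 : rho (f p) (g p) = 0 by apply/eqP; rewrite eq_le r0 rho_ge0.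
have Dp : E (a p) (rho (f p) (g p)) - 2 * mean (a p) (rho (f p) (g p)) = 0.
  by rewrite r0 mean0 subrr.
apply/cvgrPdist_le => /= e e0.
have /cvgrPdist_le /(_ _ e0) := cD p; rewrite /= Dp mulr0 => h.
apply: filterS h => q; rewrite !sub0r !normrN => h; rewrite normrM.
apply: le_trans h; rewrite -[X in _ <= X]mul1r; apply: ler_wpM2r => //.
rewrite rho2 ger0_norm; last by rewrite divr_ge0 ?addr_ge0 ?sqr_ge0.
have [->|s0] := eqVneq (f q ^+ 2 + g q ^+ 2) 0; first by rewrite invr0 mulr0.
rewrite ler_pdivrMr ?mul1r ?lerDl ?sqr_ge0 //.
by rewrite lt_neqAle eq_sym s0 addr_ge0 ?sqr_ge0.
Qed.

Lemma hess_trace t x y : hess t x y + hess t y x = E t (rho x y).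
Proof.
rewrite /hess [rho y x]rhoC; have [r0|r0] := eqVneq (rho x y) 0.
  by rewrite r0 expr0n invr0 !mulr0 !mul0r !addr0 -mean0; ring.
have E1 : x ^+ 2 / rho x y ^+ 2 + y ^+ 2 / rho x y ^+ 2 = 1.
  by rewrite -mulrDl -rho2 divff // expf_neq0.
rewrite addrACA -mulrDl E1; ring.
Qed.

(** Each second difference is e^2 times a value of [hess] at an intermediate point; uniform
    continuity on a compact set moves both points back, and the trace of the Hessian is E. *)
Lemma lap_consistency T A eta : 0 <= T -> 0 <= A -> 0 < eta ->
  exists2 e0, 0 < e0 & forall e t x y, 0 < e -> e < e0 -> 0 <= t <= T -> `|x| <= A -> `|y| <= A ->
   `|(e ^+ 2)^-1 * (W t (rho (x + e) y) + W t (rho (x - e) y) + W t (rho x (y + e)) +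
      W t (rho x (y - e)) - 4 * W t (rho x y)) - E t (rho x y)| <= eta.
Proof.
move=> T0 A0 eta0.
pose Q : set (R * (R * (R * R))) := `[0, T] `*` (`[-A, A] `*` (`[-A, A] `*` `[-1, 1])).
have cQ : compact Q.
  by do !apply: compact_setX; exact: segment_compact.
pose h (s : R) (q : R * (R * (R * R))) : R := hess q.1 (q.2.1 + q.2.2.2 * s) q.2.2.1 - hess q.1 q.2.1 q.2.2.1.
have ch : continuous (fun z : R * (R * (R * (R * R))) => h z.1 z.2).
  have c1 : continuous (fun z : R * (R * (R * (R * R))) => z.1) by exact: continuous_fst.
  have c2 : continuous (fun z : R * (R * (R * (R * R))) => z.2.1).
    by apply: (continuous_after (@continuous_snd _ _)); exact: continuous_fst.
  have c22 : continuous (fun z : R * (R * (R * (R * R))) => z.2.2).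
    by apply: (continuous_after (@continuous_snd _ _)); exact: continuous_snd.
  have c3 : continuous (fun z : R * (R * (R * (R * R))) => z.2.2.1).
    by apply: (continuous_after c22); exact: continuous_fst.
  have c222 : continuous (fun z : R * (R * (R * (R * R))) => z.2.2.2).
    by apply: (continuous_after c22); exact: continuous_snd.
  have c4 : continuous (fun z : R * (R * (R * (R * R))) => z.2.2.2.1).
    by apply: (continuous_after c222); exact: continuous_fst.
  have c5 : continuous (fun z : R * (R * (R * (R * R))) => z.2.2.2.2).
    by apply: (continuous_after c222); exact: continuous_snd.
  apply: continuousB; apply: hess_cont => //.
  by apply: continuousD => //; exact: continuousM.
have h0 q : Q q -> h 0 q = 0 by move=> _; rewrite /h mulr0 addr0 subrr.
have eta2 : 0 < eta / 2 by rewrite divr_gt0.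
have [d d0 hd] := compact_shift cQ ch h0 eta2; exists d => //.
move=> e t x y e0 ed /andP[t0 tT] xA yA.
have inQ x' y' q : `|x'| <= A -> `|y'| <= A -> -1 <= q <= 1 -> Q (t, (x', (y', q))).
  by rewrite !ler_norml => h1 h2 h3; split; [|split; [|split]]; rewrite /= in_itv /= ?t0.
have ne : `|e| < d by rewrite gtr0_norm.
have [q1 hq1 E1] := second_difference x e0 (fun s => grad_der s y t0) (fun s => hess_der s y t0).
have [q2 hq2 E2] := second_difference y e0 (fun s => grad_der s x t0) (fun s => hess_der s x t0).
have H1 := hd e _ ne (inQ x y q1 xA yA hq1); have H2 := hd e _ ne (inQ y x q2 yA xA hq2).
have e20 : e ^+ 2 != 0 by rewrite expf_neq0 // gt_eqF.
have -> : (e ^+ 2)^-1 * (W t (rho (x + e) y) + W t (rho (x - e) y) + W t (rho x (y + e)) +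
      W t (rho x (y - e)) - 4 * W t (rho x y)) - E t (rho x y) = h e (t, (x, (y, q1))) + h e (t, (y, (x, q2))).
  rewrite ![rho x _]rhoC -[rho y x]rhoC.
  rewrite (_ : _ + W t (rho (y + e) x) + _ - 4 * _ =
     (W t (rho (x + e) y) + W t (rho (x - e) y) - 2 * W t (rho x y)) +
     (W t (rho (y + e) x) + W t (rho (y - e) x) - 2 * W t (rho y x))); last first.
    by rewrite [rho y x]rhoC; ring.
  by rewrite E1 E2 -mulrDr mulKf // -hess_trace /h /=; ring.
apply: le_trans (ler_normD _ _) _; move: H1 H2; lra.
Qed.

End Consistency.

(** * Reflection on a periodic lattice *)

Section Cycle.
Variables (R : realType) (j : nat).
Notation J := j.+1.
Notation n := (j.*2.+2)%N.
Implicit Types (i : 'I_n).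

Fact mir_subproof i : ((if i == 0%N :> nat then 0 else n - i) < n)%N.
Proof. by case: ifP => // /eqP; have := ltn_ord i; lia. Qed.
Definition mir i : 'I_n := Ordinal (mir_subproof i).
(** Signed coordinate on a cycle of even length n = 2 J. The mirror is i -> -i modulo n and fixes 0
    and J, so [pos_mir] must exclude i = J. *)
Definition pos i : R := if (i <= J)%N then i%:R else i%:R - n%:R.

Lemma mir_val i : mir i = (if i == 0%N :> nat then 0 else n - i)%N :> nat.
Proof. by []. Qed.

Lemma ordS_val i : ordS i = (if i.+1 == n then 0 else i.+1)%N :> nat.
Proof.
have h := ltn_ord i; rewrite /=; case: ifP => [/eqP->|/eqP hn]; first by rewrite modnn.
by rewrite modn_small //; lia.
Qed.

Lemma ord_pred_val i : ord_pred i = (if i == 0%N :> nat then n.-1 else i.-1)%N :> nat.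
Proof.
have h := ltn_ord i; rewrite /=; case: ifP => [/eqP->|/eqP hn].
  by rewrite add0n modn_small.
have -> : ((i + n).-1 = i.-1 + n)%N by lia.
by rewrite modnDr modn_small //; lia.
Qed.

Lemma mir_S i : mir (ordS i) = ord_pred (mir i).
Proof.
apply/ord_inj; rewrite ord_pred_val !mir_val ordS_val.
have h := ltn_ord i; have [i0|i0] := eqVneq i.+1 n.
  have -> : (i == 0%N :> nat) = false by apply/negbTE; lia.
  by rewrite eqxx; case: ifP => //; lia.
have [i1|i1] := eqVneq (i : nat) 0%N; first by rewrite i1 /=; lia.
have -> : (n - i == 0)%N = false by apply/negbTE; lia.
by rewrite /=; lia.
Qed.

Lemma mir_pred i : mir (ord_pred i) = ordS (mir i).
Proof.
apply/ord_inj; rewrite ordS_val !mir_val ord_pred_val.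
have h := ltn_ord i; have [i0|i0] := eqVneq (i : nat) 0%N.
  by rewrite /=; lia.
have -> : ((n - i).+1 == n)%N = (i == 1 :> nat) by lia.
have -> : (i.-1 == 0)%N = (i == 1 :> nat) by lia.
by case: ifP => //; lia.
Qed.

Lemma mirK : involutive mir.
Proof.
move=> i; apply/ord_inj; have h := ltn_ord i => /=; repeat case: ifP => //; lia.
Qed.

Lemma mir_inner i : (i <= J)%N -> mir i = i \/ (ordS i <= J)%N /\ (ord_pred i <= J)%N.
Proof.
move=> iJ; have h := ltn_ord i; rewrite ordS_val ord_pred_val.
have [i0|i0] := eqVneq (i : nat) 0%N.
  by left; apply/ord_inj; rewrite /= i0.
have [iJ'|iJ'] := eqVneq (i : nat) J.
  by left; apply/ord_inj; rewrite /= iJ' /=; lia.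
by right; split; repeat case: ifP => //; lia.
Qed.

Lemma pos_mir i : (i < J)%N -> pos (mir i) = - pos i.
Proof.
move=> iJ; rewrite /pos /=; have [i0|i0] := eqVneq (i : nat) 0%N.
  by rewrite i0 /= oppr0.
have -> : (n - i <= J)%N = false by apply/negbTE; lia.
by rewrite ltnW // natrB; [ring|lia].
Qed.

Lemma pos_small i : (i <= J)%N -> pos i = i%:R.
Proof. by rewrite /pos => ->. Qed.

Lemma pos_bound i : `|pos i| <= J%:R.
Proof.
have h := ltn_ord i; rewrite /pos; case: ifP => hi.
  by rewrite ger0_norm // ler_nat.
by rewrite distrC ger0_norm ?subr_ge0 ?ler_nat ?(ltnW h) // -natrB ?(ltnW h) // ler_nat; lia.
Qed.

Variables (e B : R) (G : R -> R).
Hypothesis j0 : (0 < j)%N.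
Hypothesis e0 : 0 < e.
Hypothesis eB : B + e <= e * J%:R.
Hypothesis G0 : forall y, B <= `|y| -> G y = 0.

Let big (i : nat) : (j <= i)%N -> B <= `|e * i%:R|.
Proof.
move=> h; rewrite ger0_norm; last by rewrite mulr_ge0 // ltW.
have : e * j%:R <= e * i%:R by rewrite ler_pM2l // ler_nat.
by move: eB; rewrite -natr1; lra.
Qed.

(** The cyclic shift is a translation of positions except across the seam after J. There both
    arguments are at distance at least e j >= B from 0, where G vanishes. *)
Lemma cycle_S i : G (e * pos (ordS i)) = G (e * (pos i + 1)).
Proof.
have h := ltn_ord i.
have [iJ|iJ] := eqVneq (i : nat) J.
  have s : ordS i = J.+1 :> nat by rewrite ordS_val iJ; case: ifP => //; lia.
  rewrite !G0 //.
    by rewrite /pos iJ leqnn natr1 big //; lia.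
  rewrite /pos s ltnn -normrN -mulrN opprB -natrB; last by lia.
  by apply: big; lia.
congr (G (e * _)); rewrite /pos ordS_val; have [in_|hn] := eqVneq i.+1 n.
  rewrite (_ : (i <= J)%N = false); last by apply/negbTE; move: in_ iJ; lia.
  have -> : n%:R = i%:R + 1 :> R by rewrite natr1 in_.
  by rewrite /=; ring.
have -> : (i.+1 <= J)%N = (i <= J)%N by move: iJ; lia.
by case: ifP => _; rewrite -natr1 //; ring.
Qed.

Lemma cycle_pred i : G (e * pos (ord_pred i)) = G (e * (pos i - 1)).
Proof.
have h := ltn_ord i.
have [iJ|iJ] := eqVneq (i : nat) J.+1.
  have s : ord_pred i = J :> nat by rewrite ord_pred_val iJ.
  rewrite !G0 //.
    rewrite /pos iJ ltnn -normrN -mulrN !opprB addrC addrAC [_ + 1]natr1 -natrB; last by lia.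
    by apply: big; lia.
  by rewrite /pos s leqnn; apply: big; lia.
congr (G (e * _)); rewrite /pos ord_pred_val; have [i0|hn] := eqVneq (i : nat) 0%N.
  by rewrite ?i0 /= (_ : (_ <= J)%N = false) 1?natrS //; [rewrite -[in X in _ - X]natr1; ring|apply/negbTE; lia].
have -> : (i.-1 <= J)%N = (i <= J)%N by move: iJ hn; lia.
have -> : (i.-1)%:R = i%:R - 1 :> R by move: hn; case: (nat_of_ord i) => // k _; rewrite -natr1 addrK.
by case: ifP => _ //; ring.
Qed.

End Cycle.

Lemma riemann_sum (R : realType) (g : R -> R) (h eta : R) (k : nat) : continuous g -> 0 < h ->
  (forall (l : nat) s, (l < k)%N -> l%:R * h <= s <= l.+1%:R * h -> `|g s - g (l%:R * h)| <= eta) ->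
  `|itg g 0 (k%:R * h) - \sum_(l < k) h * g (l%:R * h)| <= k%:R * h * eta.
Proof.
move=> cg h0; elim: k => [|k IH] H.
  by rewrite mul0r itg_id big_ord0 subr0 normr0 mul0r.
rewrite big_ord_recr /= (itg_chasles _ 0 (k%:R * h)).
have kh : k%:R * h <= k.+1%:R * h by rewrite ler_pM2r // ler_nat.
have cc : continuous (fun _ : R => g (k%:R * h)) by exact: continuous_cst.
have E : itg g (k%:R * h) (k.+1%:R * h) - h * g (k%:R * h) =
    itg (fun s => g s - g (k%:R * h)) (k%:R * h) (k.+1%:R * h).
  by rewrite itgB // itg_cst -natr1; ring.
have e1 : `|itg (fun s => g s - g (k%:R * h)) (k%:R * h) (k.+1%:R * h)| <= eta * (k.+1%:R * h - k%:R * h).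
  apply: itg_norm_le => //; first exact: continuousB.
  by move=> s /andP[s1 s2]; apply: H => //; rewrite !ltW.
have e2 := IH (fun l s lk => H l s (leqW lk)).
rewrite (_ : _ - _ = (itg g 0 (k%:R * h) - \sum_(l < k) h * g (l%:R * h)) +
   itg (fun s => g s - g (k%:R * h)) (k%:R * h) (k.+1%:R * h)); last by rewrite -E; ring.
apply: le_trans (ler_normD _ _) _; apply: le_trans (lerD e2 e1) _.
by rewrite -natr1 le_eqVlt; apply/orP; left; apply/eqP; ring.
Qed.

Lemma sum_inj_ge (R : realFieldType) (I V : finType) (g : I -> V) (F : V -> R) (c : R) :
  injective g -> (forall x, 0 <= F x) -> (forall i, c <= F (g i)) -> #|I|%:R * c <= \sum_x F x.
Proof.
move=> gi F0 Fc; apply: (@le_trans _ _ (\sum_(x in [set g i | i : I]) F x)).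
  rewrite big_imset /=; last by move=> i j _ _; exact: gi.
  rewrite mulr_natl -[X in X <= _]sumr_const; exact: ler_sum.
by rewrite [X in _ <= X](bigID (mem [set g i | i : I])) /= lerDl sumr_ge0.
Qed.

(** * Monotonicity inequalities for the power nonlinearity *)

Section PowerDifference.
Variables (R : realType) (m C : R).
Hypotheses (m1 : 1 < m) (C0 : 0 < C).
Implicit Types (a b theta L : R).
Let m0 : 0 < m. Proof. exact: lt_trans m1. Qed.
Let P := m * C `^ (m - 1).

Lemma powR_mono_le a b : 0 <= a -> a <= b -> a `^ m <= b `^ m.
Proof. by move=> a0 ab; apply: powR_le => //; exact: ltW. Qed.

Lemma powR_lip a b : 0 <= a -> a <= b -> b <= C -> b `^ m - a `^ m <= P * (b - a).
Proof.
move=> a0 ab bC; have b0 := le_trans a0 ab.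
have := powR_tangent m1 a0 b0; rewrite -(mulr_powRB1 b0 m0) => h.
have e : b `^ (m - 1) <= C `^ (m - 1).
  by apply: powR_le => //; rewrite subr_ge0 ltW.
apply: (@le_trans _ _ (m * b `^ (m - 1) * (b - a))).
  by move: h; rewrite !mulrBr !mulrBl; lra.
by apply: ler_wpM2r; [rewrite subr_ge0|apply: ler_wpM2l => //; exact: ltW].
Qed.

(** The slope is bounded below as soon as the larger value exceeds theta, however small the other
    one is: the chord from b to a is steeper than a^(m-1). *)
Lemma powR_diff_lower theta a b : 0 < theta -> 0 <= b -> b <= a -> theta <= a ->
  theta `^ (m - 1) * (a - b) <= a `^ m - b `^ m.
Proof.
move=> t0 b0 ba ta; have a0 := le_trans b0 ba.
have mm : 0 <= m - 1 by rewrite subr_ge0 ltW.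
rewrite -(mulr_powRB1 a0 m0) -(mulr_powRB1 b0 m0).
have h1 : b * b `^ (m - 1) <= b * a `^ (m - 1) by apply: ler_wpM2l => //; exact: powR_le.
have ab : 0 <= a - b by rewrite subr_ge0.
have h2 : theta `^ (m - 1) * (a - b) <= a `^ (m - 1) * (a - b).
  by apply: ler_wpM2r => //; apply: powR_le => //; exact: ltW.
move: h1 h2; rewrite mulrBr [_ * b]mulrC [_ * a]mulrC; lra.
Qed.

Lemma powR_superadd a b : 0 <= a -> 0 <= b -> a `^ m + b `^ m <= (a + b) `^ m.
Proof.
move=> a0 b0; have ab0 := addr_ge0 a0 b0; have mm : 0 <= m - 1 by rewrite subr_ge0 ltW.
rewrite -(mulr_powRB1 a0 m0) -(mulr_powRB1 b0 m0) -(mulr_powRB1 ab0 m0) mulrDl.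
by apply: lerD; apply: ler_wpM2l => //; apply: powR_le; rewrite ?lerDl ?lerDr.
Qed.

(* The [ez] lemmas concern [e = a - b] and [z = a^m - b^m], whose product controls
   [z^2] and, as [f] vanishes on [[0, theta]], also the square of [f a - f b]. *)
Lemma ez_ge0 a b : 0 <= a -> 0 <= b -> 0 <= (a - b) * (a `^ m - b `^ m).
Proof.
move=> a0 b0; have [ab|/ltW ba] := leP b a.
  by apply: mulr_ge0; rewrite subr_ge0 //; exact: powR_mono_le.
by apply: mulr_le0; rewrite subr_le0 //; exact: powR_mono_le.
Qed.

Lemma ez_z2 a b : 0 <= a <= C -> 0 <= b <= C ->
  (a `^ m - b `^ m) ^+ 2 <= P * ((a - b) * (a `^ m - b `^ m)).
Proof.
wlog ab : a b / b <= a.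
  move=> H ha hb; have [|/ltW] := leP b a => ab; first exact: H.
  have := H b a ab hb ha; rewrite -sqrrN opprB => h; apply: le_trans h _.
  by rewrite le_eqVlt; apply/orP; left; apply/eqP; ring.
move=> /andP[a0 aC] /andP[b0 bC]; rewrite expr2 mulrA; apply: ler_wpM2r.
  by rewrite subr_ge0; exact: powR_mono_le.
exact: powR_lip.
Qed.

Lemma ez_f2 (f : R -> R) theta L a b : 0 < theta -> (forall s, 0 <= s <= theta -> f s = 0) ->
  (forall x y, 0 <= x <= C -> 0 <= y <= C -> `|f x - f y| <= L * `|x - y|) ->
  0 <= a <= C -> 0 <= b <= C ->
  (f a - f b) ^+ 2 <= L ^+ 2 / theta `^ (m - 1) * ((a - b) * (a `^ m - b `^ m)).
Proof.
move=> t0 fz fL; wlog ab : a b / b <= a.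
  move=> H ha hb; have [|/ltW] := leP b a => ab; first exact: H.
  have := H b a ab hb ha; rewrite -sqrrN opprB => h; apply: le_trans h _.
  by rewrite le_eqVlt; apply/orP; left; apply/eqP; ring.
move=> ha hb; have /andP[a0 aC] := ha; have /andP[b0 bC] := hb.
have q0 : 0 <= L ^+ 2 / theta `^ (m - 1) by rewrite divr_ge0 ?sqr_ge0 ?powR_ge0.
have [at_|ta] := leP a theta.
  rewrite !fz ?a0 ?b0 ?(le_trans ab) // subrr expr0n.
  by apply: mulr_ge0 => //; exact: ez_ge0.
have tp : 0 < theta `^ (m - 1) by exact: powR_gt0.
apply: (@le_trans _ _ (L ^+ 2 / theta `^ (m - 1) * (theta `^ (m - 1) * (a - b) ^+ 2))).
  rewrite mulrA divfK ?gt_eqF // -exprMn -[(f a - f b) ^+ 2]real_normK ?num_real //.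
  have := fL a b ha hb; rewrite (ger0_norm (_ : 0 <= a - b)) ?subr_ge0 // => h.
  rewrite lerXn2r ?nnegrE //; apply: le_trans h; exact: normr_ge0.
apply: ler_wpM2l => //; rewrite expr2 mulrCA; apply: ler_wpM2l; first by rewrite subr_ge0.
by apply: powR_diff_lower => //; exact: ltW.
Qed.

(** If u exceeds its mirror value by 2 d and the scheme does not exceed its own, one of the two
    nodes carries an error of at least d. Superadditivity of the power turns this error into
    energy. *)
Lemma ez_lower (a b a' b' d : R) : 0 < d -> 0 <= a -> 0 <= b -> 0 <= a' -> 0 <= b' ->
  2 * d <= (a - a') - (b - b') ->
  d * d `^ m <= (a - b) * (a `^ m - b `^ m) + (a' - b') * (a' `^ m - b' `^ m).
Proof.
move=> d0 a0 b0 a'0 b'0 h.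
have key x y : 0 <= x -> 0 <= y -> d <= x - y -> d * d `^ m <= (x - y) * (x `^ m - y `^ m).
  move=> x0 y0 xy; have xy0 : 0 <= x - y by exact: le_trans (ltW d0) xy.
  apply: ler_pM => //; [exact: ltW|exact: powR_ge0|].
  apply: (@le_trans _ _ ((x - y) `^ m)); first by apply: powR_le => //; exact: ltW.
  by have := powR_superadd xy0 y0; rewrite subrK; lra.
have e1 := ez_ge0 a0 b0; have e2 := ez_ge0 a'0 b'0.
have [h1|h1] := leP d (a - b); first by have := key _ _ a0 b0 h1; lra.
have h2 : d <= b' - a' by lra.
have := key _ _ b'0 a'0 h2.
have -> : (b' - a') * (b' `^ m - a' `^ m) = (a' - b') * (a' `^ m - b' `^ m) by ring.
lra.
Qed.

End PowerDifference.

Lemma index_lt (i0 q i j : nat) : (i < q)%N -> (i0 + q <= j.+1)%N ->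
  [/\ (i0 + i < j.*2.+2)%N, (i < j.*2.+2)%N, (i0 + i < j.+1)%N & (i < j.+1)%N].
Proof. by move=> h1 h2; split; lia. Qed.

Lemma norm_stencil_le (R : realFieldType) (q1 q2 q3 q4 q5 b : R) : `|q1| <= b -> `|q2| <= b ->
  `|q3| <= b -> `|q4| <= b -> `|q5| <= b -> `|q1 + q2 + q3 + q4 - 4 * q5| <= 8 * b.
Proof.
rewrite !ler_norml => /andP[? ?] /andP[? ?] /andP[? ?] /andP[? ?] /andP[? ?].
by apply/andP; split; lra.
Qed.

Lemma norm_three_le (R : realFieldType) (x y z g : R) : `|x| <= g / 3 -> `|y| <= g / 3 ->
  `|z| <= g / 3 -> `|- x + y + z| <= g.
Proof. by rewrite !ler_norml => /andP[? ?] /andP[? ?] /andP[? ?]; apply/andP; split; lra. Qed.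

(** * Energy cost of violating the reflection inequality *)

Section ReflectionEnergy.
Variable R : realType.
Implicit Types (r s t A : R).
Variables (u v ff : R -> R -> R) (f : R -> R) (m C L theta Lam r0 T : R).
Hypothesis m1 : 1 < m.
Hypothesis cu : cont2 u.
Hypothesis cv : cont2 v.
Hypothesis cff : cont2 ff.
Hypothesis C0 : 0 < C.
Hypothesis u0C : forall t r, 0 <= u t r <= C.
Hypothesis vE : forall t r, v t r = u t r `^ m.
Hypothesis ffE : forall t r, ff t r = f (u t r).
Hypothesis theta0 : 0 < theta.
Hypothesis fz : forall s, 0 <= s <= theta -> f s = 0.
Hypothesis L0 : 0 <= L.
Hypothesis fL : forall x y : R, 0 <= x <= C -> 0 <= y <= C -> `|f x - f y| <= L * `|x - y|.
Hypothesis fC : f C <= 0.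
Hypothesis Lam0 : 0 < Lam.
Hypothesis out : forall t r, 0 <= t <= T -> Lam <= r -> u t r = 0.
Hypothesis init : forall r, r0 <= r -> u 0 r = 0.

Variables (a : R) (j K p i0 q : nat) (e h g g' d k delta : R).
Hypothesis j0 : (0 < j)%N.
Hypothesis r00 : 0 < r0.
Hypothesis ra : r0 <= a.
Hypothesis e0 : 0 < e.
Hypothesis eB : Lam + a + e <= e * j.+1%:R.
Hypothesis h0 : 0 < h.
Hypothesis Kh : K%:R * h = T.
Let c : R := (e ^+ 2)^-1.
Let P : R := m * C `^ (m - 1).
Let Cf : R := L ^+ 2 / theta `^ (m - 1).
Hypothesis cfl1 : h * (4 * c * P + L) <= 1.
Hypothesis cfl2 : 16 * P * c * h <= 1.
Hypothesis g0 : 0 <= g'.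
Hypothesis gg1 : 8 * c * T * g' <= g / 3.
Hypothesis gg2 : T * g' <= g / 3.
Hypothesis consist : forall t (x y : R), 0 <= t <= T -> `|x| <= a + e * j.+1%:R -> `|y| <= a + e * j.+1%:R ->
   `|c * (wint v 0 t (rho (x + e) y) + wint v 0 t (rho (x - e) y) + wint v 0 t (rho x (y + e)) +
      wint v 0 t (rho x (y - e)) - 4 * wint v 0 t (rho x y)) - exc u ff 0 t (rho x y)| <= g / 3.
Hypothesis vmod : forall (l : nat) s r, (l < K)%N -> l%:R * h <= s <= l.+1%:R * h -> 0 <= r ->
  `|v s r - v (l%:R * h) r| <= g'.
Hypothesis fmod : forall (l : nat) s r, (l < K)%N -> l%:R * h <= s <= l.+1%:R * h -> 0 <= r ->
  `|ff s r - ff (l%:R * h) r| <= g'.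

Notation n := (j.*2.+2)%N.
Let V := ('I_n * 'I_n)%type.
Let s1 (x : V) : V := (ordS x.1, x.2).
Let p1 (x : V) : V := (ord_pred x.1, x.2).
Let s2 (x : V) : V := (x.1, ordS x.2).
Let p2 (x : V) : V := (x.1, ord_pred x.2).
Let s1K : cancel s1 p1. Proof. by case=> i l; rewrite /s1 /p1 /= ordSK. Qed.
Let s2K : cancel s2 p2. Proof. by case=> i l; rewrite /s2 /p2 /= ordSK. Qed.
Let mu (x : V) : V := (mir x.1, x.2).
(** The lattice is centred on the reflection line x = a, so that [mu] represents the reflection. *)
Let X (x : V) : R := a + e * pos R x.1.
Let Y (x : V) : R := e * pos R x.2.
Let rad (x : V) : R := rho (X x) (Y x).
Let ut (l : nat) (x : V) : R := u (l%:R * h) (rad x).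
Let phi (s : R) : R := s `^ m.
Let U (l : nat) : V -> R := scheme s1 p1 s2 p2 phi f h c (ut 0) l.

Let a0 : 0 < a. Proof. exact: lt_le_trans ra. Qed.
Let m0 : 0 < m. Proof. exact: lt_trans m1. Qed.
Let c0 : 0 <= c. Proof. by rewrite invr_ge0 sqr_ge0. Qed.
Let T0 : 0 <= T. Proof. by rewrite -Kh mulr_ge0 // ltW. Qed.
Let P0 : 0 < P. Proof. by rewrite mulr_gt0 // powR_gt0. Qed.
Let rad0 (x : V) : 0 <= rad x. Proof. exact: rho_ge0. Qed.

Let U_range l (x : V) : 0 <= U l x <= C.
Proof.
apply: (@scheme_range _ _ _ _ _ _ phi f h c P L C) => //; try exact: ltW.
- by rewrite /phi powR0 // gt_eqF.
- by move=> s t s0 st _; exact: powR_mono_le.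
- by move=> s t s0 st tC; exact: powR_lip.
- move=> s t s0 st tC; have hs : 0 <= s <= C by rewrite s0 (le_trans st).
  have ht : 0 <= t <= C by rewrite (le_trans s0).
  apply: le_trans (ler_norm _) _; apply: le_trans (fL hs ht) _.
  by rewrite distrC ger0_norm // subr_ge0.
- by rewrite fz // lexx ltW.
- by move=> y; exact: u0C.
Qed.

Let U_mirror l (x : V) : (x.1 <= j.+1)%N -> U l x <= U l (mu x).
Proof.
move=> hx; apply: (@scheme_mirror _ _ _ _ _ _ phi f h c P L C _ _ _ _ _ _ _ _ _ mu (fun x => x.1 <= j.+1)%N) => //;
  try exact: ltW.
- by rewrite /phi powR0 // gt_eqF.
- by move=> s t s0 st _; exact: powR_mono_le.
- by move=> s t s0 st tC; exact: powR_lip.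
- move=> s t s0 st tC; have hs : 0 <= s <= C by rewrite s0 (le_trans st).
  have ht : 0 <= t <= C by rewrite (le_trans s0).
  apply: le_trans (ler_norm _) _; apply: le_trans (fL hs ht) _.
  by rewrite distrC ger0_norm // subr_ge0.
- by rewrite fz // lexx ltW.
- by move=> y; rewrite /mu /s1 /p1 /= mir_S.
- by move=> y; rewrite /mu /s1 /p1 /= mir_pred.
- move=> [y1 y2] /= h1; rewrite /mu /s1 /p1 /=; case: (mir_inner h1) => [->|]; [by left|by right].
- by move=> y; exact: u0C.
(* On the half-plane x >= a >= r0 the datum vanishes, so the initial order is trivial. *)
- move=> y h1; rewrite /ut mul0r init; first by case/andP: (u0C 0 (rad (mu y))).
  apply: le_trans ra _; rewrite /rad /rho.
  rewrite -[X in X <= _](ger0_norm (ltW a0)) -sqrtr_sqr ler_wsqrtr //.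
  apply: (@le_trans _ _ (X y ^+ 2)); last by rewrite lerDl sqr_ge0.
  have aX : a <= X y by rewrite /X pos_small // lerDl mulr_ge0 // ltW.
  by rewrite lerXn2r ?nnegrE ?(ltW a0) // (le_trans (ltW a0)).
Qed.

Let lat_bound (x : V) : `|X x| <= a + e * j.+1%:R /\ `|Y x| <= a + e * j.+1%:R.
Proof.
have hb (i : 'I_n) : `|e * pos R i| <= e * j.+1%:R.
  by rewrite normrM (gtr0_norm e0) ler_pM2l //; exact: pos_bound.
split; last by apply: le_trans (hb _) _; rewrite lerDr ltW.
by apply: le_trans (ler_normD _ _) _; rewrite (gtr0_norm a0) lerD2l.
Qed.

(** Cyclic neighbours may be replaced by genuine translates because W vanishes beyond Lam and the
    lattice extends past Lam + a on both sides. *)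
Let lap_shift t (x : V) : 0 <= t <= T ->
  lap s1 p1 s2 p2 (fun x => wint v 0 t (rad x)) x =
  wint v 0 t (rho (X x + e) (Y x)) + wint v 0 t (rho (X x - e) (Y x)) +
  wint v 0 t (rho (X x) (Y x + e)) + wint v 0 t (rho (X x) (Y x - e)) -
  4 * wint v 0 t (rho (X x) (Y x)).
Proof.
move=> /andP[t0 tT].
have wz r : Lam <= r -> wint v 0 t r = 0.
  move=> hr; apply: itg_eq0 => //; first exact: cont2_r.
  move=> s /andP[s0 st]; rewrite vE out ?powR0 ?gt_eqF // (ltW s0).
  by rewrite (le_trans (ltW st)).
have rl (x' y' : R) : `|x'| <= rho x' y'.
  by rewrite -sqrtr_sqr ler_wsqrtr // lerDl sqr_ge0.
pose G1 (y : R) := wint v 0 t (rho (a + y) (Y x)).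
have hG1 (y : R) : Lam + a <= `|y| -> G1 y = 0.
  move=> hy; apply: wz; apply: le_trans (rl _ _).
  have := ler_normD (a + y) (- a); rewrite normrN (gtr0_norm a0) addrAC subrr add0r; lra.
pose G2 (y : R) := wint v 0 t (rho (X x) y).
have hG2 (y : R) : Lam + a <= `|y| -> G2 y = 0.
  move=> hy; apply: wz; rewrite rhoC; apply: le_trans (rl _ _).
  by apply: le_trans hy; rewrite lerDl ltW.
have E1 := cycle_S j0 e0 eB hG1 x.1; have E2 := cycle_pred j0 e0 eB hG1 x.1.
have E3 := cycle_S j0 e0 eB hG2 x.2; have E4 := cycle_pred j0 e0 eB hG2 x.2.
move: E1 E2 E3 E4; rewrite /G1 /G2 /lap /rad /X /Y /s1 /p1 /s2 /p2 /= => -> -> -> ->.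
by rewrite !mulrDr !mulrN1 !mulr1 !addrA.
Qed.

Let D l (x : V) : R := wint v 0 (l%:R * h) (rad x) - \sum_(i < l) h * phi (ut i x).

Let D_le l (x : V) : (l < K)%N -> `|D l x| <= T * g'.
Proof.
move=> lK; have lT : l%:R * h <= T by rewrite -Kh ler_pM2r // ler_nat ltnW.
have -> : D l x = itg (v ^~ (rad x)) 0 (l%:R * h) - \sum_(i < l) h * v (i%:R * h) (rad x).
  by rewrite /D; congr (_ - _); apply: eq_bigr => i _; rewrite vE.
apply: le_trans (@riemann_sum _ _ h g' l _ h0 _) _; first exact: cont2_r.
  by move=> i s il hs; apply: vmod => //; exact: ltn_trans lK.
by apply: ler_wpM2r.
Qed.

(** The residual of the time-summed difference equation, defined by solving that equation for it. *)
Let Gk l (x : V) : R := ut l x - U l x -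
  c * lap s1 p1 s2 p2 (fun y => \sum_(i < l) h * (phi (ut i y) - phi (U i y))) x -
  \sum_(i < l) h * (f (ut i x) - f (U i x)).

(** Three errors of size g / 3: the five-point Laplacian of W, the time quadrature of v seen through
    the discrete Laplacian (norm 8 c), and the time quadrature of the reaction. *)
Let Gk_le l (x : V) : (l < K)%N -> `|Gk l x| <= g.
Proof.
move=> lK; have lT : l%:R * h <= T by rewrite -Kh ler_pM2r // ler_nat ltnW.
have ht : 0 <= l%:R * h <= T by rewrite lT mulr_ge0 // ltW.
have [bX bY] := lat_bound x.
have h1 := consist ht bX bY; rewrite -lap_shift // in h1.
have h2 : `|itg (ff ^~ (rad x)) 0 (l%:R * h) - \sum_(i < l) h * ff (i%:R * h) (rad x)| <= T * g'.
  apply: le_trans (@riemann_sum _ _ h g' l _ h0 _) _; first exact: cont2_r.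
    by move=> i s il hs; apply: fmod => //; exact: ltn_trans lK.
  by apply: ler_wpM2r.
have h3 : `|c * lap s1 p1 s2 p2 (D l) x| <= 8 * c * T * g'.
  rewrite normrM (ger0_norm c0) [8 * c]mulrC -!mulrA; apply: ler_wpM2l => //.
  by apply: norm_stencil_le; exact: D_le.
have -> : Gk l x =
   - (c * lap s1 p1 s2 p2 (fun x => wint v 0 (l%:R * h) (rad x)) x - exc u ff 0 (l%:R * h) (rad x)) +
   c * lap s1 p1 s2 p2 (D l) x +
   (itg (ff ^~ (rad x)) 0 (l%:R * h) - \sum_(i < l) h * ff (i%:R * h) (rad x)).
  have sB1 y : \sum_(i < l) h * (phi (ut i y) - phi (U i y)) =
     \sum_(i < l) h * phi (ut i y) - \sum_(i < l) h * phi (U i y).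
    by rewrite -sumrB; apply: eq_bigr => i _; rewrite mulrBr.
  have sB2 : \sum_(i < l) h * (f (ut i x) - f (U i x)) =
     \sum_(i < l) h * ff (i%:R * h) (rad x) - \sum_(i < l) h * f (U i x).
    by rewrite -sumrB; apply: eq_bigr => i _; rewrite mulrBr ffE.
  have EU : U l x = ut 0 x + c * lap s1 p1 s2 p2 (fun y => \sum_(i < l) h * phi (U i y)) x +
     \sum_(i < l) h * f (U i x) by exact: scheme_sum.
  have Eu : ut 0 x = u 0 (rad x) by rewrite /ut mul0r.
  have lapB (w1 w2 w3 : V -> R) : (forall y, w1 y = w2 y - w3 y) ->
      lap s1 p1 s2 p2 w1 x = lap s1 p1 s2 p2 w2 x - lap s1 p1 s2 p2 w3 x.
    by move=> hw; rewrite /lap !hw; ring.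
  rewrite /Gk (lapB _ _ _ sB1) sB2 EU Eu.
  have -> : lap s1 p1 s2 p2 (D l) x = lap s1 p1 s2 p2 (fun x => wint v 0 (l%:R * h) (rad x)) x -
     lap s1 p1 s2 p2 (fun y => \sum_(i < l) h * phi (ut i y)) x by exact: lapB.
  by rewrite /exc /ut; ring.
by apply: norm_three_le => //; [exact: le_trans h3 _|exact: le_trans h2 _].
Qed.

Hypothesis delta0 : 0 < delta.
Hypothesis pK : (p <= K)%N.
Hypothesis i0q : (i0 + q <= j.+1)%N.
Hypothesis ki : forall i : nat, (i0 <= i < i0 + q)%N -> k <= e * i%:R <= k + d.
Hypothesis qd : forall i : nat, (i < q)%N -> e * i%:R <= d.
Hypothesis gap : forall (l : nat) (x y : R), (K - p <= l < K)%N -> k <= x <= k + d -> 0 <= y <= d ->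
  2 * delta <= u (l%:R * h) (rho (a + x) y) - u (l%:R * h) (rho (a - x) y).

(* The scheme inherits the reflection inequality exactly, so a violation by [u]
   is paid for by the energy distance between [u] and the scheme. *)
Lemma reflection_energy :
  p%:R * h * (2^-1 * (q * q)%:R * (delta * delta `^ m)) <=
  4 * P * T * (g ^+ 2 * #|{: V}|%:R) * (1 + 4 * P * T * Cf * h) ^+ K.
Proof.
have u0 t r : 0 <= u t r by case/andP: (u0C t r).
have Ur l (x : V) : 0 <= U l x by case/andP: (U_range l x).
have ez0 l (x : V) : 0 <= (ut l x - U l x) * (phi (ut l x) - phi (U l x)).
  exact: (ez_ge0 m1 (u0 _ _) (Ur _ _)).
have Cf0 : 0 <= Cf by rewrite /Cf divr_ge0 ?sqr_ge0 ?powR_ge0.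
have KT : K%:R * h <= T by rewrite Kh.
have := @discrete_energy R V s1 p1 s2 p2 s1K s2K
  (fun l x => ut l x - U l x) (fun l x => phi (ut l x) - phi (U l x))
  (fun l x => f (ut l x) - f (U l x)) Gk c h P Cf g T K h0 c0 P0 Cf0 cfl2.
move=> H; apply: le_trans (H _ _ _ _ KT _) => {H}; last first.
- by move=> l x lK; rewrite /Gk; ring.
- exact: Gk_le.
- by move=> l x; exact: (ez_f2 m1 theta0 fz fL (u0C _ _) (U_range _ _)).
- by move=> l x; exact: (ez_z2 m1 (u0C _ _) (U_range _ _)).
- exact: ez0.
pose S l : R := \sum_x (ut l x - U l x) * (phi (ut l x) - phi (U l x)).
have S0 l : 0 <= S l by apply: sumr_ge0 => x _; exact: ez0.
have Sl l : (K - p <= l < K)%N -> 2^-1 * (q * q)%:R * (delta * delta `^ m) <= S l.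
  (* Symmetrising the sum under the mirror pairs each node with its image, as [ez_lower] requires;
     the factor 1/2 comes from here. *)
  move=> hl; have SE : S l = 2^-1 * \sum_x ((ut l x - U l x) * (phi (ut l x) - phi (U l x)) +
      (ut l (mu x) - U l (mu x)) * (phi (ut l (mu x)) - phi (U l (mu x)))).
    rewrite big_split /= -/(S l).
    have -> : \sum_x (ut l (mu x) - U l (mu x)) * (phi (ut l (mu x)) - phi (U l (mu x))) = S l.
      have muK : cancel mu mu by case=> x1 x2; rewrite /mu /= mirK.
      exact: (sum_shift (fun x => (ut l x - U l x) * (phi (ut l x) - phi (U l x))) muK).
    by field.
  rewrite SE -mulrA; apply: ler_wpM2l; first by rewrite invr_ge0.
  have lt1 (i : 'I_q) : (i0 + i < n)%N by case: (index_lt (ltn_ord i) i0q).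
  have lt2 (i : 'I_q) : (i < n)%N by case: (index_lt (ltn_ord i) i0q).
  (* The q by q block of nodes where the violation holds, embedded in the lattice. *)
  pose gi (z : 'I_q * 'I_q) : V := (Ordinal (lt1 z.1), Ordinal (lt2 z.2)).
  have gin : injective gi.
    move=> [x1 x2] [y1 y2] [/addnI h1 h2]; congr (_, _); exact: ord_inj.
  have -> : (q * q)%N = #|{: 'I_q * 'I_q}| by rewrite card_prod card_ord.
  apply: (@sum_inj_ge _ _ _ gi (fun x => (ut l x - U l x) * (phi (ut l x) - phi (U l x)) +
      (ut l (mu x) - U l (mu x)) * (phi (ut l (mu x)) - phi (U l (mu x))))) => //.
    by move=> x; apply: addr_ge0; exact: ez0.
  move=> z; have z1 : (i0 + z.1 < j.+1)%N by case: (index_lt (ltn_ord z.1) i0q).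
  have z2 : (z.2 < j.+1)%N by case: (index_lt (ltn_ord z.2) i0q).
  have hU : U l (gi z) <= U l (mu (gi z)) by apply: U_mirror => /=; exact: ltnW.
  have Xg : X (gi z) = a + e * (i0 + z.1)%:R by rewrite /X pos_small //=; exact: ltnW.
  have Xm : X (mu (gi z)) = a - e * (i0 + z.1)%:R.
    by rewrite /X /mu /= pos_mir // pos_small /= ?(ltnW z1) // mulrN.
  have Yg : Y (gi z) = e * z.2%:R by rewrite /Y pos_small //=; exact: ltnW.
  have hx : k <= e * (i0 + z.1)%:R <= k + d by apply: ki; rewrite leq_addr ltn_add2l /=.
  have hy : 0 <= e * z.2%:R <= d by rewrite qd // andbT mulr_ge0 // ltW.
  have := gap hl hx hy => hg.
  apply: ez_lower => //; [exact: u0|exact: u0|].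
  have -> : ut l (gi z) = u (l%:R * h) (rho (a + e * (i0 + z.1)%:R) (e * z.2%:R)).
    by rewrite /ut /rad Xg Yg.
  have -> : ut l (mu (gi z)) = u (l%:R * h) (rho (a - e * (i0 + z.1)%:R) (e * z.2%:R)).
    by rewrite /ut /rad Xm -Yg.
  by apply: le_trans hg _; rewrite lerDl oppr_ge0 subr_le0.
have sc (Q : nat -> R) (b0 : R) : (forall l, 0 <= Q l) -> (forall l, (K - p <= l < K)%N -> b0 <= Q l) ->
    p%:R * b0 <= \sum_(l < K) Q l.
  move=> Q0 Qb; rewrite -(big_mkord xpredT Q) (big_cat_nat (n := (K - p)%N)) //=; last exact: leq_subr.
  apply: (@le_trans _ _ (\sum_(K - p <= l < K) b0)).
    by rewrite sumr_const_nat subKn // mulr_natl.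
  rewrite -[X in X <= _]add0r; apply: lerD; first exact: sumr_ge0.
  by rewrite !big_nat; apply: ler_sum.
rewrite -mulrA; apply: (sc (fun l => h * S l)) => l; first by rewrite mulr_ge0 // ltW.
by move=> hl; rewrite ler_pM2l //; exact: Sl.
Qed.

End ReflectionEnergy.

Lemma truncn_bounds (R : realType) (x : R) : 0 <= x ->
  (Num.truncn x)%:R <= x /\ x < (Num.truncn x).+1%:R.
Proof. by move=> x0; have /andP[] := truncn_itv x0. Qed.

Lemma expr_expR_le (R : realType) (b T : R) (K : nat) : 0 <= b -> K%:R * b <= T ->
  (1 + b) ^+ K <= expR T.
Proof.
move=> b0 h; apply: (@le_trans _ _ (expR (K%:R * b))); last by rewrite ler_expR.
rewrite expRM_natl; apply: lerXn2r; rewrite ?nnegrE ?expR_ge0 ?addr_ge0 //.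
exact: expR_ge1Dx.
Qed.

Lemma time_modulus (R : realType) (w : R -> R -> R) (T Lam g : R) : cont2 w -> 0 <= T -> 0 < g ->
  (forall t r, 0 <= t <= T -> Lam <= r -> w t r = 0) ->
  exists2 d : R, 0 < d & forall t s r, 0 <= t <= T -> 0 <= s <= T -> `|s - t| < d -> 0 <= r ->
    `|w s r - w t r| <= g.
Proof.
move=> cw T0 g0 out.
pose Q : set (R * R) := `[0, T] `*` `[0, Lam].
have cQ : compact Q by apply: compact_setX; exact: segment_compact.
pose h (s : R) (q : R * R) : R := w (q.1 + s) q.2 - w q.1 q.2.
have ch : continuous (fun z : R * (R * R) => h z.1 z.2).
  have c1 : continuous (fun z : R * (R * R) => z.2.1).
    by apply: (continuous_after (@continuous_snd _ _)); exact: continuous_fst.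
  have c2 : continuous (fun z : R * (R * R) => z.2.2).
    by apply: (continuous_after (@continuous_snd _ _)); exact: continuous_snd.
  apply: continuousB; apply: (cont2_comp cw) => //.
  by apply: continuousD => //; exact: continuous_fst.
have hz q : Q q -> h 0 q = 0 by move=> _; rewrite /h addr0 subrr.
have [d d0 hd] := compact_shift cQ ch hz g0; exists d => // t s r ht hs st r0.
have [Lr|rL] := leP Lam r; first by rewrite !out // subrr normr0 ltW.
have Qt : Q (t, r) by split; rewrite /= in_itv //= r0 ltW.
by have := hd (s - t) (t, r) st Qt; rewrite /h /= [t + _]addrC subrK => /ltW.
Qed.

(** A violation at one point persists by continuity on a small space-time box, where it costs an
    energy of order e^(-2). The energy bound also has order e^(-2), but with a factor g^2 that the
    mesh can make arbitrarily small. *)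
Lemma reflection (R : realType) (u v ff : R -> R -> R) (f : R -> R) (m C L theta Lam r0 T a k : R)
  (m1 : 1 < m)
  (cu : cont2 u)
  (cv : cont2 v)
  (cff : cont2 ff)
  (C0 : 0 < C)
  (u0C : forall t r : R, 0 <= u t r <= C)
  (vE : forall t r : R, v t r = u t r `^ m)
  (ffE : forall t r : R, ff t r = f (u t r))
  (theta0 : 0 < theta)
  (fz : forall s : R, 0 <= s <= theta -> f s = 0)
  (L0 : 0 <= L)
  (fL : forall x y : R, 0 <= x <= C -> 0 <= y <= C -> `|f x - f y| <= L * `|x - y|)
  (fC : f C <= 0)
  (Lam0 : 0 < Lam)
  (out : forall t r : R, 0 <= t <= T -> Lam <= r -> u t r = 0)
  (init : forall r : R, r0 <= r -> u 0 r = 0)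
  (star : forall s t r : R, 0 <= s -> 0 <= t -> 0 < r ->
  der (wint v s t) r (flux 1 u ff s t r / r ^+ 1))
  (r00 : 0 < r0)
  (T0 : 0 < T) :
  r0 <= a -> 0 <= k -> u T (a + k) <= u T `|a - k|.
Proof.
move=> ra k0; have a0 : 0 < a by exact: lt_le_trans ra.
have m0 : 0 < m by exact: lt_trans m1.
rewrite leNgt; apply/negP => hlt.
pose D0 := u T (a + k) - u T `|a - k|; have D00 : 0 < D0 by rewrite subr_gt0.
pose delta := D0 / 4; have delta0 : 0 < delta by rewrite divr_gt0.
pose Z (z : R * (R * R)) : R := u z.1 (rho (a + z.2.1) z.2.2) - u z.1 (rho (a - z.2.1) z.2.2).
have cZ : continuous Z.
  have c1 : continuous (fun z : R * (R * R) => z.2.1).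
    by apply: (continuous_after (@continuous_snd _ _)); exact: continuous_fst.
  have c2 : continuous (fun z : R * (R * R) => z.2.2).
    by apply: (continuous_after (@continuous_snd _ _)); exact: continuous_snd.
  have cc : continuous (fun _ : R * (R * R) => a) by exact: continuous_cst.
  have cr (g1 g2 : R * (R * R) -> R) : continuous g1 -> continuous g2 -> continuous (fun z => rho (g1 z) (g2 z)).
    move=> h1 h2; apply: (continuous_after _ (@sqrt_continuous R)).
    by apply: continuousD; exact: continuousX.
  apply: continuousB; apply: (cont2_comp cu); try exact: continuous_fst; apply: cr => //.
    exact: continuousD.
  exact: continuousB.
have rhoa (x : R) : rho x 0 = `|x| by rewrite /rho expr0n addr0 sqrtr_sqr.
have Z0 : Z (T, (k, 0)) = D0.
  by rewrite /Z /= !rhoa (ger0_norm (_ : 0 <= a + k)) // addr_ge0 // ltW.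
have D2 : 0 < D0 / 2 by rewrite divr_gt0.
have /cvgrPdist_lt /(_ _ D2) := cZ (T, (k, 0)); rewrite Z0.
move=> [[A B] /= [hA [[B1 B2] /= [hB1 hB2] hB]] hAB].
have /nbhsP_lt [d1 d10 hd1] := hA; have /nbhsP_lt [d2 d20 hd2] := hB1.
have /nbhsP_lt [d3 d30 hd3] := hB2.
pose d : R := Num.min d1 (Num.min d2 d3) / 2.
have dm : 0 < Num.min d1 (Num.min d2 d3) by rewrite !lt_min d10 d20 d30.
have d0 : 0 < d by rewrite divr_gt0.
have dd : d < Num.min d1 (Num.min d2 d3) by rewrite /d; lra.
move: dd; rewrite !lt_min => /and3P[dd1 dd2 dd3].
have gapZ (t x y : R) : T - d <= t <= T -> k <= x <= k + d -> 0 <= y <= d ->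
    2 * delta <= u t (rho (a + x) y) - u t (rho (a - x) y).
  move=> /andP[t1 t2] /andP[x1 x2] /andP[y1 y2].
  have At : A t by apply: hd1; rewrite ler0_norm; clear -t1 t2 dd1; lra.
  have Bx : B1 x by apply: hd2; rewrite ger0_norm; clear -x1 x2 dd2; lra.
  have By : B2 y by apply: hd3; rewrite subr0 ger0_norm; clear -y1 y2 dd3; lra.
  have := hAB (t, (x, y)) (conj At (hB (x, y) (conj Bx By))).
  by rewrite /= ltr_norml => /andP[_]; rewrite /Z /= /delta; clear; lra.
pose P : R := m * C `^ (m - 1).
have P0 : 0 < P by rewrite mulr_gt0 // powR_gt0.
pose Cf : R := L ^+ 2 / theta `^ (m - 1).
have Cf0 : 0 <= Cf by rewrite divr_ge0 ?sqr_ge0 ?powR_ge0.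
have [s0 s1] : T / d < (Num.truncn (T / d)).+1%:R /\ (0 < (Num.truncn (T / d)).+1)%N.
  by split => //; have [] := truncn_bounds (ltW (divr_gt0 T0 d0)).
(* With K = s p time steps, the last p of them cover T / s < d and so lie in the box of the
   violation. *)
set s := (Num.truncn (T / d)).+1 in s0 s1.
have sR : 0 < s%:R :> R by rewrite ltr0n.
(* Half-width of the lattice: Lam + a for the support, k + d for the block of the violation, and 2
   as slack for rounding to the mesh. *)
pose BB : R := Lam + a + k + d + 2.
have BB0 : 0 < BB by rewrite /BB; clear -Lam0 a0 k0 d0; lra.
pose c0 : R := T / s%:R * (2^-1 * d ^+ 2 * (delta * delta `^ m)).
have c00 : 0 < c0.
  apply: mulr_gt0; first exact: divr_gt0.
  apply: mulr_gt0; first by apply: mulr_gt0; [rewrite invr_gt0|exact: exprn_gt0].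
  by apply: mulr_gt0 => //; exact: powR_gt0.
pose Xi : R := 4 * P * T * (4 * (BB + 1) ^+ 2) * expR (T * (4 * P * T * Cf)).
have Xi0 : 0 < Xi.
  apply: mulr_gt0; last exact: expR_gt0.
  apply: mulr_gt0; first by apply: mulr_gt0 => //; exact: mulr_gt0.
  by apply: mulr_gt0 => //; rewrite exprn_gt0 // addr_gt0.
(* After multiplication by e^2, [c0] is the lower energy bound and g^2 Xi the upper one. Neither
   [c0] nor [Xi] depends on the mesh, so g is fixed first; then e from consistency, g' from e, and h
   from g'. *)
pose g : R := Num.sqrt (c0 / (2 * Xi)).
have gq : 0 < c0 / (2 * Xi) by apply: divr_gt0 => //; exact: mulr_gt0.
have g0 : 0 < g by rewrite sqrtr_gt0.
have g2 : g ^+ 2 = c0 / (2 * Xi) by rewrite sqr_sqrtr // ltW.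
pose A0 : R := a + BB + 1; have A00 : 0 <= A0 by rewrite /A0; clear -a0 BB0; lra.
have g3 : 0 < g / 3 by rewrite divr_gt0.
have cE : cont2 (exc u ff 0).
  apply: continuousB; last exact: (cont2_swap (itg_param2 (a := 0) (cont2_swap cff))).
  by apply: continuousB => //; exact: (c2snd (cont2_l (p := 0) cu)).
have hW (t r : R) : 0 <= t -> 0 < r -> der (wint v 0 t) r (itg (fun x => exc u ff 0 t x * x) 0 r / r).
  by move=> t0 rr; have := star 0 t r (lexx 0) t0 rr.
have [e1 e10 hcons] := lap_consistency (fun t => @wint_continuous _ v cv 0 t) cE hW (ltW T0) A00 g3.
pose q := ((Num.truncn (d / e1)).+1 + (Num.truncn d).+1)%N.
have q0 : (0 < q)%N by rewrite /q addSn.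
have qR : 0 < q%:R :> R by rewrite ltr0n.
have q1 : d / e1 < q%:R.
  have [_ h] := truncn_bounds (ltW (divr_gt0 d0 e10)); apply: lt_le_trans h _.
  by rewrite ler_nat leq_addr.
have q2 : d < q%:R.
  have [_ h] := truncn_bounds (ltW d0); apply: lt_le_trans h _.
  by rewrite ler_nat leq_addl.
pose e : R := d / q%:R; have e0 : 0 < e by rewrite divr_gt0.
have ee1 : e < e1 by rewrite ltr_pdivrMr // mulrC -ltr_pdivrMr.
have e_1 : e < 1 by rewrite ltr_pdivrMr // mul1r.
have eq_d : e * q%:R = d by rewrite divfK // gt_eqF.
pose j := Num.truncn (BB / e).
have [jl ju] := truncn_bounds (ltW (divr_gt0 BB0 e0)).
have jl' : e * j%:R <= BB by rewrite mulrC -ler_pdivlMr.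
have ju' : BB < e * j.+1%:R by rewrite mulrC -ltr_pdivrMr.
have j0 : (0 < j)%N.
  rewrite lt0n; apply/eqP => jz; move: ju'; rewrite jz mulr1 /BB.
  by clear -a0 k0 d0 Lam0 e_1; lra.
pose i0 := (Num.truncn (k / e)).+1.
have [il iu] := truncn_bounds (divr_ge0 k0 (ltW e0)).
have il' : e * (Num.truncn (k / e))%:R <= k by rewrite mulrC -ler_pdivlMr.
have iu' : k < e * i0%:R by rewrite mulrC -ltr_pdivrMr.
pose c : R := (e ^+ 2)^-1; have c1 : 0 < c by rewrite invr_gt0 exprn_gt0.
(* The quadrature tolerance must beat c = e^(-2), since the discrete Laplacian amplifies the error
   in v by 8 c. *)
pose g' : R := g / (3 * T * (8 * c + 1)).
have c81 : 0 < 8 * c + 1 by rewrite addr_gt0 // mulr_gt0.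
have g'0 : 0 < g' by apply: divr_gt0 => //; apply: mulr_gt0 => //; exact: mulr_gt0.
have Tg' : T * g' * (8 * c + 1) = g / 3.
  by rewrite /g'; field; rewrite !gt_eqF.
have gg1 : 8 * c * T * g' <= g / 3.
  have : 0 < T * g' by exact: mulr_gt0.
  rewrite -Tg' mulrDr mulr1 (_ : 8 * c * T * g' = T * g' * (8 * c)); last by ring.
  by move=> ?; rewrite lerDl ltW.
have gg2 : T * g' <= g / 3.
  have h : 0 <= T * g' * (8 * c) by rewrite mulr_ge0 // ltW // mulr_gt0.
  by rewrite -Tg' mulrDr mulr1 lerDr.
have vout (t r : R) : 0 <= t <= T -> Lam <= r -> v t r = 0.
  by move=> ht hr; rewrite vE out // powR0 // gt_eqF.
have fout (t r : R) : 0 <= t <= T -> Lam <= r -> ff t r = 0.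
  by move=> ht hr; rewrite ffE out // fz // lexx ltW.
have [dv dv0 hdv] := time_modulus cv (ltW T0) g'0 vout.
have [df df0 hdf] := time_modulus cff (ltW T0) g'0 fout.
pose hm := Num.min (Num.min (4 * c * P + L + 1)^-1 (16 * P * c + 1)^-1) (Num.min dv df).
have pos1 : 0 < 4 * c * P + L + 1.
  by rewrite ltr_wpDl // addr_ge0 // mulr_ge0 ?(ltW P0) // mulr_ge0 // ltW.
have pos2 : 0 < 16 * P * c + 1.
  by rewrite ltr_wpDl // mulr_ge0 ?(ltW c1) // mulr_ge0 // ltW.
have hm0 : 0 < hm by rewrite !lt_min dv0 df0 !invr_gt0 pos1 pos2.
pose p := (Num.truncn (T / (s%:R * hm))).+1.
have pR : 0 < p%:R :> R by rewrite ltr0n.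
have pb : T / (s%:R * hm) < p%:R.
  by have [] := truncn_bounds (ltW (divr_gt0 T0 (mulr_gt0 sR hm0))).
pose K := (s * p)%N.
pose h : R := T / K%:R.
have KR : 0 < K%:R :> R by rewrite natrM mulr_gt0.
have h0 : 0 < h by rewrite divr_gt0.
have Kh : K%:R * h = T by rewrite mulrC divfK // gt_eqF.
have hhm : h < hm.
  rewrite /h /K natrM ltr_pdivrMr ?mulr_gt0 //; move: pb.
  have rot (x y z : R) : x * (y * z) = z * (y * x) by ring.
  by rewrite ltr_pdivrMr ?mulr_gt0 // rot.
have ph : p%:R * h = T / s%:R.
  by rewrite /h /K natrM; field; rewrite !gt_eqF.
move: hhm; rewrite !lt_min => /andP[/andP[hm1 hm2] /andP[hm3 hm4]].
have cPL : 0 < 4 * c * P + L.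
  by apply: ltr_wpDr => //; apply: mulr_gt0 => //; exact: mulr_gt0.
have cfl1 : h * (4 * c * P + L) <= 1.
  rewrite mulrC -ler_pdivlMl // mulr1; apply: le_trans (ltW hm1) _.
  by rewrite lef_pV2 ?posrE // lerDl.
have Pc : 0 < 16 * P * c by apply: mulr_gt0 => //; exact: mulr_gt0.
have cfl2 : 16 * P * c * h <= 1.
  rewrite -ler_pdivlMl // mulr1; apply: le_trans (ltW hm2) _.
  by rewrite lef_pV2 ?posrE // lerDl.
have lK (l : nat) (t : R) : (l < K)%N -> l%:R * h <= t <= l.+1%:R * h ->
   [/\ 0 <= l%:R * h <= T, 0 <= t <= T & `|t - l%:R * h| <= h].
  move=> lk /andP[t1 t2]; have l0 : 0 <= l%:R * h by rewrite mulr_ge0 // ltW.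
  have l1 : l.+1%:R * h <= T by rewrite -Kh ler_pM2r // ler_nat.
  have l2 : l.+1%:R * h = l%:R * h + h by rewrite -natr1 mulrDl mul1r.
  clear -t1 t2 l0 l1 l2 h0; split; [by apply/andP; split; lra|by apply/andP; split; lra|].
  by rewrite ger0_norm ?subr_ge0 //; lra.
have vmod (l : nat) (t r : R) : (l < K)%N -> l%:R * h <= t <= l.+1%:R * h -> 0 <= r ->
    `|v t r - v (l%:R * h) r| <= g'.
  by move=> lk ht rr; have [h1 h2 h3] := lK l t lk ht; apply: hdv => //; exact: le_lt_trans hm3.
have fmod (l : nat) (t r : R) : (l < K)%N -> l%:R * h <= t <= l.+1%:R * h -> 0 <= r ->
    `|ff t r - ff (l%:R * h) r| <= g'.
  by move=> lk ht rr; have [h1 h2 h3] := lK l t lk ht; apply: hdf => //; exact: le_lt_trans hm4.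
have eB : Lam + a + e <= e * j.+1%:R.
  by apply: le_trans (ltW ju'); rewrite /BB; clear -k0 d0 e_1; lra.
have ejA : a + e * j.+1%:R <= A0.
  by rewrite -natr1 mulrDr mulr1 /A0; clear -jl' e_1; lra.
have cons (t x y : R) : 0 <= t <= T -> `|x| <= a + e * j.+1%:R -> `|y| <= a + e * j.+1%:R ->
   `|c * (wint v 0 t (rho (x + e) y) + wint v 0 t (rho (x - e) y) + wint v 0 t (rho x (y + e)) +
      wint v 0 t (rho x (y - e)) - 4 * wint v 0 t (rho x y)) - exc u ff 0 t (rho x y)| <= g / 3.
  move=> ht hx hy; apply: hcons => //; exact: le_trans ejA.
have pK : (p <= K)%N by rewrite /K leq_pmull.
have i0E : i0%:R = (Num.truncn (k / e))%:R + 1 :> R by rewrite natr1.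
have i0q : (i0 + q <= j.+1)%N.
  rewrite -(ler_nat R) -(ler_pM2l e0); apply: le_trans (ltW ju').
  rewrite natrD mulrDr eq_d i0E mulrDr mulr1 /BB; clear -il' e_1 Lam0 a0; lra.
have ki (i : nat) : (i0 <= i < i0 + q)%N -> k <= e * i%:R <= k + d.
  move=> /andP[i1 i2]; apply/andP; split.
    by apply: le_trans (ltW iu') _; rewrite ler_pM2l // ler_nat.
  have : e * i.+1%:R <= e * (i0 + q)%:R by rewrite ler_pM2l // ler_nat.
  by rewrite natrD mulrDr eq_d -(natr1 i) i0E 2!mulrDr mulr1; clear -il'; lra.
have qd (i : nat) : (i < q)%N -> e * i%:R <= d.
  by move=> iq; rewrite -eq_d ler_pM2l // ler_nat ltnW.
have gap (l : nat) (x y : R) : (K - p <= l < K)%N -> k <= x <= k + d -> 0 <= y <= d ->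
   2 * delta <= u (l%:R * h) (rho (a + x) y) - u (l%:R * h) (rho (a - x) y).
  move=> /andP[l1 l2]; apply: gapZ; apply/andP; split.
    have : (K - p)%:R * h <= l%:R * h by rewrite ler_pM2r // ler_nat.
    rewrite natrB // mulrBl Kh ph; have : T / s%:R <= d.
      by rewrite ler_pdivrMr // mulrC -ler_pdivrMr // ltW.
    by clear; lra.
  by rewrite -Kh ler_pM2r // ler_nat ltnW.
have := reflection_energy m1 cv cff C0 u0C vE ffE theta0 fz fL fC out init
  j0 r00 ra e0 eB h0 Kh cfl1 cfl2 (ltW g'0) gg1 gg2 cons vmod fmod delta0 pK i0q ki qd gap.
(* Both sides count nodes, of number proportional to e^(-2); multiplying by e^2 reduces the
   contradiction to g^2 Xi < c0. *)
apply/negP; rewrite -ltNge -(ltr_pM2l (exprn_gt0 2 e0)).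
rewrite ph card_prod !card_ord.
have -> : e ^+ 2 * (T / s%:R * (2^-1 * (q * q)%:R * (delta * delta `^ m))) = c0.
  by rewrite /c0 -eq_d natrM; ring.
set n2 := (j.*2.+2 * j.*2.+2)%:R; set W := (1 + _) ^+ K.
have hn : e ^+ 2 * n2 <= 4 * (BB + 1) ^+ 2.
  have -> : e ^+ 2 * n2 = 4 * (e * j.+1%:R) ^+ 2.
    rewrite /n2 natrM; have -> : j.*2.+2%:R = 2 * j.+1%:R :> R by rewrite -natrM mul2n.
    ring.
  rewrite ler_pM2l //; apply: lerXn2r; rewrite ?nnegrE.
  - by apply: mulr_ge0 => //; exact: ltW.
  - by apply: addr_ge0 => //; exact: ltW.
  - by clear -ejA; rewrite /A0 in ejA; lra.
have PT : 0 <= 4 * P * T by apply: mulr_ge0; [apply: mulr_ge0 => //|]; exact: ltW.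
have B0 : 0 <= 4 * P * T * Cf * h.
  by apply: mulr_ge0; [exact: mulr_ge0|exact: ltW].
have hw : W <= expR (T * (4 * P * T * Cf)).
  by apply: expr_expR_le => //; rewrite mulrCA Kh mulrC.
apply: (@le_lt_trans _ _ (g ^+ 2 * Xi)); last first.
  rewrite g2 (_ : c0 / (2 * Xi) * Xi = c0 / 2); last by field; rewrite gt_eqF.
  by rewrite ltr_pdivrMr // ltr_pMr // ltr1n.
have W0 : 0 <= W by apply: exprn_ge0; exact: addr_ge0.
have -> : e ^+ 2 * (4 * P * T * (g ^+ 2 * n2) * W) = g ^+ 2 * (4 * P * T * (e ^+ 2 * n2) * W) by ring.
apply: ler_wpM2l; first exact: sqr_ge0.
apply: ler_pM => //; last by apply: ler_wpM2l.
by apply: mulr_ge0 => //; apply: mulr_ge0 => //; exact: sqr_ge0.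
Qed.

(** * Decay of the reaction in the plane *)

Section Weight.
Variables (R : realType) (k : R) (i : nat).
Hypothesis k0 : 0 < k.
Hypothesis i0 : (0 < i)%N.
Implicit Types (r a b : R).

Definition iw r : R := (1 + k ^+ 2 * r ^+ 2)^-1.
(** With exponent i + 1, r z has the explicit primitive -iw^i / (2 k^2 i), so masses are exact.
    [kdz] is z' and [kp] is (r z')', r times the planar Laplacian. *)
Definition kz r : R := iw r ^+ i.+1.
Definition kdz r : R := - (2 * i.+1%:R * k ^+ 2) * (r * iw r ^+ i.+2).
Definition kp r : R := - (2 * i.+1%:R * k ^+ 2) *
  (2 * r * iw r ^+ i.+2 - 2 * i.+2%:R * k ^+ 2 * (r ^+ 3 * iw r ^+ i.+3)).

Let w0 r : 0 < 1 + k ^+ 2 * r ^+ 2.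
Proof. by rewrite ltr_wpDr // mulr_ge0 ?sqr_ge0. Qed.

Lemma iw_gt0 r : 0 < iw r. Proof. by rewrite invr_gt0. Qed.

Lemma iw_le1 r : iw r <= 1.
Proof. by rewrite invf_le1 // lerDl mulr_ge0 ?sqr_ge0. Qed.

Lemma iw_sq r : k ^+ 2 * r ^+ 2 * iw r <= 1.
Proof. by rewrite ler_pdivrMr // mul1r lerDr. Qed.

Lemma iw_der r : der iw r (- (2 * k ^+ 2 * r) * iw r ^+ 2).
Proof.
have h := @derV _ (fun r => 1 + k ^+ 2 * r ^+ 2) r _ (lt0r_neq0 (w0 r)) (derD (der_cst 1 r) (derZ (k ^+ 2) (derX 2 r))).
by apply: der_eq h _; rewrite /iw /= expr1 exprVn add0r; congr (_ * _); ring.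
Qed.

Lemma iwX_der (l : nat) r : der (fun r => iw r ^+ l.+1) r (- (2 * l.+1%:R * k ^+ 2) * (r * iw r ^+ l.+2)).
Proof.
apply: der_eq (@der_comp _ (fun y => y ^+ l.+1) iw r _ _ (iw_der r) (derX l.+1 (iw r))) _.
by rewrite /= !exprS; move: (iw r ^+ l) (l.+1%:R) => A B; ring.
Qed.

Lemma kz_der r : der kz r (kdz r).
Proof. exact: iwX_der. Qed.

Lemma kdz_der r : der (fun r => r ^+ 1 * kdz r) r (kp r).
Proof.
have h := derZ (- (2 * i.+1%:R * k ^+ 2)) (derM (derX 2 r) (iwX_der i.+1 r)).
apply: der_eq (der_ext _ h) _.
  by move=> x; rewrite /kdz expr1 expr2; move: (iw x ^+ _) (i.+1%:R) => A B; ring.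
rewrite /kp expr1 !exprS; move: (iw r ^+ i) (i.+1%:R) (i.+2%:R) => A B D; ring.
Qed.

Lemma iw_cont : continuous iw.
Proof. by move=> r; exact: der_continuous (iw_der r). Qed.

Lemma kz_cont : continuous kz.
Proof. exact/continuousX/iw_cont. Qed.

Lemma kdz_cont : continuous kdz.
Proof.
apply: continuousM; first exact: continuous_cst.
by apply: continuousM; [exact: continuous_id|exact/continuousX/iw_cont].
Qed.

Lemma kp_cont : continuous kp.
Proof.
apply: continuousM; first exact: continuous_cst.
apply: continuousB; apply: continuousM; try exact: continuous_cst.
- by apply: continuousM; [exact: continuous_cst|exact: continuous_id].
- exact/continuousX/iw_cont.
- by apply: continuousM; [exact/continuousX/continuous_id|exact/continuousX/iw_cont].
Qed.

(** A weight at scale 1 / k whose Laplacian is at most a multiple of k^2 times the weight,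
    everywhere: the growing factors occur only as k^2 r^2 iw <= 1. *)
Lemma kp_le r : 0 <= r -> `|kp r| <= 4 * i.+1%:R * i.+3%:R * k ^+ 2 * (kz r * r).
Proof.
move=> r0; have kk : 0 <= 2 * i.+1%:R * k ^+ 2.
  by apply: mulr_ge0; [exact: mulr_ge0|exact: sqr_ge0].
rewrite /kp /kz normrM normrN (ger0_norm kk).
set q := iw r ^+ i.+1.
have q0 : 0 <= q by rewrite exprn_ge0 // ltW // iw_gt0.
have E1 : 2 * r * iw r ^+ i.+2 = 2 * (q * r) * iw r by rewrite exprS /q; ring.
have E2 : 2 * i.+2%:R * k ^+ 2 * (r ^+ 3 * iw r ^+ i.+3) =
    2 * i.+2%:R * (q * r) * ((k ^+ 2 * r ^+ 2 * iw r) * iw r).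
  by rewrite [iw r ^+ i.+3]exprS [iw r ^+ i.+2]exprS -/q; ring.
rewrite E1 E2.
have i1 := iw_le1 r; have i2 := iw_gt0 r; have i3 := iw_sq r.
have i4 : 0 <= k ^+ 2 * r ^+ 2 * iw r by rewrite !mulr_ge0 ?sqr_ge0 // ltW.
have i5 : (k ^+ 2 * r ^+ 2 * iw r) * iw r <= 1 by apply: mulr_ile1 => //; exact: ltW.
have i6 : 0 <= (k ^+ 2 * r ^+ 2 * iw r) * iw r by apply: mulr_ge0 => //; exact: ltW.
have qr : 0 <= q * r by exact: mulr_ge0.
have h1 : 2 * (q * r) * iw r <= 2 * (q * r).
  by rewrite -[X in _ <= X]mulr1; apply: ler_wpM2l => //; exact: mulr_ge0.
have h2 : 2 * i.+2%:R * (q * r) * ((k ^+ 2 * r ^+ 2 * iw r) * iw r) <= 2 * i.+2%:R * (q * r).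
  by rewrite -[X in _ <= X]mulr1; apply: ler_wpM2l => //; rewrite !mulr_ge0.
have h3 : 0 <= 2 * (q * r) * iw r by apply: mulr_ge0; [exact: mulr_ge0|exact: ltW].
have h4 : 0 <= 2 * i.+2%:R * (q * r) * ((k ^+ 2 * r ^+ 2 * iw r) * iw r).
  by apply: mulr_ge0 => //; rewrite !mulr_ge0.
rewrite (_ : 4 * i.+1%:R * i.+3%:R * k ^+ 2 * (q * r) = 2 * i.+1%:R * k ^+ 2 * (2 * (q * r) + 2 * i.+2%:R * (q * r))); last first.
  have -> : i.+3%:R = i.+2%:R + 1 :> R by rewrite natr1.
  by ring.
apply: ler_wpM2l => //.
by rewrite ler_norml; apply/andP; split; lra.
Qed.

Lemma kz_mass a b : itg (fun r => kz r * r) a b = (iw a ^+ i - iw b ^+ i) / (2 * k ^+ 2 * i%:R).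
Proof.
have ki : 2 * k ^+ 2 * i%:R != 0 by rewrite !mulf_neq0 ?expf_neq0 ?pnatr_eq0 ?gt_eqF.
rewrite (@itg_ftcT _ (fun r => - (2 * k ^+ 2 * i%:R)^-1 * iw r ^+ i)).
- by ring.
- by apply: continuousM; [exact: kz_cont|exact: continuous_id].
move=> r; have h : der (fun r => iw r ^+ i) r (- (2 * i%:R * k ^+ 2) * (r * iw r ^+ i.+1)).
  by rewrite -(prednK i0); exact: iwX_der.
apply: der_eq (derZ _ h) _; rewrite (_ : 2 * i%:R * k ^+ 2 = 2 * k ^+ 2 * i%:R); last by ring.
by rewrite mulNr [- (_ * _) * _]mulNr mulrN opprK mulKf // /kz mulrC.
Qed.

Lemma kp_mass b : itg kp 0 b = b * kdz b.
Proof.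
rewrite (@itg_ftcT _ (fun r => r ^+ 1 * kdz r)); [by rewrite !expr1 mul0r subr0|exact: kp_cont|].
exact: kdz_der.
Qed.

Lemma kdz_tail b : 0 <= b -> `|b * kdz b| <= 2 * i.+1%:R * iw b.
Proof.
move=> b0; rewrite (_ : b * kdz b = - (2 * i.+1%:R * ((k ^+ 2 * b ^+ 2 * iw b) * iw b ^+ i.+1))); last first.
  by rewrite /kdz (exprS (iw b) i.+1); move: (iw b ^+ i.+1) (i.+1%:R) => A B; ring.
have i2 := iw_gt0 b; have i4 : 0 <= k ^+ 2 * b ^+ 2 * iw b by rewrite !mulr_ge0 ?sqr_ge0 // ltW.
have i5 : 0 <= iw b ^+ i.+1 by rewrite exprn_ge0 // ltW.
rewrite normrN ger0_norm; last by rewrite mulr_ge0 // mulr_ge0.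
apply: ler_wpM2l; first by rewrite mulr_ge0.
apply: (@le_trans _ _ (iw b ^+ i.+1)).
  by rewrite -[X in _ <= X]mul1r; apply: ler_wpM2r => //; exact: iw_sq.
rewrite exprS -[X in _ <= X]mulr1; apply: ler_wpM2l; first exact: ltW.
by rewrite exprn_ile1 ?iw_le1 // ltW.
Qed.

End Weight.

Lemma gronwall_forward (R : realType) (Y B : R -> R) (K s0 T : R) : continuous B -> s0 <= T ->
  (forall s, s0 <= s <= T -> Y s = Y s0 + itg B s0 s) ->
  (forall s, s0 < s < T -> K * Y s <= B s) -> Y s0 * expR (K * (T - s0)) <= Y T.
Proof.
move=> cB sT hY hB; pose Z (s : R) := expR (- K * s) * (Y s0 + itg B s0 s).
have dE s : der (fun s => expR (- K * s)) s (expR (- K * s) * - K).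
  apply: (@der_comp _ (@expR R) (fun s => - K * s)); last exact: is_derive_expR.
  by apply: der_eq (derZ (- K) (der_id s)) _; rewrite mulr1.
have dZ s : der Z s (expR (- K * s) * - K * (Y s0 + itg B s0 s) + expR (- K * s) * B s).
  apply: derM => //; apply: der_eq (derD (der_cst (Y s0) s) (itg_der s0 s cB)) _.
  by rewrite add0r.
have : Z s0 <= Z T.
  apply: (@der_ndecr _ Z _ s0 T sT (fun s _ => dZ s)).
    by apply: continuous_subspaceT => s; exact: der_continuous (dZ s).
  move=> s /andP[s1 s2]; rewrite -mulrA -mulrDr mulr_ge0 ?expR_ge0 // -hY; last by rewrite !ltW.
  have := hB s; rewrite s1 s2 => /(_ isT); lra.
rewrite /Z -!hY ?lexx ?sT // => h.
have := ler_wpM2l (expR_ge0 (K * T)) h; rewrite !mulrA -!expRD.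
have -> : K * T + - K * s0 = K * (T - s0) by ring.
have -> : K * T + - K * T = 0 by ring.
by rewrite expR0 mul1r mulrC.
Qed.

(** Diffusion costs at most kap |a - theta| z. For an excess s >= S0 the reaction is at least 2 kap
    s and pays twice that; for s <= S0 the constant 2 kap S0 covers the loss; below theta the
    diffusion bound alone suffices. *)
Lemma reaction_pointwise (R : realType) (f : R -> R) (m M theta eps c p kap S0 a b q z : R) :
  1 < m -> 0 < theta -> theta <= M -> 0 <= a <= M -> a <= theta + eps ->
  (forall s, 0 <= s <= theta -> f s = 0) ->
  (forall s, 0 <= s <= eps -> c * s `^ p <= f (theta + s)) -> 0 < c -> 1 <= p -> 0 < S0 -> 0 <= kap ->
  2 * kap <= c * S0 `^ (p - 1) -> 0 <= z -> m * M `^ (m - 1) * `|q| <= kap * z ->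
  - (2 * kap * S0) * z + kap * ((a - theta) * z) <= f a * z + (a `^ m - theta `^ m) * q.
Proof.
move=> m1 t0 tM /andP[a0 aM] aeps fz flow c0 p1 S00 kap0 hS z0 hq.
have P0 : 0 <= m * M `^ (m - 1) by rewrite mulr_ge0 ?powR_ge0 // ltW // (lt_trans ltr01).
have lip : `|a `^ m - theta `^ m| <= m * M `^ (m - 1) * `|a - theta|.
  have [h|/ltW h] := leP theta a.
    rewrite !ger0_norm ?subr_ge0 //; first exact: powR_lip (ltW t0) h aM.
    by apply: powR_mono_le => //; exact: ltW.
  rewrite distrC [`|a - _|]distrC !ger0_norm ?subr_ge0 //; first exact: powR_lip a0 h tM.
  exact: powR_mono_le.
have h1 : - (kap * `|a - theta| * z) <= (a `^ m - theta `^ m) * q.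
  rewrite lerNl; apply: le_trans (ler_norm _) _; rewrite normrN normrM.
  apply: le_trans (ler_wpM2r (normr_ge0 q) lip) _.
  have := ler_wpM2r (normr_ge0 (a - theta)) hq; rewrite mulrAC => h; apply: le_trans h _.
  by rewrite mulrAC.
have [h|/ltW h] := leP theta a; last first.
  rewrite fz ?a0 // mul0r add0r; apply: le_trans h1.
  rewrite distrC ger0_norm ?subr_ge0 //.
  have : 0 <= kap * S0 * z by rewrite !mulr_ge0 // ltW.
  by clear; lra.
set s := a - theta in h1 *; have s0 : 0 <= s by rewrite subr_ge0.
have aE : a = theta + s by rewrite /s; ring.
have fs : c * s `^ p <= f a by rewrite [in f a]aE; apply: flow; rewrite s0 /= lerBlDl.
have key : 2 * kap * s - 2 * kap * S0 <= c * s `^ p.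
  have [sS|sS] := leP s S0.
    apply: (@le_trans _ _ 0); last by apply: mulr_ge0; [exact: ltW|exact: powR_ge0].
    by rewrite subr_le0; apply: ler_wpM2l => //; exact: mulr_ge0.
  have p0 : 0 < p by exact: lt_le_trans p1.
  have pp : 0 <= p - 1 by rewrite subr_ge0.
  rewrite -(mulr_powRB1 s0 p0).
  have e1 : 2 * kap * s <= c * s `^ (p - 1) * s.
    apply: ler_wpM2r => //; apply: le_trans hS _; apply: ler_wpM2l; first exact: ltW.
    by apply: powR_le => //; exact: ltW.
  have : 0 <= kap * S0 by apply: mulr_ge0 => //; exact: ltW.
  have -> : c * (s * s `^ (p - 1)) = c * s `^ (p - 1) * s by ring.
  by move: e1; clear; lra.
rewrite (ger0_norm s0) in h1.
have := ler_wpM2r z0 (le_trans key fs); move: h1; clear; lra.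
Qed.

(* If [u t0 r1] were larger, monotonicity would make the weighted mean of
   [u - theta] grow exponentially, past the bound [eps]. *)
Lemma kaplan_step (R : realType) (u v ff : R -> R -> R) (f : R -> R)
  (m M theta eps c p Ts r2 t0 r1 S0 k : R) (i : nat)
  (m1 : 1 < m) (cu : cont2 u) (cv : cont2 v) (cff : cont2 ff) (M0 : 0 < M)
  (u0M : forall t r : R, 0 <= u t r <= M)
  (vE : forall t r : R, v t r = u t r `^ m)
  (ffE : forall t r : R, ff t r = f (u t r))
  (star : forall s t r : R, 0 <= s -> 0 <= t -> 0 < r ->
     der (wint v s t) r (flux 1 u ff s t r / r ^+ 1))
  (theta0 : 0 < theta) (thetaM : theta <= M)
  (fz : forall s : R, 0 <= s <= theta -> f s = 0)
  (eps0 : 0 < eps) (c0 : 0 < c) (p1 : 1 <= p)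
  (flow : forall s : R, 0 <= s <= eps -> c * s `^ p <= f (theta + s))
  (Ts0 : 0 <= Ts)
  (late : forall t r : R, Ts <= t -> 0 <= r -> u t r <= theta + eps)
  (supp : forall T : R, exists2 Lam : R, 0 < Lam & forall t r : R, 0 <= t <= T -> Lam <= r -> u t r = 0)
  (mono : forall t r s : R, Ts <= t -> r2 <= r -> 0 <= s <= r -> u t r <= u t s) :
  let kap := m * M `^ (m - 1) * (4 * i.+1%:R * i.+3%:R * k ^+ 2) in
  Ts <= t0 -> 0 < r1 -> r2 <= r1 -> 0 < S0 -> 0 < k -> (0 < i)%N -> 2 * kap <= c * S0 `^ (p - 1) ->
  theta <= u t0 r1 ->
  (u t0 r1 - theta) * (1 - iw k r1 ^+ i) <= 4 * S0 + theta * iw k r1 ^+ i.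
Proof.
move=> kap Tt0 r10 r21 S00 k0 i0 hS hu.
have m0 : 0 < m by exact: lt_trans m1.
have u0 t r : 0 <= u t r by case/andP: (u0M t r).
have P0 : 0 < m * M `^ (m - 1) by rewrite mulr_gt0 // powR_gt0.
have kap0 : 0 < kap.
  by apply: mulr_gt0 => //; rewrite !mulr_gt0 ?ltr0n ?exprn_gt0.
have kapE : kap = m * M `^ (m - 1) * (4 * i.+1%:R * i.+3%:R * k ^+ 2) by [].
clearbody kap.
(* The total mass of the weight against r dr on the half-line. *)
pose Z := (2 * k ^+ 2 * i%:R)^-1.
have Z0 : 0 < Z by rewrite invr_gt0 !mulr_gt0 ?ltr0n ?exprn_gt0.
(* The waiting time after which a surplus S0 Z growing at rate kap has gained eps Z, more than the
   bound u <= theta + eps allows. *)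
pose tau := eps / (kap * S0).
have tau0 : 0 < tau by rewrite divr_gt0 // mulr_gt0.
have t00 : 0 <= t0 by exact: le_trans Tt0.
pose T := t0 + tau; have tT : t0 < T by rewrite ltrDl.
have [Lam Lam0 hLam] := supp T.
(* The truncation radius b lies beyond the support up to time T and is so large that the boundary
   term theta^m b z'(b) costs at most kap S0 Z. *)
pose Q := theta `^ m * (2 * i.+1%:R) / (kap * S0 * Z).
have kSZ : 0 < kap * S0 * Z by apply: mulr_gt0 => //; exact: mulr_gt0.
have Q0 : 0 < Q by rewrite divr_gt0 // mulr_gt0 ?powR_gt0 // mulr_gt0.
pose b := Num.max (Num.max Lam r1) (1 + Q / k ^+ 2).
have bL : Lam <= b by rewrite !le_max lexx.
have br : r1 <= b by rewrite !le_max lexx orbT.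
have b0 : 0 < b by exact: lt_le_trans bL.
have bQ : Q <= k ^+ 2 * b ^+ 2.
  have b1 : 1 + Q / k ^+ 2 <= b by rewrite !le_max lexx orbT.
  have qk : 0 < Q / k ^+ 2 by rewrite divr_gt0 // exprn_gt0.
  have : Q / k ^+ 2 <= b ^+ 2.
    have b2 : 1 <= b by move: b1 qk; clear; lra.
    have : b <= b ^+ 2 by rewrite expr2 -[X in X <= _]mulr1; apply: ler_wpM2l => //; exact: ltW.
    by move: b1; clear; lra.
  by rewrite ler_pdivrMr ?exprn_gt0 // mulrC.
have cz : continuous (kz k i) by exact: kz_cont.
have cdz : continuous (kdz k i) by exact: kdz_cont.
have cp : continuous (kp k i) by exact: kp_cont.
have czr : continuous (fun r => kz k i r * r) by apply: continuousM => //; exact: continuous_id.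
have cc (a : R) : continuous (fun _ : R => a) by exact: continuous_cst.
have z0 r : 0 <= r -> 0 <= kz k i r * r.
  by move=> r0; apply: mulr_ge0 => //; apply: exprn_ge0; apply: ltW; exact: iw_gt0.
have mass a d : 0 <= a -> a <= d -> itg (fun r => kz k i r * r) a d = (iw k a ^+ i - iw k d ^+ i) * Z.
  by move=> _ _; rewrite kz_mass.
have iw0 : iw k 0 = 1 by rewrite /iw expr0n mulr0 addr0 invr1.
have iwb0 : 0 <= iw k b ^+ i by apply: exprn_ge0; apply: ltW; exact: iw_gt0.
pose y t := itg (fun r => (u t r - theta) * (kz k i r * r)) 0 b.
pose B t := itg (fun r => ff t r * kz k i r * r ^+ 1 + v t r * kp k i r) 0 b.
have cuz w t : cont2 w -> continuous (fun r => w t r * kz k i r * r ^+ 1).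
  move=> cw; apply: continuousM; last exact: cX.
  by apply: continuousM => //; exact: cont2_l.
have cB : continuous B.
  apply: (@itg_param _ _ (fun s x => ff s x * kz k i x * x ^+ 1 + v s x * kp k i x)).
  apply: continuousD.
    apply: continuousM; last exact: (c2snd (@cX R 1)).
    by apply: continuousM => //; exact: (c2snd cz).
  by apply: continuousM => //; exact: (c2snd cp).
have yE t : y t = itg (fun r => u t r * kz k i r * r ^+ 1) 0 b - theta * itg (fun r => kz k i r * r) 0 b.
  rewrite -itgZ // -itgB; [|exact: cuz|exact: continuousM].
  by congr itg; apply/funext => r; rewrite expr1; ring.
have ytime t : t0 <= t <= T -> y t = y t0 + itg B t0 t.
  move=> /andP[t1 t2]; rewrite !yE.
  have := moment_boundary cu cv cff star t00 (le_trans t00 t1) (lexx 0) (ltW b0) cz cdz cp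
    (fun x _ => kz_der k i x) (fun x _ => kdz_der k i x).
  rewrite (boundary_out m1 cu cv cff vE star) // => [|q r /andP[q1 q2] rb]; last first.
    by apply: hLam; rewrite ?(le_trans bL) // (le_trans t00 q1) (le_trans q2).
  rewrite /boundary flux0 expr1 !mul0r mulr0 !subrr addr0 => E.
  by rewrite -[X in X - _ = _](subrK (itg (fun r => u t0 r * kz k i r * r ^+ 1) 0 b)) E /B; ring.
(* Subtracting theta^m from v is free up to that truncation term, since [kp] integrates to a
   boundary value. The 3 is 2 from [reaction_pointwise] plus 1 from the truncation. *)
have Bge t : t0 <= t <= T -> kap * (y t - 3 * S0 * Z) <= B t.
  move=> /andP[t1 t2]; have Tt := le_trans Tt0 t1.
  have cv1 : continuous (fun r => v t r * kp k i r) by apply: continuousM => //; exact: cont2_l.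
  have cg1 : continuous (fun r => ff t r * (kz k i r * r) + (v t r - theta `^ m) * kp k i r).
    apply: continuousD; first by apply: continuousM => //; exact: cont2_l.
    by apply: continuousM => //; apply: continuousB => //; exact: cont2_l.
  have BE : B t = itg (fun r => ff t r * (kz k i r * r) + (v t r - theta `^ m) * kp k i r) 0 b +
      theta `^ m * itg (kp k i) 0 b.
    rewrite -itgZ // -itgD //; last exact: continuousM.
    by congr itg; apply/funext => r; rewrite expr1; ring.
  have tail : - (kap * S0 * Z) <= theta `^ m * itg (kp k i) 0 b.
    rewrite kp_mass // lerNl; apply: le_trans (ler_norm _) _; rewrite normrN normrM.
    rewrite (ger0_norm (powR_ge0 _ _)); apply: (@le_trans _ _ (theta `^ m * (2 * i.+1%:R * iw k b))).
      by apply: ler_wpM2l; [exact: powR_ge0|apply: kdz_tail => //; exact: ltW].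
    rewrite mulrA ler_pdivrMr; last by rewrite ltr_wpDr // mulr_ge0 ?sqr_ge0.
    have : Q <= 1 + k ^+ 2 * b ^+ 2 by apply: le_trans bQ _; rewrite lerDr.
    move=> hQ; have := ler_wpM2r (ltW kSZ) hQ; rewrite {1}/Q divfK ?gt_eqF // => h; apply: le_trans h _.
    by rewrite mulrC.
  have cy : continuous (fun r => (u t r - theta) * (kz k i r * r)).
    by apply: continuousM => //; apply: continuousB => //; exact: cont2_l.
  have main : - (2 * kap * S0) * itg (fun r => kz k i r * r) 0 b + kap * y t <=
     itg (fun r => ff t r * (kz k i r * r) + (v t r - theta `^ m) * kp k i r) 0 b.
    rewrite -!itgZ // -itgD; [|exact: continuousM|exact: continuousM].
    apply: itg_le => //; [|exact: ltW|].
      by apply: continuousD; exact: continuousM.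
    move=> r /andP[rr0 _]; rewrite ffE vE.
    apply: (@reaction_pointwise _ _ _ M _ eps c p) => //; try exact: ltW.
    - by apply: late => //; exact: ltW.
    - by apply: z0; exact: ltW.
    - rewrite kapE -[X in _ <= X]mulrA; apply: ler_wpM2l; first exact: ltW.
      by apply: kp_le => //; exact: ltW.
  rewrite mass ?(ltW b0) // iw0 expr1n in main.
  have : 2 * kap * S0 * ((1 - iw k b ^+ i) * Z) <= 2 * kap * S0 * Z.
    apply: ler_wpM2l; first by apply: mulr_ge0; [apply: mulr_ge0 => //|]; exact: ltW.
    by rewrite -[X in _ <= X]mul1r; apply: ler_wpM2r; [exact: ltW|rewrite gerBl].
  rewrite BE; move: main tail; rewrite mulNr; clear; lra.
have y4 : y t0 <= 4 * S0 * Z.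
  rewrite leNgt; apply/negP => hy.
  have SZ : 0 < S0 * Z by exact: mulr_gt0.
  pose h t := y t - 3 * S0 * Z.
  have h1 := @gronwall_forward _ h B kap t0 T cB (ltW tT).
  have {}h1 : h t0 * expR (kap * (T - t0)) <= h T.
    apply: h1 => s hs; first by rewrite /h ytime //; ring.
    by apply: Bge; case/andP: hs => *; rewrite !ltW.
  have h2 : S0 * Z <= h t0 by rewrite /h; move: hy; clear; lra.
  have e0 : 0 <= kap * (T - t0) by rewrite mulr_ge0 // ?(ltW kap0) // subr_ge0 ltW.
  have h3 : S0 * Z * (1 + kap * (T - t0)) <= h T.
    apply: le_trans h1; apply: ler_pM => //; [exact: ltW|exact: addr_ge0|exact: expR_ge1Dx].
  have Te : S0 * Z * (kap * (T - t0)) = eps * Z.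
    have -> : T - t0 = tau by rewrite /T; ring.
    by rewrite /tau; field; rewrite !gt_eqF.
  have yT : y T <= eps * Z.
    apply: (@le_trans _ _ (eps * itg (fun r => kz k i r * r) 0 b)).
      rewrite -itgZ //; apply: itg_le; [|exact: continuousM|exact: ltW|].
        by apply: continuousM => //; apply: continuousB => //; exact: cont2_l.
      move=> r /andP[rr0 _]; apply: ler_wpM2r; first by apply: z0; exact: ltW.
      by rewrite lerBlDl; apply: late; [exact: le_trans Tt0 (ltW tT)|exact: ltW].
    apply: ler_wpM2l; first exact: ltW.
    rewrite mass ?(ltW b0) // iw0 expr1n -[X in _ <= X]mul1r.
    by apply: ler_wpM2r; [exact: ltW|rewrite gerBl].
  move: h3; rewrite mulrDr mulr1 Te /h; move: yT SZ; clear; lra.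
(* Monotonicity gives u >= u(t0, r1) inside radius r1; outside only u >= 0 is used, at the price of
   theta times the tail of the weight. *)
have ylow : ((u t0 r1 - theta) * (1 - iw k r1 ^+ i) - theta * iw k r1 ^+ i) * Z <= y t0.
  have cy : continuous (fun r => (u t0 r - theta) * (kz k i r * r)).
    by apply: continuousM => //; apply: continuousB => //; exact: cont2_l.
  rewrite /y (itg_chasles _ 0 r1).
  have l1 : (u t0 r1 - theta) * itg (fun r => kz k i r * r) 0 r1 <=
     itg (fun r => (u t0 r - theta) * (kz k i r * r)) 0 r1.
    rewrite -itgZ //; apply: itg_le => //; [exact: continuousM|exact: ltW|].
    move=> r /andP[q1 q2]; apply: ler_wpM2r; first by apply: z0; exact: ltW.
    by rewrite lerD2r; apply: mono => //; rewrite !ltW.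
  have l2 : - theta * itg (fun r => kz k i r * r) r1 b <=
     itg (fun r => (u t0 r - theta) * (kz k i r * r)) r1 b.
    rewrite -itgZ //; apply: itg_le => //; first exact: continuousM.
    move=> r /andP[q1 q2]; apply: ler_wpM2r; first by apply: z0; exact/ltW/(lt_trans r10).
    by rewrite lerDr.
  rewrite !mass ?(ltW r10) // iw0 expr1n in l1 l2.
  have : 0 <= theta * (iw k b ^+ i * Z).
    by apply: mulr_ge0; [exact: ltW|apply: mulr_ge0 => //; exact: ltW].
  by move: l1 l2; rewrite !(mulrBl, mulrBr, mulNr, mul1r, opprB) !mulrA; clear; lra.
have := le_trans ylow y4; rewrite ler_pM2r //.
by rewrite lerBlDr.
Qed.

(** The excess 1 / p of a p over 2 makes the reaction integrable in the plane with tail r^(-1/p). It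
    is small enough for b = (p + 1) / p^2 > 0, which lets the weight live on a scale 1 / k much
    smaller than r. *)
Lemma decay_exponents (R : realType) (p : R) : 1 <= p ->
  let a := (2 + p^-1) / p in let b := 2 - a * (p - 1) in [/\ 0 < a, 0 < b & a * p = 2 + p^-1].
Proof.
move=> p1 a b; have p0 : 0 < p by exact: lt_le_trans p1.
have a0 : 0 < a by rewrite divr_gt0 // addr_gt0 // invr_gt0.
split=> //; last by rewrite /a divfK // gt_eqF.
have -> : b = (p + 1) / p ^+ 2 by rewrite /b /a; field; rewrite gt_eqF.
by rewrite divr_gt0 ?exprn_gt0 // addr_gt0.
Qed.

(** Since (k r)^2 grows like r^b, a high power of [iw] beats r^(-a). The extra 1 in a + 1 leaves a
    factor 1 / r to absorb the constant. *)
Lemma iw_decay (R : realType) (k r q a b : R) (i : nat) : 1 <= r -> 0 < q ->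
  k ^+ 2 * r ^+ 2 = q * r `^ b -> a + 1 <= b * i%:R -> 2 * q^-1 ^+ i <= r ->
  iw k r ^+ i <= 2^-1 * r `^ (- a).
Proof.
move=> r1 q0 E hi hr; have r0 : 0 < r by exact: lt_le_trans r1.
have qr : 0 < q * r `^ b by rewrite mulr_gt0 // powR_gt0.
have iw1 : iw k r <= (q * r `^ b)^-1.
  by rewrite /iw E lef_pV2 ?posrE ?addr_gt0 // lerDr.
apply: (@le_trans _ _ ((q * r `^ b)^-1 ^+ i)).
  by apply: lerXn2r => //; rewrite nnegrE; [exact/ltW/iw_gt0|rewrite invr_ge0 ltW].
rewrite invfM exprMn -[(r `^ b)^-1]powRN -[(r `^ - b) ^+ i]powR_mulrn ?powR_ge0 // -powRrM.
have e1 : r `^ (- b * i%:R) <= r `^ (- a) * r^-1.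
  rewrite -powR_inv1 ?(ltW r0) // -powR_addp // ler_powR //.
  by move: hi; rewrite mulNr; move: (b * _) => x; lra.
have q1 : 0 <= q^-1 ^+ i by rewrite exprn_ge0 // invr_ge0 ltW.
have e2 : q^-1 ^+ i * r^-1 <= 2^-1 by rewrite ler_pdivrMr // ler_pdivlMl.
apply: le_trans (ler_wpM2l q1 e1) _.
rewrite [X in X <= _]mulrCA [X in X <= _]mulrC; apply: ler_wpM2r => //; exact: powR_ge0.
Qed.

(** As z <= S / 2 <= 1/2, at least half of w remains on the left and the right is at most 4 S + S /
    2; hence the 9. *)
Lemma kaplan_bound (R : realType) (w S z theta : R) : 0 <= w -> 0 < theta <= 1 -> 0 <= S <= 1 ->
  0 <= z <= 2^-1 * S -> w * (1 - z) <= 4 * S + theta * z -> w <= 9 * S.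
Proof.
move=> w0 /andP[t0 t1] /andP[S0 S1] /andP[z0 z1] h.
have h1 : theta * z <= z by rewrite -[X in _ <= X]mul1r; apply: ler_wpM2r.
have h2 : w * z <= w * 2^-1 by apply: ler_wpM2l => //; lra.
move: h; rewrite mulrBr mulr1; lra.
Qed.

Lemma reaction_decay (R : realType) (u v ff : R -> R -> R) (f : R -> R)
  (m M theta eps c Cu p Ts r2 : R)
  (m1 : 1 < m) (cu : cont2 u) (cv : cont2 v) (cff : cont2 ff) (M0 : 0 < M)
  (u0M : forall t r : R, 0 <= u t r <= M)
  (vE : forall t r : R, v t r = u t r `^ m)
  (ffE : forall t r : R, ff t r = f (u t r))
  (star : forall s t r : R, 0 <= s -> 0 <= t -> 0 < r ->
     der (wint v s t) r (flux 1 u ff s t r / r ^+ 1))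
  (theta0 : 0 < theta) (theta1 : theta <= 1) (thetaM : theta <= M)
  (fz : forall s : R, 0 <= s <= theta -> f s = 0)
  (eps0 : 0 < eps) (c0 : 0 < c) (Cu0 : 0 < Cu) (p1 : 1 <= p)
  (flow : forall s : R, 0 <= s <= eps -> c * s `^ p <= f (theta + s) <= Cu * s `^ p)
  (Ts0 : 0 <= Ts)
  (late : forall t r : R, Ts <= t -> 0 <= r -> u t r <= theta + eps)
  (supp : forall T : R, exists2 Lam : R, 0 < Lam & forall t r : R, 0 <= t <= T -> Lam <= r -> u t r = 0)
  (mono : forall t r s : R, Ts <= t -> r2 <= r -> 0 <= s <= r -> u t r <= u t s) :
  exists2 K : R, 0 < K & exists2 rs : R, 1 <= rs & forall t r : R, Ts <= t -> rs <= r ->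
    ff t r <= K * r `^ (- (2 + p^-1)).
Proof.
have m0 : 0 < m by exact: lt_trans m1.
have p0 : 0 < p by exact: lt_le_trans p1.
have [a0 b0 ap] := decay_exponents p1.
set a := (2 + p^-1) / p in a0 b0 ap; set b := 2 - a * (p - 1) in b0.
have flow1 s : 0 <= s <= eps -> c * s `^ p <= f (theta + s) by move=> /flow /andP[].
pose i := (Num.truncn ((a + 1) / b)).+1.
have a1 : 0 < a + 1 by exact: addr_gt0.
have hi : a + 1 <= b * i%:R.
  have [_ h] := truncn_bounds (ltW (divr_gt0 a1 b0)).
  by rewrite mulrC -ler_pdivrMr // ltW.
pose D := m * M `^ (m - 1) * (4 * i.+1%:R * i.+3%:R).
have D0 : 0 < D by apply: mulr_gt0; rewrite !mulr_gt0 ?ltr0n ?powR_gt0.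
pose q := c / (2 * D); have q0 : 0 < q by apply: divr_gt0 => //; exact: mulr_gt0.
pose K := Cu * 9 `^ p; have K0 : 0 < K by apply: mulr_gt0 => //; exact: powR_gt0.
pose rs := Num.max 1 (Num.max r2 (2 * q^-1 ^+ i)).
exists K => //; exists rs; first by rewrite le_max lexx.
move=> t r Tt; rewrite !ge_max => /and3P[r1 rr2 rq].
have r0 : 0 < r by exact: lt_le_trans r1.
have Kr : 0 <= K * r `^ (- (2 + p^-1)) by apply: mulr_ge0; [exact: ltW|exact: powR_ge0].
have [ut|/ltW ut] := leP theta (u t r); last first.
  by rewrite ffE fz // ut andbT; case/andP: (u0M t r).
pose S := r `^ (- a); have S0 : 0 < S by exact: powR_gt0.
have S1 : S <= 1.
  by rewrite -(powRr0 r); apply: ler_powR => //; rewrite oppr_le0 ltW.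
(* The scale at which the condition 2 kap <= c S^(p-1) of the Kaplan step is an equality; with S =
   r^(-a) this gives (k r)^2 = q r^b. *)
pose k := Num.sqrt (q * S `^ (p - 1)).
have kk0 : 0 < q * S `^ (p - 1) by apply: mulr_gt0 => //; exact: powR_gt0.
have k0 : 0 < k by rewrite sqrtr_gt0.
have k2 : k ^+ 2 = q * S `^ (p - 1) by rewrite sqr_sqrtr // ltW.
have kr : k ^+ 2 * r ^+ 2 = q * r `^ b.
  rewrite k2 -mulrA /S -powRrM -powR_mulrn ?(ltW r0) // -powR_addp //.
  by congr (_ * _ `^ _); rewrite /b; ring.
have hS : 2 * (m * M `^ (m - 1) * (4 * i.+1%:R * i.+3%:R * k ^+ 2)) <= c * S `^ (p - 1).
  rewrite (mulrA (m * _) (4 * _ * _)) -/D k2 /q le_eqVlt; apply/orP; left; apply/eqP.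
  by field; rewrite gt_eqF.
have := kaplan_step m1 cu cv cff M0 u0M vE ffE star theta0 thetaM fz eps0 c0 p1 flow1 Ts0 late supp mono
  Tt r0 rr2 S0 k0 (ltn0Sn _) hS ut.
have iw_small : iw k r ^+ i <= 2^-1 * S by exact: iw_decay hi rq.
have iwp : 0 <= iw k r ^+ i by apply: exprn_ge0; apply: ltW; exact: iw_gt0.
move=> hk; have w9 : u t r - theta <= 9 * S.
  apply: kaplan_bound hk; rewrite ?subr_ge0 ?theta0 ?(ltW S0) //.
  by rewrite iwp.
have ur : 0 <= u t r - theta by rewrite subr_ge0.
have := flow (u t r - theta); rewrite ur /= lerBlDl late // ?(ltW r0) // => /(_ isT) /andP[_].
rewrite addrC subrK ffE => h; apply: le_trans h _.
rewrite /K -mulrA; apply: ler_wpM2l; first exact: ltW.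
apply: (@le_trans _ _ ((9 * S) `^ p)); first by apply: powR_le => //; exact: ltW.
by rewrite powRM ?(ltW S0) // /S -powRrM mulNr ap.
Qed.

(* [wint v Ts T r + mb * ln r - M * r ^+ 2] decreases in [r >= rho], [mb] being the
   reaction mass in the ball of radius [rho]. *)
Lemma budget (R : realType) (u v ff : R -> R -> R) (m M Ts T rho X : R)
  (m1 : 1 < m) (cu : cont2 u) (cv : cont2 v) (cff : cont2 ff) (M0 : 0 < M)
  (u0M : forall t r : R, 0 <= u t r <= M)
  (vE : forall t r : R, v t r = u t r `^ m)
  (star : forall s t r : R, 0 <= s -> 0 <= t -> 0 < r ->
     der (wint v s t) r (flux 1 u ff s t r / r ^+ 1))
  (Ts0 : 0 <= Ts) (TsT : Ts <= T)
  (late0 : forall t r : R, Ts <= t -> 0 <= r -> 0 <= ff t r) :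
  0 < rho -> rho < X ->
  itg (fun x => itg (ff ^~ x) Ts T * x) 0 rho * ln (X / rho) <= M `^ m * (T - Ts) + M * X ^+ 2.
Proof.
move=> rho0 rX; have X0 : 0 < X by exact: lt_trans rX.
have m0 : 0 < m by exact: lt_trans m1.
have T0 : 0 <= T by exact: le_trans TsT.
set mb := itg _ 0 rho.
have cS : continuous (fun x => itg (ff ^~ x) Ts T) by exact: (src_continuous cff).
have cSx : continuous (fun x => itg (ff ^~ x) Ts T * x) by apply: continuousM => //; exact: continuous_id.
have S0 x : 0 <= x -> 0 <= itg (ff ^~ x) Ts T.
  by move=> x0; apply: itg_ge0 => //; [exact: cont2_r|move=> s /andP[/ltW s1 _]; exact: late0].
have dln (x : R) : 0 < x -> der (fun x => ln x) x x^-1 by move=> x0; exact: is_derive1_ln.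
pose G x := wint v Ts T x + mb * ln x - M * x ^+ 2.
have dG x : 0 < x -> der G x (flux 1 u ff Ts T x / x ^+ 1 + mb * x^-1 - M * (2%:R * x ^+ 1)).
  move=> x0; apply: derB; last exact: derZ (derX 2 x).
  by apply: derD; [exact: star|apply: derZ; exact: dln].
(* The u-mass in the ball is at most M x^2, and the reaction inside the smaller ball of radius rho
   is subtracted in full because late reaction is nonnegative. *)
have fluxle x : rho <= x -> flux 1 u ff Ts T x <= M * x ^+ 2 - mb.
  move=> rx; have x0 : 0 < x by exact: lt_le_trans rx.
  have -> : mb = itg (fun y => itg (ff ^~ y) Ts T * y) 0 x - itg (fun y => itg (ff ^~ y) Ts T * y) rho x.
    by rewrite [in RHS](itg_chasles _ 0 rho x) addrK.
  have t0 : 0 <= itg (fun y => itg (ff ^~ y) Ts T * y) rho x.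
    by apply: itg_ge0 => // y /andP[y1 _]; have y0 := ltW (lt_trans rho0 y1); apply: mulr_ge0 => //; exact: S0.
  apply: (@le_trans _ _ (M * x ^+ 2 - itg (fun y => itg (ff ^~ y) Ts T * y) 0 x)); last first.
    by move: t0; clear; lra.
  have -> : M * x ^+ 2 = itg (fun _ => M * x) 0 x by rewrite itg_cst subr0 expr2 mulrA.
  have cM : continuous (fun _ : R => M * x) by exact: continuous_cst.
  rewrite -itgB // /flux; apply: itg_le; [exact: excX_continuous|exact: continuousB|exact: ltW|].
  move=> y /andP[y0 yx]; rewrite expr1 /exc !mulrBl lerD2r.
  have /andP[_ h1] := u0M T y; have /andP[h2 _] := u0M Ts y.
  apply: (@le_trans _ _ (u T y * y)); first by rewrite gerBl mulr_ge0 // ltW.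
  by apply: ler_pM => //; [case/andP: (u0M T y)|exact: ltW|exact: ltW].
have hG : G X <= G rho.
  rewrite -lerN2; apply: (@der_ndecr _ (fun x => - G x) (fun x => - (flux 1 u ff Ts T x / x ^+ 1 + mb * x^-1 - M * (2%:R * x ^+ 1)))).
  - exact: ltW.
  - by move=> x /andP[rx _]; apply: derN; apply: dG; exact: lt_trans rx.
  - apply: continuous_in_subspaceT => x; rewrite inE /= in_itv /= => /andP[rx _].
    by apply: der_continuous; apply: derN; apply: dG; exact: lt_le_trans rx.
  - move=> x /andP[/ltW rx _]; have x0 : 0 < x by exact: lt_le_trans rx.
    rewrite oppr_ge0 expr1 -mulrDl subr_le0 ler_pdivrMr //.
    have := fluxle x rx; have := sqr_ge0 x => q; have : 0 <= M * x ^+ 2 by apply: mulr_ge0 => //; exact: ltW.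
    have -> : M * (2 * x) * x = 2 * (M * x ^+ 2) by ring.
    by clear; lra.
have wX : 0 <= wint v Ts T X.
  by apply: itg_ge0 => //; [exact: cont2_r|move=> s _; rewrite vE powR_ge0].
have wr : wint v Ts T rho <= M `^ m * (T - Ts).
  rewrite -itg_cst; apply: itg_le => //; [exact: cont2_r|exact: continuous_cst|].
  by move=> s _; rewrite vE; have /andP[h1 h2] := u0M s rho; apply: powR_le => //; exact: ltW.
have q : 0 <= M * rho ^+ 2 by apply: mulr_ge0; [exact: ltW|exact: sqr_ge0].
rewrite ln_div ?posrE // mulrBr; move: hG; rewrite /G; move: wX wr q; clear; lra.
Qed.

(** * Planar mass and planar front *)

Lemma ln_le_id (R : realType) (x : R) : 0 < x -> ln x <= x.
Proof.
move=> x0; have := @le_ln1Dx R (x - 1); rewrite ltrBrDl subrr => /(_ x0).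
by rewrite addrC subrK => h; apply: le_trans h _; rewrite gerBl.
Qed.

Lemma ln_le_powR (R : realType) (x e : R) : 0 < x -> 0 < e -> ln x <= e^-1 * x `^ e.
Proof.
move=> x0 e0; have h := ln_le_id (powR_gt0 e x0); rewrite ln_powR in h.
by rewrite ler_pdivlMl.
Qed.

Lemma tail_mass (R : realType) (S : R -> R) (K p a b : R) : continuous S -> 0 < a -> a <= b -> 0 < p ->
  (forall x, a <= x -> S x <= K * x `^ (- (2 + p^-1))) ->
  0 <= K -> itg (fun x => S x * x) a b <= K * p * a `^ (- p^-1).
Proof.
move=> cS a0 ab p0 hS K0.
have cSx : continuous (fun x => S x * x) by apply: continuousM => //; exact: continuous_id.
pose H x := itg (fun x => S x * x) a x + K * p * x `^ (- p^-1).
have dH x : 0 < x -> der H x (S x * x + K * p * (- p^-1 * x `^ (- p^-1 - 1))).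
  by move=> x0; apply: derD; [exact: itg_der|apply: derZ; exact: powR_der].
have : H b <= H a.
  rewrite -lerN2; apply: (@der_ndecr _ (fun x => - H x) (fun x => - (S x * x + K * p * (- p^-1 * x `^ (- p^-1 - 1))))) => //.
  - by move=> x /andP[ax _]; apply: derN; apply: dH; exact: lt_trans ax.
  - apply: continuous_in_subspaceT => x; rewrite inE /= in_itv /= => /andP[ax _].
    by apply: der_continuous; apply: derN; apply: dH; exact: lt_le_trans ax.
  - move=> x /andP[/ltW ax _]; have x0 : 0 < x by exact: lt_le_trans ax.
    rewrite oppr_ge0 (_ : K * p * (- p^-1 * _) = - (K * x `^ (- p^-1 - 1))); last by field; rewrite gt_eqF.
    rewrite subr_le0; have := ler_wpM2r (ltW x0) (hS x ax); congr (_ <= _).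
    rewrite -mulrA -{2}[x](powRr1 (ltW x0)) -powR_addp //.
    by congr (_ * _ `^ _); ring.
rewrite /H itg_id add0r => h; apply: le_trans h; rewrite lerDl.
by apply: mulr_ge0; [apply: mulr_ge0 => //; exact: ltW|exact: powR_ge0].
Qed.

(** The radius q = T^(1/4) splits the reaction: inside it the logarithmic budget gives O(T / ln q),
    and outside it the pointwise decay gives T q^(-1/p), which is also O(T / ln q). *)
Lemma planar_mass (R : realType) (u v ff : R -> R -> R) (m M Ts K p rs Ls : R)
  (m1 : 1 < m) (cu : cont2 u) (cv : cont2 v) (cff : cont2 ff) (M0 : 0 < M)
  (u0M : forall t r : R, 0 <= u t r <= M)
  (vE : forall t r : R, v t r = u t r `^ m)
  (star : forall s t r : R, 0 <= s -> 0 <= t -> 0 < r ->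
     der (wint v s t) r (flux 1 u ff s t r / r ^+ 1))
  (Ts0 : 0 <= Ts) (p0 : 0 < p) (K0 : 0 < K) (rs1 : 1 <= rs) (Ls0 : 0 < Ls)
  (late0 : forall t r : R, Ts <= t -> 0 <= r -> 0 <= ff t r)
  (decay : forall t r : R, Ts <= t -> rs <= r -> ff t r <= K * r `^ (- (2 + p^-1)))
  (out : forall r : R, Ls <= r -> u Ts r = 0) (q t X : R) :
  1 < q -> rs <= q -> q <= X -> Ls <= X -> Ts <= t -> t <= q ^+ 4 ->
  (forall s r, Ts <= s <= t -> X <= r -> u s r = 0) ->
  itg (fun r => u t r * r ^+ 1) 0 X <=
    (M * Ls ^+ 2 + (M `^ m + M) + K * p ^+ 2) * (q ^+ 4 / ln q).
Proof.
move=> q1 rq qX LX Tt tq hX; have q0 : 0 < q by exact: lt_trans q1.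
set T := q ^+ 4 in tq *; have TsT : Ts <= T by exact: le_trans tq.
have X0 : 0 < X by exact: lt_le_trans qX.
have lq : 0 < ln q by rewrite ln_gt0.
have T0 : 0 < T by rewrite exprn_gt0.
have Tq : 0 <= T / ln q by rewrite divr_ge0 // ltW.
have cS s : continuous (fun x => itg (ff ^~ x) Ts s) by exact: (src_continuous cff).
have cSx s : continuous (fun x => itg (ff ^~ x) Ts s * x ^+ 1) by apply: continuousM => //; exact: cX.
have cux : continuous (fun x => u Ts x * x ^+ 1) by apply: continuousM; [exact: cont2_l|exact: cX].
rewrite (mass_eq m1 cu cv cff vE star Ts0 Tt X0 hX).
have -> : (fun r => (u Ts r + itg (ff ^~ r) Ts t) * r ^+ 1) = (fun r => u Ts r * r ^+ 1 + itg (ff ^~ r) Ts t * r ^+ 1).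
  by apply/funext => r; rewrite mulrDl.
rewrite itgD //.
have h1 : itg (fun r => u Ts r * r ^+ 1) 0 X <= M * Ls ^+ 2 * (T / ln q).
  have e1 : itg (fun r => u Ts r * r ^+ 1) 0 X <= M * Ls ^+ 2.
    rewrite (itg_chasles _ 0 Ls) [X in _ + X]itg_eq0 ?addr0 //; last first.
      by move=> x /andP[/ltW h _]; rewrite out // mul0r.
    have -> : M * Ls ^+ 2 = itg (fun _ => M * Ls) 0 Ls by rewrite itg_cst subr0; ring.
    apply: itg_le => //; [exact: continuous_cst|exact: ltW|].
    move=> x /andP[x0 xL]; rewrite expr1; have /andP[? ?] := u0M Ts x.
    by apply: ler_pM => //; exact: ltW.
  apply: le_trans e1 _; rewrite -[X in X <= _]mulr1; apply: ler_wpM2l.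
    by apply: mulr_ge0; [exact: ltW|exact: sqr_ge0].
  rewrite ler_pdivlMr // mul1r; apply: le_trans (ln_le_id q0) _.
  by rewrite /T -[X in X <= _]expr1; apply: ler_weXn2l => //; exact: ltW.
have St x : 0 <= x -> itg (ff ^~ x) Ts t <= itg (ff ^~ x) Ts T.
  move=> x0; rewrite (itg_chasles _ Ts t T) lerDl; apply: itg_ge0 => //; first exact: cont2_r.
  by move=> s /andP[ts _]; apply: late0 => //; exact: le_trans (ltW ts).
have S0 x : 0 <= x -> 0 <= itg (ff ^~ x) Ts T.
  by move=> x0; apply: itg_ge0 => //; [exact: cont2_r|move=> s /andP[/ltW s1 _]; exact: late0].
have h2 : itg (fun r => itg (ff ^~ r) Ts t * r ^+ 1) 0 X <= itg (fun r => itg (ff ^~ r) Ts T * r ^+ 1) 0 X.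
  apply: itg_le => //; first exact: ltW.
  by move=> x /andP[x0 _]; apply: ler_wpM2r; [rewrite expr1 ltW|apply: St; exact: ltW].
have h3 : itg (fun x => itg (ff ^~ x) Ts T * x ^+ 1) 0 q <= (M `^ m + M) * (T / ln q).
  (* The budget is applied between q and q^2: their ratio leaves ln q, while the quadratic cost M
     (q^2)^2 is still of order T. *)
  have qq : q < q ^+ 2 by rewrite -[X in X < _]expr1; apply: ltr_eXn2l.
  have := budget m1 cu cv cff M0 u0M vE star Ts0 TsT late0 q0 qq.
  have -> : q ^+ 2 / q = q by rewrite expr2 mulfK // gt_eqF.
  have -> : M * (q ^+ 2) ^+ 2 = M * T by rewrite /T -exprM.
  rewrite mulrA ler_pdivlMr // => h; apply: le_trans h _.
  rewrite mulrDl lerD2r; apply: ler_wpM2l; [exact: powR_ge0|by rewrite gerBl].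
have h4 : itg (fun x => itg (ff ^~ x) Ts T * x ^+ 1) q X <= K * p ^+ 2 * (T / ln q).
  have h : itg (fun x => itg (ff ^~ x) Ts T * x) q X <= (K * T) * p * q `^ (- p^-1).
    apply: tail_mass => //; last by apply: mulr_ge0; exact: ltW.
    move=> x qx; have x0 : 0 < x by exact: lt_le_trans qx.
    apply: (@le_trans _ _ (K * x `^ (- (2 + p^-1)) * (T - Ts))).
      rewrite -itg_cst; apply: itg_le => //; [exact: cont2_r|exact: continuous_cst|].
      by move=> s /andP[/ltW s1 _]; apply: decay => //; exact: le_trans qx.
    rewrite mulrAC; apply: ler_wpM2r; first exact: powR_ge0.
    by apply: ler_wpM2l; [exact: ltW|rewrite gerBl].
  apply: le_trans h _.
  have := @ln_le_powR _ q p^-1 q0; rewrite invr_gt0 invrK => /(_ p0) h.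
  have qp : 0 < q `^ p^-1 by exact: powR_gt0.
  have hq : (q `^ p^-1)^-1 <= p / ln q.
    by rewrite ler_pdivlMr // mulrC ler_pdivrMr.
  have KTp : 0 <= K * T * p by apply: mulr_ge0; [apply: mulr_ge0|]; exact: ltW.
  rewrite powRN; apply: le_trans (ler_wpM2l KTp hq) _.
  by rewrite le_eqVlt; apply/orP; left; apply/eqP; move: (T) (ln q) => x y; ring.
have -> : (M * Ls ^+ 2 + (M `^ m + M) + K * p ^+ 2) * (T / ln q) =
  M * Ls ^+ 2 * (T / ln q) + ((M `^ m + M) * (T / ln q) + K * p ^+ 2 * (T / ln q)) by ring.
apply: lerD h1 _; apply: le_trans h2 _; rewrite (itg_chasles _ 0 q).
exact: lerD.
Qed.

(** * The planar rate and its elementary bounds *)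

Section Rate.
Variables (R : realType) (m T : R).
Hypotheses (m1 : 1 < m) (T0 : 0 < T) (T1 : 1 <= ln T).

Definition rate : R := Num.sqrt T / ln T `^ ((m - 1) / (2 * m)).

Let m0 : 0 < m. Proof. exact: lt_trans m1. Qed.
Let L0 : 0 < ln T. Proof. exact: lt_le_trans T1. Qed.

Lemma rate_gt0 : 0 < rate.
Proof. by rewrite divr_gt0 ?sqrtr_gt0 // powR_gt0. Qed.

Lemma rate_sq : rate ^+ 2 = T / ln T `^ ((m - 1) / m).
Proof.
rewrite /rate expr_div_n sqr_sqrtr ?(ltW T0) //; congr (_ / _).
rewrite -powR_mulrn ?powR_ge0 // -powRrM; congr (_ `^ _).
by field; rewrite gt_eqF.
Qed.

Lemma rate_pow : (rate ^+ 2) `^ m = T `^ m / ln T `^ (m - 1).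
Proof.
rewrite rate_sq powRM ?invr_ge0 ?powR_ge0 ?(ltW T0) //; congr (_ * _).
by rewrite -powRN -powRrM -powRN; congr (_ `^ _); field; rewrite gt_eqF.
Qed.

Lemma rate_le_sqrt : rate <= Num.sqrt T.
Proof.
rewrite ler_pdivrMr ?powR_gt0 // -[X in X <= _]mulr1; apply: ler_wpM2l; first exact: sqrtr_ge0.
rewrite -[X in X <= _](powRr0 (ln T)); apply: ler_powR => //.
by apply: divr_ge0; [rewrite subr_ge0 ltW|apply: mulr_ge0 => //; exact: ltW].
Qed.

Lemma rate_ge_div : T / ln T <= rate ^+ 2.
Proof.
rewrite rate_sq; apply: ler_wpM2l; first exact: ltW.
rewrite lef_pV2 ?posrE ?powR_gt0 // -[X in _ <= X](powRr1 (ltW L0)); apply: ler_powR => //.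
by rewrite ler_pdivrMr // mul1r gerBl.
Qed.

(** T^(1/4) is far below the rate, the logarithm costing at most another T^(1/4); this disposes of
    fronts inside the splitting radius of [planar_mass]. *)
Lemma rate_ge_root q : 0 < q -> q ^+ 4 = T -> q <= 4 * rate.
Proof.
move=> q0 qT; have sT : Num.sqrt T = q ^+ 2.
  by rewrite -qT (exprM q 2 2) sqrtr_sqr ger0_norm // sqr_ge0.
have lT : ln T = 4 * ln q by rewrite -qT lnXn // mulr_natl.
have : ln T `^ ((m - 1) / (2 * m)) <= 4 * q.
  apply: (@le_trans _ _ (ln T)).
    rewrite -[X in _ <= X](powRr1 (ltW L0)); apply: ler_powR => //.
    rewrite ler_pdivrMr ?mulr_gt0 // mul1r; move: m0; lra.
  by rewrite lT; apply: ler_wpM2l => //; exact: ln_le_id.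
move=> h; rewrite /rate sT mulrA ler_pdivlMr ?powR_gt0 //.
have -> : 4 * q ^+ 2 = q * (4 * q) by ring.
by apply: ler_wpM2l => //; exact: ltW.
Qed.

End Rate.

Lemma sq_rate_le (R : realType) (x y c m : R) : 0 < m -> 0 <= x -> 0 <= y -> 0 <= c ->
  (x ^+ 2) `^ m <= c * (y ^+ 2) `^ m -> x <= Num.sqrt (c `^ m^-1) * y.
Proof.
move=> m0 x0 y0 c0 h; have cp : 0 <= c `^ m^-1 by exact: powR_ge0.
have : x ^+ 2 <= c `^ m^-1 * y ^+ 2.
  have := powR_root_ge m0 _ (sqr_ge0 x) h; rewrite powRM ?powR_ge0 // powRKV ?sqr_ge0 //.
  by apply; apply: mulr_ge0 => //; exact: powR_ge0.
move=> h2; rewrite -(ger0_norm x0) -sqrtr_sqr -[y in X in _ <= X](ger0_norm y0) -[`|y|]sqrtr_sqr -sqrtrM //.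
exact: ler_wsqrtr.
Qed.

Lemma planar_upper (R : realType) (u v ff : R -> R -> R) (b : R -> R)
  (m M Cf theta Ts K p rs r2 : R)
  (m1 : 1 < m) (cu : cont2 u) (cv : cont2 v) (cff : cont2 ff) (M0 : 0 < M)
  (u0M : forall t r : R, 0 <= u t r <= M)
  (vE : forall t r : R, v t r = u t r `^ m)
  (star : forall s t r : R, 0 <= s -> 0 <= t -> 0 < r ->
     der (wint v s t) r (flux 1 u ff s t r / r ^+ 1))
  (hCf : forall t r : R, - Cf * u t r <= ff t r)
  (hb : forall t r : R, 0 < t -> 0 <= r -> (0 < u t r) = (r < b t))
  (theta0 : 0 < theta) (fz : forall t r : R, u t r <= theta -> ff t r = 0)
  (Ts0 : 0 < Ts) (p0 : 0 < p) (K0 : 0 < K) (rs1 : 1 <= rs)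
  (late0 : forall t r : R, Ts <= t -> 0 <= r -> 0 <= ff t r)
  (decay : forall t r : R, Ts <= t -> rs <= r -> ff t r <= K * r `^ (- (2 + p^-1)))
  (mono : forall t r s : R, Ts <= t -> r2 <= r -> 0 <= s <= r -> u t r <= u t s) :
  exists C T0 : R, [/\ 0 < C, 0 < T0 & forall T, T0 <= T -> b T <= C * rate m T].
Proof.
have m0 : 0 < m by exact: lt_trans m1.
have u0 t r : 0 <= u t r by case/andP: (u0M t r).
have uM t r : u t r <= M by case/andP: (u0M t r).
pose Ls := Num.max (b Ts) 1; have Ls0 : 0 < Ls by rewrite lt_max ltr01 orbT.
have out r : Ls <= r -> u Ts r = 0.
  rewrite ge_max => /andP[h1 h2]; apply/eqP; rewrite eq_le u0 andbT leNgt hb // -?leNgt //.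
  exact: le_trans h2.
pose A := M * Ls ^+ 2 + (M `^ m + M) + K * p ^+ 2.
have A0 : 0 < A.
  apply: addr_gt0; last by apply: mulr_gt0 => //; exact: exprn_gt0.
  apply: addr_gt0; first by apply: mulr_gt0 => //; exact: exprn_gt0.
  by apply: addr_gt0 => //; exact: powR_gt0.
have [j hj] := exists_nat_ratio m1.
pose k2 : R := (2 * (j.+3%:R * j.+2%:R)) `^ m.
have k20 : 0 < k2 by rewrite powR_gt0 // mulr_gt0 // mulr_gt0.
pose D0 := Num.max (Num.max r2 Ls) 1; have D00 : 0 < D0 by rewrite lt_max ltr01 orbT.
pose C1 : R := 8 * (1 + D0).
have C10 : 0 < C1 by rewrite mulr_gt0 // addr_gt0.
pose C2 : R := 2 * Num.sqrt (8 * A / theta).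
have C20 : 0 <= C2 by rewrite mulr_ge0 // sqrtr_ge0.
pose C3 : R := 2 * Num.sqrt ((k2 * (4 * A) `^ (m - 1)) `^ m^-1).
have C30 : 0 <= C3 by rewrite mulr_ge0 // sqrtr_ge0.
pose Tm := expR 1 + Ts + rs ^+ 4.
have rs0 : 0 < rs by exact: lt_le_trans rs1.
have r40 : 0 < rs ^+ 4 by exact: exprn_gt0.
have e0 := expR_gt0 (1 : R).
have Tm0 : 0 < Tm by rewrite /Tm !addr_gt0.
exists (C1 + C2 + C3), Tm; split=> //.
  by rewrite -addrA ltr_wpDr // addr_ge0.
move=> T hT; have T0 : 0 < T by exact: lt_le_trans hT.
have TE : expR 1 <= T by move: hT; rewrite /Tm; move: Ts0 r40; clear; lra.
have TTs : Ts < T by move: hT; rewrite /Tm; move: e0 r40; clear; lra.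
have T4 : rs ^+ 4 <= T by move: hT; rewrite /Tm; move: e0 Ts0; clear; lra.
have L1 : 1 <= ln T by rewrite -[X in X <= _](expRK 1) ler_ln ?posrE.
have L0 : 0 < ln T by exact: lt_le_trans L1.
pose q := T `^ 4^-1.
have q4 : q ^+ 4 = T by rewrite -powR_mulrn ?powR_ge0 // -powRrM mulVf ?pnatr_eq0 // powRr1 // ltW.
have q0 : 0 < q by exact: powR_gt0.
have q1 : 1 < q.
  rewrite ltNge; apply/negP => h; have : q ^+ 4 <= 1 by apply: exprn_ile1 => //; exact: ltW.
  rewrite q4 => h1; have := le_trans TE h1; apply/negP; rewrite -ltNge.
  by rewrite -expR0 ltr_expR.
have rq : rs <= q.
  by rewrite -(@ler_pXn2r R 4) ?nnegrE ?(ltW rs0) ?(ltW q0) // q4.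
have lT : ln T = 4 * ln q by rewrite -q4 lnXn // mulr_natl.
have F0 : 0 < rate m T by exact: rate_gt0.
have Fq : q <= 4 * rate m T by exact: rate_ge_root.
have w (x c : R) : x <= c * rate m T -> (c <= C1 + C2 + C3) -> x <= (C1 + C2 + C3) * rate m T.
  by move=> h1 h2; apply: le_trans h1 _; apply: ler_wpM2r => //; exact: ltW.
set X := b T; pose rho := X / 2; have XE : X = 2 * rho by rewrite /rho; field.
have [small|big] := leP rho (Num.max q D0).
  apply: (w X C1); last by move: C20 C30; clear; lra.
  have h : Num.max q D0 <= (1 + D0) * q.
    rewrite ge_max mulrDl mul1r lerDl (mulr_ge0 (ltW D00) (ltW q0)) /=.
    apply: (@le_trans _ _ (D0 * q)); last by rewrite lerDr ltW.
    by rewrite -[X in X <= _]mulr1; apply: ler_wpM2l; exact: ltW.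
  have d1 : 0 <= 1 + D0 by rewrite addr_ge0 // ltW.
  have := ler_wpM2l d1 Fq; move: (le_trans small h); rewrite XE /C1; clear.
  move: (rate m T) ((1 + D0) * q) => x y; have -> : (1 + D0) * (4 * x) = 4 * ((1 + D0) * x) by ring.
  have -> : 8 * (1 + D0) * x = 8 * ((1 + D0) * x) by ring.
  by lra.
move: big; rewrite !gt_max => /and3P[rhoq /andP[rhor2 rhoL'] rho1].
have rhoL : Ls < rho by rewrite gt_max.
have rho0 : 0 < rho by exact: lt_trans rhoq.
have X0 : 0 < X by rewrite XE mulr_gt0.
have rX : rho < X by rewrite XE; move: rho0; clear; lra.
have hX t r : Ts <= t <= T -> X <= r -> u t r = 0.
  move=> /andP[t1 t2]; apply: (front_out m1 cu cv cff u0 uM M0 vE star hCf hb) => //.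
  exact: lt_le_trans t1.
pose Mass := 4 * A * (T / ln T).
have Mass0 : 0 < Mass by rewrite mulr_gt0 ?divr_gt0 // mulr_gt0.
have hMass t : Ts <= t <= T -> itg (fun r => u t r * r ^+ 1) 0 X <= Mass.
  move=> /andP[t1 t2].
  have := @planar_mass R u v ff m M Ts K p rs Ls m1 cu cv cff M0 u0M vE star (ltW Ts0) p0 K0 rs1 Ls0
    late0 decay out q t X q1 rq (ltW (lt_trans rhoq rX)) (ltW (lt_trans rhoL rX)) t1.
  rewrite q4 => h; apply: le_trans (h t2 _) _.
    by move=> s r /andP[s1 s2]; apply: hX; rewrite s1 (le_trans s2).
  rewrite -/A /Mass lT le_eqVlt; apply/orP; left; apply/eqP.
  by field; rewrite gt_eqF // ln_gt0.
(* Second case: rho^2 = O(T / ln T), which is stronger than the rate because (m - 1) / m < 1. *)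
have [small|big] := leP (rho ^+ 2) (2 * Mass / theta).
  apply: (w X C2); last by move: C10 C30; clear; lra.
  rewrite XE /C2 -[in X in _ <= X](mulrA 2); apply: ler_wpM2l => //.
  have h : rho ^+ 2 <= 8 * A / theta * rate m T ^+ 2.
    apply: le_trans small _; rewrite /Mass (_ : 2 * (4 * A * (T / ln T)) / theta = 8 * A / theta * (T / ln T)); last by ring.
    by apply: ler_wpM2l; [rewrite divr_ge0 ?mulr_ge0 // ltW|exact: rate_ge_div].
  rewrite -(ger0_norm (ltW rho0)) -sqrtr_sqr -[rate m T](ger0_norm (ltW F0)) -[`|rate m T|]sqrtr_sqr -sqrtrM.
    exact: ler_wsqrtr.
  by rewrite divr_ge0 ?mulr_ge0 // ltW.
(* Last case: if u exceeded theta at some r >= rho, monotonicity would give u > theta throughout the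
   disc of radius rho, and a mass of at least theta rho^2 / 2, above [Mass]. So no reaction occurs
   beyond rho. *)
have hff t r : Ts <= t <= T -> rho <= r -> ff t r = 0.
  move=> ht hr; apply: fz; rewrite leNgt; apply/negP => hu; have /andP[t1 t2] := ht.
  have := hMass t ht; apply/negP; rewrite -ltNge.
  have cux : continuous (fun x => u t x * x ^+ 1) by apply: continuousM; [exact: cont2_l|exact: cX].
  apply: (@lt_le_trans _ _ (theta * (2^-1 * rho ^+ 2))).
    move: big; rewrite ltr_pdivrMr //; clear; move: (rho ^+ 2) => y; lra.
  have -> : theta * (2^-1 * rho ^+ 2) = itg (fun x => theta * x) 0 rho.
    rewrite itgZ; last exact: continuous_id.
    rewrite (@itg_ftcT _ (fun x => 2^-1 * x ^+ 2)); [by rewrite expr0n mulr0 subr0|exact: continuous_id|].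
    by move=> x; apply: der_eq (derZ _ (derX 2 x)) _; rewrite expr1 mulKf.
  rewrite (itg_chasles _ 0 rho X) -[X in X <= _]addr0; apply: lerD.
    apply: itg_le => //; [|exact: ltW|].
      by apply: continuousM; [exact: continuous_cst|exact: continuous_id].
    move=> x /andP[x0 xr]; rewrite expr1; apply: ler_wpM2r; first exact: ltW.
    apply: le_trans (ltW hu) _; apply: mono => //; first exact: le_trans (ltW rhor2) hr.
    by rewrite (ltW x0) (le_trans (ltW xr)).
  apply: itg_ge0 => //; first exact: ltW.
  by move=> x /andP[x1 _]; rewrite mulr_ge0 // expr1 (le_trans (ltW rho0)) // ltW.
have h2 r : 0 <= r < X -> 0 < u T r by move=> /andP[r1 rX']; rewrite hb.
have h3 r : rho <= r -> u Ts r = 0 by move=> hr; apply: out; exact: le_trans (ltW rhoL) hr.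
have := front_upper m1 cu cv cff u0 vE star (ltW Ts0) TTs rho0 XE hX h2 h3 hff Mass0 hMass hj.
rewrite -/k2 expr1 divff ?gt_eqF // mulr1 => H.
apply: (w X C3); last by move: C10 C20; clear; lra.
rewrite XE /C3 -[in X in _ <= X](mulrA 2); apply: ler_wpM2l => //.
apply: sq_rate_le => //; try exact: ltW.
  by apply: mulr_ge0; [exact: ltW|exact: powR_ge0].
apply: le_trans H _; rewrite rate_pow //.
have TL : 0 <= T / ln T by rewrite divr_ge0 // ltW.
have A4 : 0 <= 4 * A by rewrite mulr_ge0 // ltW.
have iL : 0 <= (ln T)^-1 by rewrite invr_ge0 ltW.
rewrite /Mass (powRM _ A4 TL) (powRM _ (ltW T0) iL).
have -> : (ln T)^-1 `^ (m - 1) = (ln T `^ (m - 1))^-1.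
  by rewrite -powR_inv1 ?(ltW L0) // powRAC powR_inv1 ?powR_ge0.
rewrite -(@mulr_powRB1 _ T m) ?(ltW T0) //.
have e1 : 0 <= k2 * (4 * A) `^ (m - 1) * (T `^ (m - 1) / ln T `^ (m - 1)).
  apply: mulr_ge0; first by apply: mulr_ge0; [exact: ltW|exact: powR_ge0].
  by rewrite divr_ge0 ?powR_ge0.
have e2 : T - Ts <= T by rewrite gerBl ltW.
have := ler_wpM2l e1 e2; move: (T `^ (m - 1)) (ln T `^ (m - 1)) ((4 * A) `^ (m - 1)) => x y z h.
apply: le_trans (_ : k2 * z * (x / y) * (T - Ts) <= _); first by rewrite !mulrA.
by apply: le_trans h _; rewrite le_eqVlt; apply/orP; left; apply/eqP; ring.
Qed.

Lemma planar_lower (R : realType) (u v ff : R -> R -> R) (b : R -> R)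
  (m M Cf Ts kap : R)
  (m1 : 1 < m) (cu : cont2 u) (cv : cont2 v) (cff : cont2 ff) (M0 : 0 < M)
  (u0M : forall t r : R, 0 <= u t r <= M)
  (vE : forall t r : R, v t r = u t r `^ m)
  (star : forall s t r : R, 0 <= s -> 0 <= t -> 0 < r ->
     der (wint v s t) r (flux 1 u ff s t r / r ^+ 1))
  (hCf : forall t r : R, - Cf * u t r <= ff t r)
  (hb : forall t r : R, 0 < t -> 0 <= r -> (0 < u t r) = (r < b t))
  (Ts0 : 0 < Ts) (kap0 : 0 < kap)
  (late0 : forall t r : R, Ts <= t -> 0 <= r -> 0 <= ff t r)
  (lateR : forall t : R, Ts <= t -> kap <= v t 1 /\ expR 1 < b t) :
  exists c T0 : R, [/\ 0 < c, 0 < T0 & forall T, T0 <= T -> c * rate m T <= b T].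
Proof.
have m0 : 0 < m by exact: lt_trans m1.
have u0 t r : 0 <= u t r by case/andP: (u0M t r).
have uM t r : u t r <= M by case/andP: (u0M t r).
pose Kc : R := (2 `^ m / (m - 1)) `^ m.
have K0 : 0 < Kc by rewrite powR_gt0 // divr_gt0 ?powR_gt0 // subr_gt0.
pose c1 : R := 2^-1 `^ m * kap `^ (m - 1) * (4 / 2 `^ m) / Kc.
have c10 : 0 < c1.
  by rewrite divr_gt0 // !mulr_gt0 ?powR_gt0 ?invr_gt0 ?powR_gt0.
pose c2 : R := Num.sqrt ((c1^-1) `^ m^-1).
have c20 : 0 < c2 by rewrite sqrtr_gt0 powR_gt0 // invr_gt0.
pose Tm := expR 1 + 2 * Ts; have e0 := expR_gt0 (1 : R).
exists (Num.min 1 c2^-1), Tm; split.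
- by rewrite lt_min ltr01 invr_gt0.
- by rewrite /Tm addr_gt0 // mulr_gt0.
move=> T hT; have TE : expR 1 <= T by move: hT; rewrite /Tm; move: Ts0; clear; lra.
have T2 : 2 * Ts <= T by move: hT; rewrite /Tm; move: e0; clear; lra.
have TTs : Ts < T by move: Ts0 T2; clear; lra.
have T0 : 0 < T by exact: lt_le_trans TE.
have L1 : 1 <= ln T by rewrite -[X in X <= _](expRK 1) ler_ln ?posrE.
have L0 : 0 < ln T by exact: lt_le_trans L1.
have F0 : 0 < rate m T by exact: rate_gt0.
have [_ eB] := lateR T (ltW TTs); set B := b T in eB *.
have B0 : 0 < B by exact: lt_trans eB.
(* A front beyond sqrt T already exceeds the rate. Otherwise ln B <= ln T, which converts the
   constraint in B into the rate in T. *)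
have [sB|sB] := leP (Num.sqrt T) B.
  apply: le_trans sB; apply: le_trans (rate_le_sqrt m1 L1).
  by rewrite -[X in _ <= X]mul1r; apply: ler_wpM2r; [exact: ltW|rewrite ge_min lexx].
have B1 : 1 < B by apply: lt_trans eB; rewrite -[X in X < _]expR0 ltr_expR.
pose ell := ln (B / 1); have ell0 : 0 < ell by rewrite /ell divr1 ln_gt0.
have ellL : ell <= ln T.
  rewrite /ell divr1 ler_ln ?posrE //; apply: le_trans (ltW sB) _.
  rewrite -[X in _ <= X](ger0_norm (ltW T0)) -sqrtr_sqr; apply: ler_wsqrtr.
  rewrite expr2 -[X in X <= _]mulr1; apply: ler_wpM2l; first exact: ltW.
  by apply: le_trans TE; rewrite -[X in X <= _]expR0 ler_expR.
have h1 t r : Ts <= t <= T -> B <= r -> u t r = 0.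
  move=> /andP[t1 t2]; apply: (front_out m1 cu cv cff u0 uM M0 vE star hCf hb) => //.
  exact: lt_le_trans t1.
have h2 t r : Ts <= t <= T -> 1 <= r <= B -> 0 <= ff t r.
  by move=> /andP[t1 _] /andP[r1 _]; apply: late0 => //; exact: le_trans r1.
have h3 t : Ts <= t <= T -> kap <= v t 1 by move=> /andP[/lateR[]].
have := growth_constraint_exterior m1 cu cv cff u0 vE star (ltW Ts0) TTs ltr01 B1 kap0 erefl ell0 h1 h2 h3.
rewrite -/Kc.
have B20 : 0 < B ^+ 2 by exact: exprn_gt0.
have -> : 4 / B ^+ 2 * ((2 `^ m)^-1 * (B ^+ 2) `^ (1 - m)) = 4 / 2 `^ m / (B ^+ 2) `^ m.
  rewrite -(@mulr_powRB1 _ (B ^+ 2) m) ?(ltW B20) // -opprB powRN; field.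
  by rewrite !gt_eqF ?powR_gt0.
rewrite mulrA ler_pdivrMr ?powR_gt0 // => H.
have H2 : rate m T <= c2 * B.
  apply: sq_rate_le => //; try exact: ltW; first by rewrite invr_ge0 ltW.
  rewrite rate_pow // ler_pdivlMl // mulrC.
  apply: (@le_trans _ _ (2^-1 `^ m * T `^ m * (kap `^ (m - 1) / ln T `^ (m - 1)) * (4 / 2 `^ m) / Kc)).
    by rewrite /c1 le_eqVlt; apply/orP; left; apply/eqP; ring.
  rewrite ler_pdivrMr // [X in _ <= X]mulrC; apply: le_trans H.
  have k4 : 0 <= 4 / 2 `^ m :> R by rewrite divr_ge0 // powR_ge0.
  apply: ler_wpM2r => //.
  have i2 : 0 <= 2^-1 * T by rewrite mulr_ge0 // ltW.
  have i3 : 0 <= 2^-1 :> R by rewrite invr_ge0.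
  have i4 : 0 <= ell^-1 by rewrite invr_ge0 ltW.
  rewrite -/ell -(powRM m i3 (ltW T0)) (powRM _ (ltW kap0) i4).
  apply: ler_pM; [exact: powR_ge0|by rewrite divr_ge0 ?powR_ge0| |].
    by apply: powR_le; [exact: ltW|exact: i2|move: T2; clear; lra].
  apply: ler_wpM2l; first exact: powR_ge0.
  have -> : ell^-1 `^ (m - 1) = (ell `^ (m - 1))^-1.
    by rewrite -powR_inv1 ?(ltW ell0) // powRAC powR_inv1 ?powR_ge0.
  rewrite lef_pV2 ?posrE ?powR_gt0 //; apply: powR_le; [|exact: ltW|exact: ellL].
  by rewrite subr_ge0 ltW.
apply: (@le_trans _ _ (c2^-1 * rate m T)).
  by apply: ler_wpM2r; [exact: ltW|rewrite ge_min lexx orbT].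
by rewrite ler_pdivrMl.
Qed.

(** * From the hypotheses to the radial flow *)

Lemma uniform_cvg_eps (R : realType) (A : set R) (v : R -> R -> R) (w : R -> R) (e : R) :
  {uniform A, v t @[t --> +oo] --> w} -> 0 < e ->
  exists2 T : R, 0 < T & forall t r : R, T <= t -> A r -> `|v t r - w r| < e.
Proof.
move=> cv e0.
have hP : nbhs (w : {uniform` A -> R}) [set h | forall r, A r -> `|h r - w r| < e].
  apply/uniform_nbhs; exists [set xy | ball xy.1 e xy.2]; split.
    by rewrite -entourage_ballE; exists e.
  by move=> h /= hh r Ar; have := hh r Ar; rewrite /ball /= distrC.
have [M [Mr hM]] := cv _ hP.
exists (`|M| + 1); first by rewrite ltr_wpDl.
move=> t r Tt Ar; apply: hM => //; apply: lt_le_trans Tt.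
by rewrite ltr_pwDr // ler_norm.
Qed.

Lemma equiv_right_bounds (R : realType) (f : R -> R) (theta lambda p : R) : 0 < lambda -> 0 < p ->
  (fun s : R => f (theta + s)) ~_(0^'+) (fun s : R => lambda * s `^ p) -> f theta = 0 ->
  exists2 d : R, 0 < d & forall s, 0 <= s <= d ->
    lambda / 2 * s `^ p <= f (theta + s) <= 2 * lambda * s `^ p.
Proof.
move=> l0 p0 /eqaddoP h ft; have h2 : 0 < (2^-1 : R) by rewrite invr_gt0.
have := h _ h2; rewrite /= near_withinE => /nbhsP_lt [d d0 hd].
exists (d / 2); first by rewrite divr_gt0.
move=> s /andP[]; rewrite le_eqVlt => /orP[/eqP <-|s0] sd.
  by rewrite addr0 ft powR0 ?gt_eqF // !mulr0 lexx.
have sp : 0 < s `^ p by exact: powR_gt0.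
have ls : 0 <= lambda * s `^ p by rewrite mulr_ge0 ?ltW.
have sd' : `|s - 0| < d by rewrite subr0 gtr0_norm //; lra.
have := hd s sd' s0; rewrite /= !fctE (ger0_norm ls) ler_norml => /andP[h3 h4].
by apply/andP; split; lra.
Qed.

Lemma powR_max_continuous (R : realType) (m : R) : 0 < m -> continuous (fun s : R => Num.max s 0 `^ m).
Proof.
move=> m0 s; have [s0|s0] := leP s 0.
  apply/cvgrPdist_le => /= e e0; rewrite max_r // powR0 ?gt_eqF //.
  apply/nbhsP_lt; exists (e `^ m^-1); first exact: powR_gt0.
  move=> y hy; rewrite sub0r normrN ger0_norm ?powR_ge0 //.
  rewrite -[X in _ <= X](powRK m0 (ltW e0)); apply: powR_le; [exact: ltW|by rewrite le_max lexx orbT|].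
  rewrite ge_max (ltW (powR_gt0 _ e0)) andbT.
  have : y <= y - s by rewrite lerBrDr gerDl.
  by move=> h; apply: le_trans h _; apply: le_trans (ler_norm _) (ltW hy).
apply: der_continuous (m * s `^ (m - 1)) _.
apply: (@der_near _ (fun y => y `^ m)); last exact: powR_der.
have ss : 0 < s < s + 1 by rewrite s0 ltrDl ltr01.
by apply: filterS (near_itv_oo ss) => y /andP[/ltW y0 _]; rewrite max_l.
Qed.

Lemma extend_continuous (R : realType) (u : R -> R -> R) :
  {within [set z : R * R | 0 <= z.1 /\ 0 <= z.2], continuous (fun z : R * R => u z.1 z.2)} ->
  cont2 (fun t r : R => u (Num.max t 0) (Num.max r 0)).
Proof.
move=> /subspace_continuousP cu z.
pose g (z : R * R) : R * R := (Num.max z.1 0, Num.max z.2 0).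
have gA z' : 0 <= (g z').1 /\ 0 <= (g z').2 by rewrite /= !le_max !lexx !orbT.
have cg : continuous g.
  have c1 : continuous (fun z : R * R => Num.max z.1 0) by apply: continuous_max0 => x; exact: cvg_fst.
  have c2 : continuous (fun z : R * R => Num.max z.2 0) by apply: continuous_max0 => x; exact: cvg_snd.
  by move=> z'; exact: (cvg_pair (c1 z') (c2 z')).
move=> B hB; have /= h := cu (g z) (gA z) B hB.
have h2 : nbhs (g z) [set w | [set z : R * R | 0 <= z.1 /\ 0 <= z.2] w -> B (u w.1 w.2)] by exact: h.
have h3 : nbhs z (g @^-1` [set w | [set z : R * R | 0 <= z.1 /\ 0 <= z.2] w -> B (u w.1 w.2)]).
  exact: (cg z _ h2).
apply: (@filterS _ (nbhs z) _ _ _ _ h3) => z' /= h4.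
by apply: h4; exact: gA.
Qed.

Lemma deriv_within_bound (R : realType) (A : set R) (g : R -> R) (x l e : R) : 0 < e ->
  deriv_within A g x l -> exists2 d : R, 0 < d & forall y, A y -> `|y - x| < d ->
    `|g y - g x - l * (y - x)| <= e * `|y - x|.
Proof.
move=> e0 /cvgrPdist_le /(_ _ e0); rewrite near_withinE /dnbhs near_withinE.
move=> /nbhsP_lt [d d0 hd]; exists d => // y Ay yx.
have [->|yx0] := eqVneq y x; first by rewrite !subrr mulr0 subrr normr0 mulr0.
have := hd y yx yx0 Ay; have n0 : 0 < `|y - x| by rewrite normr_gt0 subr_eq0.
have n1 : y - x != 0 by rewrite subr_eq0.
by rewrite -(ler_pM2r n0) -normrM mulrBl divfK // distrC.
Qed.

Lemma deriv_within_der (R : realType) (A : set R) (g : R -> R) (x l : R) : nbhs x A ->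
  deriv_within A g x l -> der g x l.
Proof.
move=> /nbhsP_lt [d1 d10 hA] hd; apply: der_eps => e e0.
have [d d0 H] := deriv_within_bound e0 hd.
exists (Num.min d d1); first by rewrite lt_min d0.
by move=> y; rewrite lt_min => /andP[y1 y2]; apply: H => //; exact: hA.
Qed.

(** On [theta, C] the derivative is bounded by compactness and below theta f vanishes, so one
    constant serves all of [0, C], as the scheme and energy estimates require. *)
Lemma F1_lipschitz (R : realType) (theta : R) (f : R -> R) (C : R) : 0 < theta -> F1 theta f ->
  theta < C -> exists2 L : R, 0 <= L &
  forall x y : R, 0 <= x <= C -> 0 <= y <= C -> `|f x - f y| <= L * `|x - y|.
Proof.
move=> t0 [_ fz _ _ [df [d2f [[hd cdf] _ _ _]]]] tC.
have cdf' : {within `[theta, C], continuous df}.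
  apply: continuous_subspaceW cdf => x /=; rewrite !in_itv /= => /andP[->] //.
have [c1 _ h1] := EVT_max (ltW tC) cdf'; have [c2 _ h2] := EVT_min (ltW tC) cdf'.
pose L := Num.max `|df c1| `|df c2|.
have ft : f theta = 0 by rewrite fz // lexx ltW.
have dfL x : theta <= x <= C -> `|df x| <= L.
  move=> hx; have hi : x \in `[theta, C] by rewrite in_itv.
  have u1 := h1 x hi; have u2 := h2 x hi; rewrite ler_norml; apply/andP; split.
    apply: le_trans u2; rewrite lerNl; apply: (@le_trans _ _ `|df c2|).
      by rewrite -normrN ler_norm.
    by rewrite le_max lexx orbT.
  by apply: le_trans u1 _; apply: le_trans (ler_norm _) _; rewrite le_max lexx.
have fder x : theta < x -> der f x (df x).
  move=> tx; apply: (@deriv_within_der _ `[theta, +oo[%classic); last by apply: hd; rewrite /= in_itv /= (ltW tx).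
  have xx : theta < x < x + 1 by rewrite tx ltrDl ltr01.
  by apply: filterS (near_itv_oo xx) => y /andP[/ltW ty _]; rewrite /= in_itv /= ty.
have lip x y : theta < x -> x <= y -> y <= C -> `|f y - f x| <= L * (y - x).
  move=> tx; rewrite le_eqVlt => /orP[/eqP <-|xy] yC.
    by rewrite !subrr normr0 mulr0.
  have [||c /andP[xc cy] ->] := @der_mvt _ f df x y xy.
  - by move=> z /andP[xz _]; apply: fder; exact: lt_trans xz.
  - apply: continuous_in_subspaceT => z; rewrite inE /= in_itv /= => /andP[xz _].
    by apply: der_continuous; apply: fder; exact: lt_le_trans xz.
  have xy0 : 0 <= y - x by rewrite subr_ge0 ltW.
  rewrite normrM (ger0_norm xy0); apply: ler_wpM2r => //; apply: dfL.
  by rewrite (ltW (lt_trans tx xc)) (le_trans (ltW cy)).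
have tA : `[theta, +oo[%classic theta by rewrite /= in_itv /= lexx.
have [d d0 hdt] := deriv_within_bound ltr01 (hd _ tA).
have L0 : 0 <= L by rewrite le_max normr_ge0.
exists (L + 1); first exact: addr_ge0.
(* At theta only a one-sided derivative is given, so the mean value theorem starts at a nearby point
   z > theta and the derivative at theta covers [theta, z]; the error 1 in the difference quotient
   gives L + 1. *)
have lipt y : theta < y -> y <= C -> `|f y| <= (L + 1) * (y - theta).
  move=> ty yC; pose z := theta + Num.min (d / 2) (y - theta).
  have m0 : 0 < Num.min (d / 2) (y - theta) by rewrite lt_min divr_gt0 // subr_gt0.
  have tz : theta < z by rewrite ltrDl.
  have zy : z <= y by rewrite -lerBrDl ge_min lexx orbT.
  have zd : `|z - theta| < d.
    rewrite /z addrAC subrr add0r gtr0_norm //; apply: (@le_lt_trans _ _ (d / 2)); first by rewrite ge_min lexx.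
    by rewrite ltr_pdivrMr // ltr_pMr // ltr1n.
  have zA : `[theta, +oo[%classic z by rewrite /= in_itv /= (ltW tz).
  have := hdt z zA zd; rewrite ft subr0 mul1r (gtr0_norm (_ : 0 < z - theta)) ?subr_gt0 // => h3.
  have h4 := lip z y tz zy yC.
  have h5 : `|df theta * (z - theta)| <= L * (z - theta).
    have zt : 0 <= z - theta by rewrite subr_ge0 ltW.
    by rewrite normrM (ger0_norm zt); apply: ler_wpM2r => //; apply: dfL; rewrite lexx ltW.
  have h6 : `|f z| <= L * (z - theta) + (z - theta).
    have -> : f z = df theta * (z - theta) + (f z - df theta * (z - theta)) by ring.
    by apply: le_trans (ler_normD _ _) _; exact: lerD.
  have -> : f y = f z + (f y - f z) by ring.
  apply: le_trans (ler_normD _ _) _; have zt : 0 <= y - z by rewrite subr_ge0.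
  by move: h4 h6; rewrite mulrBr mulrBr => h4 h6; rewrite mulrDl mul1r mulrBr; lra.
move=> x y; wlog xy : x y / x <= y.
  move=> H hx hy; have [/H|/ltW/H] := leP x y; first by apply.
  by move=> h; rewrite distrC [`|x - y|]distrC; exact: h.
move=> /andP[x0 xC] /andP[y0 yC].
have xy0 : 0 <= y - x by rewrite subr_ge0.
rewrite distrC [`|x - y|]distrC (ger0_norm xy0).
have [yt|ty] := leP y theta.
  by rewrite !fz ?y0 ?x0 ?(le_trans xy) // subrr normr0 mulr_ge0 // addr_ge0.
have [xt|tx] := leP x theta.
  rewrite (fz x) ?x0 // subr0; apply: le_trans (lipt y ty yC) _.
  by apply: ler_wpM2l; [exact: addr_ge0|rewrite lerD2l lerN2].
apply: le_trans (lip x y tx xy yC) _; apply: ler_wpM2r => //.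
by rewrite lerDl.
Qed.

Lemma enorm_axis (R : realType) (N : nat) (i : 'I_N) (h : R) : enorm (h *: evec R i) = `|h|.
Proof.
rewrite /enorm (bigD1 i) //= big1 ?addr0.
  by rewrite !mxE !eqxx mulr1 sqrtr_sqr.
by move=> j ji; rewrite !mxE (negbTE ji) andbF mulr0 expr0n.
Qed.

(** Recovers continuity of the radial profile at r = 0 from differentiability in space, by
    restricting to a coordinate axis. *)
Lemma axis_continuous0 (R : realType) (N : nat) (i : 'I_N) (w : R -> R) :
  derivable (fun x : 'rV[R]_N => w (enorm x)) 0 (evec R i) ->
  forall e, 0 < e -> exists2 d : R, 0 < d & forall r, 0 <= r -> r < d -> `|w r - w 0| <= e.
Proof.
move=> /derivable1P hd e e0.
have cw : {for 0, continuous (fun h : R => w (enorm (h *: evec R i + 0)))}.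
  by apply: differentiable_continuous; apply/derivable1_diffP.
have /cvgrPdist_le /(_ _ e0) /nbhsP_lt [d d0 hw] := cw; exists d => // r r0 rd.
have := hw r; rewrite subr0 ger0_norm // => /(_ rd).
by rewrite !addr0 !enorm_axis normr0 (ger0_norm r0) distrC.
Qed.

(* [star] is the equation integrated over a ball and a time interval. *)
Record radial_flow (R : realType) (n : nat) (m theta C L r0 : R) (f : R -> R)
    (u v ff : R -> R -> R) (b : R -> R) : Prop := RadialFlow {
  rf_C : 1 <= C;
  rf_fC : f C <= 0;
  rf_L : 0 <= L;
  rf_r0 : 0 < r0;
  rf_u : cont2 u;
  rf_v : cont2 v;
  rf_ff : cont2 ff;
  rf_range : forall t r, 0 <= u t r <= C;
  rf_vE : forall t r, v t r = u t r `^ m;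
  rf_ffE : forall t r, ff t r = f (u t r);
  rf_fz : forall s, 0 <= s <= theta -> f s = 0;
  rf_pos : forall s, 0 <= s <= 1 -> 0 <= f s;
  rf_lip : forall x y, 0 <= x <= C -> 0 <= y <= C -> `|f x - f y| <= L * `|x - y|;
  rf_star : forall s t r, 0 <= s -> 0 <= t -> 0 < r ->
    der (wint v s t) r (flux n u ff s t r / r ^+ n);
  rf_lin : forall t r, - L * u t r <= ff t r;
  rf_max : forall t r, ff t r <= L * C;
  rf_b : forall t r, 0 < t -> 0 <= r -> (0 < u t r) = (r < b t);
  rf_init : forall r, r0 <= r -> u 0 r = 0;
  rf_supp : forall T, exists2 Lam, 0 < Lam & forall t r, 0 <= t <= T -> Lam <= r -> u t r = 0 }.

(** Extension by frozen values to negative times and radii, so that continuity holds on the whole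
    plane, as [cont2] demands. *)
Definition cut (R : realType) (u : R -> R -> R) (t r : R) : R := u (Num.max t 0) (Num.max r 0).

Lemma cutE (R : realType) (u : R -> R -> R) (t r : R) : 0 <= t -> 0 <= r -> cut u t r = u t r.
Proof. by move=> t0 r0; rewrite /cut !max_l. Qed.

Lemma weak_solution_flow (R : realType) (n : nat) (m theta s : R) (f phi : R -> R)
    (u : R -> R -> R) (b : R -> R) : 1 < m -> 0 < theta < 1 -> F1 theta f ->
  classX m phi -> weak_solution n.+1 m f (fun r => s * phi r) u ->
  (forall t : R, 0 < t -> [set x : 'rV[R]_n.+1 | 0 < u t (enorm x)]
         = [set x : 'rV[R]_n.+1 | enorm x < b t]) ->
  exists C L r0, radial_flow n m theta C L r0 f (cut u)
    (fun t r => cut u t r `^ m) (fun t r => f (cut u t r)) b.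
Proof.
move=> m1 /andP[th0 th1] F1f [cphi [r0 [r00 _ phi0 _]]] [cu0 [M uM] weak] hb.
have cu := extend_continuous cu0; have m0 : 0 < m by exact: lt_trans ltr01 m1.
(* Taking C >= 1 ensures f C <= 0, so the constant C is an upper barrier for the scheme. *)
pose C := Num.max M 1; have C1 : 1 <= C by rewrite le_max lexx orbT.
have [_ fz fpos [f1 fneg] _] := F1f.
have thC : theta < C by exact: lt_le_trans C1.
have [L L0 lip] := F1_lipschitz th0 F1f thC.
have fC : f C <= 0.
  by move: C1; rewrite le_eqVlt => /orP[/eqP <-|/fneg/ltW//]; rewrite f1.
have range t r : 0 <= cut u t r <= C.
  have := uM (Num.max t 0) (Num.max r 0); rewrite !le_max !lexx !orbT => /(_ isT isT).
  by move=> /andP[h1 h2]; rewrite /cut h1 (le_trans h2) // le_max lexx.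
have cutC : cont2 (cut u) by exact: cu.
have cv : cont2 (fun t r => cut u t r `^ m).
  have -> : (fun t r => cut u t r `^ m) = (fun t r => Num.max (cut u t r) 0 `^ m).
    by apply/funext => t; apply/funext => r; have /andP[h1 _] := range t r; rewrite max_l.
  have cm := @powR_max_continuous R m m0.
  exact (@continuous_after _ _ _ _ (fun z : R * R => cut u z.1 z.2) cutC cm).
have cff : cont2 (fun t r => f (cut u t r)).
  move=> z; apply/cvgrPdist_le => e e0; have L1 : 0 < L + 1 by exact: ltr_wpDl.
  have /cvgrPdist_le /(_ (e / (L + 1))) := cutC z.
  rewrite divr_gt0 // => /(_ isT); apply: filterS => z' h.
  apply: le_trans (lip _ _ (range _ _) (range _ _)) _.
  have h2 : L * (e / (L + 1)) <= e by rewrite mulrA ler_pdivrMr // mulrC ler_pM2l // lerDl.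
  by apply: le_trans h2; exact: ler_wpM2l.
have cU0 : continuous (fun r : R => s * phi (Num.max r 0)).
  move=> r; apply: cvgM; first exact: cvg_cst.
  have cm : continuous (fun r : R => Num.max r 0) by apply: continuous_max0 => x; exact: cvg_id.
  move: cphi => /subspace_continuousP cphi B hB.
  have mA (x : R) : `[0, +oo[%classic (Num.max x 0) by rewrite /= in_itv /= andbT le_max lexx orbT.
  have h2 : nbhs (Num.max r 0) [set w | `[0, +oo[%classic w -> B (phi w)] by exact: (cphi _ (mA r) B hB).
  apply: (@filterS _ (nbhs r) _ _ _ _ (cm r _ h2)) => x /= h4.
  by apply: h4; exact: mA.
have weak' (psi : R -> 'rV[R]_n.+1 -> R) : test_function psi ->
  \int[@lebesgue_measure R]_(t in `[0, +oo[)
    integral_RN (fun x : 'rV[R]_n.+1 =>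
      cut u t (enorm x) * derive1 (psi^~ x) t + cut u t (enorm x) `^ m * laplacian (psi t) x
      + f (cut u t (enorm x)) * psi t x)
  + integral_RN (fun x : 'rV[R]_n.+1 => s * phi (Num.max (enorm x) 0) * psi 0 x) = 0.
  move=> hpsi; apply: etrans (weak psi hpsi).
  have E (x : 'rV[R]_n.+1) : 0 <= enorm x by exact: sqrtr_ge0.
  apply: f_equal2.
    apply: eq_Rintegral => t /set_mem; rewrite [X in X -> _]/= in_itv [X in X -> _]/= andbT => t0.
    by apply: f_equal; apply/funext => x; rewrite !cutE.
  by apply: f_equal; apply/funext => x; rewrite max_l.
have star s' t r : 0 <= s' -> 0 <= t -> 0 < r ->
    der (wint (fun t r => cut u t r `^ m) s' t) r (flux n (cut u) (fun t r => f (cut u t r)) s' t r / r ^+ n).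
  by move=> s0 t0 rr; exact: (flux_identity cutC cv cff cU0 weak').
have ini r : r0 <= r -> cut u 0 r = 0.
  move=> hr; have rr : 0 < r by exact: lt_le_trans hr.
  by rewrite (initial_value cutC cv cff cU0 weak' rr) max_l ?ltW // phi0 // mulr0.
have f0 : f 0 = 0 by rewrite fz // lexx ltW.
have habs t r : `|f (cut u t r)| <= L * cut u t r.
  have /andP[h1 h2] := range t r; have := lip (cut u t r) 0.
  by rewrite f0 !subr0 (ger0_norm h1) range lexx (le_trans ler01 C1) => /(_ isT isT).
have lin t r : - L * cut u t r <= f (cut u t r).
  by have := habs t r; rewrite ler_norml mulNr => /andP[].
have hb' t r : 0 < t -> 0 <= r -> (0 < cut u t r) = (r < b t).
  move=> t0 rr; rewrite cutE ?(ltW t0) //; have := hb t t0.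
  move=> /(congr1 (fun A : set _ => A (r *: evec R ord0))) /=.
  rewrite enorm_axis (ger0_norm rr) => h.
  by apply/idP/idP; rewrite h.
have CC : 0 < C by exact: lt_le_trans C1.
have range0 t r : 0 <= cut u t r by have /andP[] := range t r.
have rangeC t r : cut u t r <= C by have /andP[] := range t r.
exists C, L, r0; split => //.
- move=> s' /andP[s0 s1]; have [st|ts] := leP s' theta; first by rewrite fz ?s0.
  by move: s1; rewrite le_eqVlt => /orP[/eqP ->|s1]; [rewrite f1|rewrite ltW // fpos // ts].
- move=> t r; apply: le_trans (ler_norm _) _; apply: le_trans (habs t r) _.
  exact: ler_wpM2l.
(* By retention the support at all times up to T lies within the front at the single time T'; the
   maximum with 1 keeps T' positive. *)
- move=> T; pose T' := Num.max T 1; exists (Num.max (b T') 1); first by rewrite lt_max ltr01 orbT.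
  move=> t r /andP[t0 tT] hr; have T0 : 0 < T' by rewrite lt_max ltr01 orbT.
  have tT' : t <= T' by rewrite le_max tT.
  apply: (retention m1 cutC cv cff range0 rangeC _ star CC lin _ t0 tT' _ hr) => //.
    by rewrite lt_max ltr01 orbT.
  move=> x; rewrite ge_max => /andP[bx x1]; apply/eqP; rewrite eq_le range0 andbT leNgt.
  by rewrite hb' // ?(le_trans ler01 x1) // -leNgt.
Qed.

Lemma planar_rate (R : realType) (m theta C L r0 lambda p : R) (f : R -> R)
    (u v ff : R -> R -> R) (b : R -> R) : 1 < m -> 0 < theta < 1 ->
  radial_flow 1 m theta C L r0 f u v ff b -> 0 < lambda -> 1 <= p ->
  (fun s : R => f (theta + s)) ~_(0^'+) (fun s : R => lambda * s `^ p) ->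
  (forall rho e, 0 < rho -> 0 < e -> exists2 T, 0 < T &
    forall t r, T <= t -> 0 <= r <= rho -> `|u t r - theta| < e) ->
  (exists C1 T1, [/\ 0 < C1, 0 < T1 & forall T, T1 <= T -> b T <= C1 * rate m T]) /\
  (exists c1 T1, [/\ 0 < c1, 0 < T1 & forall T, T1 <= T -> c1 * rate m T <= b T]).
Proof.
move=> m1 /andP[th0 th1] [C1 fC L0 r00 cu cv cff range vE ffE fz fpos lip star lin _ hb ini supp].
move=> lam0 p1 feq conv.
have p0 : 0 < p by exact: lt_le_trans p1.
have CC : 0 < C by exact: lt_le_trans C1.
have m0 : 0 < m by exact: lt_trans m1.
have fth : f theta = 0 by rewrite fz // lexx ltW.
(* Reflection across the midpoint a = (r + s) / 2, which is at least r0 as soon as r >= 2 r0. *)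
have mono (t r s : R) : 0 < t -> 2 * r0 <= r -> 0 <= s <= r -> u t r <= u t s.
  move=> t0 hr /andP[s0 sr]; have [Lam Lam0 out] := supp t.
  have := @reflection _ u v ff f m C L theta Lam r0 t ((r + s) / 2) ((r - s) / 2)
    m1 cu cv cff CC range vE ffE th0 fz L0 lip fC Lam0 out ini star r00 t0.
  have -> : (r + s) / 2 + (r - s) / 2 = r by field.
  have -> : (r + s) / 2 - (r - s) / 2 = s by field.
  rewrite (ger0_norm s0); apply; first by clear -hr s0; lra.
  by clear -sr; lra.
have [d d0 hd] := equiv_right_bounds lam0 p0 feq fth.
pose eps := Num.min d ((1 - theta) / 2).
have eps0 : 0 < eps by rewrite lt_min d0 divr_gt0 // subr_gt0.
have eps1 : theta + eps <= 1.
  have : eps <= (1 - theta) / 2 by rewrite ge_min lexx orbT.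
  by clear -th1; lra.
have flow s : 0 <= s <= eps -> lambda / 2 * s `^ p <= f (theta + s) <= 2 * lambda * s `^ p.
  by move=> /andP[s0 s1]; apply: hd; rewrite s0 (le_trans s1) // ge_min lexx.
have [T1 T10 h1] := conv (2 * r0) eps (mulr_gt0 (ltr0n _ 2) r00) eps0.
have [T2 T20 h2] := conv (expR 1) (theta / 2) (expR_gt0 1) (divr_gt0 th0 (ltr0n _ 2)).
pose Ts := Num.max T1 T2.
have Ts0 : 0 < Ts by rewrite lt_max T10.
(* Convergence to theta is only locally uniform; monotonicity beyond 2 r0 extends the upper bound to
   all radii. *)
have late t r : Ts <= t -> 0 <= r -> u t r <= theta + eps.
  rewrite ge_max => /andP[tt1 _] rr; have t0 : 0 < t by exact: lt_le_trans tt1.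
  have near x : 0 <= x <= 2 * r0 -> u t x <= theta + eps.
    by move=> hx; have := h1 t x tt1 hx; rewrite ltr_norml => /andP[_]; clear; lra.
  have [rl|rl] := leP r (2 * r0); first by apply: near; rewrite rr.
  have r2 : 0 <= 2 * r0 by exact: mulr_ge0 (ltW r00).
  apply: le_trans (mono t r (2 * r0) t0 (ltW rl) _) (near _ _); first by rewrite r2 ltW.
  by rewrite r2 lexx.
have late0 t r : Ts <= t -> 0 <= r -> 0 <= ff t r.
  move=> tt rr; rewrite ffE; apply: fpos; have /andP[-> _] := range t r.
  exact: le_trans (late t r tt rr) eps1.
have mono' t r s : Ts <= t -> 2 * r0 <= r -> 0 <= s <= r -> u t r <= u t s.
  by move=> tt; apply: mono; exact: lt_le_trans tt.
have thC : theta <= C by exact: le_trans (ltW th1) C1.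
have l2 : 0 < lambda / 2 by rewrite divr_gt0.
have l2' : 0 < 2 * lambda by exact: mulr_gt0.
have [K K0 [rs rs1 decay]] := reaction_decay m1 cu cv cff CC range vE ffE star th0 (ltW th1)
  thC fz eps0 l2 l2' p1 flow (ltW Ts0) late supp mono'.
split.
  apply: (planar_upper m1 cu cv cff CC range vE star lin hb th0 _ Ts0 p0 K0 rs1 late0 decay mono').
  by move=> t r h; rewrite ffE fz //; have /andP[-> _] := range t r.
have kap0 : 0 < (theta / 2) `^ m by rewrite powR_gt0 // divr_gt0.
apply: (planar_lower m1 cu cv cff CC range vE star lin hb Ts0 kap0 late0) => t.
rewrite ge_max => /andP[_ tt2]; have t0 : 0 < t by exact: lt_le_trans tt2.
have e1 : 1 <= expR 1 :> R by rewrite -[X in X <= _](expR0 R) ler_expR ler01.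
have low x : 0 <= x <= expR 1 -> theta / 2 <= u t x.
  by move=> hx; have := h2 t x tt2 hx; rewrite ltr_norml => /andP[h _]; clear -h; lra.
split.
  rewrite vE; apply: powR_le; [exact: ltW|by rewrite divr_ge0 // ltW|].
  by apply: low; rewrite ler01.
rewrite -hb ?(ltW (expR_gt0 _)) //; apply: lt_le_trans (low _ _); first by rewrite divr_gt0.
by rewrite (ltW (expR_gt0 _)) lexx.
Qed.

(** The sign of U_r concerns r > 0 only. The value at the origin is reached through continuity of
    U^m there, which its C^2 regularity provides. *)
Lemma ground_state_profile (R : realType) (n : nat) (m theta : R) (f U : R -> R) : 0 < m ->
  ground_state n.+1 m theta f U ->
  [/\ forall r, 0 <= r -> 0 < U r <= U 0,
      forall h, 0 < h -> h < U 0 -> exists2 d, 0 < d & forall r, 0 <= r <= d -> h <= U r &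
      forall h, 0 < h -> exists2 R0, 0 < R0 & forall r, R0 <= r -> U r < h].
Proof.
move=> m0 [U0 [[C1 _] _] dU _ lim].
have near0 := @axis_continuous0 _ _ ord0 (fun r => U r `^ m) (proj1 (C1 ord0) 0).
have U00 : 0 <= U 0 by exact/ltW/U0.
have anti x y : 0 < x -> x <= y -> U y <= U x.
  move=> x0; rewrite le_eqVlt => /orP[/eqP -> //|xy].
  have hd z : 0 < z -> der U z (derive1 U z).
    by move=> z0; have [h _] := dU z z0; rewrite derive1E; apply/derivableP.
  have [z /andP[xz _]||c /andP[xc cy] E] := @der_mvt _ U (derive1 U) x y xy.
  - by apply: hd; exact: lt_trans xz.
  - apply: continuous_in_subspaceT => z; rewrite inE /= in_itv /= => /andP[xz _].
    by apply: der_continuous; apply: hd; exact: lt_le_trans xz.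
  - rewrite -subr_le0 E; have [_ h] := dU c (lt_trans x0 xc).
    by rewrite mulr_le0_ge0 ?subr_ge0 ?(ltW xy) ?(ltW h).
have powlt x y : 0 <= x -> x < y -> x `^ m < y `^ m.
  by move=> x0 xy; apply: gt0_ltr_powR; rewrite ?nnegrE ?(ltW (le_lt_trans x0 xy)).
have powle x y : 0 <= x -> 0 <= y -> x `^ m <= y `^ m -> x <= y.
  by move=> x0 y0 h; rewrite leNgt; apply/negP => /(powlt _ _ y0); rewrite ltNge h.
split.
- move=> r; rewrite le_eqVlt => /orP[/eqP <-|r0]; first by rewrite lexx U0.
  rewrite U0 ?(ltW r0) //; apply: powle => //; first exact/ltW/U0/ltW.
  apply/ler_addgt0Pr => e e0; have [d d0 hd] := near0 e e0.
  pose x := Num.min (d / 2) r; have x0 : 0 < x by rewrite lt_min divr_gt0.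
  have xd : x < d by rewrite gt_min; apply/orP; left; clear -d0; lra.
  have := hd x (ltW x0) xd; rewrite ler_norml => /andP[_ h].
  have h2 : U r <= U x by apply: anti => //; rewrite ge_min lexx orbT.
  have h3 : U r `^ m <= U x `^ m.
    by apply: powR_le => //; [exact: ltW|exact/ltW/U0/ltW].
  by clear -h h3; lra.
- move=> h h0 hU; have e0 : 0 < U 0 `^ m - h `^ m by rewrite subr_gt0; apply: powlt => //; exact: ltW.
  have [d d0 hd] := near0 _ e0; exists (d / 2); first by rewrite divr_gt0.
  move=> r /andP[r0 rd]; have rd' : r < d by clear -d0 rd; lra.
  have := hd r r0 rd'; rewrite ler_norml => /andP[h1 _].
  apply: powle; [exact: ltW|exact/ltW/U0|by clear -h1; lra].
- move=> h h0; have /cvgrPdist_lt /(_ h h0) [M [_ hM]] := lim.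
  exists (`|M| + 1); first by rewrite ltr_wpDl.
  move=> r hr; have Mr : M < r.
    by apply: lt_le_trans hr; rewrite ltr_pwDr // ler_norm.
  have := hM r Mr; rewrite sub0r normrN ltr_norml => /andP[_]. by [].
Qed.

Lemma ground_rate (R : realType) (n : nat) (m theta C L r0 : R) (f U : R -> R)
    (u v ff : R -> R -> R) (b : R -> R) : 1 < m -> 0 < theta < 1 -> F1 theta f ->
  radial_flow n m theta C L r0 f u v ff b -> ground_state n.+1 m theta f U ->
  (forall e, 0 < e -> exists2 T, 0 < T & forall t r, T <= t -> 0 <= r -> `|u t r - U r| < e) ->
  (exists C1 T1, [/\ 0 < C1, 0 < T1 &
     forall T, T1 <= T -> b T <= C1 * T `^ (m / (n.+1%:R * (m - 1) + 2))]) /\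
  (exists c1 T1, [/\ 0 < c1, 0 < T1 &
     forall T, T1 <= T -> c1 * T `^ (m / (n.+1%:R * (m - 1) + 2)) <= b T]).
Proof.
move=> m1 /andP[th0 th1] [_ _ fpos _ _] [C1 fC L0 r00 cu cv cff range vE ffE fz fpos0 lip star lin mx hb ini supp].
move=> gs conv; have m0 : 0 < m by exact: lt_trans m1.
have [_ _ _ /andP[U01 U02] _] := gs.
have [Ur Unear Ufar] := ground_state_profile m0 gs.
have CC : 0 < C by exact: lt_le_trans C1.
have range0 t r : 0 <= u t r by have /andP[] := range t r.
have rangeC t r : u t r <= C by have /andP[] := range t r.
(* U(0) exceeds theta by 4 h, so near the origin U >= theta + 2 h and late u >= theta + h; together
   with u <= U(0) + e1 < 1 this confines u to a compact interval on which f has a positive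
   minimum. *)
pose h := (U 0 - theta) / 4; pose e1 := (1 - U 0) / 2.
have h0 : 0 < h by rewrite divr_gt0 // subr_gt0.
have e10 : 0 < e1 by rewrite divr_gt0 // subr_gt0.
have m10 : 0 < Num.min h e1 by rewrite lt_min h0.
have [T1 T10 hT1] := conv _ m10.
have top t r : T1 <= t -> 0 <= r -> u t r <= U 0 + e1.
  move=> tt rr; have := hT1 t r tt rr; have /andP[_ h2] := Ur r rr.
  rewrite lt_min => /andP[_]; rewrite ltr_norml => /andP[_ h3]; clear -h2 h3; lra.
have top1 : U 0 + e1 < 1 by rewrite /e1; clear -U02; lra.
have late_ge0 t r : T1 <= t -> 0 <= r -> 0 <= ff t r.
  move=> tt rr; rewrite ffE; apply: fpos0; rewrite range0 /=.
  exact: le_trans (top t r tt rr) (ltW top1).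
have grow x : exists T, forall t, T <= t -> x < b t.
  pose y := Num.max x 0; have y0 : 0 <= y by rewrite le_max lexx orbT.
  have /andP[Uy _] := Ur y y0; have [T T0 hT] := conv _ Uy.
  exists T => t tT; apply: (@le_lt_trans _ _ y); first by rewrite le_max lexx.
  rewrite -hb //; last exact: lt_le_trans tT.
  by have := hT t y tT y0; rewrite ltr_norml => /andP[h2 _]; clear -h2; lra.
split.
  (* Far out U < theta / 2, hence late u < theta: the reaction is confined to a fixed ball. *)
  have t2 : 0 < theta / 2 by rewrite divr_gt0.
  have [R1 R10 hR] := Ufar _ t2; have [T2 T20 hT2] := conv _ t2.
  apply: (ground_front_upper m1 cu cv cff range0 rangeC CC vE star lin mx _ hb T20 R10 _ grow).
    by rewrite mulr_ge0 // ltW.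
  move=> t r tt rr; rewrite ffE fz // range0 /=.
  have r1 : 0 <= r by exact: le_trans (ltW R10) rr.
  have := hT2 t r tt r1; have := hR r rr; rewrite ltr_norml => h2 /andP[_ h3].
  by clear -h2 h3; lra.
have hh : theta + 2 * h < U 0 by rewrite /h; clear -U01; lra.
have hp : 0 < theta + 2 * h by apply: addr_gt0 => //; exact: mulr_gt0.
have [d d0 hd] := Unear _ hp hh.
have ab : theta + h <= U 0 + e1 by clear -hh h0 e10; lra.
have abC x : theta + h <= x <= U 0 + e1 -> 0 <= x <= C.
  by move=> /andP[x1 x2]; apply/andP; split; [clear -x1 th0 h0|clear -x2 top1 C1]; lra.
have cf : {within `[theta + h, U 0 + e1], continuous f}.
  apply/subspace_continuousP => x; rewrite /= in_itv /= => hx.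
  apply/cvgrPdist_le => e e0; rewrite near_withinE; apply/nbhsP_lt.
  have L1 : 0 < L + 1 by exact: ltr_wpDl.
  exists (e / (L + 1)); first exact: divr_gt0.
  move=> y hy; rewrite /= in_itv /= => hy2; apply: le_trans (lip _ _ (abC x hx) (abC y hy2)) _.
  have h2 : L * (e / (L + 1)) <= e by rewrite mulrA ler_pdivrMr // mulrC ler_pM2l // lerDl.
  by apply: le_trans h2; apply: ler_wpM2l => //; rewrite distrC ltW.
have [c hc hmin] := EVT_min ab cf.
have fc : 0 < f c.
  move: hc; rewrite in_itv /= => /andP[c1 c2]; apply: fpos.
  by apply/andP; split; [clear -c1 h0|clear -c2 top1]; lra.
have cX k : continuous (fun r : R => r ^+ k) by exact/continuousX/continuous_id.
have cX2 : continuous (fun r : R => f c * r ^+ n) by move=> x; apply: cvgM; [exact: cvg_cst|exact: cX].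
have kap0 : 0 < itg (fun r : R => f c * r ^+ n) 0 d.
  apply: (@itg_gt0 _ _ 0 d d) => //; first by rewrite lexx ltW.
    by move=> x /andP[x0 _]; rewrite mulr_ge0 ?ltW // exprn_gt0.
  by rewrite mulr_gt0 // exprn_gt0.
apply: (ground_front_lower m1 cu cv cff range0 rangeC CC vE star lin hb T10 d0 kap0 late_ge0 _ grow).
move=> t tt; apply: itg_le => //; first exact/pint_continuous/(cont2_l cff).
  exact: ltW.
move=> x /andP[x0 xd]; apply: ler_wpM2r; first exact/exprn_ge0/ltW.
rewrite ffE; apply: hmin; rewrite in_itv /= top ?(ltW x0) // andbT.
have /hd h2 : 0 <= x <= d by rewrite !ltW.
have := hT1 t x tt (ltW x0); rewrite lt_min => /andP[]; rewrite ltr_norml => /andP[h3 _] _.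
by clear -h2 h3; lra.
Qed.

Lemma two_sided (R : realType) (b g : R -> R) :
  (exists C T, [/\ 0 < C, 0 < T & forall t, T <= t -> b t <= C * g t]) /\
  (exists c T, [/\ 0 < c, 0 < T & forall t, T <= t -> c * g t <= b t]) ->
  exists c C T, [/\ 0 < c, 0 < C, 0 < T & forall t, T <= t -> c * g t <= b t <= C * g t].
Proof.
move=> [[C [T [C0 T0 hC]]] [c [T' [c0 _ hc]]]]; exists c, C, (Num.max T T').
split=> //; first by rewrite lt_max T0.
by move=> t; rewrite ge_max => /andP[/hC -> /hc ->].
Qed.

Theorem proposition1p4 (R : realType) (N : nat) (m theta : R) (f phi : R -> R)
    (u : R -> R -> R -> R) (sigma : \bar R) (b : R -> R)
    (hm : 1 < m)
    (hf : combustion N m theta f)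
    (hphi : classX m phi)
    (hu : forall s : R, 0 < s ->
       weak_solution N m f (fun r => s * phi r) (u s))
    (hsigma : is_threshold N m theta f u sigma)
    (hfin : (sigma < +oo)%E)
    (hb : forall t : R, 0 < t ->
       [set x : 'rV[R]_N | 0 < u (fine sigma) t (enorm x)]
         = [set x : 'rV[R]_N | enorm x < b t]) :
  (N = 2%N ->
   forall lambda p : R, 0 < lambda -> 1 <= p ->
   (fun s : R => f (theta + s)) ~_(0^'+) (fun s : R => lambda * s `^ p) ->
   exists c C T : R,
     [/\ 0 < c, 0 < C, 0 < T &
       forall t : R, T <= t ->
         c * (Num.sqrt t / ln t `^ ((m - 1) / (2 * m))) <= b t
           <= C * (Num.sqrt t / ln t `^ ((m - 1) / (2 * m)))])
  /\
  ((3 <= N)%N ->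
   totally_disconnected (Upsilon N m theta f) ->
   forall Ustar : R -> R,
   ground_state N m theta f Ustar ->
   cvg_unif (u (fine sigma)) Ustar ->
   exists c C T : R,
     [/\ 0 < c, 0 < C, 0 < T &
       forall t : R, T <= t ->
         c * t `^ (m / (N%:R * (m - 1) + 2)) <= b t
           <= C * t `^ (m / (N%:R * (m - 1) + 2))]).
Proof.
have [th F1f _ _] := hf.
have [sig0 _ _ crit] := hsigma.
have s0 : 0 < fine sigma by rewrite fine_gt0 // sig0.
have flow n : N = n.+1 -> exists C L r0, radial_flow n m theta C L r0 f (cut (u (fine sigma)))
    (fun t r => cut (u (fine sigma)) t r `^ m) (fun t r => f (cut (u (fine sigma)) t r)) b.
  by move=> E; move: hu hb; rewrite E => hu' hb'; exact: (weak_solution_flow hm th F1f hphi (hu' _ s0)).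
split.
  move=> N2 lambda p lam0 p1 feq; have [C [L [r0 rf]]] := flow 1%N N2.
  have [/(_ N2) conv _] := crit hfin.
  apply: two_sided; apply: (planar_rate hm th rf lam0 p1 feq) => rho e rho0 e0.
  have [T T0 hT] := uniform_cvg_eps (conv rho rho0) e0; exists T => // t r tT hr.
  by rewrite cutE; [exact: hT|exact: le_trans (ltW T0) tT|case/andP: hr].
move=> N3 _ Us gs cvU; have N1 : N = N.-1.+1 by rewrite prednK // (leq_trans _ N3).
have [C [L [r0 rf]]] := flow _ N1; apply: two_sided.
have E : N%:R = N.-1.+1%:R :> R by rewrite -N1.
rewrite E; apply: (@ground_rate _ _ m theta C L r0 f Us _ _ _ _ hm th F1f rf).
  by rewrite -N1.
move=> e e0; have [T T0 hT] := uniform_cvg_eps cvU e0; exists T => // t r tT r1.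
by rewrite cutE //; [exact: hT|exact: le_trans (ltW T0) tT].
Qed.
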